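(* Let $c(n)$, $n\ge 0$, be the Fourier coefficients of the modular invariant $j$. Put $$m(n)=1-\frac{3}{32\pi n^{1/2}}-\frac{15}{2048\pi^2n}-\frac{105}{65536\pi^3n^{3/2}}-\frac{4725}{8388608\pi^4n^2}-\frac{72765}{268435456\pi^5n^{5/2}},$$ $$k(n)=\frac{e^{4\pi\sqrt n}}{\sqrt2\,n^{3/4}}\left(m(n)-\frac{1.57696\cdot10^{-5}}{n^{3}}\right),\qquad l(n)=\frac{e^{4\pi\sqrt n}}{\sqrt2\,n^{3/4}}\left(m(n)+\frac{1.57696\cdot10^{-5}}{n^{3}}\right).$$ Then for all integers $n\ge 7$, $k(n)<c(n)<l(n)$.
   Context: The modular invariant $j$ is defined for $\tau$ in the upper half-plane, with $q=e^{2\pi i\tau}$, by $$j(\tau)=\frac{\left(1+240\sum_{n\ge 1}\sigma_3(n)q^n\right)^3}{q\prod_{n\ge 1}(1-q^n)^{24}}=q^{-1}+\sum_{n\ge 0}c(n)q^n=q^{-1}+744+196884q+21493760q^2+\cdots,$$ where $\sigma_3(n)=\sum_{d\mid n}d^3$. This defines the integers $c(n)$, $n\ge 0$. The decimal constants in the statement are exact decimal numbers. *)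

(* Defs.v *)
From Stdlib Require Import Reals ZArith List.
From Coquelicot Require Import Coquelicot.
Open Scope R_scope.

Definition sigma3 (n : nat) : nat :=
  list_sum (map (fun d => (d ^ 3)%nat)
                (filter (fun d => Nat.eqb (n mod d) 0) (seq 1 n))).

Definition Cexp (z : C) : C :=
  (exp (Re z) * cos (Im z), exp (Re z) * sin (Im z)).

Definition nome (tau : C) : C :=
  Cexp (RtoC (2 * PI) * Ci * tau)%C.

(* Limit of a complex sequence, taken on real and imaginary parts. Like the
   real [Lim_seq] it is total; it is used below only where convergence holds
   (namely for the nome of a point of the upper half-plane). *)
Definition CLim_seq (u : nat -> C) : C :=
  (real (Lim_seq (fun n => Re (u n))), real (Lim_seq (fun n => Im (u n)))).

Fixpoint Csum (f : nat -> C) (N : nat) : C :=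
  match N with
  | O => RtoC 0
  | S N' => (Csum f N' + f N)%C
  end.

Fixpoint Cprod (f : nat -> C) (N : nat) : C :=
  match N with
  | O => RtoC 1
  | S N' => (Cprod f N' * f N)%C
  end.

(* [Csum f N] and [Cprod f N] range over 1 <= n <= N, so the two operators
   below start at n = 1. *)
Definition CSeries1 (f : nat -> C) : C := CLim_seq (Csum f).
Definition CProd1 (f : nat -> C) : C := CLim_seq (Cprod f).

Definition j (tau : C) : C :=
  let q := nome tau in
  ((RtoC 1 + RtoC 240 * CSeries1 (fun n => RtoC (INR (sigma3 n)) * q ^ n)) ^ 3
   / (q * CProd1 (fun n => (RtoC 1 - q ^ n) ^ 24)))%C.

(* c is the sequence of the c(n), n >= 0: for every tau in the upper
   half-plane, q^{-1} + sum_{n >= 0} c(n) q^n converges to j(tau). This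
   determines c uniquely. *)
Definition is_j_coefficients (c : nat -> Z) : Prop :=
  forall tau : C, 0 < Im tau ->
    is_series (fun n : nat => (RtoC (IZR (c n)) * nome tau ^ n)%C)
              (j tau - / nome tau)%C.

Definition m (n : nat) : R :=
  let x := INR n in
  1 - 3 / (32 * PI * Rpower x (1 / 2))
    - 15 / (2048 * PI ^ 2 * x)
    - 105 / (65536 * PI ^ 3 * Rpower x (3 / 2))
    - 4725 / (8388608 * PI ^ 4 * x ^ 2)
    - 72765 / (268435456 * PI ^ 5 * Rpower x (5 / 2)).

Definition k (n : nat) : R :=
  let x := INR n in
  exp (4 * PI * sqrt x) / (sqrt 2 * Rpower x (3 / 4))
  * (m n - 1.57696 / 10 ^ 5 / x ^ 3).

Definition l (n : nat) : R :=
  let x := INR n in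
  exp (4 * PI * sqrt x) / (sqrt 2 * Rpower x (3 / 4))
  * (m n + 1.57696 / 10 ^ 5 / x ^ 3).

(* Main.v *)
(* Put w = -2 pi i tau. The transformation tau -> -1/tau becomes w -> 4 pi^2 / w, and j = E4^3 / Delta
   is invariant under it: the partial fraction expansions of the hyperbolic functions, obtained by
   Herglotz's trick, turn E4 and E2 into lattice sums, and integrating E2 gives log Delta.
   Integrating exp (n w) j from a real point along the arc |w| = 2 pi / sqrt n to argument pi / 4 and
   then vertically to imaginary part pi isolates c(n). On the arc, j is replaced by its main term
   exp (4 pi^2 / w), which leaves the integral of cos t exp (4 pi sqrt n cos t), and u = sin (t / 2)
   makes this a Laplace integral with explicit remainder. This settles n >= 225.
   For smaller n the logarithmic derivative of E4^3 / Delta gives a recurrence that determines the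
   c(n) exactly, and the bounds are checked in fixed-point arithmetic. *)

Require Import Defs.
From Stdlib Require Import Reals ZArith.
From Stdlib Require Import Lra Lia List Psatz.
From Coquelicot Require Import Coquelicot.
Open Scope R_scope.

(** No contour integral is formed: a primitive of exp (n w) j, given by its q-expansion, and the
    real mean value theorem yield the same estimates. The radius of the arc is that of the saddle
    point, where n w and 4 pi^2 / w are complex conjugates; this makes the exponent of the main term
    real. The obstacle is the upper part of the vertical segment. Bounding |j(w)| there by j(Re w)
    only gives a contribution of size exp (3 sqrt 2 pi sqrt n), which exceeds the main size exp (4
    pi sqrt n). No other cusp is examined; instead the product for Delta is estimated more
    carefully: in each logarithm of 1 - q^n the leading term keeps its true real part. This gains a
    factor exp (12 - 4.06 sqrt n), enough to fall below the main term. Six terms of the Laplace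
    expansion give m(n) and leave a relative error below 7 * 10^-7 / n^3. Nearly all of the
    tolerance 1.57696 * 10^-5 / n^3 is thus available for the contour error, of relative size about
    n exp (12 - 3.25 sqrt n); from sqrt n = 15 on it fits, whence the bound 225. *)

(** * Complex arithmetic and moduli *)

Lemma C_eq (z1 z2 : C) : Re z1 = Re z2 -> Im z1 = Im z2 -> z1 = z2.
Proof. destruct z1, z2; simpl; intros -> ->; reflexivity. Qed.

Ltac Cring := apply C_eq; simpl; ring.

Lemma Re_plus (x y : C) : Re (x + y)%C = Re x + Re y.
Proof. reflexivity. Qed.
Lemma Im_plus (x y : C) : Im (x + y)%C = Im x + Im y.
Proof. reflexivity. Qed.

Lemma Re_le_Cmod (z : C) : Rabs (Re z) <= Cmod z.
Proof. eapply Rle_trans; [apply Rmax_l | apply (Rmax_Cmod z)]. Qed.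
Lemma Im_le_Cmod (z : C) : Rabs (Im z) <= Cmod z.
Proof. eapply Rle_trans; [apply Rmax_r | apply (Rmax_Cmod z)]. Qed.
Lemma Cmod_le_abs (z : C) : Cmod z <= Rabs (Re z) + Rabs (Im z).
Proof.
  unfold Cmod. apply Rsqr_incr_0_var.
  - rewrite Rsqr_sqrt by nra. unfold Rsqr, Re, Im.
    rewrite <- (pow2_abs (fst z)), <- (pow2_abs (snd z)).
    pose proof (Rabs_pos (fst z)); pose proof (Rabs_pos (snd z)); nra.
  - pose proof (Rabs_pos (Re z)); pose proof (Rabs_pos (Im z)); lra.
Qed.
Lemma Cmod_sqr (z : C) : Cmod z ^ 2 = Re z ^ 2 + Im z ^ 2.
Proof. unfold Cmod. rewrite pow2_sqrt; [reflexivity | unfold Re, Im; nra]. Qed.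

Lemma Cmod_nonneg (z : C) : 0 <= Cmod z.
Proof. apply Cmod_ge_0. Qed.

Lemma Cmod_minus_le (x y : C) : Cmod (x - y) <= Cmod x + Cmod y.
Proof. unfold Cminus. rewrite <- (Cmod_opp y). apply Cmod_triangle. Qed.

Lemma Cmod_minus_ge (x y : C) : Cmod x - Cmod y <= Cmod (x - y).
Proof.
  pose proof (Cmod_triangle (x - y) y) as H.
  replace (x - y + y)%C with x in H by ring. lra.
Qed.

Lemma Cmod_R_pos (x : R) : 0 <= x -> Cmod (RtoC x) = x.
Proof. intros; rewrite Cmod_R, Rabs_pos_eq; auto. Qed.

Lemma Cmod_pow (z : C) (n : nat) : Cmod (z ^ n)%C = Cmod z ^ n.
Proof.
  induction n; simpl; [apply Cmod_1 | rewrite Cmod_mult, IHn; reflexivity].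
Qed.

Lemma C_neq0_Re (z : C) : Re z <> 0 -> z <> RtoC 0.
Proof. intros H ->; apply H; reflexivity. Qed.
Lemma C_neq0_Im (z : C) : Im z <> 0 -> z <> RtoC 0.
Proof. intros H ->; apply H; reflexivity. Qed.
Lemma C_neq0_Cmod (z : C) : 0 < Cmod z -> z <> RtoC 0.
Proof. apply Cmod_gt_0. Qed.

Lemma RtoC_neq0 (x : R) : x <> 0 -> RtoC x <> RtoC 0.
Proof. intros H E; apply H; exact (f_equal fst E). Qed.

Lemma RtoC_pow (x : R) (n : nat) : RtoC (x ^ n) = (RtoC x ^ n)%C.
Proof. induction n; simpl; [reflexivity|]. rewrite RtoC_mult, IHn; reflexivity. Qed.

(** * The complex exponential *)

Lemma Cexp_plus (x y : C) : Cexp (x + y) = (Cexp x * Cexp y)%C.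
Proof.
  apply C_eq; unfold Cexp; simpl; rewrite exp_plus, ?cos_plus, ?sin_plus; unfold Re, Im; ring.
Qed.
Lemma Cexp_0 : Cexp (RtoC 0) = RtoC 1.
Proof. apply C_eq; unfold Cexp; simpl; rewrite exp_0, ?cos_0, ?sin_0; ring. Qed.
Lemma Cmod_Cexp (x : C) : Cmod (Cexp x) = exp (Re x).
Proof.
  unfold Cmod, Cexp; simpl.
  replace (_ + _) with ((exp (Re x)) ^ 2 * ((sin (Im x))² + (cos (Im x))²)) by (unfold Rsqr; ring).
  rewrite sin2_cos2, Rmult_1_r, sqrt_pow2; auto. left; apply exp_pos.
Qed.
Lemma Cexp_neq0 (x : C) : Cexp x <> RtoC 0.
Proof. apply C_neq0_Cmod. rewrite Cmod_Cexp; apply exp_pos. Qed.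
Lemma Cexp_opp (x : C) : Cexp (- x) = (/ Cexp x)%C.
Proof.
  assert (H : (Cexp x * Cexp (- x))%C = RtoC 1).
  { rewrite <- Cexp_plus. replace (x + - x)%C with (RtoC 0) by ring. apply Cexp_0. }
  replace (Cexp (- x)) with (/ Cexp x * (Cexp x * Cexp (- x)))%C
    by (field; apply Cexp_neq0).
  rewrite H; ring.
Qed.
Lemma Cexp_R (x : R) : Cexp (RtoC x) = RtoC (exp x).
Proof. apply C_eq; unfold Cexp; simpl; rewrite ?cos_0, ?sin_0; ring. Qed.
Lemma Cexp_INR (n : nat) (x : C) : Cexp (RtoC (INR n) * x) = (Cexp x ^ n)%C.
Proof.
  induction n.
  - simpl. replace (RtoC 0 * x)%C with (RtoC 0) by ring. apply Cexp_0.
  - rewrite S_INR. replace (RtoC (INR n + 1) * x)%C with (x + RtoC (INR n) * x)%C.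
    + rewrite Cexp_plus, IHn; reflexivity.
    + rewrite RtoC_plus; ring.
Qed.
Lemma Cexp_2PI (x : C) : Cexp (x + RtoC (2 * PI) * Ci) = Cexp x.
Proof.
  rewrite Cexp_plus. replace (Cexp (RtoC (2 * PI) * Ci)) with (RtoC 1); [ring|].
  apply C_eq; unfold Cexp; simpl;
  replace (2 * PI * 0 - 0 * 1) with 0 by ring;
  replace (2 * PI * 1 + 0 * 0) with (2 * PI) by ring;
  rewrite exp_0, ?cos_2PI, ?sin_2PI; ring.
Qed.

(** * Derivatives along real paths *)

Lemma der_eq (f : R -> R) (t l l' : R) : is_derive f t l -> l = l' -> is_derive f t l'.
Proof. intros H <-; exact H. Qed.
Lemma der_plus (f g : R -> R) (t a b : R) :
  is_derive f t a -> is_derive g t b -> is_derive (fun x => f x + g x) t (a + b).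
Proof. apply (@is_derive_plus R_AbsRing R_NormedModule). Qed.
Lemma der_minus (f g : R -> R) (t a b : R) :
  is_derive f t a -> is_derive g t b -> is_derive (fun x => f x - g x) t (a - b).
Proof. apply (@is_derive_minus R_AbsRing R_NormedModule). Qed.
Lemma der_opp (f : R -> R) (t a : R) : is_derive f t a -> is_derive (fun x => - f x) t (- a).
Proof. apply (@is_derive_opp R_AbsRing R_NormedModule). Qed.
Lemma der_const (c t : R) : is_derive (fun _ : R => c) t 0.
Proof. apply (@is_derive_const R_AbsRing R_NormedModule). Qed.
Lemma der_id (t : R) : is_derive (fun x : R => x) t 1.
Proof. apply (@is_derive_id R_AbsRing). Qed.
Lemma der_mult (f g : R -> R) (t a b : R) :
  is_derive f t a -> is_derive g t b -> is_derive (fun x => f x * g x) t (a * g t + f t * b).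
Proof. intros; apply (@is_derive_mult R_AbsRing); auto; intros; apply Rmult_comm. Qed.
Lemma der_comp (f g : R -> R) (t a b : R) :
  is_derive f (g t) a -> is_derive g t b -> is_derive (fun x => f (g x)) t (b * a).
Proof. apply (@is_derive_comp R_AbsRing R_NormedModule). Qed.

(** The only derivative of complex functions in use: along a real parameter, by components. Neither
    complex differentiability nor Cauchy's theorem is involved. *)
Definition Cderiv (f : R -> C) (t : R) (l : C) : Prop :=
  is_derive (fun x => Re (f x)) t (Re l) /\ is_derive (fun x => Im (f x)) t (Im l).

Lemma Cderiv_eq f t l l' : Cderiv f t l -> l = l' -> Cderiv f t l'.
Proof. intros H <-; exact H. Qed.
Lemma Cderiv_ext f g t l : (forall x, f x = g x) -> Cderiv f t l -> Cderiv g t l.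
Proof.
  intros E [H1 H2]; split; eapply is_derive_ext; try eassumption; intros; simpl; now rewrite E.
Qed.
Lemma Cderiv_ext_loc f g t l :
  locally t (fun x => f x = g x) -> Cderiv f t l -> Cderiv g t l.
Proof.
  intros E [H1 H2]; split; eapply is_derive_ext_loc; try eassumption;
  eapply filter_imp; try exact E; simpl; intros x ->; reflexivity.
Qed.
Lemma Cderiv_const c t : Cderiv (fun _ => c) t (RtoC 0).
Proof. split; apply der_const. Qed.
Lemma Cderiv_R (f : R -> R) t (l : R) :
  is_derive f t l -> Cderiv (fun x => RtoC (f x)) t (RtoC l).
Proof. intros H; split; [exact H | exact (der_const 0 t)]. Qed.
Lemma Cderiv_plus f g t a b :
  Cderiv f t a -> Cderiv g t b -> Cderiv (fun x => f x + g x)%C t (a + b)%C.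
Proof. intros [] []; split; apply der_plus; assumption. Qed.
Lemma Cderiv_opp f t a : Cderiv f t a -> Cderiv (fun x => - f x)%C t (- a)%C.
Proof. intros []; split; apply der_opp; assumption. Qed.
Lemma Cderiv_minus f g t a b :
  Cderiv f t a -> Cderiv g t b -> Cderiv (fun x => f x - g x)%C t (a - b)%C.
Proof. intros; apply Cderiv_plus; [|apply Cderiv_opp]; assumption. Qed.
Lemma Cderiv_mult f g t a b :
  Cderiv f t a -> Cderiv g t b -> Cderiv (fun x => f x * g x)%C t (a * g t + f t * b)%C.
Proof.
  intros [H1 H2] [H3 H4]; split; simpl.
  - eapply der_eq; [apply der_minus; apply der_mult; eassumption|]. unfold Re, Im; simpl; ring.
  - eapply der_eq; [apply der_plus; apply der_mult; eassumption|]. unfold Re, Im; simpl; ring.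
Qed.
Lemma Cderiv_inv f t a : f t <> RtoC 0 ->
  Cderiv f t a -> Cderiv (fun x => / f x)%C t (- a / (f t * f t))%C.
Proof.
  intros H0 [H1 H2].
  assert (N : Re (f t) * Re (f t) + Im (f t) * Im (f t) <> 0).
  { intros E. apply H0. apply C_eq; simpl; nra. }
  assert (D : is_derive (fun x => / (Re (f x) * Re (f x) + Im (f x) * Im (f x))) t
    (- (2 * Re a * Re (f t) + 2 * Im a * Im (f t)) / (Re (f t) * Re (f t) + Im (f t) * Im (f t)) ^ 2)).
  { apply (is_derive_inv (fun x => Re (f x) * Re (f x) + Im (f x) * Im (f x)) t); [|exact N].
    eapply der_eq; [apply der_plus; apply der_mult; eassumption|]. simpl; ring. }
  assert (N2 : (Re (f t) * Re (f t) - Im (f t) * Im (f t)) *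
       (Re (f t) * Re (f t) - Im (f t) * Im (f t)) +
     (Re (f t) * Im (f t) + Im (f t) * Re (f t)) *
       (Re (f t) * Im (f t) + Im (f t) * Re (f t)) <> 0).
  { replace (_ + _) with ((Re (f t) * Re (f t) + Im (f t) * Im (f t)) *
      (Re (f t) * Re (f t) + Im (f t) * Im (f t))) by ring.
    apply Rmult_integral_contrapositive; auto. }
  split.
  - eapply is_derive_ext with (f := fun x => Re (f x) * / (Re (f x) * Re (f x) + Im (f x) * Im (f x))).
    + intros x; simpl. unfold Rdiv, Re, Im. f_equal; f_equal; ring.
    + eapply der_eq; [apply der_mult; eassumption|].
      simpl. unfold Re, Im in *; simpl in *. field. split; [exact N2 | exact N].
  - eapply is_derive_ext with (f := fun x => - Im (f x) * / (Re (f x) * Re (f x) + Im (f x) * Im (f x))).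
    + intros x; simpl. unfold Rdiv, Re, Im. f_equal; f_equal; ring.
    + eapply der_eq; [apply der_mult; [apply der_opp|]; eassumption|].
      simpl. unfold Re, Im in *; simpl in *. field. split; [exact N2 | exact N].
Qed.
Lemma Cderiv_exp f t a : Cderiv f t a -> Cderiv (fun x => Cexp (f x)) t (a * Cexp (f t))%C.
Proof.
  intros [H1 H2].
  pose proof (der_comp exp (fun x => Re (f x)) t _ _ (is_derive_exp _) H1) as E.
  pose proof (der_comp cos (fun x => Im (f x)) t _ _ (is_derive_cos _) H2) as Co.
  pose proof (der_comp sin (fun x => Im (f x)) t _ _ (is_derive_sin _) H2) as Si.
  split.
  - refine (der_eq _ _ _ _ (der_mult _ _ _ _ _ E Co) _). unfold Cexp, Re, Im; simpl; ring.
  - refine (der_eq _ _ _ _ (der_mult _ _ _ _ _ E Si) _). unfold Cexp, Re, Im; simpl; ring.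
Qed.
Lemma Cderiv_ray (w : C) t : Cderiv (fun x => RtoC x * w)%C t w.
Proof.
  eapply Cderiv_eq.
  - apply Cderiv_mult; [apply Cderiv_R; apply der_id | apply Cderiv_const].
  - simpl. ring.
Qed.

Lemma is_derive_zero_const (f : R -> R) a b :
  (forall x, a < x < b -> is_derive f x 0) ->
  (forall x, a <= x <= b -> continuity_pt f x) ->
  a <= b -> f a = f b.
Proof.
  intros D Cc Hab. destruct (Req_dec a b) as [->|n]; auto.
  destruct (MVT_gen f a b (fun _ => 0)) as [c [_ Hc]].
  - intros x; rewrite Rmin_left, Rmax_right by lra; intros; apply D; lra.
  - intros x; rewrite Rmin_left, Rmax_right by lra; intros; apply Cc; lra.
  - lra.
Qed.

Lemma Cderiv_zero_const (f : R -> C) a b : a <= b ->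
  (forall x, a <= x <= b -> Cderiv f x (RtoC 0)) -> f a = f b.
Proof.
  intros Hab H. apply C_eq.
  - apply (is_derive_zero_const (fun x => Re (f x))); auto.
    + intros; apply (H x); lra.
    + intros x Hx. apply derivable_continuous_pt. exists 0. apply is_derive_Reals. apply (H x Hx).
  - apply (is_derive_zero_const (fun x => Im (f x))); auto.
    + intros; apply (H x); lra.
    + intros x Hx. apply derivable_continuous_pt. exists 0. apply is_derive_Reals. apply (H x Hx).
Qed.

(** * Complex series *)

Lemma ser_plus (f g : nat -> R) (a b : R) :
  is_series f a -> is_series g b -> is_series (fun n => f n + g n) (a + b).
Proof. apply (@is_series_plus R_AbsRing R_NormedModule). Qed.
Lemma ser_minus (f g : nat -> R) (a b : R) :
  is_series f a -> is_series g b -> is_series (fun n => f n - g n) (a - b).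
Proof. apply (@is_series_minus R_AbsRing R_NormedModule). Qed.
Lemma ser_opp (f : nat -> R) (a : R) : is_series f a -> is_series (fun n => - f n) (- a).
Proof. apply (@is_series_opp R_AbsRing R_NormedModule). Qed.
Lemma ser_scal (c : R) (f : nat -> R) (a : R) : is_series f a -> is_series (fun n => c * f n) (c * a).
Proof. apply (@is_series_scal R_AbsRing R_NormedModule). Qed.
Lemma ser_ext (f g : nat -> R) (a : R) : (forall n, f n = g n) -> is_series f a -> is_series g a.
Proof. apply (@is_series_ext R_AbsRing R_NormedModule). Qed.
Lemma ser_geom q : Rabs q < 1 -> is_series (fun n => q ^ n) (/ (1 - q)).
Proof. apply is_series_geom. Qed.
Lemma ser_zero : is_series (fun _ => 0) 0.
Proof.
  assert (Hq : Rabs (/ 2) < 1) by (rewrite Rabs_pos_eq; lra).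
  pose proof (ser_scal 0 _ _ (ser_geom (/ 2) Hq)) as H.
  rewrite (Rmult_0_l (/ (1 - / 2))) in H.
  eapply ser_ext; [|exact H]. intros; simpl; ring.
Qed.

(** Taken by components, so that the theory of real series applies; [is_series_Cis] links it to
    convergence in [C]. *)
Definition Cis (f : nat -> C) (l : C) : Prop :=
  is_series (fun n => Re (f n)) (Re l) /\ is_series (fun n => Im (f n)) (Im l).

Definition Cs (f : nat -> C) : C := (Series (fun n => Re (f n)), Series (fun n => Im (f n))).

Lemma Cis_unique f l l' : Cis f l -> Cis f l' -> l = l'.
Proof.
  intros [A B] [A' B']. apply C_eq.
  - rewrite <- (is_series_unique _ _ A); apply is_series_unique; auto.
  - rewrite <- (is_series_unique _ _ B); apply is_series_unique; auto.
Qed.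
Lemma Cis_Cs f l : Cis f l -> Cs f = l.
Proof. intros [A B]; apply C_eq; simpl; apply is_series_unique; auto. Qed.
Lemma Cis_ext f g l : (forall n, f n = g n) -> Cis f l -> Cis g l.
Proof. intros E [A B]; split; (eapply is_series_ext; [|eassumption]); intros; simpl; now rewrite E. Qed.
Lemma Cis_eq f l l' : Cis f l -> l = l' -> Cis f l'.
Proof. intros H <-; auto. Qed.
Lemma Cis_plus f g a b : Cis f a -> Cis g b -> Cis (fun n => f n + g n)%C (a + b)%C.
Proof. intros [] []; split; apply ser_plus; assumption. Qed.
Lemma Cis_opp f a : Cis f a -> Cis (fun n => - f n)%C (- a)%C.
Proof. intros []; split; apply ser_opp; assumption. Qed.
Lemma Cis_minus f g a b : Cis f a -> Cis g b -> Cis (fun n => f n - g n)%C (a - b)%C.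
Proof. intros; apply Cis_plus; [|apply Cis_opp]; assumption. Qed.
Lemma Cis_scal c f a : Cis f a -> Cis (fun n => c * f n)%C (c * a)%C.
Proof.
  intros [A B]; split; simpl.
  - apply ser_minus; apply ser_scal; assumption.
  - apply ser_plus; apply ser_scal; assumption.
Qed.
Lemma Cis_0 : Cis (fun _ => RtoC 0) (RtoC 0).
Proof. split; exact ser_zero. Qed.
Lemma Cis_R (f : nat -> R) l : is_series f l -> Cis (fun n => RtoC (f n)) (RtoC l).
Proof. intros H; split; [exact H | exact ser_zero]. Qed.

Lemma ex_series_le_R (f g : nat -> R) :
  (forall n, Rabs (f n) <= g n) -> ex_series g -> ex_series f.
Proof. intros H; apply (@ex_series_le R_AbsRing R_CompleteNormedModule). exact H. Qed.

Lemma Cis_dom f (M : nat -> R) :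
  (forall n, Cmod (f n) <= M n) -> ex_series M -> Cis f (Cs f).
Proof.
  intros H E; split; apply Series_correct; eapply ex_series_le_R; try exact E;
  intros n; (eapply Rle_trans; [|apply H]); [apply Re_le_Cmod | apply Im_le_Cmod].
Qed.
Lemma Cis_ex_dom f (M : nat -> R) :
  (forall n, Cmod (f n) <= M n) -> ex_series M -> exists l, Cis f l.
Proof. intros; exists (Cs f); eapply Cis_dom; eauto. Qed.

Lemma is_series_decr f (l : R) : is_series (fun n => f (S n)) l -> is_series f (l + f 0%nat).
Proof. intros. apply is_series_decr_1. simpl. unfold plus, opp; simpl.
  replace (l + f 0%nat + - f 0%nat) with l by ring. assumption. Qed.
Lemma is_series_incr f (l : R) : is_series f l -> is_series (fun n => f (S n)) (l - f 0%nat).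
Proof. intros. apply is_series_incr_1. simpl. unfold plus; simpl.
  replace (l - f 0%nat + f 0%nat) with l by ring. assumption. Qed.
Lemma Cis_decr f l : Cis (fun n => f (S n)) l -> Cis f (l + f 0%nat)%C.
Proof.
  intros []; split; simpl.
  - apply (is_series_decr (fun n => Re (f n))); assumption.
  - apply (is_series_decr (fun n => Im (f n))); assumption.
Qed.
Lemma Cis_incr f l : Cis f l -> Cis (fun n => f (S n)) (l - f 0%nat)%C.
Proof.
  intros []; split; simpl.
  - apply (is_series_incr (fun n => Re (f n))); assumption.
  - apply (is_series_incr (fun n => Im (f n))); assumption.
Qed.

Fixpoint psum (f : nat -> C) (N : nat) : C :=
  match N with O => RtoC 0 | S N' => (psum f N' + f N')%C end.

Lemma psum_ext f g N : (forall n, (n < N)%nat -> f n = g n) -> psum f N = psum g N.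
Proof. induction N; intros H; simpl; auto. rewrite IHN, H; auto. Qed.

Lemma Re_psum f N : Re (psum f (S N)) = sum_n (fun n => Re (f n)) N.
Proof.
  induction N.
  - rewrite sum_O. unfold Re, Im; simpl. ring.
  - rewrite sum_Sn, <- IHN. reflexivity.
Qed.
Lemma Im_psum f N : Im (psum f (S N)) = sum_n (fun n => Im (f n)) N.
Proof.
  induction N.
  - rewrite sum_O. unfold Re, Im; simpl. ring.
  - rewrite sum_Sn, <- IHN. reflexivity.
Qed.

Definition Clim (u : nat -> C) (l : C) : Prop :=
  is_lim_seq (fun n => Re (u n)) (Re l) /\ is_lim_seq (fun n => Im (u n)) (Im l).

Lemma Cis_Clim f l : Cis f l <-> Clim (psum f) l.
Proof.
  split; intros [A B]; split.
  - apply is_lim_seq_incr_1. eapply is_lim_seq_ext; [|exact A]. intros; symmetry; apply Re_psum.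
  - apply is_lim_seq_incr_1. eapply is_lim_seq_ext; [|exact B]. intros; symmetry; apply Im_psum.
  - apply is_lim_seq_incr_1 in A. eapply is_lim_seq_ext in A; [exact A|]. intros; apply Re_psum.
  - apply is_lim_seq_incr_1 in B. eapply is_lim_seq_ext in B; [exact B|]. intros; apply Im_psum.
Qed.

Lemma Clim_unique u l l' : Clim u l -> Clim u l' -> l = l'.
Proof.
  intros [A B] [A' B']. apply is_lim_seq_unique in A, B, A', B'.
  apply C_eq; congruence.
Qed.
Lemma Clim_ext u v l : (forall n, u n = v n) -> Clim u l -> Clim v l.
Proof. intros E [A B]; split; (eapply is_lim_seq_ext; [|eassumption]); intros; simpl; now rewrite E. Qed.
Lemma Clim_plus u v a b : Clim u a -> Clim v b -> Clim (fun n => u n + v n)%C (a + b)%C.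
Proof. intros [] []; split; apply is_lim_seq_plus'; assumption. Qed.
Lemma Clim_opp u a : Clim u a -> Clim (fun n => - u n)%C (- a)%C.
Proof. intros [H1 H2]; split; simpl; [apply is_lim_seq_opp in H1 | apply is_lim_seq_opp in H2]; assumption. Qed.
Lemma Clim_minus u v a b : Clim u a -> Clim v b -> Clim (fun n => u n - v n)%C (a - b)%C.
Proof. intros; apply Clim_plus; [|apply Clim_opp]; assumption. Qed.
Lemma Clim_mult u v a b : Clim u a -> Clim v b -> Clim (fun n => u n * v n)%C (a * b)%C.
Proof.
  intros [] []; split; simpl.
  - apply is_lim_seq_minus'; apply is_lim_seq_mult'; assumption.
  - apply is_lim_seq_plus'; apply is_lim_seq_mult'; assumption.
Qed.
Lemma Clim_const a : Clim (fun _ => a) a.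
Proof. split; apply is_lim_seq_const. Qed.
Lemma Clim_subseq u a (p : nat -> nat) :
  (forall n, (p n < p (S n))%nat) -> Clim u a -> Clim (fun n => u (p n)) a.
Proof.
  intros H []; split.
  - apply (is_lim_seq_subseq (fun n => Re (u n))); auto. apply eventually_subseq; auto.
  - apply (is_lim_seq_subseq (fun n => Im (u n))); auto. apply eventually_subseq; auto.
Qed.
Lemma is_lim_seq_squeeze0 (u : nat -> R) (a : R) (e : nat -> R) :
  (forall n, Rabs (u n - a) <= e n) -> is_lim_seq e 0 -> is_lim_seq u a.
Proof.
  intros H E.
  apply is_lim_seq_le_le with (u := fun n => a - e n) (w := fun n => a + e n).
  - intros n. specialize (H n). apply Rabs_le_between in H. lra.
  - replace (Finite a) with (Finite (a - 0)) by (f_equal; ring).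
    apply is_lim_seq_minus'; auto; apply is_lim_seq_const.
  - replace (Finite a) with (Finite (a + 0)) by (f_equal; ring).
    apply is_lim_seq_plus'; auto; apply is_lim_seq_const.
Qed.
Lemma Clim_squeeze u a (e : nat -> R) :
  (forall n, Cmod (u n - a) <= e n) -> is_lim_seq e 0 -> Clim u a.
Proof.
  intros H E; split; apply is_lim_seq_squeeze0 with e; auto; intros n;
  eapply Rle_trans; [|apply (H n) | |apply (H n)].
  - apply (Re_le_Cmod (u n - a)%C).
  - apply (Im_le_Cmod (u n - a)%C).
Qed.

Lemma Cmod_psum f M N : (forall n, Cmod (f n) <= M n) -> Cmod (psum f (S N)) <= sum_n M N.
Proof.
  intros H. induction N.
  - rewrite sum_O. simpl. replace (RtoC 0 + f 0%nat)%C with (f 0%nat) by ring. apply H.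
  - rewrite sum_Sn. change (psum f (S (S N))) with (psum f (S N) + f (S N))%C.
    eapply Rle_trans; [apply Cmod_triangle|]. apply Rplus_le_compat; auto.
Qed.

Lemma Clim_Cmod_le u a M : Clim u a -> (forall n, Cmod (u n) <= M) -> Cmod a <= M.
Proof.
  intros [A B] H.
  assert (L : is_lim_seq (fun n => Re (u n) * Re (u n) + Im (u n) * Im (u n))
    (Re a * Re a + Im a * Im a)).
  { apply is_lim_seq_plus'; apply is_lim_seq_mult'; assumption. }
  assert (M0 : 0 <= M) by (eapply Rle_trans; [apply Cmod_nonneg | apply (H 0%nat)]).
  assert (Q : Rbar_le (Re a * Re a + Im a * Im a) (M * M)).
  { eapply is_lim_seq_le; [|exact L|apply is_lim_seq_const].
    intros n; simpl.
    pose proof (Cmod_sqr (u n)) as E. pose proof (Cmod_nonneg (u n)).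
    specialize (H n). nra. }
  simpl in Q. pose proof (Cmod_sqr a). pose proof (Cmod_nonneg a). nra.
Qed.

Lemma sum_n_le_series (M : nat -> R) s N :
  (forall n, 0 <= M n) -> is_series M s -> sum_n M N <= s.
Proof.
  intros P S. apply (is_lim_seq_incr_compare (sum_n M)); [exact S|].
  intros n. rewrite sum_Sn. unfold plus; simpl. specialize (P (Datatypes.S n)). lra.
Qed.

Lemma Cis_Cmod_le f l M s :
  (forall n, Cmod (f n) <= M n) -> Cis f l -> is_series M s -> Cmod l <= s.
Proof.
  intros H A S. apply (Clim_Cmod_le (fun n => psum f (Datatypes.S n))).
  - apply Cis_Clim in A. destruct A as [A B]; split.
    + apply (is_lim_seq_incr_1 (fun n => Re (psum f n))); auto.
    + apply (is_lim_seq_incr_1 (fun n => Im (psum f n))); auto.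
  - intros n. eapply Rle_trans; [apply Cmod_psum; exact H|].
    apply sum_n_le_series; auto.
    intros k; eapply Rle_trans; [apply Cmod_nonneg | apply H].
Qed.

(** * Dominated double series *)

Fixpoint rsum (f : nat -> R) (N : nat) : R :=
  match N with O => 0 | S N' => rsum f N' + f N' end.

Lemma rsum_sum_n f N : rsum f (S N) = sum_n f N.
Proof.
  induction N.
  - rewrite sum_O. simpl. ring.
  - rewrite sum_Sn, <- IHN. reflexivity.
Qed.
Lemma rsum_scal c f N : rsum (fun n => c * f n) N = c * rsum f N.
Proof. induction N; simpl; [ring|rewrite IHN; ring]. Qed.
Lemma rsum_lim f (s : R) : is_series f s -> is_lim_seq (rsum f) s.
Proof.
  intros A. apply is_lim_seq_incr_1. eapply is_lim_seq_ext; [|exact A].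
  intros; symmetry; apply rsum_sum_n.
Qed.
Lemma rsum_le_series f (s : R) N : (forall n, 0 <= f n) -> is_series f s -> rsum f N <= s.
Proof.
  intros P A. destruct N.
  - simpl. apply (Rle_trans _ (sum_n f 0)); [rewrite sum_O; apply P | apply sum_n_le_series; auto].
  - rewrite rsum_sum_n. apply sum_n_le_series; auto.
Qed.
Lemma Cmod_psum_rsum f M N :
  (forall n, (n < N)%nat -> Cmod (f n) <= M n) -> Cmod (psum f N) <= rsum M N.
Proof.
  induction N; intros H; simpl.
  - rewrite Cmod_0. lra.
  - eapply Rle_trans; [apply Cmod_triangle|]. apply Rplus_le_compat; auto.
Qed.

Lemma psum_plus f g N : psum (fun n => f n + g n)%C N = (psum f N + psum g N)%C.
Proof. induction N; simpl; [ring|]. rewrite IHN. ring. Qed.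
Lemma psum_minus f g N : psum (fun n => f n - g n)%C N = (psum f N - psum g N)%C.
Proof. induction N; simpl; [ring|]. rewrite IHN. ring. Qed.
Lemma psum_scal c f N : psum (fun n => c * f n)%C N = (c * psum f N)%C.
Proof. induction N; simpl; [ring|]. rewrite IHN. ring. Qed.
Lemma psum_0 N : psum (fun _ => RtoC 0) N = RtoC 0.
Proof. induction N; simpl; [|rewrite IHN]; ring. Qed.
Lemma psum_swap (a : nat -> nat -> C) N K :
  psum (fun i => psum (fun j => a i j) N) K = psum (fun j => psum (fun i => a i j) K) N.
Proof.
  induction K; simpl.
  - symmetry; apply psum_0.
  - rewrite IHK, <- psum_plus. reflexivity.
Qed.

(** Removing one term at a time shows that the tail of f is itself a series dominated by the tail of
    M. *)
Lemma Cis_tail f l (M : nat -> R) (s : R) N :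
  (forall n, Cmod (f n) <= M n) -> Cis f l -> is_series M s ->
  Cmod (l - psum f N) <= s - rsum M N.
Proof.
  intros H A B.
  assert (G : Cis (fun n => f (n + N)%nat) (l - psum f N)%C /\
    is_series (fun n => M (n + N)%nat) (s - rsum M N)).
  { induction N as [|N [IH1 IH2]].
    - simpl. split.
      + eapply Cis_eq; [eapply Cis_ext; [|exact A]|]; [intros; f_equal; lia | ring].
      + replace (s - 0) with s by ring. eapply ser_ext; [|exact B]; intros; f_equal; lia.
    - apply Cis_incr in IH1. apply is_series_incr in IH2. split.
      + eapply Cis_eq; [eapply Cis_ext; [|exact IH1]|]; [intros; simpl; f_equal; lia |].
        simpl. ring.
      + replace (s - rsum M (S N)) with (s - rsum M N - M (0 + N)%nat) by (simpl; ring).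
        eapply ser_ext; [|exact IH2]. intros; simpl; f_equal; lia. }
  destruct G as [G1 G2].
  apply (Cis_Cmod_le _ _ _ _ (fun n => H (n + N)%nat) G1 G2).
Qed.

Lemma ser_scal_r (c : R) (f : nat -> R) (a : R) :
  is_series f a -> is_series (fun n => f n * c) (a * c).
Proof.
  intros H. rewrite (Rmult_comm a). eapply ser_ext; [|apply (ser_scal c), H].
  intros; apply Rmult_comm.
Qed.
Lemma ser_nonneg f (s : R) : (forall n, 0 <= f n) -> is_series f s -> 0 <= s.
Proof. intros P A. apply (rsum_le_series f s 0 P A). Qed.

Section Fubini.
Variables (a : nat -> nat -> C) (u v : nat -> R) (su sv : R).
Hypothesis Hu : forall i, 0 <= u i.
Hypothesis Hv : forall j, 0 <= v j.
Hypothesis Ha : forall i j, Cmod (a i j) <= u i * v j.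
Hypothesis Su : is_series u su.
Hypothesis Sv : is_series v sv.

(** Cutting each of N full rows after N entries costs the tail of v times the weight u of the row.
    The same estimate is applied to the transposed array. *)
Lemma rows_square (r : nat -> C) N : (forall i, Cis (a i) (r i)) ->
  Cmod (psum r N - psum (fun i => psum (fun j => a i j) N) N) <= su * (sv - rsum v N).
Proof.
  intros R. rewrite <- psum_minus.
  assert (T : 0 <= sv - rsum v N) by (pose proof (rsum_le_series v sv N Hv Sv); lra).
  eapply Rle_trans; [apply (Cmod_psum_rsum _ (fun i => (sv - rsum v N) * u i))|].
  - intros i _. eapply Rle_trans.
    + apply (Cis_tail _ _ (fun j => u i * v j) (u i * sv) N (Ha i) (R i)). apply ser_scal, Sv.
    + rewrite rsum_scal. right; ring.
  - rewrite rsum_scal, Rmult_comm. apply Rmult_le_compat_r; auto.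
    apply rsum_le_series; auto.
Qed.
End Fubini.

(* Both iterated sums are the limit of the sums over the squares i, j < N. *)
Lemma Cis_Fubini (a : nat -> nat -> C) (u v : nat -> R) (r c : nat -> C) s :
  (forall i, 0 <= u i) -> (forall j, 0 <= v j) ->
  (forall i j, Cmod (a i j) <= u i * v j) -> ex_series u -> ex_series v ->
  (forall i, Cis (a i) (r i)) -> (forall j, Cis (fun i => a i j) (c j)) ->
  Cis r s -> Cis c s.
Proof.
  intros Hu Hv Ha [su Su] [sv Sv] Hr Cc A.
  pose proof (ser_nonneg _ _ Hu Su) as pu.
  assert (Bc : forall j, Cmod (c j) <= su * v j).
  { intros j. apply (Cis_Cmod_le (fun i => a i j) (c j) (fun i => u i * v j)); auto.
    apply ser_scal_r; exact Su. }
  destruct (Cis_ex_dom c _ Bc) as [s' A'].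
  { exists (su * sv). apply ser_scal; exact Sv. }
  replace s with s'; auto.
  apply Cis_Clim in A. apply Cis_Clim in A'.
  assert (L : Clim (fun N => psum r N - psum c N)%C (RtoC 0)).
  { apply Clim_squeeze with (e := fun N => su * (sv - rsum v N) + sv * (su - rsum u N)).
    - intros N.
      pose proof (rows_square a u v su sv Hu Hv Ha Su Sv r N Hr) as H1.
      assert (Ha' : forall i j, Cmod (a j i) <= v i * u j) by (intros; rewrite Rmult_comm; auto).
      pose proof (rows_square (fun i j => a j i) v u sv su Hv Hu Ha' Sv Su c N Cc) as H2.
      rewrite <- psum_swap in H2.
      replace (psum r N - psum c N - RtoC 0)%C with
       ((psum r N - psum (fun i => psum (fun j => a i j) N) N)
        - (psum c N - psum (fun i => psum (fun j => a i j) N) N))%C by ring.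
      eapply Rle_trans; [apply Cmod_minus_le|]. apply Rplus_le_compat; assumption.
    - replace (Finite 0) with (Finite (su * (sv - sv) + sv * (su - su))) by (f_equal; ring).
      apply is_lim_seq_plus'; apply is_lim_seq_mult'; try apply is_lim_seq_const;
      apply is_lim_seq_minus'; try apply is_lim_seq_const; apply rsum_lim; assumption. }
  pose proof (Clim_unique _ _ _ L (Clim_minus _ _ _ _ A A')) as E.
  replace s' with (s - (s - s'))%C by ring. rewrite <- E. ring.
Qed.

(** * Termwise differentiation *)

(** The Weierstrass test makes the series and the series of derivatives converge uniformly on the
    open interval, as [CVU_Derive] requires. *)
Lemma ser_derive (f f' : nat -> R -> R) (M M' : nat -> R) a b t :
  a < t < b ->
  (forall n x, a < x < b -> is_derive (f n) x (f' n x)) ->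
  (forall n x, a < x < b -> continuity_pt (f' n) x) ->
  (forall n x, a < x < b -> Rabs (f n x) <= M n) -> ex_series M ->
  (forall n x, a < x < b -> Rabs (f' n x) <= M' n) -> ex_series M' ->
  is_derive (fun x => Series (fun n => f n x)) t (Series (fun n => f' n t)).
Proof.
  intros Ht Hd Hc HM [sM SM] HM' [sM' SM'].
  set (D := fun x => a < x < b).
  assert (oD : open D) by (apply open_and; [apply open_gt | apply open_lt]).
  assert (U : forall (g : nat -> R -> R) N s, (forall n x, D x -> Rabs (g n x) <= N n) ->
     is_series N s -> CVU_dom (fun n x => sum_n (fun k => g k x) n) D).
  { intros g N s HN SN eps.
    destruct SN with (P := fun y => Rabs (y - s) < eps) as [N0 HN0].
    { exists eps. intros y Hy. exact Hy. }
    exists N0. intros n Hn x Hx.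
    assert (E : is_series (fun k => g k x) (Series (fun k => g k x))).
    { apply Series_correct. eapply ex_series_le_R; [intros k; apply (HN k x Hx)|].
      exists s; auto. }
    pose proof (Cis_tail _ _ N s (S n) (fun k => Rle_trans _ _ _ (Req_le _ _ (Cmod_R _)) (HN k x Hx)) (Cis_R _ _ E) SN) as T.
    replace (RtoC (Series (fun k => g k x)) - psum (fun k => RtoC (g k x)) (S n))%C
      with (RtoC (Series (fun k => g k x) - sum_n (fun k => g k x) n)) in T.
    2:{ rewrite RtoC_minus. f_equal. f_equal. apply C_eq.
        - rewrite Re_psum. reflexivity.
        - rewrite Im_psum. symmetry. simpl. clear. induction n; [rewrite sum_O; reflexivity|].
          rewrite sum_Sn, IHn. unfold plus; simpl. ring. }
    rewrite Cmod_R, Rabs_minus_sym in T.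
    assert (X : real (Lim_seq (fun n0 => sum_n (fun k => g k x) n0)) = Series (fun k => g k x)) by reflexivity.
    rewrite X. rewrite rsum_sum_n in T.
    eapply Rle_lt_trans; [exact T|]. specialize (HN0 n Hn). simpl in HN0.
    rewrite Rabs_minus_sym in HN0. eapply Rle_lt_trans; [apply Rle_abs | exact HN0]. }
  assert (DS : forall n x, D x -> is_derive (fun y => sum_n (fun k => f k y) n) x (sum_n (fun k => f' k x) n)).
  { intros n x Hx. apply (is_derive_sum_n (fun k => f k)). intros; apply Hd; exact Hx. }
  assert (DE : forall n x, D x -> Derive (fun y => sum_n (fun k => f k y) n) x = sum_n (fun k => f' k x) n).
  { intros; apply is_derive_unique, DS; auto. }
  assert (CV' : CVU_dom (fun n x => Derive (fun y => sum_n (fun k => f k y) n) x) D).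
  { pose proof (U f' M' sM' HM' SM') as V.
    intros eps. destruct (V eps) as [N0 H0]. exists N0. intros n Hn x Hx.
    rewrite DE by auto.
    rewrite (Lim_seq_ext _ (fun n0 => sum_n (fun k => f' k x) n0)); [apply H0; auto|].
    intros k; apply DE; auto. }
  pose proof (CVU_Derive (fun n x => sum_n (fun k => f k x) n) D oD) as Q.
  assert (G : is_derive (fun y => real (Lim_seq (fun n => sum_n (fun k => f k y) n))) t
     (real (Lim_seq (fun n => Derive (fun y => sum_n (fun k => f k y) n) t)))).
  { apply Q; auto.
    - intros x y z Hx Hy Hz. unfold D in *; lra.
    - apply (U f M sM HM SM).
    - intros n x Hx. eexists; apply DS; auto.
    - intros n x Hx.
      apply continuity_pt_ext_loc with (f := fun x => sum_n (fun k => f' k x) n).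
      + destruct (oD x Hx) as [e He]. exists e. intros y Hy. symmetry. apply DE. apply He, Hy.
      + induction n.
        * apply continuity_pt_ext with (f := f' 0%nat); [intros; rewrite sum_O; auto | apply Hc; auto].
        * apply continuity_pt_ext with (f := fun x => sum_n (fun k => f' k x) n + f' (S n) x);
          [intros; rewrite sum_Sn; auto |]. apply continuity_pt_plus; auto. }
  rewrite (Lim_seq_ext _ (fun n0 => sum_n (fun k => f' k t) n0)) in G; [exact G|].
  intros k; apply DE; auto.
Qed.

Lemma is_derive_continuity_pt (f : R -> R) x (l : R) : is_derive f x l -> continuity_pt f x.
Proof. intros H. apply derivable_continuous_pt. exists l. apply is_derive_Reals; exact H. Qed.

Lemma Cs_derive (f f' : nat -> R -> C) (M M' : nat -> R) a b t :
  a < t < b ->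
  (forall n x, a < x < b -> Cderiv (f n) x (f' n x)) ->
  (forall n x, a < x < b -> exists d, Cderiv (f' n) x d) ->
  (forall n x, a < x < b -> Cmod (f n x) <= M n) -> ex_series M ->
  (forall n x, a < x < b -> Cmod (f' n x) <= M' n) -> ex_series M' ->
  Cderiv (fun x => Cs (fun n => f n x)) t (Cs (fun n => f' n t)).
Proof.
  intros Ht Hd Hd' HM SM HM' SM'; split.
  - refine (ser_derive (fun n x => Re (f n x)) (fun n x => Re (f' n x)) M M' a b t Ht _ _ _ SM _ SM').
    + intros n x Hx; exact (proj1 (Hd n x Hx)).
    + intros n x Hx; destruct (Hd' n x Hx) as [d Hdd]; exact (is_derive_continuity_pt _ _ _ (proj1 Hdd)).
    + intros n x Hx; exact (Rle_trans _ _ _ (Re_le_Cmod _) (HM n x Hx)).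
    + intros n x Hx; exact (Rle_trans _ _ _ (Re_le_Cmod _) (HM' n x Hx)).
  - refine (ser_derive (fun n x => Im (f n x)) (fun n x => Im (f' n x)) M M' a b t Ht _ _ _ SM _ SM').
    + intros n x Hx; exact (proj2 (Hd n x Hx)).
    + intros n x Hx; destruct (Hd' n x Hx) as [d Hdd]; exact (is_derive_continuity_pt _ _ _ (proj2 Hdd)).
    + intros n x Hx; exact (Rle_trans _ _ _ (Im_le_Cmod _) (HM n x Hx)).
    + intros n x Hx; exact (Rle_trans _ _ _ (Im_le_Cmod _) (HM' n x Hx)).
Qed.

(** * Taylor bounds for the complex exponential *)

Lemma exp_le x y : x <= y -> exp x <= exp y.
Proof. intros [H|H]; [left; apply exp_increasing; auto | right; f_equal; auto]. Qed.

(** There is no mean value equality for complex values. The real theorem is applied to the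
    projection of g onto the direction v = g 1 - g 0, and Cauchy-Schwarz bounds the derivative of
    the projection by |v| K. *)
Lemma Cmod_mean_value (g g' : R -> C) K :
  (forall t, 0 <= t <= 1 -> Cderiv g t (g' t)) ->
  (forall t, 0 <= t <= 1 -> Cmod (g' t) <= K) -> Cmod (g 1 - g 0) <= K.
Proof.
  intros D B. set (v := (g 1 - g 0)%C).
  assert (K0 : 0 <= K) by (eapply Rle_trans; [apply Cmod_nonneg | apply (B 0); lra]).
  set (phi := fun t => Re v * Re (g t) + Im v * Im (g t)).
  destruct (MVT_gen phi 0 1 (fun t => Re v * Re (g' t) + Im v * Im (g' t))) as [c [Hc E]].
  - intros x; rewrite Rmin_left, Rmax_right by lra; intros Hx. destruct (D x) as [D1 D2]; [lra|].
    refine (der_eq _ _ _ _ (der_plus _ _ _ _ _ (der_mult _ _ _ _ _ (der_const (Re v) x) D1)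
      (der_mult _ _ _ _ _ (der_const (Im v) x) D2)) _). ring.
  - intros x; rewrite Rmin_left, Rmax_right by lra; intros Hx. destruct (D x) as [D1 D2]; [lra|].
    eapply is_derive_continuity_pt.
    exact (der_plus _ _ _ _ _ (der_mult _ _ _ _ _ (der_const (Re v) x) D1)
      (der_mult _ _ _ _ _ (der_const (Im v) x) D2)).
  - rewrite Rmin_left, Rmax_right in Hc by lra.
    assert (E2 : phi 1 - phi 0 = Cmod v ^ 2).
    { rewrite Cmod_sqr. unfold phi, v, Re, Im; simpl. ring. }
    pose proof (Cmod_nonneg v). specialize (B c Hc). pose proof (Cmod_nonneg (g' c)).
    pose proof (Cmod_sqr v). pose proof (Cmod_sqr (g' c)).
    assert (CS : Re v * Re (g' c) + Im v * Im (g' c) <= Cmod v * Cmod (g' c)).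
    { apply Rsqr_incr_0_var; [|nra]. unfold Rsqr.
      assert (0 <= (Re v * Im (g' c) - Im v * Re (g' c)) ^ 2) by apply pow2_ge_0. nra. }
    destruct (Req_dec (Cmod v) 0); [lra|].
    apply (Rmult_le_reg_l (Cmod v)); nra.
Qed.

Lemma Re_le_Cmod' z : Re z <= Cmod z.
Proof. eapply Rle_trans; [apply Rle_abs | apply Re_le_Cmod]. Qed.

Lemma Cmod_exp_ray y t : 0 <= t <= 1 -> Cmod (Cexp (RtoC t * y)) <= exp (Cmod y).
Proof.
  intros Ht. rewrite Cmod_Cexp. apply exp_le.
  replace (Re (RtoC t * y)%C) with (t * Re y) by (unfold Re; simpl; ring).
  pose proof (Re_le_Cmod' y). pose proof (Cmod_nonneg y). nra.
Qed.
Lemma Cexp_bound1 y : Cmod (Cexp y - RtoC 1) <= Cmod y * exp (Cmod y).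
Proof.
  pose proof (Cmod_mean_value (fun t => Cexp (RtoC t * y)) (fun t => y * Cexp (RtoC t * y))%C
    (Cmod y * exp (Cmod y))) as H.
  cbv beta in H. replace (RtoC 1 * y)%C with y in H by ring.
  replace (RtoC 0 * y)%C with (RtoC 0) in H by ring. rewrite Cexp_0 in H.
  apply H; intros t Ht.
  - apply Cderiv_exp, Cderiv_ray.
  - rewrite Cmod_mult. apply Rmult_le_compat_l; [apply Cmod_nonneg | apply Cmod_exp_ray; auto].
Qed.
Lemma Cmod_scal_le t y : 0 <= t <= 1 -> Cmod (RtoC t * y) <= Cmod y.
Proof. intros. rewrite Cmod_mult, Cmod_R_pos by lra. pose proof (Cmod_nonneg y). nra. Qed.

Lemma Cexp_bound1_ray y t : 0 <= t <= 1 ->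
  Cmod (Cexp (RtoC t * y) - RtoC 1) <= Cmod y * exp (Cmod y).
Proof.
  intros Ht. eapply Rle_trans; [apply Cexp_bound1|].
  apply Rmult_le_compat; try apply Cmod_nonneg; [left; apply exp_pos | | apply exp_le];
  apply Cmod_scal_le; auto.
Qed.
(** Along the ray t y the derivative of a Taylor remainder is y times the preceding remainder, so
    each order follows from the one before by [Cmod_mean_value]. *)
Lemma Cexp_bound2 y : Cmod (Cexp y - RtoC 1 - y) <= Cmod y ^ 2 * exp (Cmod y).
Proof.
  pose proof (Cmod_mean_value (fun t => Cexp (RtoC t * y) - RtoC t * y)%C
    (fun t => y * Cexp (RtoC t * y) - y)%C
    (Cmod y ^ 2 * exp (Cmod y))) as H.
  cbv beta in H. replace (RtoC 1 * y)%C with y in H by ring.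
  replace (RtoC 0 * y)%C with (RtoC 0) in H by ring. rewrite Cexp_0 in H.
  replace (Cexp y - RtoC 1 - y)%C with (Cexp y - y - (RtoC 1 - RtoC 0))%C by ring.
  apply H; intros t Ht.
  - apply Cderiv_minus; [apply Cderiv_exp|]; apply Cderiv_ray.
  - replace (y * Cexp (RtoC t * y) - y)%C with (y * (Cexp (RtoC t * y) - RtoC 1))%C by ring.
    rewrite Cmod_mult. replace (Cmod y ^ 2 * exp (Cmod y)) with (Cmod y * (Cmod y * exp (Cmod y))) by ring.
    apply Rmult_le_compat_l; [apply Cmod_nonneg | apply Cexp_bound1_ray; auto].
Qed.
Lemma C2_eq : RtoC 2 = (RtoC 1 + RtoC 1)%C.
Proof. rewrite <- RtoC_plus; f_equal; ring. Qed.
Lemma Cexp_bound3 y :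
  Cmod (Cexp y - RtoC 1 - y - y * y / RtoC 2) <= Cmod y ^ 3 * exp (Cmod y).
Proof.
  pose proof (Cmod_mean_value (fun t => Cexp (RtoC t * y) - RtoC t * y - (RtoC t * y) * (RtoC t * y) * / RtoC 2)%C
    (fun t => y * Cexp (RtoC t * y) - y - y * (RtoC t * y))%C
    (Cmod y ^ 3 * exp (Cmod y))) as H.
  cbv beta in H. replace (RtoC 1 * y)%C with y in H by ring.
  replace (RtoC 0 * y)%C with (RtoC 0) in H by ring. rewrite Cexp_0 in H.
  replace (Cexp y - RtoC 1 - y - y * y / RtoC 2)%C with
   (Cexp y - y - y * y * / RtoC 2 - (RtoC 1 - RtoC 0 - RtoC 0 * RtoC 0 * / RtoC 2))%C
   by (field; apply RtoC_neq0; lra).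
  apply H; intros t Ht.
  - apply Cderiv_minus; [apply Cderiv_minus; [apply Cderiv_exp|]; apply Cderiv_ray|].
    eapply Cderiv_eq; [apply Cderiv_mult; [apply Cderiv_mult; apply Cderiv_ray | apply Cderiv_const]|].
    rewrite C2_eq. field.
  - replace (y * Cexp (RtoC t * y) - y - y * (RtoC t * y))%C
     with (y * (Cexp (RtoC t * y) - RtoC 1 - RtoC t * y))%C by ring.
    rewrite Cmod_mult. replace (Cmod y ^ 3 * exp (Cmod y)) with (Cmod y * (Cmod y ^ 2 * exp (Cmod y))) by ring.
    apply Rmult_le_compat_l; [apply Cmod_nonneg|].
    eapply Rle_trans; [apply Cexp_bound2|].
    assert (Cmod (RtoC t * y) <= Cmod y) by (apply Cmod_scal_le; auto).
    apply Rmult_le_compat; [apply pow2_ge_0 | left; apply exp_pos | | apply exp_le; auto].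
    apply pow_incr; split; [apply Cmod_nonneg | auto].
Qed.

(** * Symmetric sums over the integers *)

Fixpoint zsum (g : Z -> C) (N : nat) : C :=
  match N with
  | O => g 0%Z
  | S N' => (zsum g N' + (g (Z.of_nat N) + g (- Z.of_nat N)%Z))%C
  end.

Lemma zsum_psum g N :
  zsum g N = (g 0%Z + psum (fun m => g (Z.of_nat (S m)) + g (- Z.of_nat (S m))%Z)%C N)%C.
Proof. induction N; cbn [zsum psum]; [ring|]. rewrite IHN. ring. Qed.
Lemma zsum_ext g h N : (forall m, g m = h m) -> zsum g N = zsum h N.
Proof. intros E; induction N; cbn [zsum]; rewrite ?IHN, ?E; auto. Qed.
Lemma zsum_scal c g N : zsum (fun m => c * g m)%C N = (c * zsum g N)%C.
Proof. induction N; cbn [zsum]; [reflexivity|]. rewrite IHN. ring. Qed.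
Lemma zsum_refl g N : zsum (fun m => g (- m)%Z) N = zsum g N.
Proof. induction N; cbn [zsum]; [reflexivity|]. rewrite IHN, Z.opp_involutive. ring. Qed.
(** Moving the window [-N, N] by one step gains the index N + 1 and loses -N. *)
Lemma zsum_succ g N :
  (zsum (fun m => g (m + 1)%Z) N + g (- Z.of_nat N)%Z)%C = (zsum g N + g (Z.of_nat N + 1)%Z)%C.
Proof.
  induction N.
  - simpl. ring.
  - cbn [zsum].
    replace (Z.of_nat (S N)) with (Z.of_nat N + 1)%Z by lia.
    replace (- (Z.of_nat N + 1) + 1)%Z with (- Z.of_nat N)%Z by lia.
    set (a := zsum (fun m => g (m + 1)%Z) N) in *.
    replace (a + (g (Z.of_nat N + 1 + 1)%Z + g (- Z.of_nat N)%Z) + g (- (Z.of_nat N + 1))%Z)%C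
      with ((a + g (- Z.of_nat N)%Z) + (g (Z.of_nat N + 1 + 1)%Z + g (- (Z.of_nat N + 1))%Z))%C by ring.
    rewrite IHN. ring.
Qed.
(** The even and odd indices together fill [-2 N, 2 N + 1], one term more than a symmetric
    window. *)
Lemma zsum_dup g N :
  (zsum (fun m => g (2 * m)%Z) N + zsum (fun m => g (2 * m + 1)%Z) N)%C
  = (zsum g (2 * N) + g (2 * Z.of_nat N + 1)%Z)%C.
Proof.
  induction N.
  - simpl. reflexivity.
  - replace (2 * S N)%nat with (S (S (2 * N))) by lia. cbn [zsum].
    set (a := zsum (fun m => g (2 * m)%Z) N) in *.
    set (b := zsum (fun m => g (2 * m + 1)%Z) N) in *.
    replace (a + (g (2 * Z.of_nat (S N))%Z + g (2 * - Z.of_nat (S N))%Z) +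
      (b + (g (2 * Z.of_nat (S N) + 1)%Z + g (2 * - Z.of_nat (S N) + 1)%Z)))%C with
      ((a + b) + (g (2 * Z.of_nat (S N))%Z + g (2 * - Z.of_nat (S N))%Z) +
      (g (2 * Z.of_nat (S N) + 1)%Z + g (2 * - Z.of_nat (S N) + 1)%Z))%C by ring.
    rewrite IHN.
    replace (Z.of_nat (S (2 * N))) with (2 * Z.of_nat N + 1)%Z by lia.
    replace (Z.of_nat (S (S (2 * N)))) with (2 * Z.of_nat (S N))%Z by lia.
    replace (2 * - Z.of_nat (S N))%Z with (- (2 * Z.of_nat (S N)))%Z by lia.
    replace (- (2 * Z.of_nat (S N)) + 1)%Z with (- (2 * Z.of_nat N + 1))%Z by lia.
    ring.
Qed.

Definition is_zseries (g : Z -> C) (l : C) : Prop := Clim (zsum g) l.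

Lemma LZ_ext g h l : (forall m, g m = h m) -> is_zseries g l -> is_zseries h l.
Proof. intros E; apply Clim_ext; intros; apply zsum_ext; auto. Qed.
Lemma LZ_Cis g l :
  is_zseries g l <-> Cis (fun m => g (Z.of_nat (S m)) + g (- Z.of_nat (S m))%Z)%C (l - g 0%Z)%C.
Proof.
  rewrite Cis_Clim. split; intros H.
  - eapply Clim_ext; [|apply (Clim_minus _ _ _ _ H (Clim_const (g 0%Z)))].
    intros n; cbv beta. rewrite zsum_psum. ring.
  - replace l with ((l - g 0%Z) + g 0%Z)%C by ring.
    eapply Clim_ext; [|apply (Clim_plus _ _ _ _ H (Clim_const (g 0%Z)))].
    intros n; cbv beta. rewrite zsum_psum. ring.
Qed.
Lemma LZ_scal c g l : is_zseries g l -> is_zseries (fun m => c * g m)%C (c * l)%C.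
Proof.
  intros H. eapply Clim_ext; [intros; symmetry; apply zsum_scal|].
  apply Clim_mult; [apply Clim_const | exact H].
Qed.

Definition u2 (n : nat) : R := / INR (S n) ^ 2.

Lemma INR_S_pos n : 0 < INR (S n).
Proof. apply lt_0_INR; lia. Qed.
Lemma INR_S_ge1 n : 1 <= INR (S n).
Proof. rewrite S_INR. pose proof (pos_INR n); lra. Qed.
Lemma u2_pos n : 0 <= u2 n.
Proof. left; apply Rinv_0_lt_compat, pow_lt, INR_S_pos. Qed.

(** Comparison with the telescoping series of 2 / (x (x + 1)), where x = n + 1. *)
Lemma ex_series_u2 : ex_series u2.
Proof.
  apply (ex_series_le_R u2 (fun n => 2 * (/ INR (S n) - / INR (S (S n))))).
  - intros n. rewrite Rabs_pos_eq by apply u2_pos. unfold u2.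
    rewrite (S_INR (S n)). pose proof (INR_S_ge1 n) as H. set (x := INR (S n)) in *.
    replace (2 * (/ x - / (x + 1))) with ((2 / (x + 1)) * / x) by (field; lra).
    replace (/ x ^ 2) with (/ x * / x) by (field; lra).
    apply Rmult_le_compat_r; [left; apply Rinv_0_lt_compat; lra|].
    apply Rmult_le_reg_l with (x * (x + 1)); [nra|]. field_simplify; lra.
  - exists (2 * (1 - 0)). apply ser_scal.
    assert (L : is_lim_seq (fun n => / INR (S n)) 0).
    { apply (is_lim_seq_incr_1 (fun n => / INR n)).
      replace (Finite 0) with (Rbar_inv p_infty) by reflexivity.
      apply is_lim_seq_inv; [apply is_lim_seq_INR | discriminate]. }
    assert (L2 : is_lim_seq (fun n => 1 - / INR (S (S n))) (1 - 0)).
    { apply is_lim_seq_minus'; [apply is_lim_seq_const|].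
      apply (is_lim_seq_incr_1 (fun n => / INR (S n))); exact L. }
    apply (is_lim_seq_ext _ (sum_n (fun n => / INR (S n) - / INR (S (S n))))) in L2; [exact L2|].
    intros n. induction n.
    + rewrite sum_O. simpl. lra.
    + rewrite sum_Sn, <- IHn. unfold plus; simpl. lra.
Qed.

Lemma LZ_ex_dom g K :
  (forall m, m <> 0%Z -> Cmod (g m) <= K / IZR m ^ 2) ->
  exists l, is_zseries g l /\ Cmod (l - g 0%Z) <= 2 * K * Series u2.
Proof.
  intros H.
  assert (B : forall n, Cmod (g (Z.of_nat (S n)) + g (- Z.of_nat (S n))%Z) <= 2 * K * u2 n).
  { intros n. eapply Rle_trans; [apply Cmod_triangle|].
    pose proof (H (Z.of_nat (S n)) ltac:(lia)) as H1. pose proof (H (- Z.of_nat (S n))%Z ltac:(lia)) as H2.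
    rewrite opp_IZR in H2. rewrite <- INR_IZR_INZ in *. unfold u2, Rdiv in *.
    replace ((- INR (S n)) ^ 2) with (INR (S n) ^ 2) in H2 by ring. lra. }
  destruct (Cis_ex_dom _ _ B) as [l Hl].
  { destruct ex_series_u2 as [s Hs]. exists (2 * K * s). apply ser_scal; auto. }
  exists (l + g 0%Z)%C. split.
  - apply LZ_Cis. eapply Cis_eq; [exact Hl | ring].
  - replace (l + g 0%Z - g 0%Z)%C with l by ring.
    apply (Cis_Cmod_le _ _ _ _ B Hl). apply ser_scal, Series_correct, ex_series_u2.
Qed.

(** This is what allows a symmetric sum, possibly not absolutely convergent, to be shifted or split
    by parity: the boundary terms disappear in the limit. *)
Definition vanishing (g : Z -> C) : Prop :=
  Clim (fun n => g (Z.of_nat n)) (RtoC 0) /\ Clim (fun n => g (- Z.of_nat n)%Z) (RtoC 0).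

Lemma Clim_incr u l : Clim (fun n => u (S n)) l <-> Clim u l.
Proof.
  split; intros [A B]; split.
  - apply (is_lim_seq_incr_1 (fun n => Re (u n))); exact A.
  - apply (is_lim_seq_incr_1 (fun n => Im (u n))); exact B.
  - apply (is_lim_seq_incr_1 (fun n => Re (u n))) in A; exact A.
  - apply (is_lim_seq_incr_1 (fun n => Im (u n))) in B; exact B.
Qed.

Lemma vanishing_bound g K : 
  (forall m, m <> 0%Z -> Cmod (g m) <= K / IZR m ^ 2) -> vanishing g.
Proof.
  intros H.
  assert (L : is_lim_seq (fun n => K * u2 n) 0).
  { replace (Finite 0) with (Finite (K * 0)) by (f_equal; ring).
    apply is_lim_seq_mult'; [apply is_lim_seq_const|].
    apply (ex_series_lim_0 u2), ex_series_u2. }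
  split; apply Clim_incr; apply Clim_squeeze with (e := fun n => K * u2 n); auto; intros n.
  - pose proof (H (Z.of_nat (S n)) ltac:(lia)) as H1.
    rewrite <- INR_IZR_INZ in H1. replace (_ - _)%C with (g (Z.of_nat (S n))) by ring. exact H1.
  - pose proof (H (- Z.of_nat (S n))%Z ltac:(lia)) as H1.
    rewrite opp_IZR, <- INR_IZR_INZ in H1. replace (_ - _)%C with (g (- Z.of_nat (S n))%Z) by ring.
    unfold u2. replace ((- INR (S n)) ^ 2) with (INR (S n) ^ 2) in H1 by ring. exact H1.
Qed.

Lemma vanishing_succ g : vanishing g -> vanishing (fun m => g (m + 1)%Z).
Proof.
  intros [A B]; split.
  - apply Clim_incr in A. eapply Clim_ext; [|exact A]. intros; cbv beta; f_equal; lia.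
  - apply Clim_incr. eapply Clim_ext; [|exact B]. intros; cbv beta; f_equal; lia.
Qed.
Lemma vanishing_refl g : vanishing g -> vanishing (fun m => g (- m)%Z).
Proof.
  intros [A B]; split; auto. eapply Clim_ext; [|exact A]. intros; cbv beta; f_equal; lia.
Qed.
Lemma LZ_refl g l : is_zseries g l -> is_zseries (fun m => g (- m)%Z) l.
Proof. intros H; eapply Clim_ext; [|exact H]. intros; symmetry; apply zsum_refl. Qed.

Lemma LZ_succ g l : vanishing g -> is_zseries g l -> is_zseries (fun m => g (m + 1)%Z) l.
Proof.
  intros [A B] H. unfold is_zseries.
  apply Clim_incr in A.
  pose proof (Clim_minus _ _ _ _ (Clim_plus _ _ _ _ H A) B) as Q.
  replace l with (l + RtoC 0 - RtoC 0)%C by ring.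
  eapply Clim_ext; [|exact Q]. intros n; cbv beta.
  pose proof (zsum_succ g n) as E. replace (Z.of_nat (S n)) with (Z.of_nat n + 1)%Z by lia.
  rewrite <- E. ring.
Qed.

Lemma LZ_shift g l (p : Z) : vanishing g -> is_zseries g l -> is_zseries (fun m => g (m + p)%Z) l.
Proof.
  assert (P : forall (n : nat) h, vanishing h -> is_zseries h l -> is_zseries (fun m => h (m + Z.of_nat n)%Z) l).
  { induction n; intros h V H.
    - eapply LZ_ext; [|exact H]. intros; f_equal; lia.
    - eapply LZ_ext; [|apply (IHn (fun m => h (m + 1)%Z)); [apply vanishing_succ; auto | apply LZ_succ; auto]].
      intros; cbv beta; f_equal; lia. }
  intros V H. destruct (Z_le_gt_dec 0 p).
  - eapply LZ_ext; [|apply (P (Z.to_nat p) g V H)]. intros; cbv beta; f_equal; lia.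
  - eapply LZ_ext; [|apply LZ_refl, (P (Z.to_nat (- p)) (fun m => g (- m)%Z)); [apply vanishing_refl; auto | apply LZ_refl; auto]].
    intros; cbv beta; f_equal; lia.
Qed.

Lemma LZ_dup g a b l : vanishing g ->
  is_zseries (fun m => g (2 * m)%Z) a -> is_zseries (fun m => g (2 * m + 1)%Z) b -> is_zseries g l -> (a + b = l)%C.
Proof.
  intros [V _] A B L.
  apply (Clim_unique (fun n => zsum g (2 * n) + g (2 * Z.of_nat n + 1)%Z)%C).
  - eapply Clim_ext; [|apply (Clim_plus _ _ _ _ A B)]. intros; apply zsum_dup.
  - replace l with (l + RtoC 0)%C by ring. apply Clim_plus.
    + apply (Clim_subseq (zsum g) l (fun n => (2 * n)%nat)); [intros; lia | exact L].
    + eapply Clim_ext; [|apply (Clim_subseq (fun n => g (Z.of_nat n)) (RtoC 0) (fun n => (2 * n + 1)%nat)); [intros; lia | exact V]].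
      intros; cbv beta. f_equal. lia.
Qed.

(** * Partial fractions of the hyperbolic functions *)

(* [Afun x] and [Bfun x / 6] are the sums of 1 / (x + 2 pi i m)^2 and
   1 / (x + 2 pi i m)^4 over the integers m. *)
Definition Afun (x : C) : C := (Cexp x / ((Cexp x - RtoC 1) * (Cexp x - RtoC 1)))%C.
Definition Bfun (x : C) : C :=
  (Afun x + (RtoC 1 + RtoC 1) * (RtoC 1 + RtoC 1 + RtoC 1) * (Afun x * Afun x))%C.
Definition inv2 (x : C) : C := (/ (x * x))%C.
Definition inv4 (x : C) : C := (inv2 x * inv2 x)%C.
Definition tr (x : C) (m : Z) : C := (x + RtoC (2 * PI * IZR m) * Ci)%C.

Lemma Re_tr x m : Re (tr x m) = Re x.
Proof. unfold tr, Re; simpl. ring. Qed.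
Lemma Im_tr x m : Im (tr x m) = Im x + 2 * PI * IZR m.
Proof. unfold tr, Im; simpl. ring. Qed.

Lemma PI_gt3 : 3 < PI.
Proof. pose proof PI2_3_2; lra. Qed.

Lemma sin_lb_third t : 0 <= t <= 2 -> t / 3 <= sin t.
Proof.
  intros [H0 H1]. pose proof PI_gt3 as P3.
  destruct (sin_bound t 0 H0 ltac:(lra)) as [L _].
  eapply Rle_trans; [|exact L].
  unfold sin_approx, sin_term. simpl.
  replace (_ + _) with (t - t * (t * t) / 6) by field.
  assert (0 <= t * t <= 4) by nra. nra.
Qed.

Lemma one_minus_cos_ge b : Rabs b <= 4 -> b ^ 2 / 18 <= 1 - cos b.
Proof.
  intros H.
  replace b with (2 * (b / 2)) at 2 by field. rewrite cos_2a_sin.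
  assert (E : Rabs (b / 2) / 3 <= sin (Rabs (b / 2))).
  { apply sin_lb_third. rewrite Rabs_div by lra. rewrite (Rabs_pos_eq 2) by lra.
    pose proof (Rabs_pos b); lra. }
  assert (Q : sin (Rabs (b / 2)) * sin (Rabs (b / 2)) = sin (b / 2) * sin (b / 2)).
  { unfold Rabs; destruct (Rcase_abs (b / 2)); rewrite ?sin_neg; ring. }
  assert (Q2 : Rabs (b / 2) * Rabs (b / 2) = (b / 2) * (b / 2)).
  { unfold Rabs; destruct (Rcase_abs (b / 2)); ring. }
  pose proof (Rabs_pos (b / 2)). nra.
Qed.

Lemma exp_minus1_ge a : 0 <= a -> a <= exp a - 1.
Proof. intros. pose proof (exp_ineq1_le a). lra. Qed.

Lemma Cexp_sub1_sqr x :
  Cmod (Cexp x - RtoC 1) ^ 2 = (exp (Re x) - 1) ^ 2 + 2 * exp (Re x) * (1 - cos (Im x)).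
Proof.
  rewrite Cmod_sqr. unfold Cexp, Re, Im; simpl.
  pose proof (sin2_cos2 (snd x)) as E. unfold Rsqr in E.
  set (s := sin (snd x)) in *. set (c := cos (snd x)) in *. set (e := exp (fst x)).
  replace ((e * s + - 0) * ((e * s + - 0) * 1)) with (e * e * (s * s)) by ring.
  replace (s * s) with (1 - c * c) by lra. ring.
Qed.

(** In [Cexp_sub1_sqr] the first summand is at least (Re x)^2 and the second at least (Im x)^2 / 9.
    The bound 4 on |Im x| leaves room for pi. *)
Lemma Cexp_sub1_ge x : 0 <= Re x -> Rabs (Im x) <= 4 -> Cmod x / 3 <= Cmod (Cexp x - RtoC 1).
Proof.
  intros Ha Hb.
  pose proof (Cexp_sub1_sqr x) as E. pose proof (one_minus_cos_ge _ Hb) as Q.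
  pose proof (exp_minus1_ge _ Ha) as Q2.
  pose proof (Cmod_sqr x) as E2. pose proof (Cmod_nonneg x). pose proof (Cmod_nonneg (Cexp x - RtoC 1)).
  apply Rsqr_incr_0_var; auto. unfold Rsqr.
  assert (Re x * Re x <= (exp (Re x) - 1) ^ 2) by nra.
  assert (Im x ^ 2 / 9 <= 2 * exp (Re x) * (1 - cos (Im x))) by (pose proof (COS_bound (Im x)); nra).
  nra.
Qed.

Lemma Cmod_pos x : x <> RtoC 0 -> 0 < Cmod x.
Proof. apply Cmod_gt_0. Qed.

Lemma Cmod_inv2 x : x <> RtoC 0 -> Cmod (inv2 x) = / Cmod x ^ 2.
Proof.
  intros H. unfold inv2. rewrite Cmod_inv by (apply Cmult_neq_0; auto).
  rewrite Cmod_mult. f_equal; ring.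
Qed.
Lemma Cmod_inv4 x : x <> RtoC 0 -> Cmod (inv4 x) = / Cmod x ^ 4.
Proof.
  intros H. unfold inv4. rewrite Cmod_mult, Cmod_inv2 by auto.
  pose proof (Cmod_pos x H). field. lra.
Qed.

(** The right half of the closed period strip without 0, the only pole there of the functions to be
    compared. Points with Re x = 0 are included so that x = pi i, which yields the zeta values, is
    covered. *)
Definition Om (x : C) : Prop := 0 <= Re x /\ Rabs (Im x) <= PI /\ x <> RtoC 0.

Lemma Om_exp x : Om x -> Cmod x / 3 <= Cmod (Cexp x - RtoC 1).
Proof. intros [H [H1 _]]. apply Cexp_sub1_ge; auto. pose proof PI_4; lra. Qed.
Lemma Om_exp_neq x : Om x -> (Cexp x - RtoC 1)%C <> RtoC 0.
Proof.
  intros H. apply C_neq0_Cmod. pose proof (Om_exp x H).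
  destruct H as [_ [_ H]]. apply Cmod_pos in H. lra.
Qed.

Lemma exp_1_le3 x : x <= 1 -> exp x <= 3.
Proof. intros. eapply Rle_trans; [apply exp_le; eassumption | apply exp_le_3]. Qed.

Lemma Afun_bound_big x : Om x -> 1 <= Cmod x -> Cmod (Afun x) <= 27.
Proof.
  intros O H. pose proof (Om_exp x O) as L. pose proof (Om_exp_neq x O) as N.
  unfold Afun, Cdiv. rewrite Cmod_mult, Cmod_inv by (apply Cmult_neq_0; auto).
  rewrite Cmod_mult, Cmod_Cexp.
  set (d := Cmod (Cexp x - RtoC 1)) in *.
  assert (D : 0 < d) by lra.
  apply Rmult_le_reg_r with (d * d); [nra|].
  rewrite Rmult_assoc, Rinv_l by nra. rewrite Rmult_1_r.
  destruct (Rle_dec (Re x) 1) as [r|r].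
  - pose proof (exp_1_le3 _ r). nra.
  - assert (G : exp (Re x) - 1 <= d).
    { pose proof (Cmod_minus_ge (Cexp x) (RtoC 1)) as G. rewrite Cmod_Cexp, Cmod_1 in G. exact G. }
    pose proof (exp_ineq1_le (Re x)). nra.
Qed.

(** With D = e^x - 1 the difference is (x^2 D - (D - x) (D + x)) / (x D)^2, where the numerator is
    O(|x|^3) and the denominator at least |x|^4 / 9. The bound is crude, but the weight in
    [herglotz] tolerates a simple pole. *)
Lemma Afun_bound_small x : Om x -> Cmod x <= 1 ->
  Cmod (Afun x - inv2 x) <= 135 / Cmod x.
Proof.
  intros O H. pose proof (Om_exp x O) as L. pose proof (Om_exp_neq x O) as N.
  pose proof (Cexp_bound1 x) as B1. pose proof (Cexp_bound2 x) as B2.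
  pose proof (exp_1_le3 _ H) as E3.
  destruct O as [_ [_ X0]]. pose proof (Cmod_pos x X0) as Hp.
  set (D := (Cexp x - RtoC 1)%C) in *.
  assert (EA : (Afun x - inv2 x)%C = (((x * x) * D - (D - x) * (D + x)) / (x * x * (D * D)))%C).
  { unfold Afun, inv2. fold D. replace (Cexp x) with (D + RtoC 1)%C by (unfold D; ring).
    field. split; auto. }
  rewrite EA. clear EA. clearbody D. unfold Cdiv.
  rewrite Cmod_mult, Cmod_inv by (repeat apply Cmult_neq_0; auto).
  rewrite !Cmod_mult.
  remember (Cmod x) as r eqn:Er. remember (Cmod D) as d eqn:Ed.
  assert (Hd : d <= 3 * r) by nra.
  assert (Hr : Cmod (D - x) <= 3 * r ^ 2) by nra.
  assert (Hs : Cmod (D + x) <= 4 * r) by (pose proof (Cmod_triangle D x); lra).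
  assert (Hn : Cmod (x * x * D - (D - x) * (D + x)) <= 15 * r ^ 3).
  { eapply Rle_trans; [apply Cmod_minus_le|]. rewrite !Cmod_mult, <- Er, <- Ed.
    pose proof (Cmod_nonneg (D - x)). pose proof (Cmod_nonneg (D + x)).
    assert (r * r * d <= 3 * r ^ 3) by nra.
    assert (Cmod (D - x) * Cmod (D + x) <= 3 * r ^ 2 * (4 * r)) by (apply Rmult_le_compat; auto).
    nra. }
  assert (Hdd : r * r / 9 <= d * d) by nra.
  apply Rle_trans with (15 * r ^ 3 * / (r * r * (r * r / 9))).
  - apply Rmult_le_compat; [apply Cmod_nonneg | left; apply Rinv_0_lt_compat | exact Hn |].
    + assert (0 < r * r) by nra. nra.
    + assert (0 < r * r) by nra. apply Rinv_le_contravar; nra.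
  - right. field. lra.
Qed.

Lemma Om_inv_bound x : Om x -> Cmod (Afun x - inv2 x) <= 135 * (1 + / Cmod x).
Proof.
  intros O. pose proof O as [_ [_ X0]]. pose proof (Cmod_pos x X0) as Hp.
  assert (0 < / Cmod x) by (apply Rinv_0_lt_compat; auto).
  destruct (Rle_dec (Cmod x) 1) as [r|r].
  - pose proof (Afun_bound_small x O r). unfold Rdiv in *. lra.
  - eapply Rle_trans; [apply Cmod_minus_le|].
    pose proof (Afun_bound_big x O ltac:(lra)). rewrite Cmod_inv2 by auto.
    assert (/ Cmod x ^ 2 <= 1).
    { rewrite <- Rinv_1. apply Rinv_le_contravar; nra. }
    lra.
Qed.

Lemma half_neq0 x : x <> RtoC 0 -> (x / RtoC 2)%C <> RtoC 0.
Proof.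
  intros H E. apply H. replace x with (x / RtoC 2 * RtoC 2)%C; [rewrite E; ring|].
  field.
Qed.
Lemma Re_half x : Re (x / RtoC 2)%C = Re x / 2.
Proof. unfold Re; simpl. field. Qed.
Lemma Im_half x : Im (x / RtoC 2)%C = Im x / 2.
Proof. unfold Im; simpl. field. Qed.
Lemma Cmod_half x : Cmod (x / RtoC 2) = Cmod x / 2.
Proof.
  unfold Cdiv. rewrite Cmod_mult, Cmod_inv, Cmod_R_pos by (try lra; apply RtoC_neq0; lra). reflexivity.
Qed.
Lemma Om_half x : Om x -> Om (x / RtoC 2)%C.
Proof.
  intros [A [B X0]]. repeat split.
  - rewrite Re_half; lra.
  - rewrite Im_half. unfold Rdiv. rewrite Rabs_mult, (Rabs_pos_eq (/ 2)) by lra.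
    pose proof (Rabs_pos (Im x)). lra.
  - apply half_neq0; auto.
Qed.

(** The second solution y of 2 y = x modulo 2 pi i, beside x / 2. The sign is chosen so that y
    remains in the strip; its imaginary part then has modulus at least pi / 2, away from the
    pole. *)
Definition other (x : C) : C :=
  if Rle_dec 0 (Im x) then (x / RtoC 2 - RtoC PI * Ci)%C else (x / RtoC 2 + RtoC PI * Ci)%C.

Lemma Om_other x : Om x -> Om (other x) /\ 1 <= Cmod (other x).
Proof.
  intros [A [B X0]]. pose proof PI_gt3. apply Rabs_le_between in B.
  assert (R0 : Re (other x) = Re x / 2).
  { unfold other; destruct (Rle_dec 0 (Im x)); unfold Re; simpl; field. }
  assert (I0 : PI / 2 <= Rabs (Im (other x)) <= PI).
  { unfold other; destruct (Rle_dec 0 (Im x)).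
    - replace (Im (x / RtoC 2 - RtoC PI * Ci)%C) with (Im x / 2 - PI) by (unfold Im; simpl; field).
      rewrite Rabs_left1; lra.
    - replace (Im (x / RtoC 2 + RtoC PI * Ci)%C) with (Im x / 2 + PI) by (unfold Im; simpl; field).
      rewrite Rabs_pos_eq; lra. }
  assert (M1 : 1 <= Cmod (other x)) by (pose proof (Im_le_Cmod (other x)); lra).
  split; auto. repeat split; try lra. apply C_neq0_Cmod; lra.
Qed.

(* Herglotz's trick: the functional equation contracts the weighted sup norm
   with weight 1 + |x|^-e by the factor 3/4. *)
Lemma herglotz (T : C -> C) (e : nat) (K : R) :
  (forall x, Om x -> T x = (RtoC (/ (2 * 2 ^ e)) * (T (x / RtoC 2) + T (other x)))%C) ->
  (1 <= e)%nat ->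
  (forall x, Om x -> Cmod (T x) <= K * (1 + (/ Cmod x) ^ e)) ->
  forall x, Om x -> T x = RtoC 0.
Proof.
  intros F He B.
  assert (G : forall k x, Om x -> Cmod (T x) <= K * (3 / 4) ^ k * (1 + (/ Cmod x) ^ e)).
  { induction k; intros x O.
    - simpl. rewrite Rmult_1_r. apply B; auto.
    - rewrite (F x O).
      destruct (Om_other x O) as [O2 M2]. pose proof (Om_half x O) as O1.
      pose proof (IHk _ O1) as I1. pose proof (IHk _ O2) as I2.
      rewrite Cmod_half in I1.
      pose proof O as [_ [_ X0]]. apply Cmod_pos in X0.
      assert (P2 : 2 <= 2 ^ e) by (replace 2 with (2 ^ 1) at 1 by ring; apply Rle_pow; [lra|lia]).
      set (c := K * (3 / 4) ^ k) in *. set (p := 2 ^ e) in *. set (t := (/ Cmod x) ^ e) in *.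
      assert (T0 : 0 <= t) by (apply pow_le; left; apply Rinv_0_lt_compat; auto).
      replace ((/ (Cmod x / 2)) ^ e) with (p * t) in I1
        by (unfold p, t; rewrite <- Rpow_mult_distr; f_equal; field; lra).
      assert (U : (/ Cmod (other x)) ^ e <= 1).
      { rewrite <- (pow1 e). apply pow_incr. split; [left; apply Rinv_0_lt_compat; lra|].
        rewrite <- Rinv_1. apply Rinv_le_contravar; lra. }
      assert (U0 : 0 <= (/ Cmod (other x)) ^ e) by (apply pow_le; left; apply Rinv_0_lt_compat; lra).
      assert (c0 : 0 <= c) by (pose proof (Cmod_nonneg (T (other x))); nra).
      rewrite Cmod_mult, Cmod_R_pos by (left; apply Rinv_0_lt_compat; lra).
      apply Rle_trans with (/ (2 * p) * (c * (1 + p * t) + c * 2)).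
      + apply Rmult_le_compat_l; [left; apply Rinv_0_lt_compat; lra|].
        eapply Rle_trans; [apply Cmod_triangle|]. apply Rplus_le_compat; auto.
        eapply Rle_trans; [exact I2|]. nra.
      (* With p = 2^e >= 2 and t = |x|^-e, the two values contribute (3 + p t) / (2 p) <= 3 / 4 + t
         / 2 <= 3 / 4 (1 + t). *)
      + replace (K * (3 / 4) ^ S k) with (c * (3 / 4)) by (unfold c; simpl; ring).
        replace (/ (2 * p) * (c * (1 + p * t) + c * 2)) with (c * (3 / 2 * / p + t / 2)) by (field; lra).
        rewrite Rmult_assoc. apply Rmult_le_compat_l; auto.
        assert (/ p <= / 2) by (apply Rinv_le_contravar; lra). lra. }
  intros x O. destruct (Ceq_dec (T x) (RtoC 0)) as [E|E]; auto. exfalso.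
  apply Cmod_pos in E.
  assert (L : is_lim_seq (fun k => K * (3 / 4) ^ k * (1 + (/ Cmod x) ^ e)) (K * 0 * (1 + (/ Cmod x) ^ e))).
  { apply is_lim_seq_mult'; [|apply is_lim_seq_const].
    apply is_lim_seq_mult'; [apply is_lim_seq_const|].
    apply is_lim_seq_geom. rewrite Rabs_pos_eq; lra. }
  assert (Q : Rbar_le (Cmod (T x)) (K * 0 * (1 + (/ Cmod x) ^ e))).
  { eapply is_lim_seq_le; [|apply is_lim_seq_const|exact L]. intros k; apply G; auto. }
  simpl in Q. lra.
Qed.

Definition C6 : C := ((RtoC 1 + RtoC 1) * (RtoC 1 + RtoC 1 + RtoC 1))%C.

Lemma Ci_sqr : (Ci * Ci)%C = (- RtoC 1)%C.
Proof. Cring. Qed.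

Lemma IZR_abs_ge1 m : m <> 0%Z -> 1 <= Rabs (IZR m).
Proof. intros H. rewrite <- abs_IZR. apply IZR_le. lia. Qed.

Lemma tr_lower x m : Rabs (Im x) <= PI -> m <> 0%Z -> Rabs (IZR m) <= Cmod (tr x m).
Proof.
  intros B H. pose proof (IZR_abs_ge1 m H). pose proof PI_gt3.
  eapply Rle_trans; [|apply Im_le_Cmod]. rewrite Im_tr.
  pose proof (Rabs_triang_inv (2 * PI * IZR m) (- Im x)) as Q.
  rewrite Rabs_Ropp in Q. rewrite !Rabs_mult, (Rabs_pos_eq 2), (Rabs_pos_eq PI) in Q by lra.
  replace (2 * PI * IZR m - - Im x) with (Im x + 2 * PI * IZR m) in Q by ring. nra.
Qed.

Definition Zs (p : C -> C) (x : C) : C :=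
  (p x + Cs (fun n => p (tr x (Z.of_nat (S n))) + p (tr x (- Z.of_nat (S n))))%C)%C.

Lemma tr_half x m : tr x (2 * m) = (RtoC 2 * tr (x / RtoC 2) m)%C.
Proof. unfold tr. rewrite mult_IZR. apply C_eq; unfold Re, Im; simpl; field. Qed.
Lemma tr_half_plus x m : tr x (2 * m + 1) = (RtoC 2 * tr (x / RtoC 2 + RtoC PI * Ci) m)%C.
Proof. unfold tr. rewrite plus_IZR, mult_IZR. apply C_eq; unfold Re, Im; simpl; field. Qed.
Lemma tr_half_minus x m : tr x (2 * m + -1) = (RtoC 2 * tr (x / RtoC 2 - RtoC PI * Ci) m)%C.
Proof. unfold tr. rewrite plus_IZR, mult_IZR. apply C_eq; unfold Re, Im; simpl; field. Qed.
Lemma tr_0 x : tr x 0 = x.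
Proof. unfold tr. apply C_eq; unfold Re, Im; simpl; ring. Qed.

(** The summand p stands for [inv2] (e = 1) and [inv4] (e = 3): homogeneous of degree -(e + 1) under
    doubling, with at least quadratic decay. *)
Section Lattice.
Variables (p : C -> C) (e : nat).
Hypothesis p_dec : forall y, 1 <= Cmod y -> Cmod (p y) <= / Cmod y ^ 2.
Hypothesis p_two : forall y, y <> RtoC 0 -> p (RtoC 2 * y)%C = (RtoC (/ (2 * 2 ^ e)) * p y)%C.

Lemma p_tr_bound x m : Rabs (Im x) <= PI -> m <> 0%Z -> Cmod (p (tr x m)) <= 1 / IZR m ^ 2.
Proof.
  intros B H. pose proof (tr_lower x m B H) as Q. pose proof (IZR_abs_ge1 m H) as I.
  eapply Rle_trans; [apply p_dec; lra|]. unfold Rdiv. rewrite Rmult_1_l.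
  rewrite <- (pow2_abs (IZR m)). apply Rinv_le_contravar; [apply pow_lt; lra|].
  apply pow_incr; lra.
Qed.
Lemma Zs_LZ x : Rabs (Im x) <= PI ->
  is_zseries (fun m => p (tr x m)) (Zs p x) /\ Cmod (Zs p x - p x) <= 2 * 1 * Series u2.
Proof.
  intros B.
  destruct (LZ_ex_dom (fun m => p (tr x m)) 1 (fun m => p_tr_bound x m B)) as [l [H1 H2]].
  assert (E : Zs p x = l).
  { unfold Zs. apply (proj1 (LZ_Cis _ _)) in H1. cbv beta in H1. rewrite tr_0 in H1. rewrite (Cis_Cs _ _ H1). ring. }
  rewrite E; split; auto. cbv beta in H2. rewrite tr_0 in H2; exact H2.
Qed.
Lemma p_tr_vanishing x : Rabs (Im x) <= PI -> vanishing (fun m => p (tr x m)).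
Proof. intros B. apply (vanishing_bound _ 1). intros; apply p_tr_bound; auto. Qed.

Lemma Om_tr_neq0 x m : Om x -> tr x m <> RtoC 0.
Proof.
  intros [A [B X0]]. destruct (Z.eq_dec m 0) as [->|n].
  - rewrite tr_0; auto.
  - apply C_neq0_Cmod. pose proof (tr_lower x m B n). pose proof (IZR_abs_ge1 m n). lra.
Qed.

(** Even m give the sum at x / 2 and odd m the sum at [other x], once a factor 2 is taken out of
    every lattice point. *)
Lemma Zs_dup x : Om x ->
  Zs p x = (RtoC (/ (2 * 2 ^ e)) * (Zs p (x / RtoC 2) + Zs p (other x)))%C.
Proof.
  intros O. pose proof (Om_half x O) as O1. pose proof (Om_other x O) as [O2 _].
  pose proof O as [_ [B _]]. pose proof O1 as [_ [B1 _]]. pose proof O2 as [_ [B2 _]].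
  pose proof (proj1 (Zs_LZ x B)) as L. pose proof (proj1 (Zs_LZ _ B1)) as L1.
  pose proof (proj1 (Zs_LZ _ B2)) as L2. pose proof (p_tr_vanishing x B) as V.
  apply (LZ_scal (RtoC (/ (2 * 2 ^ e)))) in L1. apply (LZ_scal (RtoC (/ (2 * 2 ^ e)))) in L2.
  assert (E1 : is_zseries (fun m => p (tr x (2 * m))) (RtoC (/ (2 * 2 ^ e)) * Zs p (x / RtoC 2))%C).
  { eapply LZ_ext; [|exact L1]. intros m; cbv beta. rewrite tr_half, p_two; auto.
    apply Om_tr_neq0; auto. }
  destruct (Rle_dec 0 (Im x)) as [r|r].
  - assert (E2 : is_zseries (fun m => p (tr x (2 * m + -1))) (RtoC (/ (2 * 2 ^ e)) * Zs p (other x))%C).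
    { eapply LZ_ext; [|exact L2]. intros m; cbv beta.
      assert (Q : other x = (x / RtoC 2 - RtoC PI * Ci)%C) by (unfold other; destruct (Rle_dec 0 (Im x)); (reflexivity || contradiction)).
      rewrite tr_half_minus, <- Q, p_two; auto. apply Om_tr_neq0; auto. }
    assert (E1' : is_zseries (fun m => p (tr x (2 * m + 1 + -1))) (RtoC (/ (2 * 2 ^ e)) * Zs p (x / RtoC 2))%C).
    { eapply LZ_ext; [|exact E1]. intros m; cbv beta. do 2 f_equal. lia. }
    (* The odd indices appear here as 2 m - 1, so the series is shifted by one before it is split by
       parity. *)
    pose proof (LZ_shift _ _ (-1) V L) as L'.
    assert (V' : vanishing (fun m => p (tr x (m + -1)))).
    { destruct (vanishing_refl _ (vanishing_succ _ (vanishing_refl _ V))) as [W1 W2]. split.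
      - eapply Clim_ext; [|exact W1]. intros; cbv beta; do 2 f_equal; lia.
      - eapply Clim_ext; [|exact W2]. intros; cbv beta; do 2 f_equal; lia. }
    pose proof (LZ_dup (fun m => p (tr x (m + -1))) _ _ _ V' E2 E1' L') as Q. rewrite <- Q. ring.
  - assert (E2 : is_zseries (fun m => p (tr x (2 * m + 1))) (RtoC (/ (2 * 2 ^ e)) * Zs p (other x))%C).
    { eapply LZ_ext; [|exact L2]. intros m; cbv beta.
      assert (Q : other x = (x / RtoC 2 + RtoC PI * Ci)%C) by (unfold other; destruct (Rle_dec 0 (Im x)); (reflexivity || contradiction)).
      rewrite tr_half_plus, <- Q, p_two; auto. apply Om_tr_neq0; auto. }
    pose proof (LZ_dup (fun m => p (tr x m)) _ _ _ V E1 E2 L) as Q. rewrite <- Q. ring.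
Qed.
End Lattice.

Lemma inv2_dec y : 1 <= Cmod y -> Cmod (inv2 y) <= / Cmod y ^ 2.
Proof. intros. rewrite Cmod_inv2; [lra|]. apply C_neq0_Cmod; lra. Qed.
Lemma inv4_dec y : 1 <= Cmod y -> Cmod (inv4 y) <= / Cmod y ^ 2.
Proof.
  intros H. rewrite Cmod_inv4 by (apply C_neq0_Cmod; lra).
  apply Rinv_le_contravar; [apply pow_lt; lra | apply Rle_pow; [lra|lia]].
Qed.
Lemma inv2_two y : y <> RtoC 0 -> inv2 (RtoC 2 * y)%C = (RtoC (/ (2 * 2 ^ 1)) * inv2 y)%C.
Proof.
  intros. unfold inv2. rewrite RtoC_inv, pow_1, RtoC_mult by lra.
  field. auto.
Qed.
Lemma inv4_two y : y <> RtoC 0 -> inv4 (RtoC 2 * y)%C = (RtoC (/ (2 * 2 ^ 3)) * inv4 y)%C.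
Proof.
  intros. unfold inv4. rewrite inv2_two by auto.
  replace (/ (2 * 2 ^ 3)) with (/ (2 * 2 ^ 1) * / (2 * 2 ^ 1)) by field.
  rewrite RtoC_mult. ring.
Qed.

Lemma Cexp_PI : Cexp (RtoC PI * Ci) = (- RtoC 1)%C.
Proof.
  apply C_eq; unfold Cexp, Re, Im; simpl;
  replace (PI * 0 - 0 * 1) with 0 by ring; replace (PI * 1 + 0 * 0) with PI by ring;
  rewrite exp_0, ?cos_PI, ?sin_PI; ring.
Qed.
Lemma Cexp_half x : Cexp x = (Cexp (x / RtoC 2) * Cexp (x / RtoC 2))%C.
Proof. rewrite <- Cexp_plus. f_equal. field. Qed.
Lemma Cexp_other x : Cexp (other x) = (- Cexp (x / RtoC 2))%C.
Proof.
  unfold other. destruct (Rle_dec 0 (Im x)); unfold Cminus; rewrite Cexp_plus, ?Cexp_opp, Cexp_PI.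
  - field.
  - ring.
Qed.

Lemma Om_half_exps x : Om x -> let E := Cexp (x / RtoC 2) in
  (E - RtoC 1)%C <> RtoC 0 /\ (E + RtoC 1)%C <> RtoC 0.
Proof.
  intros O E. split.
  - apply Om_exp_neq, Om_half, O.
  - intros H. apply (Om_exp_neq _ (proj1 (Om_other x O))). rewrite Cexp_other.
    fold E. replace (- E - RtoC 1)%C with (- (E + RtoC 1))%C by ring. rewrite H. ring.
Qed.

Lemma Afun_dup x : Om x ->
  Afun x = (RtoC (/ (2 * 2 ^ 1)) * (Afun (x / RtoC 2) + Afun (other x)))%C.
Proof.
  intros O. destruct (Om_half_exps x O) as [H1 H2].
  unfold Afun. rewrite Cexp_other, (Cexp_half x). set (E := Cexp (x / RtoC 2)) in *.
  rewrite pow_1, RtoC_inv, RtoC_mult, C2_eq by lra.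
  assert ((- E - RtoC 1)%C <> RtoC 0).
  { intros H. apply H2. replace (E + RtoC 1)%C with (- (- E - RtoC 1))%C by ring. rewrite H; ring. }
  assert ((E * E - RtoC 1)%C <> RtoC 0).
  { replace (E * E - RtoC 1)%C with ((E - RtoC 1) * (E + RtoC 1))%C by ring. apply Cmult_neq_0; auto. }
  field. repeat split; auto.
Qed.
Lemma Bfun_dup x : Om x ->
  Bfun x = (RtoC (/ (2 * 2 ^ 3)) * (Bfun (x / RtoC 2) + Bfun (other x)))%C.
Proof.
  intros O. destruct (Om_half_exps x O) as [H1 H2].
  unfold Bfun, Afun. rewrite Cexp_other, (Cexp_half x). set (E := Cexp (x / RtoC 2)) in *.
  replace (/ (2 * 2 ^ 3)) with (/ (2 * 2) * / (2 * 2)) by field.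
  rewrite RtoC_mult, RtoC_inv, RtoC_mult, C2_eq by lra.
  assert ((- E - RtoC 1)%C <> RtoC 0).
  { intros H. apply H2. replace (E + RtoC 1)%C with (- (- E - RtoC 1))%C by ring. rewrite H; ring. }
  assert ((E * E - RtoC 1)%C <> RtoC 0).
  { replace (E * E - RtoC 1)%C with ((E - RtoC 1) * (E + RtoC 1))%C by ring. apply Cmult_neq_0; auto. }
  field. repeat split; auto.
Qed.

Lemma Cminus_eq0 (a b : C) : (a - b)%C = RtoC 0 -> a = b.
Proof. intros H. replace a with ((a - b) + b)%C by ring. rewrite H. ring. Qed.

(** Both sides satisfy the same duplication formula and have the same double pole at 0; Herglotz's
    trick makes their difference vanish. *)
Lemma Afun_Om x : Om x -> Afun x = Zs inv2 x.
Proof.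
  intros O. apply Cminus_eq0.
  apply (herglotz (fun x => Afun x - Zs inv2 x)%C 1 (135 + 2 * Series u2)); [ | lia | | exact O];
    clear x O; intros x O.
  - cbv beta. rewrite (Afun_dup x O) at 1. rewrite (Zs_dup inv2 1 inv2_dec inv2_two x O). ring.
  - pose proof O as [_ [B X0]]. pose proof (Om_inv_bound x O) as A1.
    pose proof (proj2 (Zs_LZ inv2 inv2_dec x B)) as A2.
    replace (Afun x - Zs inv2 x)%C with ((Afun x - inv2 x) - (Zs inv2 x - inv2 x))%C by ring.
    eapply Rle_trans; [apply Cmod_minus_le|].
    apply Cmod_pos, Rinv_0_lt_compat in X0. rewrite pow_1.
    pose proof (Cmod_nonneg (Zs inv2 x - inv2 x)). nra.
Qed.

(** Put A = d + x^-2 in B = A + 6 A^2. The poles of order four cancel against 6 [inv4], and what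
    remains is O(1 + |x|^-3), which the weight with e = 3 admits. *)
Lemma Bfun_Om x : Om x -> Bfun x = (C6 * Zs inv4 x)%C.
Proof.
  intros O. apply Cminus_eq0.
  set (U := Series u2).
  assert (M6 : Cmod C6 = 6).
  { replace C6 with (RtoC 6) by (unfold C6; rewrite <- !RtoC_plus, <- RtoC_mult; f_equal; ring).
    apply Cmod_R_pos; lra. }
  apply (herglotz (fun x => Bfun x - C6 * Zs inv4 x)%C 3 (6 * (270 * 274) + 135 + 136 + 6 * (2 * U))); [ | lia | | exact O];
    clear x O; intros x O.
  - cbv beta. rewrite (Bfun_dup x O) at 1. rewrite (Zs_dup inv4 3 inv4_dec inv4_two x O). ring.
  - pose proof O as [_ [B X0]]. pose proof (Om_inv_bound x O) as A1.
    pose proof (proj2 (Zs_LZ inv4 inv4_dec x B)) as A2. fold U in A2.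
    set (d := (Afun x - inv2 x)%C) in *.
    replace (Bfun x - C6 * Zs inv4 x)%C with
      ((C6 * (d * (d + (RtoC 1 + RtoC 1) * inv2 x)) + (d + inv2 x)) - C6 * (Zs inv4 x - inv4 x))%C
      by (unfold Bfun, inv4, d, C6; ring).
    pose proof (Cmod_inv2 x X0) as I2.
    apply Cmod_pos, Rinv_0_lt_compat in X0. 
    set (t := / Cmod x) in *.
    assert (I2' : Cmod (inv2 x) = t ^ 2) by (rewrite I2; unfold t; rewrite pow_inv; auto).
    assert (D2 : Cmod (d + (RtoC 1 + RtoC 1) * inv2 x) <= 135 * (1 + t) + 2 * t ^ 2).
    { eapply Rle_trans; [apply Cmod_triangle|]. apply Rplus_le_compat; auto.
      rewrite Cmod_mult, I2', <- RtoC_plus, Cmod_R_pos by lra. lra. }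
    eapply Rle_trans; [apply Cmod_minus_le|]. rewrite Cmod_mult, M6.
    eapply Rle_trans; [apply Rplus_le_compat_r, Cmod_triangle|]. rewrite !Cmod_mult, M6.
    pose proof (Cmod_triangle d (inv2 x)) as D3. rewrite I2' in D3.
    assert (P1 : Cmod d * Cmod (d + (RtoC 1 + RtoC 1) * inv2 x) <= 135 * (1 + t) * (135 * (1 + t) + 2 * t ^ 2)).
    { apply Rmult_le_compat; auto; apply Cmod_nonneg. }
    pose proof (Cmod_nonneg (Zs inv4 x - inv4 x)) as Z0.
    assert (t3 : 0 < t ^ 3) by (apply pow_lt; auto).
    assert (b1 : t <= 1 + t ^ 3).
    { destruct (Rle_dec t 1); [lra|]. assert (1 <= t * t) by nra. simpl; nra. }
    assert (b2 : t ^ 2 <= 1 + t ^ 3).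
    { destruct (Rle_dec t 1); [nra|]. assert (1 <= t * t) by nra. simpl; nra. }
    assert (b3 : 135 * (1 + t) * (135 * (1 + t) + 2 * t ^ 2) <= 270 * 274 * (1 + t ^ 3)).
    { replace (135 * (1 + t) * (135 * (1 + t) + 2 * t ^ 2)) with
        (18225 + 36450 * t + 18495 * t ^ 2 + 270 * t ^ 3) by ring. lra. }
    nra.
Qed.

(* Periodicity removes the restriction on the imaginary part. *)

Lemma tr_tr x a b : tr (tr x a) b = tr x (b + a).
Proof. unfold tr. rewrite plus_IZR. apply C_eq; unfold Re, Im; simpl; ring. Qed.
Lemma Cexp_tr x m : Cexp (tr x m) = Cexp x.
Proof.
  assert (P : forall n y, Cexp (tr y (Z.of_nat n)) = Cexp y).
  { induction n; intros y.
    - rewrite tr_0; auto.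
    - replace (Z.of_nat (S n)) with (1 + Z.of_nat n)%Z by lia.
      rewrite <- tr_tr. rewrite <- (IHn y). unfold tr at 1. rewrite Rmult_1_r. apply Cexp_2PI. }
  destruct (Z_le_gt_dec 0 m).
  - rewrite <- (Z2Nat.id m) by lia. apply P.
  - rewrite <- (P (Z.to_nat (- m)) (tr x m)). rewrite tr_tr. rewrite Z2Nat.id by lia.
    replace (- m + m)%Z with 0%Z by lia. rewrite tr_0; auto.
Qed.
Lemma strip x : exists k, Rabs (Im (tr x k)) <= PI.
Proof.
  pose proof PI_gt3 as P3.
  exists (- up ((Im x - PI) / (2 * PI)))%Z.
  destruct (archimed ((Im x - PI) / (2 * PI))) as [H1 H2].
  rewrite Im_tr, opp_IZR. set (u := IZR (up ((Im x - PI) / (2 * PI)))) in *.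
  set (v := (Im x - PI) / (2 * PI)) in *.
  replace (Im x) with (v * (2 * PI) + PI) by (unfold v; field; lra).
  apply Rabs_le; split; nra.
Qed.

Lemma inv2_LZ x : 0 < Re x -> is_zseries (fun m => inv2 (tr x m)) (Afun x).
Proof.
  intros Hx. destruct (strip x) as [k Hk].
  assert (O : Om (tr x k)).
  { repeat split; auto; [rewrite Re_tr; lra|]. apply C_neq0_Re. rewrite Re_tr; lra. }
  assert (E : Afun x = Zs inv2 (tr x k)).
  { rewrite <- Afun_Om by auto. unfold Afun. rewrite Cexp_tr; auto. }
  rewrite E.
  pose proof (proj1 (Zs_LZ inv2 inv2_dec (tr x k) Hk)) as L.
  pose proof (p_tr_vanishing inv2 inv2_dec (tr x k) Hk) as V.
  eapply LZ_ext; [|apply (LZ_shift _ _ (- k) V L)]. intros m; cbv beta.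
  rewrite tr_tr. do 2 f_equal. lia.
Qed.
Lemma inv4_LZ x : 0 < Re x -> is_zseries (fun m => C6 * inv4 (tr x m))%C (Bfun x).
Proof.
  intros Hx. destruct (strip x) as [k Hk].
  assert (O : Om (tr x k)).
  { repeat split; auto; [rewrite Re_tr; lra|]. apply C_neq0_Re. rewrite Re_tr; lra. }
  assert (E : Bfun x = (C6 * Zs inv4 (tr x k))%C).
  { rewrite <- Bfun_Om by auto. unfold Bfun, Afun. rewrite Cexp_tr; auto. }
  rewrite E. apply LZ_scal.
  pose proof (proj1 (Zs_LZ inv4 inv4_dec (tr x k) Hk)) as L.
  pose proof (p_tr_vanishing inv4 inv4_dec (tr x k) Hk) as V.
  eapply LZ_ext; [|apply (LZ_shift _ _ (- k) V L)]. intros m; cbv beta.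
  rewrite tr_tr. do 2 f_equal. lia.
Qed.

(** * Values of zeta(2) and zeta(4) *)

Definition u4 (n : nat) : R := / INR (S n) ^ 4.

Lemma Om_iPI : Om (RtoC PI * Ci)%C.
Proof.
  pose proof PI_gt3. repeat split.
  - unfold Re; simpl; lra.
  - replace (Im (RtoC PI * Ci)%C) with PI by (unfold Im; simpl; ring). rewrite Rabs_pos_eq; lra.
  - apply C_neq0_Im. unfold Im; simpl; lra.
Qed.
Lemma tr_iPI m : tr (RtoC PI * Ci)%C m = (RtoC (PI * IZR (2 * m + 1)) * Ci)%C.
Proof. unfold tr. rewrite plus_IZR, mult_IZR. apply C_eq; unfold Re, Im; simpl; ring. Qed.
Lemma inv2_imag a : a <> 0 -> inv2 (RtoC a * Ci)%C = RtoC (- / a ^ 2).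
Proof.
  intros H. unfold inv2. 
  replace (RtoC a * Ci * (RtoC a * Ci))%C with (RtoC (- a ^ 2)) by (apply C_eq; unfold Re, Im; simpl; ring).
  rewrite <- RtoC_inv by (apply Ropp_neq_0_compat, pow_nonzero; auto).
  f_equal. field. auto.
Qed.
Lemma Afun_iPI : Afun (RtoC PI * Ci)%C = RtoC (- (1 / 4)).
Proof.
  unfold Afun. rewrite Cexp_PI.
  replace ((- RtoC 1 - RtoC 1) * (- RtoC 1 - RtoC 1))%C with (RtoC 4) by (apply C_eq; unfold Re, Im; simpl; ring).
  unfold Cdiv. rewrite <- RtoC_inv, <- RtoC_opp, <- RtoC_mult by lra. f_equal. field.
Qed.
Lemma IZR_odd_neq0 m : IZR (2 * m + 1) <> 0.
Proof. intros H. apply eq_IZR_R0 in H. lia. Qed.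

(** The even terms reproduce the sum over all integers times 2^(-2 e), so the odd ones make up the
    share 1 - 2^(-2 e). The last division by 2 accounts for negative m. *)
Lemma zeta_of_dup (e : nat) (w : R) : (1 <= e)%nat ->
  is_zseries (fun m => RtoC (/ IZR (2 * m + 1) ^ (2 * e))) (RtoC w) ->
  is_series (fun n => / INR (S n) ^ (2 * e)) (w / (1 - / 2 ^ (2 * e)) / 2).
Proof.
  intros He H.
  set (g := fun m : Z => RtoC (/ IZR m ^ (2 * e))).
  assert (B : forall m, m <> 0%Z -> Cmod (g m) <= 1 / IZR m ^ 2).
  { intros m Hm. unfold g. pose proof (IZR_abs_ge1 m Hm) as I.
    rewrite Cmod_R, Rabs_inv, <- RPow_abs. unfold Rdiv. rewrite Rmult_1_l, <- (pow2_abs (IZR m)).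
    apply Rinv_le_contravar; [apply pow_lt; lra|]. apply Rle_pow; [lra|lia]. }
  assert (P4 : 4 <= 2 ^ (2 * e)).
  { replace 4 with (2 ^ 2) by ring. apply Rle_pow; [lra|lia]. }
  destruct (LZ_ex_dom g 1 B) as [l [L _]].
  (* By the convention / 0 = 0 the index m = 0 contributes nothing. *)
  assert (G0 : g 0%Z = RtoC 0).
  { unfold g. rewrite pow_ne_zero by lia. rewrite Rinv_0. reflexivity. }
  assert (E : is_zseries (fun m => g (2 * m)%Z) (RtoC (/ 2 ^ (2 * e)) * l)%C).
  { eapply LZ_ext; [|apply LZ_scal, L]. intros m; unfold g; cbv beta.
    rewrite <- RtoC_mult, mult_IZR, Rpow_mult_distr, Rinv_mult. reflexivity. }
  pose proof (LZ_dup g _ _ _ (vanishing_bound g 1 B) E H L) as Q.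
  apply (proj1 (LZ_Cis _ _)) in L. rewrite G0 in L. destruct L as [L _].
  assert (Q' : Re l = w / (1 - / 2 ^ (2 * e))).
  { apply (f_equal Re) in Q. unfold Re in *; simpl in Q. simpl (2 * e)%nat.
    set (z := 2 ^ (2 * e)) in *. change (2 ^ (e + (e + 0))) with z in Q.
    change (2 ^ (e + (e + 0))) with z.
    assert (/ z <= / 4) by (apply Rinv_le_contravar; lra).
    apply Rmult_eq_reg_r with (1 - / z); [|lra]. unfold Rdiv. rewrite Rmult_assoc, Rinv_l by lra. lra. }
  rewrite <- Q'.
  apply (ser_scal (/ 2)) in L. 
  replace (/ 2 * Re (l - RtoC 0)%C) with (Re l / 2) in L by (unfold Re; simpl; field).
  eapply ser_ext; [|exact L]. intros n. cbv beta. unfold g. rewrite opp_IZR, <- INR_IZR_INZ.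
  rewrite <- RtoC_plus. change (Re (RtoC ?x)) with x. unfold Re; simpl fst.
  replace ((- INR (S n)) ^ (2 * e)) with (INR (S n) ^ (2 * e)).
  - field. apply pow_nonzero. pose proof (INR_S_pos n); lra.
  - rewrite !pow_mult. f_equal. ring.
Qed.

(** At x = pi i the lattice points are the odd multiples of pi i, and [Afun] takes the value -1 /
    4. *)
Lemma zeta2 : is_series u2 (PI ^ 2 / 6).
Proof.
  pose proof PI_gt3 as P3. pose proof Om_iPI as O.
  pose proof (proj1 (Zs_LZ inv2 inv2_dec _ (proj1 (proj2 O)))) as L.
  rewrite <- Afun_Om, Afun_iPI in L by exact O.
  apply (LZ_scal (RtoC (- PI ^ 2))) in L. rewrite <- RtoC_mult in L.
  replace (PI ^ 2 / 6) with (- PI ^ 2 * - (1 / 4) / (1 - / 2 ^ (2 * 1)) / 2) by (simpl; field).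
  apply (zeta_of_dup 1); [lia|].
  eapply LZ_ext; [|exact L]. intros m; cbv beta.
  pose proof (IZR_odd_neq0 m).
  rewrite tr_iPI, inv2_imag, <- RtoC_mult by (apply Rmult_integral_contrapositive; split; [lra|auto]).
  f_equal. change (2 * 1)%nat with 2%nat. field. split; [auto|lra].
Qed.

Lemma zeta4 : is_series u4 (PI ^ 4 / 90).
Proof.
  pose proof PI_gt3 as P3. pose proof Om_iPI as O.
  pose proof (proj1 (Zs_LZ inv4 inv4_dec _ (proj1 (proj2 O)))) as L.
  apply (LZ_scal C6) in L.
  rewrite <- Bfun_Om in L by exact O.
  assert (E6 : C6 = RtoC 6) by (unfold C6; rewrite <- !RtoC_plus, <- RtoC_mult; f_equal; ring).
  assert (EB : Bfun (RtoC PI * Ci)%C = RtoC (1 / 8)).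
  { unfold Bfun. fold C6. rewrite E6, Afun_iPI, <- !RtoC_mult, <- RtoC_plus. f_equal. field. }
  rewrite EB in L.
  apply (LZ_scal (RtoC (PI ^ 4 / 6))) in L. rewrite <- RtoC_mult in L.
  replace (PI ^ 4 / 90) with (PI ^ 4 / 6 * (1 / 8) / (1 - / 2 ^ (2 * 2)) / 2) by (simpl; field).
  apply (zeta_of_dup 2); [lia|].
  eapply LZ_ext; [|exact L]. intros m; cbv beta.
  pose proof (IZR_odd_neq0 m).
  unfold inv4. rewrite E6, tr_iPI, inv2_imag, <- !RtoC_mult by (apply Rmult_integral_contrapositive; split; [lra|auto]).
  f_equal. change (2 * 2)%nat with 4%nat. field. split; [auto|lra].
Qed.

(** * Lattice sums *)

(** A constant c > 0 with |t w + 2 pi i m| >= c max (t, |m|) for all t >= 0 and integers m, as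
    [lattice_lower] shows. It makes all majorants of lattice sums explicit. *)
Definition cw (w : C) : R := Rmin (Re w) (2 * PI / (1 + Rabs (Im w) / Re w)).

Lemma cw_pos w : 0 < Re w -> 0 < cw w.
Proof.
  intros H. pose proof PI_gt3. unfold cw. apply Rmin_glb_lt; auto.
  apply Rdiv_lt_0_compat; [lra|].
  assert (0 <= Rabs (Im w) / Re w) by (apply Rdiv_le_0_compat; auto; apply Rabs_pos). lra.
Qed.

Lemma lattice_lower w t m : 0 < Re w -> 0 <= t ->
  cw w * t <= Cmod (tr (RtoC t * w) m) /\ cw w * Rabs (IZR m) <= Cmod (tr (RtoC t * w) m).
Proof.
  intros H Ht. set (x := tr (RtoC t * w) m). pose proof PI_gt3.
  pose proof (Re_le_Cmod' x) as A. pose proof (Im_le_Cmod x) as B.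
  assert (EA : Re x = t * Re w) by (unfold x; rewrite Re_tr; unfold Re; simpl; ring).
  assert (EB : Im x = t * Im w + 2 * PI * IZR m) by (unfold x; rewrite Im_tr; unfold Im; simpl; ring).
  set (r := Rabs (Im w) / Re w).
  assert (r0 : 0 <= r) by (apply Rdiv_le_0_compat; auto; apply Rabs_pos).
  assert (L1 : cw w <= Re w) by apply Rmin_l.
  assert (L2 : cw w <= 2 * PI / (1 + r)) by apply Rmin_r.
  split; [nra|].
  assert (Q : 2 * PI * Rabs (IZR m) <= Cmod x * (1 + r)).
  { pose proof (Rabs_triang (Im x) (- (t * Im w))) as T.
    replace (Im x + - (t * Im w)) with (2 * PI * IZR m) in T by (rewrite EB; ring).
    rewrite Rabs_Ropp, !Rabs_mult, (Rabs_pos_eq 2), (Rabs_pos_eq PI), (Rabs_pos_eq t) in T by lra.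
    assert (Rabs (Im w) = r * Re w) by (unfold r; field; lra). nra. }
  pose proof (Rabs_pos (IZR m)).
  apply Rle_trans with (2 * PI / (1 + r) * Rabs (IZR m)); [nra|].
  apply Rmult_le_reg_r with (1 + r); [lra|].
  replace (2 * PI / (1 + r) * Rabs (IZR m) * (1 + r)) with (2 * PI * Rabs (IZR m)) by (field; lra). exact Q.
Qed.

Lemma lattice_neq0 w t m : 0 < Re w -> 0 < t -> tr (RtoC t * w) m <> RtoC 0.
Proof.
  intros H Ht. apply C_neq0_Cmod. pose proof (cw_pos w H).
  pose proof (proj1 (lattice_lower w t m H (Rlt_le _ _ Ht))). nra.
Qed.

(** This is coth (x / 2) / 2 - 1 / x. Its partial fractions [pf1] pair the indices m and -m, since
    the single terms 1 / (x + 2 pi i m) are not absolutely summable. *)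
Definition hfun (x : C) : C := (/ (Cexp x - RtoC 1) + / (RtoC 1 + RtoC 1) - / x)%C.
Definition pf1 (x : C) (n : nat) : C :=
  (/ tr x (Z.of_nat (S n)) + / tr x (- Z.of_nat (S n)))%C.

Lemma Cexp_neq1 x : 0 < Re x -> (Cexp x - RtoC 1)%C <> RtoC 0.
Proof.
  intros H. apply C_neq0_Cmod. pose proof (Cmod_minus_ge (Cexp x) (RtoC 1)) as Q.
  rewrite Cmod_Cexp, Cmod_1 in Q. pose proof (exp_ineq1 (Re x)). lra.
Qed.

Lemma pf1_eq x n : tr x (Z.of_nat (S n)) <> RtoC 0 -> tr x (- Z.of_nat (S n)) <> RtoC 0 ->
  pf1 x n = ((x + x) / (tr x (Z.of_nat (S n)) * tr x (- Z.of_nat (S n))))%C.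
Proof.
  intros H1 H2. unfold pf1.
  replace (x + x)%C with (tr x (Z.of_nat (S n)) + tr x (- Z.of_nat (S n)))%C.
  - field. auto.
  - unfold tr. rewrite opp_IZR. apply C_eq; unfold Re, Im; simpl; ring.
Qed.

Lemma Rabs_IZR_S n : Rabs (IZR (Z.of_nat (S n))) = INR (S n).
Proof. rewrite <- INR_IZR_INZ. apply Rabs_pos_eq, pos_INR. Qed.
Lemma Rabs_IZR_opp_S n : Rabs (IZR (- Z.of_nat (S n))) = INR (S n).
Proof. rewrite opp_IZR, Rabs_Ropp. apply Rabs_IZR_S. Qed.

Lemma pf1_bound w t n : 0 < Re w -> 0 < t ->
  Cmod (pf1 (RtoC t * w) n) <= 2 * t * Cmod w / cw w ^ 2 * u2 n.
Proof.
  intros H Ht. pose proof (cw_pos w H) as cp.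
  pose proof (lattice_neq0 w t (Z.of_nat (S n)) H Ht) as N1.
  pose proof (lattice_neq0 w t (- Z.of_nat (S n)) H Ht) as N2.
  destruct (lattice_lower w t (Z.of_nat (S n)) H (Rlt_le _ _ Ht)) as [_ L1].
  destruct (lattice_lower w t (- Z.of_nat (S n)) H (Rlt_le _ _ Ht)) as [_ L2].
  rewrite Rabs_IZR_S in L1. rewrite Rabs_IZR_opp_S in L2.
  rewrite pf1_eq by auto.
  unfold Cdiv. rewrite Cmod_mult, Cmod_inv, Cmod_mult by (apply Cmult_neq_0; auto).
  assert (E : Cmod (RtoC t * w + RtoC t * w) = 2 * t * Cmod w).
  { replace (RtoC t * w + RtoC t * w)%C with (RtoC (2 * t) * w)%C by (apply C_eq; unfold Re, Im; simpl; ring).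
    rewrite Cmod_mult, Cmod_R_pos by lra. ring. }
  rewrite E. unfold u2. pose proof (INR_S_pos n) as Ip.
  replace (2 * t * Cmod w / cw w ^ 2 * / INR (S n) ^ 2) with
    (2 * t * Cmod w * / ((cw w * INR (S n)) * (cw w * INR (S n)))) by (field; lra).
  apply Rmult_le_compat_l; [pose proof (Cmod_nonneg w); nra|].
  assert (0 < cw w * INR (S n)) by nra.
  apply Rinv_le_contravar; [nra|]. apply Rmult_le_compat; lra.
Qed.

Lemma inv2_pair_bound w t n : 0 < Re w -> 0 < t ->
  Cmod (inv2 (tr (RtoC t * w) (Z.of_nat (S n))) + inv2 (tr (RtoC t * w) (- Z.of_nat (S n))))
   <= 2 / cw w ^ 2 * u2 n.
Proof.
  intros H Ht. pose proof (cw_pos w H) as cp.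
  pose proof (lattice_neq0 w t (Z.of_nat (S n)) H Ht) as N1.
  pose proof (lattice_neq0 w t (- Z.of_nat (S n)) H Ht) as N2.
  destruct (lattice_lower w t (Z.of_nat (S n)) H (Rlt_le _ _ Ht)) as [_ L1].
  destruct (lattice_lower w t (- Z.of_nat (S n)) H (Rlt_le _ _ Ht)) as [_ L2].
  rewrite Rabs_IZR_S in L1. rewrite Rabs_IZR_opp_S in L2.
  eapply Rle_trans; [apply Cmod_triangle|]. rewrite !Cmod_inv2 by auto.
  pose proof (INR_S_pos n) as Ip. unfold u2.
  replace (2 / cw w ^ 2 * / INR (S n) ^ 2) with
    (/ (cw w * INR (S n)) ^ 2 + / (cw w * INR (S n)) ^ 2) by (field; lra).
  assert (0 < cw w * INR (S n)) by nra.
  apply Rplus_le_compat; (apply Rinv_le_contravar; [apply pow_lt; lra | apply pow_incr; lra]).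
Qed.

Lemma tr_ray_deriv w m t : Cderiv (fun s => tr (RtoC s * w) m) t w.
Proof.
  eapply Cderiv_eq; [apply Cderiv_plus; [apply Cderiv_ray | apply Cderiv_const]|]. ring.
Qed.
Lemma inv_tr_deriv w m t : 0 < Re w -> 0 < t ->
  Cderiv (fun s => / tr (RtoC s * w) m)%C t (- w * inv2 (tr (RtoC t * w) m))%C.
Proof.
  intros H Ht. eapply Cderiv_eq; [apply Cderiv_inv; [apply lattice_neq0; auto | apply tr_ray_deriv]|].
  unfold inv2. field. apply lattice_neq0; auto.
Qed.
Lemma inv2_tr_deriv w m t : 0 < Re w -> 0 < t ->
  exists d, Cderiv (fun s => inv2 (tr (RtoC s * w) m))%C t d.
Proof.
  intros H Ht. eexists. unfold inv2.
  apply Cderiv_inv; [apply Cmult_neq_0; apply lattice_neq0; auto|].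
  apply Cderiv_mult; apply tr_ray_deriv.
Qed.

Lemma ex_series_scal_u2 K : ex_series (fun n => K * u2 n).
Proof. destruct ex_series_u2 as [s Hs]. exists (K * s). apply ser_scal; exact Hs. Qed.

Lemma Afun_pairs x : 0 < Re x ->
  Cis (fun n => inv2 (tr x (Z.of_nat (S n))) + inv2 (tr x (- Z.of_nat (S n))))%C
    (Afun x - inv2 x)%C.
Proof.
  intros H. pose proof (proj1 (LZ_Cis _ _) (inv2_LZ x H)) as L. cbv beta in L.
  rewrite tr_0 in L. exact L.
Qed.

Lemma pf1_deriv w t : 0 < Re w -> 0 < t ->
  Cderiv (fun s => Cs (pf1 (RtoC s * w))) t (- w * (Afun (RtoC t * w) - inv2 (RtoC t * w)))%C.
Proof.
  intros H Ht.
  pose proof (cw_pos w H) as cp.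
  assert (E : Cs (fun n => - w * (inv2 (tr (RtoC t * w) (Z.of_nat (S n))) + inv2 (tr (RtoC t * w) (- Z.of_nat (S n)))))%C
    = (- w * (Afun (RtoC t * w) - inv2 (RtoC t * w)))%C).
  { apply Cis_Cs, Cis_scal, Afun_pairs. unfold Re; simpl. unfold Re in H. nra. }
  rewrite <- E.
  apply (Cs_derive (fun n s => pf1 (RtoC s * w) n)
    (fun n s => - w * (inv2 (tr (RtoC s * w) (Z.of_nat (S n))) + inv2 (tr (RtoC s * w) (- Z.of_nat (S n)))))%C
    (fun n => 4 * t * Cmod w / cw w ^ 2 * u2 n) (fun n => Cmod w * (2 / cw w ^ 2) * u2 n) (t / 2) (2 * t)).
  - lra.
  - intros n x Hx. eapply Cderiv_eq; [apply Cderiv_plus; apply inv_tr_deriv; auto; lra|]. ring.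
  - intros n x Hx.
    destruct (inv2_tr_deriv w (Z.of_nat (S n)) x H ltac:(lra)) as [d1 D1].
    destruct (inv2_tr_deriv w (- Z.of_nat (S n)) x H ltac:(lra)) as [d2 D2].
    eexists. apply Cderiv_mult; [apply Cderiv_const|]. apply Cderiv_plus; eassumption.
  - intros n x Hx. eapply Rle_trans; [apply pf1_bound; auto; lra|].
    apply Rmult_le_compat_r; [apply u2_pos|]. unfold Rdiv. apply Rmult_le_compat_r.
    + left; apply Rinv_0_lt_compat, pow_lt; auto.
    + pose proof (Cmod_nonneg w). nra.
  - apply ex_series_scal_u2.
  - intros n x Hx. rewrite Cmod_mult, Cmod_opp, Rmult_assoc.
    apply Rmult_le_compat_l; [apply Cmod_nonneg | apply inv2_pair_bound; auto; lra].
  - apply ex_series_scal_u2.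
Qed.

Lemma hfun_deriv w t : 0 < Re w -> 0 < t ->
  Cderiv (fun s => hfun (RtoC s * w)) t (- w * (Afun (RtoC t * w) - inv2 (RtoC t * w)))%C.
Proof.
  intros H Ht. 
  assert (R1 : 0 < Re (RtoC t * w)%C) by (unfold Re; simpl; unfold Re in H; nra).
  pose proof (Cexp_neq1 _ R1) as N.
  assert (N2 : (RtoC t * w)%C <> RtoC 0) by (apply C_neq0_Re; lra).
  eapply Cderiv_eq.
  - apply Cderiv_minus; [apply Cderiv_plus; [apply Cderiv_inv|apply Cderiv_const]|apply Cderiv_inv].
    + exact N.
    + apply Cderiv_minus; [apply Cderiv_exp, Cderiv_ray | apply Cderiv_const].
    + exact N2.
    + apply Cderiv_ray.
  - cbv beta. unfold Afun, inv2. set (x := (RtoC t * w)%C) in *. field. auto.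
Qed.

Lemma hfun_small x : 0 < Re x -> Cmod x <= 1 -> Cmod (hfun x) <= 100 * Cmod x.
Proof.
  intros H Hx.
  assert (O : Om x).
  { repeat split; [lra| |apply C_neq0_Re; lra]. pose proof (Im_le_Cmod x). pose proof PI_gt3. lra. }
  pose proof (Om_exp x O) as L. pose proof (Om_exp_neq x O) as N.
  pose proof (Cexp_bound2 x) as B2. pose proof (Cexp_bound3 x) as B3.
  pose proof (exp_1_le3 _ Hx) as E3. destruct O as [_ [_ X0]]. pose proof (Cmod_pos x X0) as Hp.
  remember (Cexp x - RtoC 1)%C as D eqn:ED. 
  set (S3 := (D - x - x * x / RtoC 2)%C) in *.
  assert (EH : hfun x = ((x * (D - x) - (RtoC 1 + RtoC 1) * S3) / ((RtoC 1 + RtoC 1) * x * D))%C).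
  { unfold hfun, S3. rewrite <- ED, C2_eq. field. auto. }
  rewrite EH.
  assert (E2 : Cmod (RtoC 1 + RtoC 1) = 2) by (rewrite <- C2_eq; apply Cmod_R_pos; lra).
  assert (N2 : (RtoC 1 + RtoC 1)%C <> RtoC 0) by (apply C_neq0_Cmod; lra).
  unfold Cdiv. rewrite Cmod_mult, Cmod_inv by (repeat apply Cmult_neq_0; auto).
  rewrite !Cmod_mult, E2. clear EH.
  assert (M : Cmod (x * (D - x) - (RtoC 1 + RtoC 1) * S3) <= 9 * Cmod x ^ 3).
  { eapply Rle_trans; [apply Cmod_minus_le|]. rewrite !Cmod_mult, E2.
    assert (Cmod (D - x) <= 3 * Cmod x ^ 2) by (pose proof (pow2_ge_0 (Cmod x)); nra).
    assert (Cmod S3 <= 3 * Cmod x ^ 3) by (assert (0 < Cmod x ^ 3) by (apply pow_lt; auto); nra).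
    nra. }
  apply Rle_trans with (9 * Cmod x ^ 3 * / (2 * Cmod x * (Cmod x / 3))).
  - apply Rmult_le_compat; [apply Cmod_nonneg | | exact M |].
    + left. apply Rinv_0_lt_compat. assert (0 < Cmod D) by lra. nra.
    + apply Rinv_le_contravar; nra.
  - replace (9 * Cmod x ^ 3 * / (2 * Cmod x * (Cmod x / 3))) with (27 / 2 * Cmod x) by (field; lra). lra.
Qed.

Lemma pf1_Cis w t : 0 < Re w -> 0 < t -> Cis (pf1 (RtoC t * w)) (Cs (pf1 (RtoC t * w))).
Proof.
  intros H Ht. apply Cis_dom with (M := fun n => 2 * t * Cmod w / cw w ^ 2 * u2 n).
  - intros; apply pf1_bound; auto.
  - apply ex_series_scal_u2.
Qed.

(** Along the ray t w both sides have the same derivative, by the expansion of [Afun], so their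
    difference is constant for 0 < t <= 1. Both are O(t) as t tends to 0, hence the constant is
    0. *)
Lemma hfun_pf1 w : 0 < Re w -> Cis (pf1 w) (hfun w).
Proof.
  intros H.
  pose proof (cw_pos w H) as cp.
  set (Hh := fun t => (hfun (RtoC t * w) - Cs (pf1 (RtoC t * w)))%C).
  assert (Cst : forall t, 0 < t <= 1 -> Hh t = Hh 1).
  { intros t Ht. apply Cderiv_zero_const; [lra|]. intros x Hx. unfold Hh.
    eapply Cderiv_eq; [apply Cderiv_minus; [apply hfun_deriv | apply pf1_deriv]; auto; lra|]. ring. }
  set (K := 100 * Cmod w + 2 * Cmod w / cw w ^ 2 * Series u2).
  pose proof (Cmod_nonneg w) as w0.
  assert (wp : 0 < Cmod w) by (apply Cmod_pos, C_neq0_Re; lra).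
  assert (Bd : forall t, 0 < t <= 1 -> t * Cmod w <= 1 -> Cmod (Hh t) <= t * K).
  { intros t Ht Hs. unfold Hh. eapply Rle_trans; [apply Cmod_minus_le|].
    assert (M : Cmod (RtoC t * w) = t * Cmod w) by (rewrite Cmod_mult, Cmod_R_pos by lra; ring).
    assert (R1 : 0 < Re (RtoC t * w)%C) by (unfold Re; simpl; unfold Re in H; nra).
    pose proof (hfun_small _ R1 ltac:(lra)) as B1. rewrite M in B1.
    assert (B2 : Cmod (Cs (pf1 (RtoC t * w))) <= 2 * t * Cmod w / cw w ^ 2 * Series u2).
    { apply (Cis_Cmod_le _ _ (fun n => 2 * t * Cmod w / cw w ^ 2 * u2 n) _ (fun n => pf1_bound w t n H (proj1 Ht))).
      - apply pf1_Cis; auto; lra.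
      - apply ser_scal, Series_correct, ex_series_u2. }
    replace (t * K) with (100 * (t * Cmod w) + 2 * t * Cmod w / cw w ^ 2 * Series u2) by (unfold K; field; lra).
    lra. }
  assert (Z : Hh 1 = RtoC 0).
  { destruct (Ceq_dec (Hh 1) (RtoC 0)) as [E|E]; auto. exfalso.
    apply Cmod_pos in E.
    assert (K0 : 0 <= K).
    { unfold K. pose proof (ser_nonneg _ _ u2_pos (Series_correct _ ex_series_u2)).
      assert (0 <= 2 * Cmod w / cw w ^ 2) by (apply Rdiv_le_0_compat; [lra|apply pow_lt; auto]). nra. }
    (* Small enough for t |w| <= 1 and for t K to stay below the supposedly positive value |Hh
       1|. *)
    set (t := Rmin (Rmin 1 (/ Cmod w)) (Cmod (Hh 1) / (2 * (K + 1)))).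
    assert (T0 : 0 < t).
    { unfold t. repeat apply Rmin_glb_lt; try lra; [apply Rinv_0_lt_compat; auto|].
      apply Rdiv_lt_0_compat; lra. }
    assert (T1 : t <= 1) by (eapply Rle_trans; [apply Rmin_l | apply Rmin_l]).
    assert (T2 : t <= / Cmod w) by (eapply Rle_trans; [apply Rmin_l | apply Rmin_r]).
    assert (T3 : t <= Cmod (Hh 1) / (2 * (K + 1))) by apply Rmin_r.
    assert (T4 : t * Cmod w <= 1).
    { apply Rle_trans with (/ Cmod w * Cmod w); [apply Rmult_le_compat_r; lra|]. rewrite Rinv_l; lra. }
    pose proof (Bd t ltac:(lra) T4) as B. rewrite Cst in B by lra.
    assert (t * (2 * (K + 1)) <= Cmod (Hh 1)).
    { apply Rle_trans with (Cmod (Hh 1) / (2 * (K + 1)) * (2 * (K + 1))); [apply Rmult_le_compat_r; lra|].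
      right; field; lra. }
    nra. }
  unfold Hh in Z. replace (RtoC 1 * w)%C with w in Z by ring. apply Cminus_eq0 in Z.
  rewrite Z. replace w with (RtoC 1 * w)%C by ring. apply pf1_Cis; auto; lra.
Qed.

(** * Transformation of the Eisenstein series *)

(* With w = -2 pi i tau, this is tau -> -1/tau. *)
Definition dual (w : C) : C := (RtoC (2 * PI) * RtoC (2 * PI) / w)%C.

Lemma Re_pos_neq0 w : 0 < Re w -> w <> RtoC 0.
Proof. intros; apply C_neq0_Re; lra. Qed.
Lemma Re_dual w : w <> RtoC 0 -> Re (dual w) = 4 * PI ^ 2 * Re w / Cmod w ^ 2.
Proof.
  intros H. pose proof (Cmod_pos w H). rewrite Cmod_sqr.
  assert (Re w ^ 2 + Im w ^ 2 <> 0) by (rewrite <- Cmod_sqr; apply pow_nonzero; lra).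
  unfold dual, Re, Im in *; simpl in *. field. intros E; apply H1; lra.
Qed.
Lemma Re_dual_pos w : 0 < Re w -> 0 < Re (dual w).
Proof.
  intros H. pose proof (Re_pos_neq0 w H) as N. rewrite Re_dual by auto.
  pose proof (Cmod_pos w N). pose proof PI_gt3.
  apply Rdiv_lt_0_compat; [|apply pow_lt; auto]. assert (0 < PI ^ 2) by (apply pow_lt; lra). nra.
Qed.
Lemma two_PI_neq0 : RtoC (2 * PI) <> RtoC 0.
Proof. apply RtoC_neq0. pose proof PI_gt3; lra. Qed.

Definition nw (w : C) (n : nat) : C := (RtoC (INR (S n)) * w)%C.
Lemma Re_RC a z : Re (RtoC a * z)%C = a * Re z.
Proof. unfold Re; simpl; ring. Qed.
Lemma Im_RC a z : Im (RtoC a * z)%C = a * Im z.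
Proof. unfold Im; simpl; ring. Qed.
Lemma Re_nw w n : Re (nw w n) = INR (S n) * Re w.
Proof. apply Re_RC. Qed.
Lemma Re_nw_pos w n : 0 < Re w -> 0 < Re (nw w n).
Proof. intros; rewrite Re_nw. pose proof (INR_S_pos n). nra. Qed.

(* [gam w] is tau when w = -2 pi i tau. *)
Definition gam (w : C) : C := (w * Ci / RtoC (2 * PI))%C.
Lemma gam_neq0 w : w <> RtoC 0 -> gam w <> RtoC 0.
Proof.
  intros H. unfold gam, Cdiv. repeat apply Cmult_neq_0; auto.
  - apply C_neq0_Im. simpl. lra.
  - intros E. apply two_PI_neq0. pose proof (Cinv_r _ two_PI_neq0) as Q. rewrite E in Q.
    exfalso. apply (f_equal fst) in Q. simpl in Q. lra.
Qed.

(** The lattice spanned by w and 2 pi i is [gam w] times the one spanned by [dual w] and 2 pi i,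
    with the two coordinates exchanged. Every transformation formula below rests on this
    exchange. *)
Lemma swap_aux (w K M : C) : w <> RtoC 0 ->
  (K * w + RtoC (2 * PI) * M * Ci = gam w * (M * dual w + (- (RtoC (2 * PI) * K)) * Ci))%C.
Proof.
  intros H. unfold gam, dual.
  replace (w * Ci / RtoC (2 * PI) * (M * (RtoC (2 * PI) * RtoC (2 * PI) / w) + - (RtoC (2 * PI) * K) * Ci))%C
    with (RtoC (2 * PI) * M * Ci - (Ci * Ci) * (K * w))%C.
  - rewrite Ci_sqr. ring.
  - field. split; auto. apply two_PI_neq0.
Qed.
Lemma swap1 w k m : w <> RtoC 0 ->
  tr (nw w k) (Z.of_nat (S m)) = (gam w * tr (nw (dual w) m) (- Z.of_nat (S k)))%C.
Proof.
  intros H. unfold tr, nw. rewrite opp_IZR, <- !INR_IZR_INZ.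
  replace (2 * PI * - INR (S k)) with (- (2 * PI * INR (S k))) by ring.
  rewrite RtoC_opp, !(RtoC_mult (2 * PI) (INR _)). rewrite <- swap_aux by auto. ring.
Qed.
Lemma swap2 w k m : w <> RtoC 0 ->
  tr (nw w k) (- Z.of_nat (S m)) = (- gam w * tr (nw (dual w) m) (Z.of_nat (S k)))%C.
Proof.
  intros H. unfold tr, nw. rewrite opp_IZR, <- !INR_IZR_INZ.
  replace (2 * PI * - INR (S m)) with (2 * PI * (- INR (S m))) by ring.
  rewrite !(RtoC_mult (2 * PI)), RtoC_opp.
  pose proof (swap_aux w (RtoC (INR (S k))) (- RtoC (INR (S m)))%C H) as E.
  rewrite E. ring.
Qed.

Lemma inv2_mult a b : a <> RtoC 0 -> b <> RtoC 0 -> inv2 (a * b)%C = (inv2 a * inv2 b)%C.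
Proof. intros; unfold inv2; field; auto. Qed.
Lemma inv4_mult a b : a <> RtoC 0 -> b <> RtoC 0 -> inv4 (a * b)%C = (inv4 a * inv4 b)%C.
Proof. intros; unfold inv4; rewrite inv2_mult by auto; ring. Qed.
Lemma inv2_opp a : inv2 (- a)%C = inv2 a.
Proof. unfold inv2. f_equal. ring. Qed.
Lemma inv4_opp a : inv4 (- a)%C = inv4 a.
Proof. unfold inv4. rewrite inv2_opp; auto. Qed.
Lemma Copp_neq0 a : a <> RtoC 0 -> (- a)%C <> RtoC 0.
Proof. intros H E. apply H. replace a with (- - a)%C by ring. rewrite E. ring. Qed.

Lemma nw_tr_neq0 w k m : 0 < Re w -> tr (nw w k) m <> RtoC 0.
Proof. intros. apply lattice_neq0; auto. apply INR_S_pos. Qed.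

(* Size of lattice points: |k w + 2 pi i m|^2 >= c^2 k m for k, m >= 1. *)
Lemma nw_lower w k m : 0 < Re w -> m <> 0%Z ->
  cw w * INR (S k) <= Cmod (tr (nw w k) m) /\ cw w * Rabs (IZR m) <= Cmod (tr (nw w k) m).
Proof. intros H Hm. apply lattice_lower; auto. apply pos_INR. Qed.

Lemma inv4_lattice_bound w k m (n : nat) : 0 < Re w -> Rabs (IZR m) = INR (S n) ->
  Cmod (inv4 (tr (nw w k) m)) <= / cw w ^ 4 * u2 k * u2 n.
Proof.
  intros H Hm. pose proof (cw_pos w H) as cp. pose proof (INR_S_pos k). pose proof (INR_S_pos n).
  destruct (nw_lower w k m H) as [L1 L2].
  { intros ->. rewrite Rabs_R0 in Hm. lra. }
  rewrite Hm in L2. rewrite Cmod_inv4 by (apply nw_tr_neq0; auto). unfold u2.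
  replace (/ cw w ^ 4 * / INR (S k) ^ 2 * / INR (S n) ^ 2) with
    (/ ((cw w * INR (S k)) ^ 2 * (cw w * INR (S n)) ^ 2)) by (field; lra).
  assert (0 < cw w * INR (S k)) by nra. assert (0 < cw w * INR (S n)) by nra.
  apply Rinv_le_contravar; [apply Rmult_lt_0_compat; apply pow_lt; auto|].
  replace (Cmod (tr (nw w k) m) ^ 4) with (Cmod (tr (nw w k) m) ^ 2 * Cmod (tr (nw w k) m) ^ 2) by ring.
  apply Rmult_le_compat; try apply pow2_ge_0; apply pow_incr; lra.
Qed.

Lemma Cis_C_scal_l (c : C) f l : c <> RtoC 0 -> Cis (fun n => c * f n)%C l -> Cis f (/ c * l)%C.
Proof.
  intros H A. eapply Cis_ext; [|apply (Cis_scal (/ c)), A]. intros n; cbv beta. field; auto.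
Qed.

Lemma Cis_inv4_nw w : w <> RtoC 0 -> Cis (fun k => inv4 (nw w k)) (RtoC (PI ^ 4 / 90) * inv4 w)%C.
Proof.
  intros H. rewrite Cmult_comm.
  eapply Cis_ext; [|apply (Cis_scal (inv4 w)), Cis_R, zeta4]. intros n; cbv beta. unfold nw.
  pose proof (INR_S_pos n). rewrite inv4_mult by (auto; apply RtoC_neq0; lra). rewrite Cmult_comm. f_equal.
  unfold inv4, inv2, u4. rewrite <- !RtoC_mult, <- RtoC_inv by (apply Rmult_integral_contrapositive; lra).
  rewrite <- RtoC_mult. f_equal. field. lra.
Qed.
Lemma Cis_inv2_nw w : w <> RtoC 0 -> Cis (fun k => inv2 (nw w k)) (RtoC (PI ^ 2 / 6) * inv2 w)%C.
Proof.
  intros H. rewrite Cmult_comm.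
  eapply Cis_ext; [|apply (Cis_scal (inv2 w)), Cis_R, zeta2]. intros n; cbv beta. unfold nw.
  pose proof (INR_S_pos n). rewrite inv2_mult by (auto; apply RtoC_neq0; lra). rewrite Cmult_comm. f_equal.
  unfold inv2, u2. rewrite <- !RtoC_mult, <- RtoC_inv by (apply Rmult_integral_contrapositive; lra).
  f_equal. field. lra.
Qed.

Lemma C6_neq0 : C6 <> RtoC 0.
Proof.
  unfold C6. rewrite <- !RtoC_plus, <- RtoC_mult. apply RtoC_neq0. lra.
Qed.
Lemma Bfun_pairs x : 0 < Re x ->
  Cis (fun n => inv4 (tr x (Z.of_nat (S n))) + inv4 (tr x (- Z.of_nat (S n))))%C
    (/ C6 * Bfun x - inv4 x)%C.
Proof.
  intros H. pose proof (proj1 (LZ_Cis _ _) (inv4_LZ x H)) as L. cbv beta in L.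
  rewrite tr_0 in L.
  eapply Cis_eq; [apply (Cis_C_scal_l C6); [apply C6_neq0|]; eapply Cis_ext; [|exact L]|].
  - intros n; cbv beta. ring.
  - field. apply C6_neq0.
Qed.

(** Equals the sum of sigma_3(n) q^n with q = e^-w, by [S3_q]; it is first handled as a lattice
    sum. *)
Definition S3fun (w : C) : C := Cs (fun k => Bfun (nw w k)).

(** The double sum of (k w + 2 pi i m)^-4 over k >= 1 and m <> 0: its rows are partial fractions at
    k w, its columns, after exchanging the coordinates, partial fractions at multiples of the dual
    point. *)
Lemma S3_lattice w : 0 < Re w -> exists s,
  Cis (fun k => / C6 * Bfun (nw w k) - inv4 (nw w k))%C s /\
  Cis (fun m => inv4 (gam w) * (/ C6 * Bfun (nw (dual w) m) - inv4 (nw (dual w) m)))%C s.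
Proof.
  intros H. pose proof (Re_pos_neq0 w H) as W0. pose proof (Re_dual_pos w H) as Hd.
  pose proof (cw_pos w H) as cp.
  set (a := fun k m : nat => (inv4 (tr (nw w k) (Z.of_nat (S m))) + inv4 (tr (nw w k) (- Z.of_nat (S m))))%C).
  set (K := 2 * / cw w ^ 4).
  assert (K0 : 0 <= K) by (unfold K; pose proof (Rinv_0_lt_compat _ (pow_lt _ 4 cp)); lra).
  assert (B : forall k m, Cmod (a k m) <= K * u2 k * u2 m).
  { intros k m. eapply Rle_trans; [apply Cmod_triangle|].
    pose proof (inv4_lattice_bound w k _ m H (Rabs_IZR_S m)).
    pose proof (inv4_lattice_bound w k _ m H (Rabs_IZR_opp_S m)). unfold K. lra. }
  assert (R1 : forall k, Cis (a k) (/ C6 * Bfun (nw w k) - inv4 (nw w k))%C).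
  { intros k. apply Bfun_pairs, Re_nw_pos, H. }
  assert (R2 : forall m, Cis (fun k => a k m) (inv4 (gam w) * (/ C6 * Bfun (nw (dual w) m) - inv4 (nw (dual w) m)))%C).
  { intros m. eapply Cis_ext; [|apply Cis_scal, Bfun_pairs, Re_nw_pos, Hd].
    intros k; cbv beta; unfold a. rewrite (swap1 w k m W0), (swap2 w k m W0).
    pose proof (gam_neq0 w W0) as G0. pose proof (Copp_neq0 _ G0) as G1.
    pose proof (nw_tr_neq0 (dual w) m (Z.of_nat (S k)) Hd) as T1.
    pose proof (nw_tr_neq0 (dual w) m (- Z.of_nat (S k)) Hd) as T2.
    rewrite !inv4_mult, inv4_opp by assumption. ring. }
  destruct (Cis_ex_dom (fun k => / C6 * Bfun (nw w k) - inv4 (nw w k))%C (fun k => K * Series u2 * u2 k)) as [s Hs].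
  { intros k. replace (K * Series u2 * u2 k) with (K * u2 k * Series u2) by ring.
    apply (Cis_Cmod_le (a k) _ (fun m => K * u2 k * u2 m)); auto.
    apply ser_scal, Series_correct, ex_series_u2. }
  { apply ex_series_scal_u2. }
  exists s. split; auto.
  apply (Cis_Fubini a (fun k => K * u2 k) u2 (fun k => / C6 * Bfun (nw w k) - inv4 (nw w k))%C); auto.
  - intros k. pose proof (u2_pos k). nra.
  - apply u2_pos.
  - apply ex_series_scal_u2.
  - apply ex_series_u2.
Qed.

Lemma Cis_S3 w : 0 < Re w -> Cis (fun k => Bfun (nw w k)) (S3fun w).
Proof.
  intros H. pose proof (Re_pos_neq0 w H) as W0. pose proof C6_neq0 as N6.
  destruct (S3_lattice w H) as [s [A _]].
  assert (Q : Cis (fun k => Bfun (nw w k)) (C6 * (s + RtoC (PI ^ 4 / 90) * inv4 w))%C).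
  { eapply Cis_ext; [|apply Cis_scal, (Cis_plus _ _ _ _ A (Cis_inv4_nw w W0))].
    intros k; cbv beta. field. auto. }
  unfold S3fun. rewrite (Cis_Cs _ _ Q). exact Q.
Qed.

(** The terms m = 0 left out of the rows sum to zeta(4) w^-4, and 6 zeta(4) w^-4 = gam^-4 / 240. The
    corresponding terms on the dual side give 1 / 240; so the constant term of E4 arises. *)
Lemma S3_transform w : 0 < Re w ->
  (S3fun w + RtoC (/ 240) = inv4 (gam w) * (S3fun (dual w) + RtoC (/ 240)))%C.
Proof.
  intros H. pose proof (Re_pos_neq0 w H) as W0. pose proof C6_neq0 as N6.
  pose proof (Re_dual_pos w H) as Hd. pose proof (Re_pos_neq0 _ Hd) as D0.
  pose proof (gam_neq0 w W0) as G0.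
  destruct (S3_lattice w H) as [s [A B]].
  pose proof (Cis_minus _ _ _ _ (Cis_scal (/ C6) _ _ (Cis_S3 w H)) (Cis_inv4_nw w W0)) as A'.
  pose proof (Cis_scal (inv4 (gam w)) _ _ (Cis_minus _ _ _ _ (Cis_scal (/ C6) _ _ (Cis_S3 _ Hd)) (Cis_inv4_nw _ D0))) as B'.
  pose proof (Cis_unique _ _ _ A A') as E1. pose proof (Cis_unique _ _ _ B B') as E2.
  rewrite E1 in E2.
  assert (E3 : S3fun w = (C6 * RtoC (PI ^ 4 / 90) * inv4 w + inv4 (gam w) * S3fun (dual w) -
    C6 * RtoC (PI ^ 4 / 90) * (inv4 (gam w) * inv4 (dual w)))%C).
  { replace (S3fun w) with (C6 * ((/ C6 * S3fun w - RtoC (PI ^ 4 / 90) * inv4 w) + RtoC (PI ^ 4 / 90) * inv4 w))%C by (field; auto).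
    rewrite E2. field; auto. }
  rewrite E3.
  assert (P : RtoC (2 * PI) <> RtoC 0) by apply two_PI_neq0.
  assert (Q1 : inv4 w = (inv4 (gam w) * RtoC (/ (2 * PI) ^ 4))%C).
  { rewrite RtoC_inv, RtoC_pow by (apply pow_nonzero; pose proof PI_gt3; lra).
    assert (E : inv4 (gam w) = (inv4 w * (RtoC (2 * PI) ^ 4))%C).
    { unfold gam. replace (w * Ci / RtoC (2 * PI))%C with (w * (Ci / RtoC (2 * PI)))%C by (field; auto).
      assert (Ci <> RtoC 0) by (apply C_neq0_Im; simpl; lra).
      assert ((Ci / RtoC (2 * PI))%C <> RtoC 0).
      { replace (Ci / RtoC (2 * PI))%C with (gam (RtoC 1)) by (unfold gam; field; auto).
        apply gam_neq0. apply RtoC_neq0; lra. }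
      rewrite inv4_mult by auto. f_equal. unfold inv4, inv2.
      replace (/ (Ci / RtoC (2 * PI) * (Ci / RtoC (2 * PI))))%C with (RtoC (2 * PI) ^ 2 / (Ci * Ci))%C by (field; auto).
      rewrite Ci_sqr. field. }
    rewrite E. field; auto. }
  assert (Q2 : (inv4 (gam w) * inv4 (dual w))%C = RtoC (/ (2 * PI) ^ 4)).
  { rewrite <- inv4_mult by auto.
    replace (gam w * dual w)%C with (RtoC (2 * PI) * Ci)%C by (unfold gam, dual; field; auto).
    unfold inv4. rewrite inv2_imag by (pose proof PI_gt3; lra).
    rewrite <- RtoC_mult. f_equal. field. pose proof PI_gt3; lra. }
  rewrite Q2, Q1.
  assert (E6 : C6 = RtoC 6) by (unfold C6; rewrite <- !RtoC_plus, <- RtoC_mult; f_equal; ring).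
  assert (V : (C6 * RtoC (PI ^ 4 / 90) * RtoC (/ (2 * PI) ^ 4))%C = RtoC (/ 240)).
  { rewrite E6, <- !RtoC_mult. f_equal. field. pose proof PI_gt3; lra. }
  replace (C6 * RtoC (PI ^ 4 / 90) * (inv4 (gam w) * RtoC (/ (2 * PI) ^ 4)))%C with
    (inv4 (gam w) * (C6 * RtoC (PI ^ 4 / 90) * RtoC (/ (2 * PI) ^ 4)))%C by ring.
  rewrite V. ring.
Qed.

(** * The weight two sum and its conditional convergence *)

Definition D4 : C := (RtoC (4 * PI) * Ci)%C.
(* Subtracting a term that telescopes in m makes the double sum of 1 / (k w + 2 pi i m)^2
   absolutely convergent; summing that term in the two orders gives different values, whence the
   non-modular term in the transformation of E2. *)
Definition telescoping_term (x : C) : C := (/ D4 * (/ tr x (-1) - / tr x 1))%C.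
Definition Ffun (x : C) : C := (inv2 x - telescoping_term x)%C.
Definition pj (w : C) (j k : nat) : C :=
  (/ tr (nw w k) (Z.of_nat j) - / tr (nw w k) (- Z.of_nat j))%C.

Lemma Ci_neq0 : Ci <> RtoC 0.
Proof. apply C_neq0_Im. simpl. lra. Qed.
Lemma D4_neq0 : D4 <> RtoC 0.
Proof. apply Cmult_neq_0; [apply RtoC_neq0; pose proof PI_gt3; lra | apply Ci_neq0]. Qed.

Lemma lim_inv_S c : is_lim_seq (fun n => c * / INR (S n)) 0.
Proof.
  replace (Finite 0) with (Finite (c * 0)) by (f_equal; ring).
  apply is_lim_seq_mult'; [apply is_lim_seq_const|].
  apply (is_lim_seq_incr_1 (fun n => / INR n)).
  replace (Finite 0) with (Rbar_inv p_infty) by reflexivity.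
  apply is_lim_seq_inv; [apply is_lim_seq_INR | discriminate].
Qed.

Lemma inv_tr_vanishing w k : 0 < Re w -> vanishing (fun m => / tr (nw w k) m)%C.
Proof.
  intros H. pose proof (cw_pos w H) as cp.
  assert (B : forall n m, Rabs (IZR m) = INR (S n) -> Cmod (/ tr (nw w k) m) <= / cw w * / INR (S n)).
  { intros n m E. pose proof (INR_S_pos n).
    destruct (nw_lower w k m H) as [_ L]; [intros ->; rewrite Rabs_R0 in E; lra|].
    rewrite Cmod_inv by (apply nw_tr_neq0; auto). rewrite E in L. rewrite <- Rinv_mult.
    apply Rinv_le_contravar; [nra|exact L]. }
  split; apply Clim_incr; apply Clim_squeeze with (e := fun n => / cw w * / INR (S n));
    try apply lim_inv_S; intros n.
  - replace (_ - _)%C with (/ tr (nw w k) (Z.of_nat (S n)))%C by ring. apply B, Rabs_IZR_S.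
  - replace (_ - _)%C with (/ tr (nw w k) (- Z.of_nat (S n)))%C by ring. apply B, Rabs_IZR_opp_S.
Qed.

Lemma zsum_gtel x N : zsum (fun m => telescoping_term (tr x m)) N =
  (/ D4 * (/ tr x (- Z.of_nat N - 1) + / tr x (- Z.of_nat N) - / tr x (Z.of_nat N) - / tr x (Z.of_nat N + 1)))%C.
Proof.
  induction N.
  - cbn [zsum]. unfold telescoping_term. rewrite !tr_tr. cbn [Z.of_nat Z.opp Z.add Z.sub Z.of_nat]. ring.
  - cbn [zsum]. rewrite IHN. unfold telescoping_term. rewrite !tr_tr.
    replace (-1 + Z.of_nat (S N))%Z with (Z.of_nat N) by lia.
    replace (1 + Z.of_nat (S N))%Z with (Z.of_nat (S N) + 1)%Z by lia.
    replace (-1 + - Z.of_nat (S N))%Z with (- Z.of_nat (S N) - 1)%Z by lia.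
    replace (1 + - Z.of_nat (S N))%Z with (- Z.of_nat N)%Z by lia.
    replace (- Z.of_nat N - 1)%Z with (- Z.of_nat (S N))%Z by lia.
    replace (Z.of_nat N + 1)%Z with (Z.of_nat (S N)) by lia. ring.
Qed.

Lemma LZ_gtel w k : 0 < Re w -> is_zseries (fun m => telescoping_term (tr (nw w k) m)) (RtoC 0).
Proof.
  intros H. destruct (inv_tr_vanishing w k H) as [V1 V2].
  pose proof (proj2 (Clim_incr _ _) V1) as V3. pose proof (proj2 (Clim_incr _ _) V2) as V4.
  pose proof (Clim_mult _ _ _ _ (Clim_const (/ D4)%C)
    (Clim_minus _ _ _ _ (Clim_minus _ _ _ _ (Clim_plus _ _ _ _ V4 V2) V1) V3)) as Q.
  replace (RtoC 0) with (/ D4 * (RtoC 0 + RtoC 0 - RtoC 0 - RtoC 0))%C by ring.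
  eapply Clim_ext; [|exact Q]. intros N. cbv beta. rewrite zsum_gtel.
  replace (- Z.of_nat N - 1)%Z with (- Z.of_nat (S N))%Z by lia.
  replace (Z.of_nat N + 1)%Z with (Z.of_nat (S N)) by lia. reflexivity.
Qed.

Lemma Ffun_pairs w k : 0 < Re w ->
  Cis (fun n => Ffun (tr (nw w k) (Z.of_nat (S n))) + Ffun (tr (nw w k) (- Z.of_nat (S n))))%C
    (Afun (nw w k) - Ffun (nw w k))%C.
Proof.
  intros H.
  pose proof (proj1 (LZ_Cis _ _) (LZ_gtel w k H)) as L. cbv beta in L. rewrite tr_0 in L.
  pose proof (Cis_minus _ _ _ _ (Afun_pairs _ (Re_nw_pos w k H)) L) as Q.
  eapply Cis_eq; [eapply Cis_ext; [|exact Q]|].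
  - intros n; cbv beta; unfold Ffun; ring.
  - unfold Ffun; ring.
Qed.

(** The telescoping term equals 1 / ((x + 2 pi i) (x - 2 pi i)), so subtracting it from 1 / x^2
    leaves a term of order |x|^-4. *)
Lemma Ffun_eq x : x <> RtoC 0 -> tr x 1 <> RtoC 0 -> tr x (-1) <> RtoC 0 ->
  Ffun x = (RtoC (4 * PI ^ 2) * (/ (x * x) * / (tr x 1 * tr x (-1))))%C.
Proof.
  intros H0 H1 H2. unfold Ffun, telescoping_term, inv2.
  assert (E : (/ D4 * (/ tr x (-1) - / tr x 1))%C = (/ (tr x 1 * tr x (-1)))%C).
  { replace (/ tr x (-1) - / tr x 1)%C with ((tr x 1 - tr x (-1)) / (tr x 1 * tr x (-1)))%C by (field; auto).
    replace (tr x 1 - tr x (-1))%C with D4.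
    - field. repeat split; auto. apply D4_neq0.
    - unfold tr, D4. apply C_eq; unfold Re, Im; simpl; ring. }
  rewrite E.
  replace (/ (x * x) - / (tr x 1 * tr x (-1)))%C with
    ((tr x 1 * tr x (-1) - x * x) * (/ (x * x) * / (tr x 1 * tr x (-1))))%C by (field; auto).
  f_equal. unfold tr. apply C_eq; unfold Re, Im; simpl; ring.
Qed.

Lemma Ffun_bound w k m (n : nat) : 0 < Re w -> Rabs (IZR m) = INR (S n) ->
  Cmod (Ffun (tr (nw w k) m)) <= 4 * PI ^ 2 * / cw w ^ 4 * u2 k * u2 n.
Proof.
  intros H Hm. pose proof (cw_pos w H) as cp. pose proof (INR_S_pos k) as kp. pose proof (INR_S_pos n) as np.
  pose proof PI_gt3 as P3.
  assert (m0 : m <> 0%Z) by (intros ->; rewrite Rabs_R0 in Hm; lra).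
  destruct (nw_lower w k m H m0) as [L1 L2]. rewrite Hm in L2.
  rewrite Ffun_eq by (rewrite ?tr_tr; apply nw_tr_neq0; auto). rewrite !tr_tr.
  destruct (lattice_lower w (INR (S k)) (1 + m) H (pos_INR _)) as [L3 L4].
  destruct (lattice_lower w (INR (S k)) (-1 + m) H (pos_INR _)) as [L5 L6].
  fold (nw w k) in L3, L4, L5, L6.
  rewrite !Cmod_mult, Cmod_R_pos by nra.
  rewrite !Cmod_inv by (apply Cmult_neq_0; apply nw_tr_neq0; auto). rewrite !Cmod_mult.
  set (x := Cmod (tr (nw w k) m)) in *. set (y := Cmod (tr (nw w k) (1 + m))) in *.
  set (z := Cmod (tr (nw w k) (-1 + m))) in *.
  rewrite plus_IZR in L4, L6.
  set (K := INR (S k)) in *. set (N := INR (S n)) in *. set (c := cw w) in *.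
  assert (p1 : 0 < c * K) by nra. assert (p2 : 0 < c * N) by nra.
  (* One of m + 1 and m - 1 is at least as far from 0 as m; the point over the other one is bounded
     below through k. *)
  assert (YZ : (c * K) * (c * N) <= y * z).
  { destruct (Rle_dec 0 (IZR m)) as [s|s].
    - assert (Q : Rabs (1 + IZR m) >= N) by (rewrite Rabs_pos_eq in Hm by lra; rewrite Rabs_pos_eq; lra).
      rewrite Rmult_comm. apply Rmult_le_compat; try lra. nra.
    - assert (Q : Rabs (-1 + IZR m) >= N) by (rewrite Rabs_left in Hm by lra; rewrite Rabs_left; lra).
      apply Rmult_le_compat; try lra. nra. }
  assert (XX : (c * K) * (c * N) <= x * x) by (apply Rmult_le_compat; lra).
  unfold u2. fold K N.
  replace (4 * PI ^ 2 * / c ^ 4 * / K ^ 2 * / N ^ 2) with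
    (4 * PI ^ 2 * (/ (c * K * (c * N)) * / (c * K * (c * N)))) by (field; unfold N, K, c in *; lra).
  assert (0 < c * K * (c * N)) by nra.
  apply Rmult_le_compat_l; [nra|].
  apply Rmult_le_compat; try (left; apply Rinv_0_lt_compat; lra); apply Rinv_le_contravar; auto.
Qed.

(** The sum of [pj w j] over k, which the exchange of coordinates turns into partial fractions of
    [hfun] at the dual point. At j = 0 the two terms of [pj] cancel. *)
Definition pj_sum (w : C) (j : nat) : C :=
  match j with O => RtoC 0 | S m => (/ gam w * hfun (nw (dual w) m))%C end.

Lemma Cis_pj w j : 0 < Re w -> Cis (pj w j) (pj_sum w j).
Proof.
  intros H. pose proof (Re_pos_neq0 w H) as W0. pose proof (Re_dual_pos w H) as Hd.
  pose proof (gam_neq0 w W0) as G0. pose proof (Copp_neq0 _ G0) as G1.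
  destruct j as [|m].
  - eapply Cis_ext; [|apply Cis_0]. intros k. unfold pj. simpl. ring.
  - simpl pj_sum. eapply Cis_ext; [|apply Cis_scal, hfun_pf1, Re_nw_pos, Hd].
    intros k; cbv beta. unfold pj, pf1. rewrite (swap1 w k m W0), (swap2 w k m W0).
    pose proof (nw_tr_neq0 (dual w) m (Z.of_nat (S k)) Hd) as T1.
    pose proof (nw_tr_neq0 (dual w) m (- Z.of_nat (S k)) Hd) as T2.
    field. auto.
Qed.

Lemma gtel_pair w k m :
  (telescoping_term (tr (nw w k) (Z.of_nat (S m))) + telescoping_term (tr (nw w k) (- Z.of_nat (S m))))%C
  = (/ D4 * (pj w m k - pj w (S (S m)) k))%C.
Proof.
  unfold telescoping_term, pj. rewrite !tr_tr.
  replace (-1 + Z.of_nat (S m))%Z with (Z.of_nat m) by lia.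
  replace (1 + Z.of_nat (S m))%Z with (Z.of_nat (S (S m))) by lia.
  replace (-1 + - Z.of_nat (S m))%Z with (- Z.of_nat (S (S m)))%Z by lia.
  replace (1 + - Z.of_nat (S m))%Z with (- Z.of_nat m)%Z by lia. ring.
Qed.

(** That this limit is 1 / 2 and not 0 is the source of the anomalous term of E2. *)
Lemma Clim_hfun w : 0 < Re w -> Clim (fun m => hfun (nw w m)) (/ (RtoC 1 + RtoC 1))%C.
Proof.
  intros H. apply Clim_squeeze with (e := fun n => 2 * / Re w * / INR (S n)); [|apply lim_inv_S].
  intros n. pose proof (Re_nw_pos w n H) as P. pose proof (INR_S_pos n) as Ip.
  unfold hfun. set (x := nw w n) in *.
  replace (_ - _)%C with (/ (Cexp x - RtoC 1) - / x)%C by ring.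
  eapply Rle_trans; [apply Cmod_minus_le|].
  rewrite !Cmod_inv by (try apply Cexp_neq1; try apply Re_pos_neq0; auto).
  assert (E : Re x = INR (S n) * Re w) by apply Re_nw.
  assert (A1 : Re x <= Cmod (Cexp x - RtoC 1)).
  { pose proof (Cmod_minus_ge (Cexp x) (RtoC 1)) as Q. rewrite Cmod_Cexp, Cmod_1 in Q.
    pose proof (exp_ineq1_le (Re x)). lra. }
  pose proof (Re_le_Cmod' x) as A2.
  pose proof (Rinv_le_contravar _ _ P A1) as I1. pose proof (Rinv_le_contravar _ _ P A2) as I2.
  replace (2 * / Re w * / INR (S n)) with (/ Re x + / Re x) by (rewrite E; field; lra). lra.
Qed.

(** Equals the sum of sigma_1(n) q^n with q = e^-w, by [S1_q]. *)
Definition S1fun (w : C) : C := Cs (fun k => Afun (nw w k)).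

Definition column (w : C) (m : nat) : C :=
  (inv2 (gam w) * (Afun (nw (dual w) m) - inv2 (nw (dual w) m))
    - / D4 * (pj_sum w m - pj_sum w (S (S m))))%C.

(** The double counting of weight four with [Ffun] in place of 1 / x^2. Along rows the subtracted
    terms sum to 0; along columns they leave differences of [pj_sum]. *)
Lemma S1_lattice w : 0 < Re w -> exists s,
  Cis (fun k => Afun (nw w k) - Ffun (nw w k))%C s /\ Cis (column w) s.
Proof.
  intros H. pose proof (Re_pos_neq0 w H) as W0. pose proof (Re_dual_pos w H) as Hd.
  pose proof (cw_pos w H) as cp. pose proof PI_gt3 as P3.
  set (a := fun k m : nat => (Ffun (tr (nw w k) (Z.of_nat (S m))) + Ffun (tr (nw w k) (- Z.of_nat (S m))))%C).
  set (K := 2 * (4 * PI ^ 2 * / cw w ^ 4)).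
  assert (K0 : 0 <= K).
  { unfold K. pose proof (Rinv_0_lt_compat _ (pow_lt _ 4 cp)). pose proof (pow2_ge_0 PI). nra. }
  assert (B : forall k m, Cmod (a k m) <= K * u2 k * u2 m).
  { intros k m. eapply Rle_trans; [apply Cmod_triangle|].
    pose proof (Ffun_bound w k _ m H (Rabs_IZR_S m)).
    pose proof (Ffun_bound w k _ m H (Rabs_IZR_opp_S m)). unfold K. lra. }
  assert (R1 : forall k, Cis (a k) (Afun (nw w k) - Ffun (nw w k))%C).
  { intros k. apply Ffun_pairs, H. }
  assert (R2 : forall m, Cis (fun k => a k m) (column w m)).
  { intros m.
    eapply Cis_ext; [|apply Cis_minus; [apply Cis_scal, Afun_pairs, Re_nw_pos, Hd |
      apply Cis_scal, Cis_minus; [apply (Cis_pj w m H) | apply (Cis_pj w (S (S m)) H)]]].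
    intros k; cbv beta. rewrite <- gtel_pair. unfold a, Ffun.
    rewrite (swap1 w k m W0), (swap2 w k m W0).
    pose proof (gam_neq0 w W0) as G0. pose proof (Copp_neq0 _ G0) as G1.
    pose proof (nw_tr_neq0 (dual w) m (Z.of_nat (S k)) Hd) as T1.
    pose proof (nw_tr_neq0 (dual w) m (- Z.of_nat (S k)) Hd) as T2.
    rewrite !inv2_mult, inv2_opp by assumption. ring. }
  destruct (Cis_ex_dom (fun k => Afun (nw w k) - Ffun (nw w k))%C (fun k => K * Series u2 * u2 k)) as [s Hs].
  { intros k. replace (K * Series u2 * u2 k) with (K * u2 k * Series u2) by ring.
    apply (Cis_Cmod_le (a k) _ (fun m => K * u2 k * u2 m)); auto.
    apply ser_scal, Series_correct, ex_series_u2. }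
  { apply ex_series_scal_u2. }
  exists s. split; auto.
  apply (Cis_Fubini a (fun k => K * u2 k) u2 (fun k => Afun (nw w k) - Ffun (nw w k))%C); auto.
  - intros k. pose proof (u2_pos k). nra.
  - apply u2_pos.
  - apply ex_series_scal_u2.
  - apply ex_series_u2.
Qed.

Lemma Cis_S1_aux w s : 0 < Re w -> Cis (fun k => Afun (nw w k) - Ffun (nw w k))%C s ->
  Cis (fun k => Afun (nw w k)) (s + RtoC (PI ^ 2 / 6) * inv2 w + / D4 * pj_sum w 1)%C.
Proof.
  intros H A.
  eapply Cis_ext; [|apply (Cis_plus _ _ _ _ (Cis_plus _ _ _ _ A (Cis_inv2_nw w (Re_pos_neq0 w H)))
    (Cis_scal (/ D4) _ _ (Cis_pj w 1 H)))].
  intros k; cbv beta. unfold Ffun, telescoping_term, pj. change (- Z.of_nat 1)%Z with (-1)%Z. change (Z.of_nat 1) with 1%Z. ring.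
Qed.
Lemma Cis_S1 w : 0 < Re w -> Cis (fun k => Afun (nw w k)) (S1fun w).
Proof.
  intros H. destruct (S1_lattice w H) as [s [A _]].
  pose proof (Cis_S1_aux w s H A) as Q. unfold S1fun. rewrite (Cis_Cs _ _ Q). exact Q.
Qed.

(** Summed over m, the differences of [pj_sum] telescope to [pj_sum w 1] - 1 / gam, the last part
    being twice the limit 1 / (2 gam). The first part cancels against the same term from the rows at
    m = 0, and 1 / (D4 gam) remains. *)
Lemma S1_transform w : 0 < Re w ->
  (S1fun w - RtoC (/ 24) = inv2 (gam w) * (S1fun (dual w) - RtoC (/ 24)) + / (D4 * gam w))%C.
Proof.
  intros H. pose proof (Re_pos_neq0 w H) as W0.
  pose proof (Re_dual_pos w H) as Hd. pose proof (Re_pos_neq0 _ Hd) as D0.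
  pose proof (gam_neq0 w W0) as G0. pose proof D4_neq0 as Q0. pose proof two_PI_neq0 as P0.
  destruct (S1_lattice w H) as [s [A B]].
  pose proof (Cis_unique _ _ _ (Cis_S1 w H) (Cis_S1_aux w s H A)) as E1.
  pose proof (Cis_scal (inv2 (gam w)) _ _ (Cis_minus _ _ _ _ (Cis_S1 _ Hd) (Cis_inv2_nw _ D0))) as B'.
  apply Cis_Clim in B. apply Cis_Clim in B'.
  assert (LP : Clim (fun N => pj_sum w (S N)) (/ gam w * / (RtoC 1 + RtoC 1))%C).
  { simpl. apply Clim_mult; [apply Clim_const | apply Clim_hfun, Hd]. }
  pose proof (proj1 (Clim_incr (pj_sum w) _) LP) as LP0.
  assert (T : forall N, psum (fun m => pj_sum w m - pj_sum w (S (S m)))%C N = (pj_sum w 1 - pj_sum w N - pj_sum w (S N))%C).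
  { induction N; [cbn [psum]; simpl (pj_sum w 0); ring|]. cbn [psum]. rewrite IHN. ring. }
  assert (B2 : Clim (psum (column w))
    (inv2 (gam w) * (S1fun (dual w) - RtoC (PI ^ 2 / 6) * inv2 (dual w))
      - / D4 * (pj_sum w 1 - / gam w * / (RtoC 1 + RtoC 1) - / gam w * / (RtoC 1 + RtoC 1)))%C).
  { eapply Clim_ext; [|apply (Clim_minus _ _ _ _ B' (Clim_mult _ _ _ _ (Clim_const (/ D4)%C)
      (Clim_minus _ _ _ _ (Clim_minus _ _ _ _ (Clim_const (pj_sum w 1)) LP0) LP)))].
    intros N; cbv beta. rewrite <- T, <- psum_scal, <- psum_minus. reflexivity. }
  pose proof (Clim_unique _ _ _ B B2) as E2. rewrite E1, E2.
  assert (g1 : inv2 (gam w) = (- (RtoC (2 * PI) * RtoC (2 * PI)) * inv2 w)%C).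
  { unfold gam, inv2.
    replace (/ (w * Ci / RtoC (2 * PI) * (w * Ci / RtoC (2 * PI))))%C with
      (RtoC (2 * PI) * RtoC (2 * PI) / (w * w * (Ci * Ci)))%C by (field; repeat split; auto; apply Ci_neq0).
    rewrite Ci_sqr. field; auto. }
  assert (g2 : (inv2 (gam w) * inv2 (dual w))%C = (- / (RtoC (2 * PI) * RtoC (2 * PI)))%C).
  { rewrite g1. unfold dual, inv2. field. auto. }
  assert (g3 : RtoC (/ 24) = (RtoC (PI ^ 2 / 6) * / (RtoC (2 * PI) * RtoC (2 * PI)))%C).
  { pose proof PI_gt3. rewrite <- RtoC_mult, <- RtoC_inv, <- RtoC_mult by nra. f_equal. field. lra. }
  replace (inv2 (gam w) * (S1fun (dual w) - RtoC (PI ^ 2 / 6) * inv2 (dual w)))%C with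
    (inv2 (gam w) * S1fun (dual w) - RtoC (PI ^ 2 / 6) * (inv2 (gam w) * inv2 (dual w)))%C by ring.
  rewrite g2, g3, g1. field. auto.
Qed.

(** * Expansions in powers of q *)

Lemma ex_series_poly_geom (p : nat) (r : R) : 0 <= r < 1 ->
  ex_series (fun n => INR (S n) ^ p * r ^ S n).
Proof.
  intros [[H0|<-] H1].
  2:{ exists 0. eapply ser_ext; [|exact ser_zero]. intros n; simpl. ring. }
  assert (E : ex_series (fun n => Rabs (INR (S n) ^ p * r ^ S n))).
  { apply (ex_series_DAlembert _ r); auto.
    - intros n. apply Rmult_integral_contrapositive; split; apply pow_nonzero; [|lra].
      pose proof (INR_S_pos n); lra.
    - assert (L : is_lim_seq (fun n => (1 + 1 * / INR (S n)) ^ p * r) ((1 + 0) ^ p * r)).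
      { apply is_lim_seq_mult'; [|apply is_lim_seq_const].
        assert (L0 : is_lim_seq (fun n => 1 + 1 * / INR (S n)) (1 + 0)).
        { apply is_lim_seq_plus'; [apply is_lim_seq_const | apply lim_inv_S]. }
        clear -L0. induction p; simpl; [apply is_lim_seq_const|].
        apply is_lim_seq_mult'; auto. }
      rewrite Rplus_0_r, pow1, Rmult_1_l in L.
      eapply is_lim_seq_ext; [|exact L]. intros n; simpl (r ^ _).
      pose proof (INR_S_pos n). pose proof (INR_S_pos (S n)).
      rewrite Rabs_pos_eq.
      + replace (1 + 1 * / INR (S n)) with (INR (S (S n)) * / INR (S n)) by (rewrite (S_INR (S n)); field; lra).
        rewrite Rpow_mult_distr, pow_inv. field. repeat split; try lra; apply pow_nonzero; lra.
      + apply Rdiv_le_0_compat.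
        * apply Rmult_le_pos; [apply pow_le; lra | left; repeat apply Rmult_lt_0_compat; auto; apply pow_lt; auto].
        * apply Rmult_lt_0_compat; [apply pow_lt; auto | apply Rmult_lt_0_compat; auto; apply pow_lt; auto]. }
  destruct E as [s Hs]. exists s. eapply ser_ext; [|exact Hs]. intros n; cbv beta.
  apply Rabs_pos_eq. apply Rmult_le_pos; apply pow_le; [left; apply INR_S_pos | lra].
Qed.

Definition Tp (p : nat) (z : C) : C := Cs (fun n => RtoC (INR (S n) ^ p) * z ^ S n)%C.

Lemma Tp_Cis p z : Cmod z < 1 -> Cis (fun n => RtoC (INR (S n) ^ p) * z ^ S n)%C (Tp p z).
Proof.
  intros H. apply Cis_dom with (M := fun n => INR (S n) ^ p * Cmod z ^ S n).
  - intros n. rewrite Cmod_mult, Cmod_pow, Cmod_R_pos; [lra|].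
    apply pow_le. left; apply INR_S_pos.
  - apply ex_series_poly_geom. split; [apply Cmod_nonneg | auto].
Qed.

Lemma Cmod_lt1_neq z : Cmod z < 1 -> (RtoC 1 - z)%C <> RtoC 0.
Proof.
  intros H. apply C_neq0_Cmod. pose proof (Cmod_minus_ge (RtoC 1) z) as Q. rewrite Cmod_1 in Q. lra.
Qed.

(** Multiplication by 1 - z takes differences of the coefficients, which lowers the degree p and
    lets the rational form of each [Tp p] follow from the preceding ones. *)
Lemma Tp_diff p z : Cmod z < 1 ->
  Cis (fun n => RtoC (INR (S n) ^ S p - INR n ^ S p) * z ^ S n)%C ((RtoC 1 - z) * Tp (S p) z)%C.
Proof.
  intros H. pose proof (Tp_Cis (S p) z H) as A.
  assert (B : Cis (fun n => RtoC (INR n ^ S p) * z ^ S n)%C (z * Tp (S p) z)%C).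
  { pose proof (Cis_scal z _ _ A) as Q.
    replace (z * Tp (S p) z)%C with (z * Tp (S p) z + RtoC (INR 0 ^ S p) * z ^ 1)%C.
    - apply (Cis_decr (fun n => RtoC (INR n ^ S p) * z ^ S n)%C).
      eapply Cis_ext; [|exact Q]. intros n; cbv beta. change (z ^ S (S n))%C with (z * z ^ S n)%C. ring.
    - rewrite pow_ne_zero by discriminate. ring. }
  eapply Cis_eq; [eapply Cis_ext; [|apply (Cis_minus _ _ _ _ A B)]|].
  - intros n; cbv beta. rewrite RtoC_minus. ring.
  - ring.
Qed.

Lemma Tp_0 z : Cmod z < 1 -> ((RtoC 1 - z) * Tp 0 z)%C = z.
Proof.
  intros H. pose proof (Tp_Cis 0 z H) as A.
  pose proof (Cis_scal z _ _ A) as Q.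
  assert (B : Cis (fun n => RtoC (INR (S n) ^ 0) * z ^ S n)%C (z * Tp 0 z + z)%C).
  { eapply Cis_eq; [apply Cis_decr; eapply Cis_ext; [|exact Q]|].
    - intros n; simpl. ring.
    - simpl. ring. }
  pose proof (Cis_unique _ _ _ A B) as E. rewrite E at 1.
  transitivity (z * Tp 0 z + z - z * (z * Tp 0 z + z))%C; [ring|]. rewrite <- E. rewrite E at 1. ring.
Qed.
Lemma Tp_1 z : Cmod z < 1 -> ((RtoC 1 - z) * Tp 1 z)%C = Tp 0 z.
Proof.
  intros H. apply (Cis_unique _ _ _ (Tp_diff 0 z H)).
  eapply Cis_ext; [|apply (Tp_Cis 0 z H)]. intros n; cbv beta. do 2 f_equal.
  rewrite !pow_1, S_INR. simpl. ring.
Qed.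
Lemma Tp_2 z : Cmod z < 1 -> ((RtoC 1 - z) * Tp 2 z)%C = (RtoC 2 * Tp 1 z - Tp 0 z)%C.
Proof.
  intros H. apply (Cis_unique _ _ _ (Tp_diff 1 z H)).
  eapply Cis_ext; [|apply (Cis_minus _ _ _ _ (Cis_scal (RtoC 2) _ _ (Tp_Cis 1 z H)) (Tp_Cis 0 z H))].
  intros n; cbv beta. rewrite Cmult_assoc, <- RtoC_mult.
  replace (INR (S n) ^ 2 - INR n ^ 2) with (2 * INR (S n) ^ 1 - INR (S n) ^ 0) by (rewrite S_INR; ring).
  rewrite RtoC_minus. ring.
Qed.
Lemma Tp_3 z : Cmod z < 1 ->
  ((RtoC 1 - z) * Tp 3 z)%C = (RtoC 3 * Tp 2 z - RtoC 3 * Tp 1 z + Tp 0 z)%C.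
Proof.
  intros H. apply (Cis_unique _ _ _ (Tp_diff 2 z H)).
  eapply Cis_ext; [|apply (Cis_plus _ _ _ _ (Cis_minus _ _ _ _ (Cis_scal (RtoC 3) _ _ (Tp_Cis 2 z H))
   (Cis_scal (RtoC 3) _ _ (Tp_Cis 1 z H))) (Tp_Cis 0 z H))].
  intros n; cbv beta. rewrite !Cmult_assoc, <- !RtoC_mult.
  replace (INR (S n) ^ 3 - INR n ^ 3) with (3 * INR (S n) ^ 2 - 3 * INR (S n) ^ 1 + INR (S n) ^ 0) by (rewrite S_INR; ring).
  rewrite RtoC_plus, RtoC_minus. ring.
Qed.

Lemma Cmod_qexp w : 0 < Re w -> Cmod (Cexp (- w)) < 1.
Proof.
  intros H. rewrite Cmod_Cexp. replace (Re (- w)%C) with (- Re w) by reflexivity.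
  rewrite <- exp_0. apply exp_increasing. lra.
Qed.

Lemma C3_eq : RtoC 3 = (RtoC 1 + RtoC 1 + RtoC 1)%C.
Proof. rewrite <- !RtoC_plus; f_equal; ring. Qed.

Lemma Afun_T x : 0 < Re x -> Afun x = Tp 1 (Cexp (- x)).
Proof.
  intros H. pose proof (Cmod_qexp x H) as Q. set (z := Cexp (- x)) in *.
  pose proof (Cmod_lt1_neq z Q) as N. pose proof (Tp_0 z Q) as T0. pose proof (Tp_1 z Q) as T1.
  assert (Ez : Cexp x = (/ z)%C) by (unfold z; rewrite Cexp_opp; field; apply Cexp_neq0).
  assert (z0 : z <> RtoC 0) by apply Cexp_neq0.
  unfold Afun. rewrite Ez.
  replace (Tp 1 z) with (z / ((RtoC 1 - z) * (RtoC 1 - z)))%C.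
  - field. auto.
  - rewrite <- T0 at 1. rewrite <- T1. field. auto.
Qed.
Lemma Bfun_T x : 0 < Re x -> Bfun x = Tp 3 (Cexp (- x)).
Proof.
  intros H. pose proof (Cmod_qexp x H) as Q. unfold Bfun. rewrite Afun_T by auto.
  set (z := Cexp (- x)) in *.
  pose proof (Cmod_lt1_neq z Q) as N. pose proof (Tp_0 z Q) as T0. pose proof (Tp_1 z Q) as T1.
  pose proof (Tp_2 z Q) as T2. pose proof (Tp_3 z Q) as T3. rewrite C2_eq in T2. rewrite C3_eq in T3.
  assert (E0 : Tp 0 z = (z / (RtoC 1 - z))%C) by (rewrite <- T0 at 2; field; auto).
  assert (E1 : Tp 1 z = (Tp 0 z / (RtoC 1 - z))%C) by (rewrite <- T1; field; auto).
  assert (E2 : Tp 2 z = (((RtoC 1 + RtoC 1) * Tp 1 z - Tp 0 z) / (RtoC 1 - z))%C) by (rewrite <- T2; field; auto).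
  assert (E3 : Tp 3 z = (((RtoC 1 + RtoC 1 + RtoC 1) * Tp 2 z - (RtoC 1 + RtoC 1 + RtoC 1) * Tp 1 z + Tp 0 z) / (RtoC 1 - z))%C)
    by (rewrite <- T3; field; auto).
  rewrite E3, E2, E1, E0. field. auto.
Qed.

(** ** Logarithm of 1 - z *)

(** This is -log (1 - z) as a power series, so that no branch of a complex logarithm has to be
    chosen. *)
Definition ell (z : C) : C := Cs (fun k => RtoC (/ INR (S k)) * z ^ S k)%C.

Lemma Rinv_INR_S_le1 k : 0 <= / INR (S k) <= 1.
Proof.
  pose proof (INR_S_ge1 k). split; [left; apply Rinv_0_lt_compat; lra|].
  rewrite <- Rinv_1. apply Rinv_le_contravar; lra.
Qed.

Lemma ser_geom_S r : 0 <= r < 1 -> is_series (fun n => r ^ S n) (r / (1 - r)).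
Proof. intros H. unfold Rdiv. apply ser_scal, ser_geom. rewrite Rabs_pos_eq; lra. Qed.

Lemma ell_term_le z k : Cmod (RtoC (/ INR (S k)) * z ^ S k) <= Cmod z ^ S k.
Proof.
  rewrite Cmod_mult, Cmod_pow, Cmod_R_pos by apply Rinv_INR_S_le1.
  pose proof (Rinv_INR_S_le1 k). assert (0 <= Cmod z ^ S k) by (apply pow_le, Cmod_nonneg). nra.
Qed.
Lemma ell_Cis z : Cmod z < 1 -> Cis (fun k => RtoC (/ INR (S k)) * z ^ S k)%C (ell z).
Proof.
  intros H. apply Cis_dom with (M := fun k => Cmod z ^ S k); [apply ell_term_le|].
  eexists; apply ser_geom_S. split; [apply Cmod_nonneg|auto].
Qed.
Lemma ell_bound z : Cmod z < 1 -> Cmod (ell z) <= Cmod z / (1 - Cmod z).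
Proof.
  intros H. apply (Cis_Cmod_le _ _ _ _ (ell_term_le z) (ell_Cis z H)).
  apply ser_geom_S. split; [apply Cmod_nonneg|auto].
Qed.

Lemma Cderiv_pow z n t :
  Cderiv (fun s => (RtoC s * z) ^ S n)%C t (RtoC (INR (S n)) * z * (RtoC t * z) ^ n)%C.
Proof.
  induction n.
  - eapply Cderiv_ext; [|eapply Cderiv_eq; [apply (Cderiv_ray z)|]].
    + intros x; simpl; ring.
    + simpl. ring.
  - eapply Cderiv_eq.
    + change (fun s => (RtoC s * z) ^ S (S n))%C with (fun s => (RtoC s * z) * (RtoC s * z) ^ S n)%C.
      apply Cderiv_mult; [apply Cderiv_ray | exact IHn].
    + rewrite (S_INR (S n)), RtoC_plus. change ((RtoC t * z) ^ S n)%C with ((RtoC t * z) * (RtoC t * z) ^ n)%C. ring.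
Qed.
Lemma Cderiv_pow_ex z n t : exists d, Cderiv (fun s => (RtoC s * z) ^ n)%C t d.
Proof.
  destruct n.
  - exists (RtoC 0). exact (Cderiv_const (RtoC 1) t).
  - eexists. apply Cderiv_pow.
Qed.

Lemma Cis_geom z : Cmod z < 1 -> Cis (fun n => z ^ n)%C (/ (RtoC 1 - z))%C.
Proof.
  intros H. pose proof (Cmod_lt1_neq z H) as N. 
  destruct (Cis_ex_dom (fun n => z ^ n)%C (fun n => Cmod z ^ n)) as [l A].
  - intros n. rewrite Cmod_pow; lra.
  - eexists; apply ser_geom. rewrite Rabs_pos_eq; [auto | apply Cmod_nonneg].
  - pose proof (Cis_incr _ _ A) as B. 
    assert (E : l = (z * l + RtoC 1)%C).
    { pose proof (Cis_unique _ _ _ B (Cis_ext _ _ _ (fun n => eq_refl) (Cis_scal z _ _ A))) as Q.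
      simpl in Q. rewrite <- Q. ring. }
    eapply Cis_eq; [exact A|].
    assert (E2 : ((RtoC 1 - z) * l)%C = RtoC 1) by (transitivity (l - z * l)%C; [ring|]; rewrite E at 1; ring).
    replace l with (/ (RtoC 1 - z) * ((RtoC 1 - z) * l))%C by (field; auto). rewrite E2. ring.
Qed.

(** The product exp (ell (s z)) (1 - s z) has zero derivative in s and equals 1 at s = 0. *)
Lemma Cexp_ell z : Cmod z < 1 -> Cexp (- ell z) = (RtoC 1 - z)%C.
Proof.
  intros H. pose proof (Cmod_nonneg z) as H0.
  (* Leaves (1 + e) |z| < 1, so that [0, 1] lies inside an open interval of uniform convergence. *)
  set (e := (1 - Cmod z) / 2).
  assert (e0 : 0 < e) by (unfold e; lra).
  assert (r1 : forall s, - e < s < 1 + e -> Cmod (RtoC s * z) <= (1 + e) * Cmod z).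
  { intros s Hs. rewrite Cmod_mult, Cmod_R. apply Rmult_le_compat_r; auto. apply Rabs_le. lra. }
  assert (r2 : 0 <= (1 + e) * Cmod z < 1) by (unfold e; nra).
  assert (D : forall s, 0 <= s <= 1 ->
    Cderiv (fun t => ell (RtoC t * z)) s (z / (RtoC 1 - RtoC s * z))%C).
  { intros s Hs.
    assert (E : Cs (fun n => z * (RtoC s * z) ^ n)%C = (z / (RtoC 1 - RtoC s * z))%C).
    { apply Cis_Cs, Cis_scal, Cis_geom. pose proof (r1 s ltac:(lra)). lra. }
    rewrite <- E.
    apply (Cs_derive (fun k t => RtoC (/ INR (S k)) * (RtoC t * z) ^ S k)%C
      (fun n t => z * (RtoC t * z) ^ n)%C (fun k => ((1 + e) * Cmod z) ^ S k)
      (fun k => Cmod z * ((1 + e) * Cmod z) ^ k) (- e) (1 + e)); try lra.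
    - intros n x Hx. eapply Cderiv_eq; [apply Cderiv_mult; [apply Cderiv_const | apply Cderiv_pow]|].
      cbv beta. transitivity ((RtoC (/ INR (S n)) * RtoC (INR (S n))) * (z * (RtoC x * z) ^ n))%C; [ring|].
      rewrite <- RtoC_mult, Rinv_l by (pose proof (INR_S_pos n); lra). ring.
    - intros n x Hx. destruct (Cderiv_pow_ex z n x) as [d Hd]. eexists.
      apply Cderiv_mult; [apply Cderiv_const | exact Hd].
    - intros n x Hx. eapply Rle_trans; [apply ell_term_le|]. apply pow_incr. split; [apply Cmod_nonneg|auto].
    - eexists. apply ser_geom_S; auto.
    - intros n x Hx. rewrite Cmod_mult, Cmod_pow. apply Rmult_le_compat_l; auto.
      apply pow_incr. split; [apply Cmod_nonneg|auto].
    - eexists. apply ser_scal, ser_geom. rewrite Rabs_pos_eq; lra. }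
  assert (Z : (fun s => Cexp (ell (RtoC s * z)) * (RtoC 1 - RtoC s * z))%C 0 =
              (fun s => Cexp (ell (RtoC s * z)) * (RtoC 1 - RtoC s * z))%C 1).
  { apply (Cderiv_zero_const (fun s => Cexp (ell (RtoC s * z)) * (RtoC 1 - RtoC s * z))%C 0 1); [lra|]. intros s Hs.
    assert (N : (RtoC 1 - RtoC s * z)%C <> RtoC 0) by (apply Cmod_lt1_neq; pose proof (r1 s ltac:(lra)); lra).
    eapply Cderiv_eq.
    - apply Cderiv_mult; [apply Cderiv_exp, D; auto | apply Cderiv_minus; [apply Cderiv_const | apply Cderiv_ray]].
    - cbv beta. field. auto. }
  cbv beta in Z.
  replace (RtoC 0 * z)%C with (RtoC 0) in Z by ring. replace (RtoC 1 * z)%C with z in Z by ring.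
  assert (L0 : ell (RtoC 0) = RtoC 0).
  { apply Cis_Cs. eapply Cis_ext; [|apply Cis_0]. intros n; simpl. ring. }
  rewrite L0, Cexp_0 in Z. rewrite Cexp_opp.
  pose proof (Cexp_neq0 (ell z)) as N.
  replace (RtoC 1 - z)%C with (/ Cexp (ell z) * (Cexp (ell z) * (RtoC 1 - z)))%C by (field; auto).
  rewrite <- Z. ring.
Qed.

(** * Lambert series *)

Lemma psum_add f M N : psum f (M + N) = (psum f M + psum (fun n => f (M + n)%nat) N)%C.
Proof.
  induction N; simpl; [rewrite Nat.add_0_r; ring|].
  rewrite Nat.add_succ_r. simpl. rewrite IHN. ring.
Qed.

(** Index n stands for the exponent n + 1. Since the spread series is known to converge, its sum may
    be read off along the partial sums of length (d + 1) K, where it agrees with the original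
    series. *)
Lemma Cis_sparse (g : nat -> C) (d : nat) l :
  Cis g l ->
  (exists s, Cis (fun n => if (S n mod S d =? 0)%nat then g (S n / S d - 1)%nat else RtoC 0) s) ->
  Cis (fun n => if (S n mod S d =? 0)%nat then g (S n / S d - 1)%nat else RtoC 0) l.
Proof.
  intros A [s B].
  set (h := fun n => if (S n mod S d =? 0)%nat then g (S n / S d - 1)%nat else RtoC 0) in *.
  replace l with s; auto.
  apply Cis_Clim in A. pose proof (proj1 (Cis_Clim _ _) B) as B'.
  apply (Clim_unique (fun K => psum h (S d * K))).
  - apply (Clim_subseq (psum h) s (fun K => (S d * K)%nat)); [intros; lia | exact B'].
  - eapply Clim_ext; [|exact A]. intros K. symmetry.
    induction K.
    + rewrite Nat.mul_0_r. reflexivity.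
    + replace (S d * S K)%nat with (S d * K + S d)%nat by lia.
      rewrite psum_add, IHK. cbn [psum]. 
      assert (Z : psum (fun n => h (S d * K + n)%nat) d = RtoC 0).
      { rewrite (psum_ext _ (fun _ => RtoC 0)); [apply psum_0|]. intros n Hn. unfold h.
        replace (S (S d * K + n)) with (S n + K * S d)%nat by lia.
        rewrite Nat.Div0.mod_add, Nat.mod_small by lia. reflexivity. }
      rewrite Z. unfold h.
      replace (S (S d * K + d)) with ((K + 1) * S d)%nat by lia.
      rewrite Nat.Div0.mod_mul, Nat.div_mul by lia. simpl (0 =? 0)%nat. cbv iota.
      replace (K + 1 - 1)%nat with K by lia. ring.
Qed.

Lemma Cis_finite (f : nat -> C) N : (forall n, (N <= n)%nat -> f n = RtoC 0) -> Cis f (psum f N).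
Proof.
  intros H. apply Cis_Clim.
  assert (E : forall k, psum f (N + k) = psum f N).
  { intros k. rewrite psum_add. rewrite (psum_ext (fun n => f (N + n)%nat) (fun _ => RtoC 0)); [rewrite psum_0; ring|].
    intros; apply H; lia. }
  split.
  - apply (is_lim_seq_incr_n _ N). eapply is_lim_seq_ext; [|apply is_lim_seq_const].
    intros n; cbv beta. rewrite Nat.add_comm, E. reflexivity.
  - apply (is_lim_seq_incr_n _ N). eapply is_lim_seq_ext; [|apply is_lim_seq_const].
    intros n; cbv beta. rewrite Nat.add_comm, E. reflexivity.
Qed.

Lemma RtoC_rsum f N : RtoC (rsum f N) = psum (fun n => RtoC (f n)) N.
Proof. induction N; simpl; [reflexivity|]. rewrite RtoC_plus, IHN. reflexivity. Qed.

(* [dsum f N] is the sum of [f d (N / d)] over the divisors d of N. *)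
Definition dsum (f : nat -> nat -> R) (N : nat) : R :=
  rsum (fun i => if (N mod S i =? 0)%nat then f (S i) (N / S i)%nat else 0) N.

Section Lambert.
Variables (f : nat -> nat -> R) (z : C).
Hypothesis Hf : forall d k, (1 <= d)%nat -> (1 <= k)%nat -> Rabs (f d k) <= INR (d * k) ^ 3.
Hypothesis Hz : Cmod z < 1.

(** In |z|^N = rho^N rho^N one power controls a divisor d <= N and the other N itself, so the
    majorant factors as [Cis_Fubini] requires. *)
Let rho := sqrt (Cmod z).
Lemma rho_spec : 0 <= rho < 1 /\ Cmod z = rho * rho.
Proof.
  unfold rho. split; [split|].
  - apply sqrt_pos.
  - rewrite <- sqrt_1. apply sqrt_lt_1_alt. split; [apply Cmod_nonneg|auto].
  - symmetry. apply sqrt_sqrt, Cmod_nonneg.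
Qed.
Lemma pow_le_exp a b : (a <= b)%nat -> rho ^ b <= rho ^ a.
Proof.
  intros H. destruct rho_spec as [[P1 P2] _]. replace b with (a + (b - a))%nat by lia.
  rewrite pow_add. assert (0 <= rho ^ a) by (apply pow_le; auto).
  assert (rho ^ (b - a) <= 1) by (rewrite <- (pow1 (b - a)); apply pow_incr; lra).
  nra.
Qed.

Lemma Cis_lambert_row d r :
  Cis (fun k => RtoC (f (S d) (S k)) * z ^ (S d * S k))%C r ->
  Cis (fun n => if (S n mod S d =? 0)%nat then RtoC (f (S d) (S n / S d)%nat) * z ^ S n else RtoC 0)%C r.
Proof.
  destruct rho_spec as [[P1 P2] P3].
  intros A. 
  assert (E : forall n, (if (S n mod S d =? 0)%nat then RtoC (f (S d) (S n / S d)%nat) * z ^ S n else RtoC 0)%C =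
     (if (S n mod S d =? 0)%nat then (fun k => RtoC (f (S d) (S k)) * z ^ (S d * S k))%C (S n / S d - 1)%nat else RtoC 0)).
  { intros n. destruct (Nat.eqb_spec (S n mod S d) 0) as [H|H]; auto.
    pose proof (Nat.div_mod_eq (S n) (S d)) as Q. rewrite H in Q.
    assert (S n / S d <> 0)%nat by (intros H0; rewrite H0 in Q; lia).
    replace (S (S n / S d - 1)) with (S n / S d)%nat by lia.
    do 2 f_equal. lia. }
  eapply Cis_ext; [intros n; symmetry; apply E|].
  apply (Cis_sparse (fun k => RtoC (f (S d) (S k)) * z ^ (S d * S k))%C); auto.
  apply (Cis_ex_dom _ (fun n => INR (S n) ^ 3 * Cmod z ^ S n)).
  - intros n. rewrite <- E.
    assert (0 <= INR (S n) ^ 3 * Cmod z ^ S n) by (apply Rmult_le_pos; apply pow_le; [apply pos_INR | apply Cmod_nonneg]).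
    destruct (Nat.eqb_spec (S n mod S d) 0) as [H0|H0]; [|rewrite Cmod_0; auto].
    pose proof (Nat.div_mod_eq (S n) (S d)) as Q. rewrite H0 in Q.
    assert (S n / S d <> 0)%nat by (intros H1; rewrite H1 in Q; lia).
    rewrite Cmod_mult, Cmod_pow, Cmod_R. apply Rmult_le_compat_r; [apply pow_le, Cmod_nonneg|].
    eapply Rle_trans; [apply Hf; lia|]. right. do 2 f_equal. lia.
  - apply ex_series_poly_geom. split; [apply Cmod_nonneg | auto].
Qed.

(** Row d is spread over the exponents N = d k; column N then collects exactly the divisors of N. *)
Lemma Cis_lambert (r : nat -> C) l :
  (forall d, Cis (fun k => RtoC (f (S d) (S k)) * z ^ (S d * S k))%C (r d)) -> Cis r l ->
  Cis (fun n => RtoC (dsum f (S n)) * z ^ S n)%C l.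
Proof.
  destruct rho_spec as [[P1 P2] P3].
  intros R A.
  apply (Cis_Fubini (fun d n => if (S n mod S d =? 0)%nat then RtoC (f (S d) (S n / S d)%nat) * z ^ S n else RtoC 0)%C
    (fun d => rho ^ S d) (fun n => INR (S n) ^ 3 * rho ^ S n) r); auto.
  - intros i. apply pow_le; auto.
  - intros n. apply Rmult_le_pos; apply pow_le; [apply pos_INR | auto].
  - intros d n.
    assert (0 <= rho ^ S d * (INR (S n) ^ 3 * rho ^ S n)).
    { apply Rmult_le_pos; [|apply Rmult_le_pos]; apply pow_le; auto; apply pos_INR. }
    destruct (Nat.eqb_spec (S n mod S d) 0) as [H0|H0]; [|rewrite Cmod_0; auto].
    pose proof (Nat.div_mod_eq (S n) (S d)) as Q. rewrite H0 in Q.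
    assert (N0 : (S n / S d <> 0)%nat) by (intros H1; rewrite H1 in Q; lia).
    rewrite Cmod_mult, Cmod_pow, Cmod_R, P3, Rpow_mult_distr.
    assert (L : rho ^ S n <= rho ^ S d) by (apply pow_le_exp; nia).
    assert (F : Rabs (f (S d) (S n / S d)%nat) <= INR (S n) ^ 3).
    { eapply Rle_trans; [apply Hf; lia|]. right. do 2 f_equal. lia. }
    assert (0 <= rho ^ S n) by (apply pow_le; auto).
    replace (rho ^ S d * (INR (S n) ^ 3 * rho ^ S n)) with (INR (S n) ^ 3 * (rho ^ S d * rho ^ S n)) by ring.
    apply Rmult_le_compat; auto; [apply Rabs_pos | nra |]. apply Rmult_le_compat_r; auto.
  - eexists; apply ser_geom_S; auto.
  - apply ex_series_poly_geom; auto.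
  - intros d. apply Cis_lambert_row, R.
  - intros n. unfold dsum. rewrite RtoC_rsum, Cmult_comm, <- psum_scal.
    rewrite (psum_ext _ (fun d => if (S n mod S d =? 0)%nat then RtoC (f (S d) (S n / S d)%nat) * z ^ S n else RtoC 0)%C).
    + apply Cis_finite. intros d Hd. rewrite Nat.mod_small by lia. reflexivity.
    + intros d _. destruct (Nat.eqb (S n mod S d) 0); ring.
Qed.

Lemma Cis_lambert_swap (r c : nat -> C) l :
  (forall d, Cis (fun k => RtoC (f (S d) (S k)) * z ^ (S d * S k))%C (r d)) ->
  (forall k, Cis (fun d => RtoC (f (S d) (S k)) * z ^ (S d * S k))%C (c k)) ->
  Cis r l -> Cis c l.
Proof.
  destruct rho_spec as [[P1 P2] P3].
  intros R Cc A.
  apply (Cis_Fubini (fun d k => RtoC (f (S d) (S k)) * z ^ (S d * S k))%C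
    (fun d => INR (S d) ^ 3 * rho ^ S d) (fun k => INR (S k) ^ 3 * rho ^ S k) r); auto.
  1,2: intros n; apply Rmult_le_pos; apply pow_le; [apply pos_INR | auto].
  2,3: apply ex_series_poly_geom; auto.
  intros d k. rewrite Cmod_mult, Cmod_R, Cmod_pow, P3, Rpow_mult_distr, <- pow_add.
  replace (INR (S d) ^ 3 * rho ^ S d * (INR (S k) ^ 3 * rho ^ S k)) with
    (INR (S d * S k) ^ 3 * rho ^ (S d + S k)) by (rewrite mult_INR, Rpow_mult_distr, pow_add; ring).
  apply Rmult_le_compat; [apply Rabs_pos | apply pow_le; auto | apply Hf; lia | apply pow_le_exp; nia].
Qed.
End Lambert.

Definition sig1 (N : nat) : R := dsum (fun d _ => INR d) N.

Lemma nw_exp w n : Cexp (- nw w n) = (Cexp (- w) ^ S n)%C.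
Proof. unfold nw. rewrite <- Cexp_INR. f_equal. ring. Qed.

Lemma Cpow_mult (z : C) a b : ((z ^ a) ^ b)%C = (z ^ (a * b))%C.
Proof.
  induction b; simpl; [rewrite Nat.mul_0_r; reflexivity|].
  rewrite IHb, Nat.mul_succ_r, Nat.add_comm, Cpow_add_r. reflexivity.
Qed.

Lemma INR_mul_ge a b : (1 <= a)%nat -> (1 <= b)%nat -> 1 <= INR a /\ 1 <= INR b /\ INR a <= INR (a * b) /\ INR b <= INR (a * b).
Proof.
  intros. repeat split; try (apply (le_INR 1); lia); apply le_INR; nia.
Qed.

(* Both Eisenstein sums are double series over (k, n) of n^p q^(k n). *)
Lemma Cis_sigma_q (p : nat) (w l : C) : 0 < Re w -> (p <= 3)%nat ->
  Cis (fun k => Tp p (Cexp (- nw w k))) l ->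
  Cis (fun n => RtoC (dsum (fun d _ => (INR d ^ p)%R) (S n)) * Cexp (- w) ^ S n)%C l.
Proof.
  intros H Hp A. pose proof (Cmod_qexp w H) as Q. set (q := Cexp (- w)) in *.
  assert (Qp : forall n, Cmod (q ^ S n) < 1).
  { intros n. unfold q. rewrite <- nw_exp. apply Cmod_qexp, Re_nw_pos, H. }
  assert (Hf : forall d k, (1 <= d)%nat -> (1 <= k)%nat -> Rabs (INR d ^ p) <= INR (d * k) ^ 3).
  { intros d k Hd Hk. destruct (INR_mul_ge d k Hd Hk) as [I1 [I2 [I3 I4]]].
    rewrite Rabs_pos_eq by (apply pow_le; lra).
    apply Rle_trans with (INR d ^ 3); [apply Rle_pow; auto | apply pow_incr; lra]. }
  (* Summing over k first gives the Lambert series of n^p q^n / (1 - q^n), which is afterwards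
     regrouped by N = n k. *)
  assert (A' : Cis (fun d => RtoC (INR (S d) ^ p) * (/ (RtoC 1 - q ^ S d) * q ^ S d))%C l).
  { apply (Cis_lambert_swap (fun k n => (INR n ^ p)%R) q) with (r := fun k => Tp p (Cexp (- nw w k))); auto.
    - intros d k Hd Hk. rewrite Nat.mul_comm. apply Hf; auto.
    - intros k. rewrite nw_exp. fold q. eapply Cis_ext; [|apply Tp_Cis, Qp].
      intros n; cbv beta. rewrite Cpow_mult. reflexivity.
    - intros n. apply Cis_scal.
      rewrite Cmult_comm. eapply Cis_ext; [|apply Cis_scal, Cis_geom, (Qp n)].
      intros k; cbv beta. rewrite Cpow_mult, <- Cpow_add_r. f_equal. lia. }
  apply (Cis_lambert (fun d _ => (INR d ^ p)%R) q Hf Q (fun d => (RtoC (INR (S d) ^ p) * (/ (RtoC 1 - q ^ S d) * q ^ S d))%C)); auto.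
  intros d. apply Cis_scal.
  rewrite Cmult_comm. eapply Cis_ext; [|apply Cis_scal, Cis_geom, (Qp d)].
  intros k; cbv beta. rewrite Cpow_mult, <- Cpow_add_r. f_equal. lia.
Qed.

Lemma dsum_ext f g N : (forall d k, f d k = g d k) -> dsum f N = dsum g N.
Proof.
  intros E. unfold dsum.
  assert (G : forall K, rsum (fun i => if (N mod S i =? 0)%nat then f (S i) (N / S i)%nat else 0) K
    = rsum (fun i => if (N mod S i =? 0)%nat then g (S i) (N / S i)%nat else 0) K); [|apply G].
  induction K; cbn [rsum]; [reflexivity|]. rewrite IHK, E. reflexivity.
Qed.

Lemma S1_q w : 0 < Re w ->
  Cis (fun n => RtoC (sig1 (S n)) * Cexp (- w) ^ S n)%C (S1fun w).
Proof.
  intros H. eapply Cis_ext; [|apply (Cis_sigma_q 1 w); auto].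
  - intros n; cbv beta. do 2 f_equal. apply dsum_ext. intros; apply pow_1.
  - eapply Cis_ext; [|apply Cis_S1, H]. intros k; cbv beta. apply Afun_T, Re_nw_pos, H.
Qed.

Lemma sigma3_dsum n : INR (sigma3 n) = dsum (fun d _ => INR d ^ 3) n.
Proof.
  unfold sigma3, dsum.
  assert (G : forall N, INR (list_sum (map (fun d => (d ^ 3)%nat) (filter (fun d => Nat.eqb (n mod d) 0) (seq 1 N)))) =
    rsum (fun i => if (n mod S i =? 0)%nat then INR (S i) ^ 3 else 0) N).
  { induction N; [reflexivity|].
    rewrite seq_S, filter_app, map_app, list_sum_app, plus_INR, IHN. cbn [rsum]. f_equal.
    simpl (1 + N)%nat. cbn [filter]. destruct (n mod S N =? 0)%nat.
    - cbn [map list_sum fold_right]. rewrite Nat.add_0_r, <- pow_INR. reflexivity.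
    - reflexivity. }
  apply G.
Qed.
Lemma S3_q w : 0 < Re w ->
  Cis (fun n => RtoC (INR (sigma3 (S n))) * Cexp (- w) ^ S n)%C (S3fun w).
Proof.
  intros H. eapply Cis_ext; [|apply (Cis_sigma_q 3 w); auto].
  - intros n; cbv beta. rewrite sigma3_dsum. reflexivity.
  - eapply Cis_ext; [|apply Cis_S3, H]. intros k; cbv beta. apply Bfun_T, Re_nw_pos, H.
Qed.

(** Minus the logarithm of the product of all 1 - q^n; hence Delta is exp (-w - 24 Dfun w). *)
Definition Dfun (w : C) : C := Cs (fun n => ell (Cexp (- w) ^ S n)).

Lemma ell_qpow_bound w n : 0 < Re w ->
  Cmod (ell (Cexp (- w) ^ S n)) <= / (1 - Cmod (Cexp (- w))) * Cmod (Cexp (- w)) ^ S n.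
Proof.
  intros H. pose proof (Cmod_qexp w H) as Q. pose proof (Cmod_nonneg (Cexp (- w))) as Q0.
  set (r := Cmod (Cexp (- w))) in *.
  assert (E : Cmod (Cexp (- w) ^ S n) = r ^ S n) by apply Cmod_pow.
  assert (L : r ^ S n <= r).
  { simpl. assert (r ^ n <= 1) by (rewrite <- (pow1 n); apply pow_incr; lra). nra. }
  eapply Rle_trans; [apply ell_bound; lra|]. rewrite E. unfold Rdiv. rewrite Rmult_comm.
  apply Rmult_le_compat_r; [apply pow_le; auto|]. apply Rinv_le_contravar; lra.
Qed.
Lemma Cis_D w : 0 < Re w -> Cis (fun n => ell (Cexp (- w) ^ S n)) (Dfun w).
Proof.
  intros H. apply Cis_dom with (M := fun n => / (1 - Cmod (Cexp (- w))) * Cmod (Cexp (- w)) ^ S n).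
  - intros n; apply ell_qpow_bound, H.
  - eexists. apply ser_scal, ser_geom_S. split; [apply Cmod_nonneg | apply Cmod_qexp, H].
Qed.

Lemma dsum_inv N : (1 <= N)%nat -> dsum (fun _ k => / INR k) N = sig1 N / INR N.
Proof.
  intros HN. unfold sig1, dsum, Rdiv. rewrite Rmult_comm, <- rsum_scal.
  assert (G : forall K, rsum (fun i => if (N mod S i =? 0)%nat then / INR (N / S i) else 0) K
    = rsum (fun i => / INR N * (if (N mod S i =? 0)%nat then INR (S i) else 0)) K); [|apply G].
  induction K as [|n IHn]; cbn [rsum]; [reflexivity|]. rewrite IHn. f_equal.
  destruct (Nat.eqb_spec (N mod S n) 0) as [H|H]; [|ring].
  pose proof (Nat.div_mod_eq N (S n)) as Q. rewrite H, Nat.add_0_r in Q.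
  assert (N0 : (N / S n <> 0)%nat) by (intros H0; rewrite H0 in Q; lia).
  rewrite Q at 2. rewrite mult_INR.
  pose proof (INR_S_pos n). assert (0 < INR (N / S n)) by (apply lt_0_INR; lia).
  field. lra.
Qed.

Lemma D_q w : 0 < Re w ->
  Cis (fun n => RtoC (sig1 (S n) / INR (S n)) * Cexp (- w) ^ S n)%C (Dfun w).
Proof.
  intros H. pose proof (Cmod_qexp w H) as Q. set (q := Cexp (- w)) in *.
  assert (Qp : forall n, Cmod (q ^ S n) < 1).
  { intros n. unfold q. rewrite <- nw_exp. apply Cmod_qexp, Re_nw_pos, H. }
  eapply Cis_ext; [|apply (Cis_lambert (fun _ k => / INR k) q) with (r := fun n => ell (q ^ S n))]; auto.
  - intros n; cbv beta. rewrite dsum_inv by lia. reflexivity.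
  - intros d k Hd Hk. destruct (INR_mul_ge d k Hd Hk) as [I1 [I2 [I3 I4]]].
    rewrite Rabs_pos_eq by (left; apply Rinv_0_lt_compat; lra).
    apply Rle_trans with 1; [rewrite <- Rinv_1; apply Rinv_le_contravar; lra|].
    rewrite <- (pow1 3). apply pow_incr. lra.
  - intros d. eapply Cis_ext; [|apply ell_Cis, Qp]. intros k; cbv beta. rewrite Cpow_mult. reflexivity.
  - apply Cis_D, H.
Qed.

Lemma Clim_exp u l : Clim u l -> Clim (fun n => Cexp (u n)) (Cexp l).
Proof.
  intros [A B].
  assert (E : is_lim_seq (fun n => exp (Re (u n))) (exp (Re l))).
  { apply (is_lim_seq_continuous exp); auto. apply derivable_continuous, derivable_exp. }
  assert (Cc : is_lim_seq (fun n => cos (Im (u n))) (cos (Im l))).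
  { apply (is_lim_seq_continuous cos); auto. apply continuity_cos. }
  assert (Sc : is_lim_seq (fun n => sin (Im (u n))) (sin (Im l))).
  { apply (is_lim_seq_continuous sin); auto. apply continuity_sin. }
  split; simpl; apply is_lim_seq_mult'; assumption.
Qed.

(** * Modularity of j *)

(** The hypotheses under which a q-series can be differentiated term by term along a path: Re w
    bounded away from 0, which bounds |q| below 1, and bounded speed. The interval is open, hence
    slightly larger than the one of interest. *)
Record path_ok (w w' : R -> C) (a b delta M : R) : Prop := {
  path_der : forall x, a < x < b -> Cderiv w x (w' x);
  path_der2 : forall x, a < x < b -> exists d, Cderiv w' x d;
  path_pos : 0 < delta;
  path_Re : forall x, a < x < b -> delta <= Re (w x);
  path_speed : forall x, a < x < b -> Cmod (w' x) <= M }.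

Lemma qser_deriv (c : nat -> C) w w' a b delta M t :
  path_ok w w' a b delta M -> a < t < b ->
  ex_series (fun n => INR (S n) * Cmod (c n) * exp (- delta) ^ S n) ->
  Cderiv (fun x => Cs (fun n => c n * Cexp (- w x) ^ S n)%C) t
    (Cs (fun n => - w' t * (RtoC (INR (S n)) * c n * Cexp (- w t) ^ S n))%C).
Proof.
  intros [H1 H2 H3 H4 H5] Ht Hc.
  set (r := exp (- delta)) in *.
  assert (r1 : 0 <= r < 1).
  { unfold r. split; [left; apply exp_pos|]. rewrite <- exp_0. apply exp_increasing. lra. }
  assert (q1 : forall x n, a < x < b -> Cmod (Cexp (- w x) ^ n) <= r ^ n).
  { intros x n Hx. rewrite Cmod_pow, Cmod_Cexp. apply pow_incr. split; [left; apply exp_pos|].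
    unfold r. apply exp_le. simpl. pose proof (H4 x Hx) as Q. unfold Re in Q. lra. }
  assert (M0 : 0 <= M) by (eapply Rle_trans; [apply Cmod_nonneg | apply (H5 t Ht)]).
  assert (D : forall n x, a < x < b -> Cderiv (fun x => Cexp (- w x) ^ S n)%C x
    (- w' x * (RtoC (INR (S n)) * Cexp (- w x) ^ S n))%C).
  { intros n x Hx. apply (Cderiv_ext (fun x => Cexp (- nw (w x) n))).
    - intros y. apply nw_exp.
    - eapply Cderiv_eq; [apply Cderiv_exp, Cderiv_opp; unfold nw; apply Cderiv_mult; [apply Cderiv_const | apply H1, Hx]|].
      cbv beta. change (Cexp (- (RtoC (INR (S n)) * w x))) with (Cexp (- nw (w x) n)). rewrite nw_exp. ring. }
  assert (T0 : forall n, 0 <= Cmod (c n) * r ^ S n).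
  { intros n. apply Rmult_le_pos; [apply Cmod_nonneg | apply pow_le; lra]. }
  apply (Cs_derive (fun n x => c n * Cexp (- w x) ^ S n)%C
    (fun n x => - w' x * (RtoC (INR (S n)) * c n * Cexp (- w x) ^ S n))%C
    (fun n => INR (S n) * Cmod (c n) * r ^ S n) (fun n => M * (INR (S n) * Cmod (c n) * r ^ S n)) a b); auto.
  - intros n x Hx. eapply Cderiv_eq; [apply Cderiv_mult; [apply Cderiv_const | apply D, Hx]|]. cbv beta. ring.
  - intros n x Hx. destruct (H2 x Hx) as [d Hd]. eexists.
    apply Cderiv_mult; [apply Cderiv_opp, Hd|]. apply Cderiv_mult; [apply Cderiv_const | apply D, Hx].
  - intros n x Hx. rewrite Cmod_mult. pose proof (INR_S_ge1 n). pose proof (T0 n). rewrite Rmult_assoc.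
    apply Rle_trans with (Cmod (c n) * r ^ S n); [apply Rmult_le_compat_l; auto; apply Cmod_nonneg | nra].
  - intros n x Hx. rewrite !Cmod_mult, Cmod_opp, Cmod_R_pos by apply pos_INR.
    apply Rmult_le_compat; auto; [apply Cmod_nonneg | |].
    + apply Rmult_le_pos; [apply Rmult_le_pos; [apply pos_INR|]|]; apply Cmod_nonneg.
    + apply Rmult_le_compat_l; auto. apply Rmult_le_pos; [apply pos_INR | apply Cmod_nonneg].
  - destruct Hc as [s Hs]. exists (M * s). apply ser_scal, Hs.
Qed.

Lemma sig1_bound n : 0 <= sig1 (S n) <= INR (S n) ^ 2.
Proof.
  unfold sig1, dsum.
  assert (G : forall K, (K <= S n)%nat -> 0 <= rsum (fun i => if (S n mod S i =? 0)%nat then INR (S i) else 0) K <= INR K * INR (S n)).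
  { induction K; intros HK; cbn [rsum].
    - simpl. lra.
    - specialize (IHK ltac:(lia)). 
      assert (0 <= INR (S K) <= INR (S n)) by (split; [apply pos_INR | apply le_INR; lia]).
      rewrite (S_INR K) in *. pose proof (pos_INR K). destruct (S n mod S K =? 0)%nat; split; nra. }
  specialize (G (S n) (le_n _)). replace (INR (S n) ^ 2) with (INR (S n) * INR (S n)) by ring. lra.
Qed.

Lemma D_deriv w w' a b delta M t : path_ok w w' a b delta M -> a < t < b ->
  Cderiv (fun x => Dfun (w x)) t (- w' t * S1fun (w t))%C.
Proof.
  intros P Ht. pose proof P as [H1 H2 H3 H4 H5].
  assert (E : Cs (fun n => - w' t * (RtoC (INR (S n)) * RtoC (sig1 (S n) / INR (S n)) * Cexp (- w t) ^ S n))%C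
    = (- w' t * S1fun (w t))%C).
  { apply Cis_Cs, Cis_scal. eapply Cis_ext; [|apply S1_q]. 
    - intros n; cbv beta. rewrite <- RtoC_mult. do 2 f_equal. field. pose proof (INR_S_pos n); lra.
    - pose proof (H4 t Ht); lra. }
  rewrite <- E.
  apply (Cderiv_ext_loc (fun x => Cs (fun n => RtoC (sig1 (S n) / INR (S n)) * Cexp (- w x) ^ S n)%C)).
  - assert (O : open (fun x => a < x < b)) by (apply open_and; [apply open_gt | apply open_lt]).
    destruct (O t Ht) as [e He]. exists e. intros y Hy. apply Cis_Cs, D_q.
    pose proof (H4 y (He y Hy)); lra.
  - apply (qser_deriv (fun n => RtoC (sig1 (S n) / INR (S n))) w w' a b delta M t P Ht).
    eapply ex_series_le_R; [|apply (ex_series_poly_geom 2 (exp (- delta)))].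
    + intros n. pose proof (sig1_bound n). pose proof (INR_S_pos n).
      rewrite Cmod_R_pos by (apply Rdiv_le_0_compat; lra).
      replace (INR (S n) * (sig1 (S n) / INR (S n))) with (sig1 (S n)) by (field; lra).
      assert (0 <= exp (- delta) ^ S n) by (apply pow_le; left; apply exp_pos).
      rewrite Rabs_pos_eq by nra. apply Rmult_le_compat_r; lra.
    + split; [left; apply exp_pos|]. rewrite <- exp_0. apply exp_increasing. lra.
Qed.

(* [Cexp (Ufun w)] is 1 / Delta. *)
Definition Ufun (w : C) : C := (w + RtoC 24 * Dfun w)%C.

Lemma U_deriv w w' a b delta M t : path_ok w w' a b delta M -> a < t < b ->
  Cderiv (fun x => Ufun (w x)) t (w' t * (RtoC 1 - RtoC 24 * S1fun (w t)))%C.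
Proof.
  intros P Ht. pose proof P as [H1 H2 H3 H4 H5].
  eapply Cderiv_eq; [apply Cderiv_plus; [apply H1, Ht | apply Cderiv_mult; [apply Cderiv_const | eapply D_deriv; eauto]]|].
  cbv beta. ring.
Qed.

Lemma dual_deriv w w' t : w t <> RtoC 0 -> Cderiv w t (w' t) ->
  Cderiv (fun x => dual (w x)) t (- (RtoC (2 * PI) * RtoC (2 * PI)) * w' t / (w t * w t))%C.
Proof.
  intros H D. eapply Cderiv_eq; [apply Cderiv_mult; [apply Cderiv_const | apply Cderiv_inv; eauto]|].
  cbv beta. field. auto.
Qed.

Lemma Cmod_two_PI : Cmod (RtoC (2 * PI)) = 2 * PI.
Proof. apply Cmod_R_pos. pose proof PI_gt3; lra. Qed.

(* The path from the fixed point 2 pi to w along which the transformation of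
   the discriminant is obtained from that of E_2. *)
Definition seg (w : C) (t : R) : C := (RtoC (2 * PI) + RtoC t * (w - RtoC (2 * PI)))%C.

Lemma seg_paths w : 0 < Re w -> exists e delta M, 0 < e /\
  path_ok (seg w) (fun _ => w - RtoC (2 * PI))%C (- e) (1 + e) delta M /\
  path_ok (fun t => dual (seg w t))
    (fun t => - (RtoC (2 * PI) * RtoC (2 * PI)) * (w - RtoC (2 * PI)) / (seg w t * seg w t))%C
    (- e) (1 + e) delta M.
Proof.
  intros H. pose proof PI_gt3 as P3.
  set (v := (w - RtoC (2 * PI))%C).
  set (d0 := Rmin (2 * PI) (Re w)). set (mx := Rmax (2 * PI) (Re w)).
  assert (d0p : 0 < d0) by (apply Rmin_glb_lt; lra).
  assert (dm : d0 <= mx) by (eapply Rle_trans; [apply Rmin_l | apply Rmax_l]).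
  (* Overshooting [0, 1] by e lowers the real part by at most e mx = d0 / 2. *)
  set (e := d0 / (2 * mx)).
  assert (e0 : 0 < e) by (apply Rdiv_lt_0_compat; lra).
  assert (em : e * mx = d0 / 2) by (unfold e; field; lra).
  assert (e1 : e <= 1) by (unfold e; apply Rmult_le_reg_r with (2 * mx); [lra|]; field_simplify; lra).
  assert (Dseg : forall x, Cderiv (seg w) x v).
  { intros x. eapply Cderiv_eq; [apply Cderiv_plus; [apply Cderiv_const | apply Cderiv_ray]|]. unfold v; ring. }
  assert (Rs : forall x, - e < x < 1 + e -> d0 / 2 <= Re (seg w x)).
  { intros x Hx. replace (Re (seg w x)) with ((1 - x) * (2 * PI) + x * Re w) by (unfold seg, Re; simpl; ring).
    assert (d0 <= 2 * PI) by apply Rmin_l. assert (d0 <= Re w) by apply Rmin_r.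
    assert (2 * PI <= mx) by apply Rmax_l. assert (Re w <= mx) by apply Rmax_r.
    destruct (Rle_dec x 0); [nra|]. destruct (Rle_dec x 1); nra. }
  set (W := 2 * PI + 2 * Cmod v).
  assert (Wp : 0 < W) by (unfold W; pose proof (Cmod_nonneg v); lra).
  assert (Ms : forall x, - e < x < 1 + e -> Cmod (seg w x) <= W).
  { intros x Hx. unfold seg. eapply Rle_trans; [apply Cmod_triangle|]. rewrite Cmod_two_PI, Cmod_mult, Cmod_R.
    fold v. unfold W. assert (Rabs x <= 2) by (apply Rabs_le; lra). pose proof (Cmod_nonneg v). nra. }
  assert (Nz : forall x, - e < x < 1 + e -> seg w x <> RtoC 0).
  { intros x Hx. apply C_neq0_Re. pose proof (Rs x Hx). lra. }
  assert (Ls : forall x, - e < x < 1 + e -> d0 / 2 <= Cmod (seg w x)).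
  { intros x Hx. eapply Rle_trans; [apply Rs, Hx | apply Re_le_Cmod']. }
  set (d1 := 4 * PI ^ 2 * (d0 / 2) / W ^ 2).
  assert (d1p : 0 < d1).
  { unfold d1. apply Rdiv_lt_0_compat; [|apply pow_lt; auto].
    assert (0 < PI ^ 2) by (apply pow_lt; lra). nra. }
  set (M1 := 2 * PI * (2 * PI) * Cmod v / (d0 / 2) ^ 2).
  exists e, (Rmin (d0 / 2) d1), (Rmax (Cmod v) M1). split; auto. split; constructor.
  - intros; apply Dseg.
  - intros. eexists. apply Cderiv_const.
  - apply Rmin_glb_lt; lra.
  - intros x Hx. eapply Rle_trans; [apply Rmin_l | auto].
  - intros. apply Rmax_l.
  - intros x Hx. apply (dual_deriv (seg w) (fun _ => v)); [apply Nz; auto | apply Dseg].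
  - intros x Hx. eexists. apply Cderiv_mult; [apply Cderiv_const | apply Cderiv_inv].
    + apply Cmult_neq_0; apply Nz; auto.
    + apply Cderiv_mult; apply Dseg.
  - apply Rmin_glb_lt; lra.
  - intros x Hx. eapply Rle_trans; [apply Rmin_r|]. rewrite Re_dual by (apply Nz; auto).
    unfold d1. apply Rmult_le_compat.
    + assert (0 < PI ^ 2) by (apply pow_lt; lra). nra.
    + left; apply Rinv_0_lt_compat, pow_lt; auto.
    + apply Rmult_le_compat_l; [assert (0 < PI ^ 2) by (apply pow_lt; lra); lra | auto].
    + pose proof (Ls x Hx). apply Rinv_le_contravar; [apply pow_lt; lra|].
      apply pow_incr. split; [lra | apply Ms; auto].
  - intros x Hx. eapply Rle_trans; [|apply Rmax_r]. pose proof (Ls x Hx). pose proof (Cmod_nonneg v).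
    unfold Cdiv. rewrite !Cmod_mult, Cmod_opp, Cmod_inv, !Cmod_mult, Cmod_two_PI by (apply Cmult_neq_0; apply Nz; auto).
    fold v. unfold M1, Rdiv at 1. apply Rmult_le_compat_l; [assert (0 <= 2 * PI * (2 * PI)) by nra; nra|].
    apply Rinv_le_contravar; [apply pow_lt; lra|]. replace ((d0 / 2) ^ 2) with (d0 / 2 * (d0 / 2)) by ring. apply Rmult_le_compat; lra.
Qed.

Lemma inv2_gam w : w <> RtoC 0 -> inv2 (gam w) = (- (RtoC (2 * PI) * RtoC (2 * PI)) / (w * w))%C.
Proof.
  intros W0. pose proof two_PI_neq0. unfold gam, inv2.
  replace (/ (w * Ci / RtoC (2 * PI) * (w * Ci / RtoC (2 * PI))))%C with
    (RtoC (2 * PI) * RtoC (2 * PI) / (w * w * (Ci * Ci)))%C by (field; repeat split; auto; apply Ci_neq0).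
  rewrite Ci_sqr. field; auto.
Qed.
Lemma inv_D4_gam w : w <> RtoC 0 -> (/ (D4 * gam w))%C = (- / (RtoC 2 * w))%C.
Proof.
  intros W0. pose proof two_PI_neq0 as P0. unfold D4, gam.
  replace (RtoC (4 * PI)) with (RtoC 2 * RtoC (2 * PI))%C by (rewrite <- RtoC_mult; f_equal; ring).
  replace (RtoC 2 * RtoC (2 * PI) * Ci * (w * Ci / RtoC (2 * PI)))%C with (RtoC 2 * w * (Ci * Ci))%C by (field; auto).
  rewrite Ci_sqr. assert (RtoC 2 <> RtoC 0) by (apply RtoC_neq0; lra). field; auto.
Qed.

(** By [S1_transform] the quotient of the two sides is constant on the segment from 2 pi to w, where
    the anomalous term of E2 cancels the derivative of 1 / w; at the fixed point 2 pi both sides are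
    1. The twelfth power is the transformation of Delta. *)
Lemma U_transform w : 0 < Re w ->
  Cexp (RtoC (/ 12) * (Ufun w - Ufun (dual w))) = (w / RtoC (2 * PI))%C.
Proof.
  intros H. destruct (seg_paths w H) as [e [delta [M [e0 [P1 P2]]]]].
  pose proof two_PI_neq0 as P0.
  assert (S0 : seg w 0 = RtoC (2 * PI)) by (unfold seg; ring).
  assert (S1 : seg w 1 = w) by (unfold seg; ring).
  set (Z := fun t => (Cexp (RtoC (/ 12) * (Ufun (seg w t) - Ufun (dual (seg w t)))) * / seg w t)%C).
  assert (E : Z 0 = Z 1).
  { apply Cderiv_zero_const; [lra|]. intros t Ht.
    assert (Ht' : - e < t < 1 + e) by lra.
    pose proof (path_Re _ _ _ _ _ _ P1 t Ht') as R1. pose proof (path_pos _ _ _ _ _ _ P1) as d0.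
    assert (Rp : 0 < Re (seg w t)) by lra. pose proof (Re_pos_neq0 _ Rp) as N.
    pose proof (U_deriv _ _ _ _ _ _ t P1 Ht') as D1. pose proof (U_deriv _ _ _ _ _ _ t P2 Ht') as D2.
    cbv beta in D1, D2.
    eapply Cderiv_eq.
    - apply Cderiv_mult; [apply Cderiv_exp, Cderiv_mult; [apply Cderiv_const | apply Cderiv_minus; [exact D1 | exact D2]]
        | apply Cderiv_inv; [exact N | apply (path_der _ _ _ _ _ _ P1 t Ht')]].
    - cbv beta. pose proof (S1_transform (seg w t) Rp) as T.
      rewrite inv2_gam, inv_D4_gam in T by auto.
      set (x := seg w t) in *. set (v := (w - RtoC (2 * PI))%C). set (Y := Cexp _).
      set (A := S1fun x) in *. set (B := S1fun (dual x)) in *. set (p := RtoC (2 * PI)) in *.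
      assert (EA : A = (- (p * p) / (x * x) * (B - RtoC (/ 24)) + - / (RtoC 2 * x) + RtoC (/ 24))%C).
      { rewrite <- T. ring. }
      rewrite EA.
      replace (RtoC (/ 12)) with (RtoC 2 * RtoC (/ 24))%C by (rewrite <- RtoC_mult; f_equal; field).
      assert (E24 : (RtoC 24 * RtoC (/ 24))%C = RtoC 1) by (rewrite <- RtoC_mult; f_equal; field).
      assert (N2 : RtoC 2 <> RtoC 0) by (apply RtoC_neq0; lra).
      assert (EI : RtoC (/ 24) = (/ RtoC 24)%C) by (apply RtoC_inv; lra).
      assert (N24 : RtoC 24 <> RtoC 0) by (apply RtoC_neq0; lra).
      rewrite EI. field. auto. }
  unfold Z in E. rewrite S0, S1 in E.
  assert (DP : dual (RtoC (2 * PI)) = RtoC (2 * PI)) by (unfold dual; field; auto).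
  rewrite DP in E.
  replace (RtoC (/ 12) * (Ufun (RtoC (2 * PI)) - Ufun (RtoC (2 * PI))))%C with (RtoC 0) in E by ring.
  rewrite Cexp_0 in E. pose proof (Re_pos_neq0 w H) as W0.
  set (Y := Cexp (RtoC (/ 12) * (Ufun w - Ufun (dual w)))) in *.
  replace Y with ((Y * / w) * w)%C by (field; auto). rewrite <- E. field. auto.
Qed.

Definition E4fun (w : C) : C := (RtoC 1 + RtoC 240 * S3fun w)%C.
Definition Jfun (w : C) : C := (E4fun w ^ 3 * Cexp (Ufun w))%C.

Lemma E4_transform w : 0 < Re w -> E4fun w = (inv4 (gam w) * E4fun (dual w))%C.
Proof.
  intros H. pose proof (S3_transform w H) as T.
  assert (E : forall x, E4fun x = (RtoC 240 * (S3fun x + RtoC (/ 240)))%C).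
  { intros x. unfold E4fun. rewrite Cmult_plus_distr_l, <- RtoC_mult, Rinv_r by lra. ring. }
  rewrite !E, T. ring.
Qed.

(** The factor gam^-12 from E4^3 cancels (w / 2 pi)^12 from 1 / Delta, since gam = i w / (2 pi) and
    i^12 = 1. *)
Lemma J_transform w : 0 < Re w -> Jfun w = Jfun (dual w).
Proof.
  intros H. pose proof (Re_pos_neq0 w H) as W0. pose proof two_PI_neq0 as P0.
  unfold Jfun. rewrite (E4_transform w H).
  assert (EU : Cexp (Ufun w) = ((w / RtoC (2 * PI)) ^ 12 * Cexp (Ufun (dual w)))%C).
  { rewrite <- U_transform by auto. rewrite <- Cexp_INR.
    rewrite <- Cexp_plus. f_equal.
    replace (RtoC (INR 12) * (RtoC (/ 12) * (Ufun w - Ufun (dual w))))%C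
      with ((RtoC (INR 12) * RtoC (/ 12)) * (Ufun w - Ufun (dual w)))%C by ring.
    rewrite <- RtoC_mult. replace (INR 12 * / 12) with 1 by (simpl; field). ring. }
  rewrite EU. unfold inv4. rewrite inv2_gam by auto. field. auto.
Qed.

Lemma nome_gam w : nome (gam w) = Cexp (- w).
Proof.
  unfold nome. f_equal. unfold gam. pose proof two_PI_neq0.
  replace (RtoC (2 * PI) * Ci * (w * Ci / RtoC (2 * PI)))%C with (w * (Ci * Ci))%C by (field; auto).
  rewrite Ci_sqr. ring.
Qed.
Lemma Im_gam w : Im (gam w) = Re w / (2 * PI).
Proof.
  pose proof PI_gt3. unfold gam, Im, Re; simpl. field. lra.
Qed.

Lemma Csum_psum f N : Csum f N = psum (fun n => f (S n)) N.
Proof. induction N; simpl; [reflexivity|]. rewrite IHN. reflexivity. Qed.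

Lemma CLim_seq_Clim u l : Clim u l -> CLim_seq u = l.
Proof.
  intros [A B]. unfold CLim_seq. apply is_lim_seq_unique in A, B. rewrite A, B.
  apply C_eq; reflexivity.
Qed.

Lemma Cprod_eta w N : 0 < Re w ->
  Cprod (fun n => (RtoC 1 - Cexp (- w) ^ n) ^ 24)%C N =
  Cexp (- RtoC 24 * psum (fun n => ell (Cexp (- w) ^ S n)) N).
Proof.
  intros H. induction N.
  - cbn [Cprod psum]. rewrite Cmult_0_r. symmetry; apply Cexp_0.
  - cbn [Cprod psum]. rewrite IHN, Cmult_plus_distr_l, Cexp_plus. f_equal.
    assert (Q : Cmod (Cexp (- w) ^ S N) < 1).
    { rewrite <- nw_exp. apply Cmod_qexp, Re_nw_pos, H. }
    rewrite <- (Cexp_ell _ Q), <- Cexp_INR. f_equal.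
    replace (INR 24) with 24 by (simpl; ring). ring.
Qed.

Lemma j_Jfun w : 0 < Re w -> j (gam w) = Jfun w.
Proof.
  intros H. unfold j. rewrite nome_gam.
  assert (E1 : CSeries1 (fun n => RtoC (INR (sigma3 n)) * Cexp (- w) ^ n)%C = S3fun w).
  { apply CLim_seq_Clim. eapply Clim_ext; [intros; symmetry; apply Csum_psum|].
    apply Cis_Clim, S3_q, H. }
  assert (E2 : CProd1 (fun n => (RtoC 1 - Cexp (- w) ^ n) ^ 24)%C = Cexp (- RtoC 24 * Dfun w)).
  { apply CLim_seq_Clim. eapply Clim_ext; [intros; symmetry; apply Cprod_eta, H|].
    apply Clim_exp, Clim_mult; [apply Clim_const|]. apply Cis_Clim, Cis_D, H. }
  cbv zeta. rewrite E1, E2. unfold Jfun, E4fun, Ufun. rewrite Cexp_plus, Cexp_opp.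
  replace (- RtoC 24 * Dfun w)%C with (- (RtoC 24 * Dfun w))%C by ring.
  rewrite Cexp_opp. field. split; apply Cexp_neq0.
Qed.

Lemma is_series_Cis (f : nat -> C) (l : C) : is_series f l -> Cis f l.
Proof.
  intros H.
  assert (E : forall n, Re (sum_n f n) = sum_n (fun k => Re (f k)) n /\ Im (sum_n f n) = sum_n (fun k => Im (f k)) n).
  { induction n; [rewrite !sum_O; auto|]. rewrite !sum_Sn. destruct IHn as [A B].
    split; [rewrite <- A | rewrite <- B]; reflexivity. }
  unfold is_series in H. split.
  - apply (is_lim_seq_ext (fun n => Re (sum_n f n)) _ (Re l)); [apply E|].
    apply (filterlim_comp _ _ _ (sum_n f) fst _ _ _ H).
    intros P [e He]. exists e. intros y Hy. apply He, Hy.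
  - apply (is_lim_seq_ext (fun n => Im (sum_n f n)) _ (Im l)); [apply E|].
    apply (filterlim_comp _ _ _ (sum_n f) snd _ _ _ H).
    intros P [e He]. exists e. intros y Hy. apply He, Hy.
Qed.

Lemma j_coefficients_series (c : nat -> Z) w : is_j_coefficients c -> 0 < Re w ->
  Cis (fun n => RtoC (IZR (c n)) * Cexp (- w) ^ n)%C (Jfun w - Cexp w)%C.
Proof.
  intros hc H. pose proof PI_gt3.
  assert (Hg : 0 < Im (gam w)) by (rewrite Im_gam; apply Rdiv_lt_0_compat; lra).
  pose proof (is_series_Cis _ _ (hc (gam w) Hg)) as Q.
  rewrite j_Jfun, nome_gam, Cexp_opp in Q by auto.
  replace (/ / Cexp w)%C with (Cexp w) in Q by (field; apply Cexp_neq0).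
  rewrite Cexp_opp. exact Q.
Qed.

(** * Estimates for j *)

Definition S3R (a : R) : R := Re (S3fun (RtoC a)).
Definition DR (a : R) : R := Re (Dfun (RtoC a)).

Lemma Cexp_Ropp a : Cexp (- RtoC a) = RtoC (exp (- a)).
Proof. rewrite <- RtoC_opp. apply Cexp_R. Qed.
Lemma exp_opp_lt1 a : 0 < a -> 0 <= exp (- a) < 1.
Proof. intros; split; [left; apply exp_pos|]. rewrite <- exp_0. apply exp_increasing; lra. Qed.

Lemma S3R_series a : 0 < a -> is_series (fun n => INR (sigma3 (S n)) * exp (- a) ^ S n) (S3R a).
Proof.
  intros H. destruct (S3_q (RtoC a) H) as [A _]. eapply ser_ext; [|exact A].
  intros n; cbv beta. rewrite Cexp_Ropp, <- RtoC_pow, <- RtoC_mult. reflexivity.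
Qed.
Lemma DR_series a : 0 < a -> is_series (fun n => Re (ell (RtoC (exp (- a) ^ S n)))) (DR a).
Proof.
  intros H. destruct (Cis_D (RtoC a) H) as [A _]. eapply ser_ext; [|exact A].
  intros n; cbv beta. rewrite Cexp_Ropp, <- RtoC_pow. reflexivity.
Qed.

Lemma Cis_R_real (f : nat -> R) l : Cis (fun n => RtoC (f n)) l -> l = RtoC (Re l).
Proof.
  intros [A B]. apply (Cis_unique (fun n => RtoC (f n))); [split; assumption|]. apply Cis_R, A.
Qed.
Lemma S3fun_R a : 0 < a -> S3fun (RtoC a) = RtoC (S3R a).
Proof.
  intros H. apply (Cis_R_real (fun n => INR (sigma3 (S n)) * exp (- a) ^ S n)).
  eapply Cis_ext; [|apply S3_q, H].
  intros n; cbv beta. rewrite Cexp_Ropp, <- RtoC_pow, <- RtoC_mult. reflexivity.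
Qed.
Lemma Dfun_R a : 0 < a -> Dfun (RtoC a) = RtoC (DR a).
Proof.
  intros H. apply (Cis_R_real (fun n => sig1 (S n) / INR (S n) * exp (- a) ^ S n)).
  eapply Cis_ext; [|apply D_q, H].
  intros n; cbv beta. rewrite Cexp_Ropp, <- RtoC_pow, <- RtoC_mult. reflexivity.
Qed.

Lemma Cmod_q w : Cmod (Cexp (- w)) = exp (- Re w).
Proof. rewrite Cmod_Cexp. reflexivity. Qed.

Lemma S3fun_le w : 0 < Re w -> Cmod (S3fun w) <= S3R (Re w).
Proof.
  intros H. apply (Cis_Cmod_le _ _ (fun n => INR (sigma3 (S n)) * exp (- Re w) ^ S n) _) with (2 := S3_q w H).
  - intros n. rewrite Cmod_mult, Cmod_pow, Cmod_q, Cmod_R_pos by apply pos_INR. lra.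
  - apply S3R_series, H.
Qed.

(** Together with [sigma3_le] this dominates the series of sigma_3 by a geometric one of ratio 16
    q. *)
Lemma pow4_le n : INR (S n) ^ 4 <= 16 ^ n.
Proof.
  induction n; [simpl; lra|].
  rewrite S_INR. pose proof (INR_S_ge1 n). change (16 ^ S n) with (16 * 16 ^ n).
  assert ((INR (S n) + 1) ^ 4 <= (2 * INR (S n)) ^ 4) by (apply pow_incr; lra).
  rewrite Rpow_mult_distr in H0. lra.
Qed.
Lemma sigma3_le n : INR (sigma3 (S n)) <= INR (S n) ^ 4.
Proof.
  rewrite sigma3_dsum. unfold dsum.
  assert (G : forall K, (K <= S n)%nat -> rsum (fun i => if (S n mod S i =? 0)%nat then INR (S i) ^ 3 else 0) K <= INR K * INR (S n) ^ 3).
  { induction K; intros HK; cbn [rsum].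
    - simpl. lra.
    - specialize (IHK ltac:(lia)).
      assert (0 <= INR (S K) <= INR (S n)) by (split; [apply pos_INR | apply le_INR; lia]).
      assert (0 <= INR (S K) ^ 3 <= INR (S n) ^ 3) by (split; [apply pow_le | apply pow_incr]; lra).
      rewrite (S_INR K) in *. pose proof (pos_INR K). destruct (S n mod S K =? 0)%nat; nra. }
  eapply Rle_trans; [apply (G (S n)), le_n|]. right. ring.
Qed.
Lemma S3R_bound a : 0 < a -> 16 * exp (- a) < 1 ->
  0 <= S3R a <= exp (- a) / (1 - 16 * exp (- a)).
Proof.
  intros H H16. pose proof (exp_opp_lt1 a H) as Hr. set (r := exp (- a)) in *.
  pose proof (S3R_series a H) as A. fold r in A.
  split.
  - apply (ser_nonneg _ _) with (2 := A). intros n. apply Rmult_le_pos; [apply pos_INR | apply pow_le; lra].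
  - assert (B : is_series (fun n => r * (16 * r) ^ n) (r * / (1 - 16 * r))).
    { apply ser_scal, ser_geom. rewrite Rabs_pos_eq; lra. }
    pose proof (ser_minus _ _ _ _ B A) as Q.
    assert (0 <= r * / (1 - 16 * r) - S3R a); [|unfold Rdiv; lra].
    apply (ser_nonneg _ _) with (2 := Q). intros n.
    pose proof (sigma3_le n). pose proof (pow4_le n). rewrite Rpow_mult_distr.
    change (r ^ S n) with (r * r ^ n). assert (0 <= r * r ^ n) by (apply Rmult_le_pos; [lra|apply pow_le; lra]).
    assert (INR (sigma3 (S n)) * (r * r ^ n) <= 16 ^ n * (r * r ^ n)) by (apply Rmult_le_compat_r; lra). lra.
Qed.

Lemma Dfun_bound w : 0 < Re w ->
  Cmod (Dfun w) <= / (1 - exp (- Re w)) * (exp (- Re w) / (1 - exp (- Re w))).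
Proof.
  intros H. pose proof (exp_opp_lt1 _ H) as Hr.
  apply (Cis_Cmod_le _ _ (fun n => / (1 - exp (- Re w)) * exp (- Re w) ^ S n) _) with (2 := Cis_D w H).
  - intros n. pose proof (ell_qpow_bound w n H) as Q. rewrite Cmod_q in Q. exact Q.
  - apply ser_scal, ser_geom_S, Hr.
Qed.

Lemma exp_2PI_small a : 2 * PI <= a -> exp (- a) <= / 256.
Proof.
  intros H. pose proof PI_gt3.
  apply Rle_trans with (exp (Ropp 6)); [apply exp_le; lra|].
  rewrite exp_Ropp. apply Rinv_le_contravar; [lra|].
  replace (exp 6) with (exp (1 / 8) ^ 48).
  - pose proof (exp_ineq1_le (1 / 8)).
    apply Rle_trans with ((1 + 1 / 8) ^ 48); [lra|]. apply pow_incr; lra.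
  - rewrite <- (exp_ln (exp (1 / 8))) at 1 by apply exp_pos. rewrite ln_exp, <- Rpower_pow by apply exp_pos.
    unfold Rpower. rewrite ln_exp. f_equal. simpl. field.
Qed.

Lemma exp_le_inv y : y < 1 -> exp y <= / (1 - y).
Proof.
  intros H. replace y with (- - y) at 1 by ring. rewrite exp_Ropp.
  apply Rinv_le_contravar; [lra|]. pose proof (exp_ineq1_le (- y)). lra.
Qed.

(** Rounds up 1.12 (7 * 256 + 24.5), the value reached in [J_near_cusp]. *)
Definition J_cusp_bound : R := 2100.

(** With x = E4 - 1 and y = 24 Dfun, both O(q), the difference is e^w (((1 + x)^3 - 1) e^y + e^y -
    1), and the factor e^w is absorbed by |q| = e^(-Re w). *)
Lemma J_near_cusp w : 2 * PI <= Re w -> Cmod (Jfun w - Cexp w) <= J_cusp_bound.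
Proof.
  intros H. pose proof PI_gt3 as P3. assert (Hp : 0 < Re w) by lra.
  pose proof (exp_2PI_small _ H) as Hr. pose proof (exp_opp_lt1 _ Hp) as Hr0.
  pose proof (S3fun_le w Hp) as B1. pose proof (Dfun_bound w Hp) as B2.
  assert (Er : exp (Re w) * exp (- Re w) = 1) by (rewrite <- exp_plus, Rplus_opp_r; apply exp_0).
  assert (rp : 0 < exp (- Re w)) by apply exp_pos. assert (ep : 0 < exp (Re w)) by apply exp_pos.
  set (r := exp (- Re w)) in *. 
  destruct (S3R_bound (Re w) Hp ltac:(fold r; lra)) as [S0 S1]. fold r in S1.
  assert (I16 : / (1 - 16 * r) <= 16 / 15).
  { replace (16 / 15) with (/ (15 / 16)) by field. apply Rinv_le_contravar; lra. }
  assert (I1 : 0 < / (1 - r) <= 256 / 255).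
  { split; [apply Rinv_0_lt_compat; lra|]. replace (256 / 255) with (/ (255 / 256)) by field. apply Rinv_le_contravar; lra. }
  set (x := (RtoC 240 * S3fun w)%C). set (y := (RtoC 24 * Dfun w)%C).
  assert (Bx : Cmod x <= 256 * r).
  { unfold x. rewrite Cmod_mult, Cmod_R_pos by lra. unfold Rdiv in S1.
    assert (r * / (1 - 16 * r) <= r * (16 / 15)) by (apply Rmult_le_compat_l; lra). lra. }
  assert (By : Cmod y <= 24.5 * r).
  { unfold y. rewrite Cmod_mult, Cmod_R_pos by lra.
    assert (/ (1 - r) * (r / (1 - r)) <= 256 / 255 * (256 / 255) * r).
    { unfold Rdiv at 1. replace (/ (1 - r) * (r * / (1 - r))) with (/ (1 - r) * / (1 - r) * r) by ring.
      apply Rmult_le_compat_r; [lra|]. apply Rmult_le_compat; lra. }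
    lra. }
  assert (EJ : (Jfun w - Cexp w)%C = (Cexp w * ((x * (RtoC 3 + RtoC 3 * x + x * x)) * Cexp y + (Cexp y - RtoC 1)))%C).
  { unfold Jfun, E4fun, Ufun. fold x y. rewrite Cexp_plus, C3_eq. ring. }
  rewrite EJ, Cmod_mult, Cmod_Cexp. clear EJ.
  pose proof (Cmod_nonneg x) as x0. pose proof (Cmod_nonneg y) as y0.
  assert (Ey : exp (Cmod y) <= 1.12).
  { eapply Rle_trans; [apply exp_le_inv; lra|].
    apply Rle_trans with (/ (100 / 112)); [apply Rinv_le_contravar; lra | lra]. }
  assert (M1 : Cmod (Cexp y) <= 1.12).
  { rewrite Cmod_Cexp. eapply Rle_trans; [apply exp_le, Re_le_Cmod'|exact Ey]. }
  assert (M2 : Cmod (Cexp y - RtoC 1) <= 1.12 * (24.5 * r)).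
  { eapply Rle_trans; [apply Cexp_bound1|]. rewrite Rmult_comm. apply Rmult_le_compat; auto. left; apply exp_pos. }
  assert (M3 : Cmod (RtoC 3 + RtoC 3 * x + x * x) <= 7).
  { eapply Rle_trans; [apply Cmod_triangle|]. eapply Rle_trans; [apply Rplus_le_compat_r, Cmod_triangle|].
    rewrite !Cmod_mult, Cmod_R_pos by lra. nra. }
  assert (M4 : Cmod (x * (RtoC 3 + RtoC 3 * x + x * x) * Cexp y + (Cexp y - RtoC 1)) <= 2100 * r).
  { eapply Rle_trans; [apply Cmod_triangle|]. rewrite !Cmod_mult.
    pose proof (Cmod_nonneg (RtoC 3 + RtoC 3 * x + x * x)). pose proof (Cmod_nonneg (Cexp y)).
    assert (Cmod x * Cmod (RtoC 3 + RtoC 3 * x + x * x) <= 256 * r * 7) by (apply Rmult_le_compat; auto).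
    assert (Cmod x * Cmod (RtoC 3 + RtoC 3 * x + x * x) * Cmod (Cexp y) <= 256 * r * 7 * 1.12).
    { apply Rmult_le_compat; auto. apply Rmult_le_pos; auto. }
    lra. }
  unfold J_cusp_bound. apply Rle_trans with (exp (Re w) * (2100 * r)); [apply Rmult_le_compat_l; lra|].
  replace (exp (Re w) * (2100 * r)) with (2100 * (exp (Re w) * r)) by ring. rewrite Er. lra.
Qed.

Lemma J_major w : 0 < Re w -> 2 * PI <= Re (dual w) -> Cmod (Jfun w - Cexp (dual w)) <= J_cusp_bound.
Proof. intros H Hd. rewrite J_transform by auto. apply J_near_cusp, Hd. Qed.

Definition JR (a : R) : R := (1 + 240 * S3R a) ^ 3 * exp (a + 24 * DR a).
Lemma Jfun_R a : 0 < a -> Jfun (RtoC a) = RtoC (JR a).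
Proof.
  intros H. unfold Jfun, E4fun, Ufun, JR. rewrite S3fun_R, Dfun_R by auto.
  rewrite <- !RtoC_mult, <- !RtoC_plus, Cexp_R, <- RtoC_pow, <- RtoC_mult. reflexivity.
Qed.

Lemma JR_bound a : 0 < a <= 2 * PI -> JR a <= exp (4 * PI ^ 2 / a) + J_cusp_bound.
Proof.
  intros [H H2]. pose proof PI_gt3.
  assert (D : dual (RtoC a) = RtoC (4 * PI ^ 2 / a)).
  { unfold dual, Cdiv. rewrite <- !RtoC_mult, <- RtoC_inv, <- RtoC_mult by lra. f_equal. field. lra. }
  assert (Q : 2 * PI <= 4 * PI ^ 2 / a).
  { apply Rmult_le_reg_r with a; auto. replace (4 * PI ^ 2 / a * a) with (4 * PI ^ 2) by (field; lra). nra. }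
  pose proof (J_major (RtoC a) H) as M. rewrite D in M. specialize (M Q).
  rewrite Jfun_R, Cexp_R, <- RtoC_minus, Cmod_R in M by auto.
  apply Rabs_le_between in M. lra.
Qed.

(* Only the first term of the logarithm is improved on: |q| replaced by Re q. *)
Lemma Re_ell_le z : Cmod z < 1 ->
  Re (ell z) <= Re (ell (RtoC (Cmod z))) - (Cmod z - Re z).
Proof.
  intros H. destruct (ell_Cis z H) as [A _].
  destruct (ell_Cis (RtoC (Cmod z))) as [B _]; [rewrite Cmod_R_pos; auto; apply Cmod_nonneg|].
  pose proof (ser_minus _ _ _ _ B A) as Q.
  assert (T : forall n, 0 <= Re (RtoC (/ INR (S n)) * RtoC (Cmod z) ^ S n)%C - Re (RtoC (/ INR (S n)) * z ^ S n)%C).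
  { intros n. rewrite <- RtoC_pow, !Re_RC. change (Re (RtoC (Cmod z ^ S n))) with (Cmod z ^ S n).
    rewrite <- Cmod_pow. pose proof (Re_le_Cmod' (z ^ S n)%C). pose proof (Rinv_INR_S_le1 n). nra. }
  pose proof (rsum_le_series _ _ 1 T Q) as R1. cbn [rsum] in R1.
  rewrite !Re_RC in R1. change (INR 1) with 1 in R1. rewrite Rinv_1 in R1.
  change (z ^ 1)%C with (z * RtoC 1)%C in R1. change (RtoC (Cmod z) ^ 1)%C with (RtoC (Cmod z) * RtoC 1)%C in R1.
  replace (z * RtoC 1)%C with z in R1 by ring.
  replace (RtoC (Cmod z) * RtoC 1)%C with (RtoC (Cmod z)) in R1 by ring.
  change (Re (RtoC (Cmod z))) with (Cmod z) in R1. lra.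
Qed.

(** The gains |q|^n - Re q^n of [Re_ell_le] summed over n are two geometric series. *)
Lemma Re_D_le w : 0 < Re w ->
  Re (Dfun w) <= DR (Re w) - (/ (exp (Re w) - 1) - Re (/ (Cexp w - RtoC 1))%C).
Proof.
  intros H. pose proof (Cmod_qexp w H) as Q1. pose proof (exp_opp_lt1 _ H) as Hr.
  destruct (Cis_D w H) as [A _]. pose proof (DR_series _ H) as B.
  pose proof (ser_geom_S _ Hr) as G1.
  pose proof (Cis_scal (Cexp (- w)) _ _ (Cis_geom _ Q1)) as [G2 _].
  pose proof (ser_minus _ _ _ _ (ser_minus _ _ _ _ B A) (ser_minus _ _ _ _ G1 G2)) as Q.
  apply (ser_nonneg _ _) in Q.
  - assert (E1 : exp (- Re w) / (1 - exp (- Re w)) = / (exp (Re w) - 1)).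
    { rewrite exp_Ropp. pose proof (exp_ineq1 (Re w)). field. split; [|lra]. pose proof (exp_pos (Re w)); lra. }
    assert (E2 : (Cexp (- w) * / (RtoC 1 - Cexp (- w)))%C = (/ (Cexp w - RtoC 1))%C).
    { rewrite Cexp_opp. pose proof (Cexp_neq1 w H). pose proof (Cexp_neq0 w). field. auto. }
    rewrite E1, E2 in Q. lra.
  - intros n. cbv beta.
    assert (Qn : Cmod (Cexp (- w) ^ S n) = exp (- Re w) ^ S n) by (rewrite Cmod_pow, Cmod_q; reflexivity).
    pose proof (Re_ell_le (Cexp (- w) ^ S n)%C) as L. rewrite Qn in L.
    assert (exp (- Re w) ^ S n < 1).
    { rewrite <- Qn, <- nw_exp. apply Cmod_qexp, Re_nw_pos, H. }
    specialize (L H0). change (Cexp (- w) * Cexp (- w) ^ n)%C with (Cexp (- w) ^ S n)%C. lra.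
Qed.

(** Nonnegative coefficients give |E4(w)| <= E4(Re w), the factor 1 / Delta is compared with its
    real value by [Re_D_le], and on the real axis the transformation to the dual point bounds J. The
    exponential factor is small when w is much farther from the poles of 1 / (e^w - 1) than Re w is
    from 0. *)
Lemma J_minor w : 0 < Re w <= 2 * PI ->
  Cmod (Jfun w) <= (exp (4 * PI ^ 2 / Re w) + J_cusp_bound) *
    exp (- 24 * (/ (exp (Re w) - 1) - / Cmod (Cexp w - RtoC 1))).
Proof.
  intros [H H2]. set (d := / (exp (Re w) - 1) - / Cmod (Cexp w - RtoC 1)).
  assert (D : Re (Dfun w) <= DR (Re w) - d).
  { eapply Rle_trans; [apply Re_D_le, H|]. unfold d.
    pose proof (Re_le_Cmod' (/ (Cexp w - RtoC 1))%C) as Q. rewrite Cmod_inv in Q by (apply Cexp_neq1, H). lra. }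
  apply Rle_trans with (JR (Re w) * exp (- 24 * d)).
  - unfold Jfun, JR. rewrite Cmod_mult, Cmod_pow, Cmod_Cexp, Rmult_assoc, <- exp_plus.
    apply Rmult_le_compat; [apply pow_le, Cmod_nonneg | left; apply exp_pos | | ].
    + apply pow_incr. split; [apply Cmod_nonneg|]. unfold E4fun. eapply Rle_trans; [apply Cmod_triangle|].
      rewrite Cmod_1, Cmod_mult, Cmod_R_pos by lra. pose proof (S3fun_le w H). lra.
    + apply exp_le. unfold Ufun. rewrite Re_plus, Re_RC. lra.
  - apply Rmult_le_compat_r; [left; apply exp_pos|]. apply JR_bound. lra.
Qed.

(** * Isolating a coefficient *)

Lemma Cis_term_bound f l : Cis f l -> exists K, 0 <= K /\ forall n, Cmod (f n) <= K.
Proof.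
  intros [A B].
  assert (G : forall (g : nat -> R) (s : R), is_series g s -> exists K, 0 <= K /\ forall n, Rabs (g n) <= K).
  { intros g s H. assert (L : is_lim_seq g 0) by (apply ex_series_lim_0; exists s; exact H).
    apply is_lim_seq_Reals in L.
    destruct (L 1 Rlt_0_1) as [N HN].
    assert (F : exists K, 0 <= K /\ forall n, (n < N)%nat -> Rabs (g n) <= K).
    { clear. induction N as [|N [K [K0 HK]]].
      - exists 0. split; [lra|]. intros; lia.
      - exists (K + Rabs (g N)). pose proof (Rabs_pos (g N)). split; [lra|]. intros n Hn.
        destruct (Nat.eq_dec n N) as [->|H0]; [lra|]. specialize (HK n ltac:(lia)). lra. }
    destruct F as [K [K0 HK]]. exists (K + 1). split; [lra|]. intros n.
    destruct (lt_dec n N) as [h|h]; [specialize (HK n h); lra|].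
    specialize (HN n ltac:(lia)). unfold Rdist in HN. rewrite Rminus_0_r in HN. lra. }
  destruct (G _ _ A) as [K1 [P1 H1]]. destruct (G _ _ B) as [K2 [P2 H2]].
  exists (K1 + K2). split; [lra|]. intros n. eapply Rle_trans; [apply Cmod_le_abs|].
  specialize (H1 n); specialize (H2 n); lra.
Qed.

Section Primitive.
Variable c : nat -> Z.
Hypothesis hc : is_j_coefficients c.

(** Convergence at q = u = sqrt r bounds |c_k| u^k; the other factor u^k pays for the factor k. *)
Lemma coeff_summable r : 0 < r < 1 ->
  ex_series (fun k => INR (S k) * Rabs (IZR (c (S k))) * r ^ S k).
Proof.
  intros [r0 r1].
  assert (s1 : 0 < sqrt r < 1).
  { split; [apply sqrt_lt_R0; auto|]. rewrite <- sqrt_1. apply sqrt_lt_1_alt. lra. }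
  set (u := sqrt r) in *. assert (E : r = u * u) by (unfold u; rewrite sqrt_sqrt; lra).
  set (x := - ln u).
  assert (xp : 0 < x).
  { unfold x. pose proof (ln_increasing u 1 ltac:(lra) ltac:(lra)) as Q. rewrite ln_1 in Q. lra. }
  assert (Eu : exp (- x) = u) by (unfold x; rewrite Ropp_involutive; apply exp_ln; lra).
  destruct (Cis_term_bound _ _ (j_coefficients_series c (RtoC x) hc xp)) as [K [K0 HK]].
  destruct (ex_series_poly_geom 1 u ltac:(lra)) as [s Hs].
  apply (ex_series_le_R _ (fun k => K * (INR (S k) ^ 1 * u ^ S k))).
  - intros k. specialize (HK (S k)). rewrite Cmod_mult, Cmod_pow, Cmod_R, Cmod_q in HK.
    change (Re (RtoC x)) with x in HK. rewrite Eu in HK.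
    pose proof (pos_INR (S k)). assert (0 <= u ^ S k) by (apply pow_le; lra).
    pose proof (Rabs_pos (IZR (c (S k)))).
    rewrite E, Rpow_mult_distr, pow_1, Rabs_pos_eq.
    + replace (INR (S k) * Rabs (IZR (c (S k))) * (u ^ S k * u ^ S k)) with
       ((Rabs (IZR (c (S k))) * u ^ S k) * (INR (S k) * u ^ S k)) by ring.
      apply Rmult_le_compat_r; auto. apply Rmult_le_pos; auto.
    + apply Rmult_le_pos; [apply Rmult_le_pos; auto|]. apply Rmult_le_pos; auto.
  - exists (K * s). apply ser_scal, Hs.
Qed.

Variable n0 : nat.
Let n := S n0.
Definition dcoef (m : nat) : R := if Nat.eqb m n then 0 else IZR (c m) / (INR n - INR m).
(* A primitive of exp (n w) j: only the coefficient of q^n leaves a linear term, so the imaginary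
   part of [Psi], which vanishes for real w, is pi c(n) when Im w = pi. *)
Definition Psi (w : C) : C :=
  (RtoC (IZR (c n)) * w
   + Cexp (RtoC (INR n) * w) * (Cs (fun k => RtoC (dcoef (S k)) * Cexp (- w) ^ S k) + RtoC (dcoef 0))
   + RtoC (/ (INR n + 1)) * Cexp (RtoC (INR n + 1) * w))%C.

Lemma INR_diff_ge m : m <> n -> 1 <= Rabs (INR n - INR m).
Proof.
  intros H. rewrite !INR_IZR_INZ, <- minus_IZR, <- abs_IZR. apply IZR_le. lia.
Qed.
Lemma dcoef_le m : Rabs (dcoef m) <= Rabs (IZR (c m)).
Proof.
  unfold dcoef. destruct (Nat.eqb_spec m n) as [h|h]; [rewrite Rabs_R0; apply Rabs_pos|].
  pose proof (INR_diff_ge m h). rewrite Rabs_div by (intros E; rewrite E, Rabs_R0 in H; lra).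
  pose proof (Rabs_pos (IZR (c m))). apply Rmult_le_reg_r with (Rabs (INR n - INR m)); [lra|].
  unfold Rdiv. rewrite Rmult_assoc, Rinv_l by lra. nra.
Qed.
Lemma dcoef_mult m : (INR n - INR m) * dcoef m = if Nat.eqb m n then 0 else IZR (c m).
Proof.
  unfold dcoef. destruct (Nat.eqb_spec m n) as [h|h]; [ring|].
  pose proof (INR_diff_ge m h). field. intros E; rewrite E, Rabs_R0 in H; lra.
Qed.

Lemma coeff_Cis (d : nat -> R) w : 0 < Re w -> (forall k, Rabs (d (S k)) <= INR (S k) * Rabs (IZR (c (S k)))) ->
  Cis (fun k => RtoC (d (S k)) * Cexp (- w) ^ S k)%C (Cs (fun k => RtoC (d (S k)) * Cexp (- w) ^ S k)%C).
Proof.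
  intros H Hd. eapply Cis_dom; [|apply (coeff_summable (exp (- Re w)))].
  - intros k. rewrite Cmod_mult, Cmod_pow, Cmod_q, Cmod_R. apply Rmult_le_compat_r.
    + apply pow_le; left; apply exp_pos.
    + apply Hd.
  - split; [apply exp_pos|]. rewrite <- exp_0. apply exp_increasing; lra.
Qed.

Lemma Cis_single (v : C) k0 : Cis (fun k => if Nat.eqb k k0 then v else RtoC 0) v.
Proof.
  pose proof (Cis_finite (fun k => if Nat.eqb k k0 then v else RtoC 0) (S k0)) as F.
  eapply Cis_eq; [apply F|].
  - intros k Hk. destruct (Nat.eqb_spec k k0); [lia|auto].
  - cbn [psum]. rewrite Nat.eqb_refl, (psum_ext _ (fun _ => RtoC 0)); [rewrite psum_0; ring|].
    intros k Hk. destruct (Nat.eqb_spec k k0); [lia|auto].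
Qed.

Lemma Psi_deriv w w' a b delta M t : path_ok w w' a b delta M -> a < t < b ->
  Cderiv (fun x => Psi (w x)) t (w' t * (Cexp (RtoC (INR n) * w t) * Jfun (w t)))%C.
Proof.
  intros P Ht. pose proof P as [H1 H2 H3 H4 H5]. pose proof (H4 t Ht) as Hd. assert (Hp : 0 < Re (w t)) by lra.
  assert (r1 : 0 < exp (- delta) < 1).
  { split; [apply exp_pos|]. rewrite <- exp_0. apply exp_increasing; lra. }
  pose proof (qser_deriv (fun k => RtoC (dcoef (S k))) w w' a b delta M t P Ht) as Q.
  assert (Q1 : ex_series (fun k => INR (S k) * Cmod (RtoC (dcoef (S k))) * exp (- delta) ^ S k)).
  { eapply ex_series_le_R; [|apply (coeff_summable _ r1)]. intros k. rewrite Cmod_R.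
    assert (0 <= exp (- delta) ^ S k) by (apply pow_le; lra). pose proof (pos_INR (S k)).
    pose proof (Rabs_pos (dcoef (S k))). pose proof (dcoef_le (S k)).
    rewrite Rabs_pos_eq by (apply Rmult_le_pos; [apply Rmult_le_pos|]; auto).
    apply Rmult_le_compat_r; auto. apply Rmult_le_compat_l; auto. }
  specialize (Q Q1). clear Q1.
  eapply Cderiv_eq.
  - unfold Psi. apply Cderiv_plus; [apply Cderiv_plus|].
    + apply Cderiv_mult; [apply Cderiv_const | apply H1, Ht].
    + apply Cderiv_mult; [apply Cderiv_exp, Cderiv_mult; [apply Cderiv_const | apply H1, Ht]|].
      apply Cderiv_plus; [exact Q | apply Cderiv_const].
    + apply Cderiv_mult; [apply Cderiv_const|]. apply Cderiv_exp, Cderiv_mult; [apply Cderiv_const | apply H1, Ht].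
  - cbv beta.
    set (q := Cexp (- w t)). set (X := Cs (fun k => RtoC (dcoef (S k)) * q ^ S k)%C).
    set (Y := Cs (fun k => - w' t * (RtoC (INR (S k)) * RtoC (dcoef (S k)) * q ^ S k))%C).
    pose proof (j_coefficients_series c (w t) hc Hp) as A. fold q in A. apply Cis_incr in A.
    assert (BX : Cis (fun k => RtoC (dcoef (S k)) * q ^ S k)%C X).
    { apply (coeff_Cis dcoef (w t) Hp). intros m.
      pose proof (dcoef_le (S m)). pose proof (INR_S_ge1 m). pose proof (Rabs_pos (IZR (c (S m)))). nra. }
    assert (BY : Cis (fun k => - w' t * (RtoC (INR (S k)) * RtoC (dcoef (S k)) * q ^ S k))%C Y).
    { assert (B : Cis (fun k => RtoC (INR (S k)) * RtoC (dcoef (S k)) * q ^ S k)%C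
        (Cs (fun k => RtoC (INR (S k) * dcoef (S k)) * q ^ S k)%C)).
      { eapply Cis_ext; [|apply (coeff_Cis (fun m => INR m * dcoef m) (w t) Hp)].
        - intros k; cbv beta. rewrite RtoC_mult. reflexivity.
        - intros k. cbv beta. rewrite Rabs_mult, (Rabs_pos_eq (INR (S k))) by apply pos_INR.
          apply Rmult_le_compat_l; [apply pos_INR | apply dcoef_le]. }
      apply (Cis_scal (- w' t)) in B. unfold Y. rewrite (Cis_Cs _ _ B). exact B. }
    pose proof (Cis_plus _ _ _ _ (Cis_scal (w' t * RtoC (INR n)) _ _ BX) BY) as L1.
    pose proof (Cis_minus _ _ _ _ (Cis_scal (w' t) _ _ A)
      (Cis_scal (w' t) _ _ (Cis_single (RtoC (IZR (c n)) * q ^ n)%C n0))) as L2.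
    (* Index k stands for the exponent k + 1, so the exponent n to be left out is k = n0. Term by
       term this is [dcoef_mult]. *)
    assert (E : (w' t * RtoC (INR n) * X + Y)%C =
      (w' t * (Jfun (w t) - Cexp (w t) - RtoC (IZR (c 0)) * q ^ 0) - w' t * (RtoC (IZR (c n)) * q ^ n))%C).
    { apply (Cis_unique _ _ _ L1). eapply Cis_ext; [|exact L2]. intros k; cbv beta.
      pose proof (dcoef_mult (S k)) as D.
      transitivity (w' t * (RtoC ((INR n - INR (S k)) * dcoef (S k)) * q ^ S k))%C.
      2:{ rewrite RtoC_mult, RtoC_minus. ring. }
      rewrite D. unfold n. change (Nat.eqb (S k) (S n0)) with (Nat.eqb k n0).
      destruct (Nat.eqb_spec k n0) as [->|h]; ring. }
    assert (D0 : (RtoC (INR n) * RtoC (dcoef 0))%C = RtoC (IZR (c 0))).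
    { rewrite <- RtoC_mult. f_equal. pose proof (dcoef_mult 0) as D. unfold n in *. simpl (Nat.eqb 0 (S n0)) in D.
      cbv iota in D. rewrite <- D. simpl (INR 0). ring. }
    assert (Eq : (Cexp (RtoC (INR n) * w t) * q ^ n)%C = RtoC 1).
    { unfold q. rewrite <- Cexp_INR, <- Cexp_plus.
      replace (RtoC (INR n) * w t + RtoC (INR n) * - w t)%C with (RtoC 0) by ring. apply Cexp_0. }
    assert (En : (RtoC (/ (INR n + 1)) * RtoC (INR n + 1))%C = RtoC 1).
    { rewrite <- RtoC_mult. f_equal. pose proof (pos_INR n). field. lra. }
    assert (Ee : Cexp (RtoC (INR n + 1) * w t) = (Cexp (RtoC (INR n) * w t) * Cexp (w t))%C).
    { rewrite <- Cexp_plus. f_equal. rewrite RtoC_plus. ring. }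
    rewrite Ee. set (eN := Cexp (RtoC (INR n) * w t)) in *. set (eW := Cexp (w t)) in *.
    transitivity (RtoC (IZR (c n)) * w' t + eN * (w' t * RtoC (INR n) * X + Y)
      + w' t * eN * (RtoC (INR n) * RtoC (dcoef 0)) + (RtoC (/ (INR n + 1)) * RtoC (INR n + 1)) * w' t * eN * eW)%C.
    { ring. }
    rewrite E, D0, En.
    transitivity (RtoC (IZR (c n)) * w' t * (RtoC 1 - eN * q ^ n) + w' t * eN * Jfun (w t))%C.
    { change (q ^ 0)%C with (RtoC 1). ring. }
    rewrite Eq. ring.
Qed.

(** When e^w is real every term except the linear one is real. This covers both ends of the contour,
    Im w = 0 and Im w = pi. *)
Lemma Psi_Im_real w x y : Cexp (- w) = RtoC x -> Cexp w = RtoC y -> Im (Psi w) = IZR (c n) * Im w.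
Proof.
  intros Hx Hy. unfold Psi.
  assert (E1 : Cexp (RtoC (INR n) * w) = RtoC (y ^ n)) by (rewrite Cexp_INR, Hy, RtoC_pow; reflexivity).
  assert (E2 : Cexp (RtoC (INR n + 1) * w) = RtoC (y ^ S n)).
  { rewrite <- S_INR, Cexp_INR, Hy, RtoC_pow; reflexivity. }
  assert (E3 : Im (Cs (fun k => RtoC (dcoef (S k)) * Cexp (- w) ^ S k)%C) = 0).
  { change (Series (fun k => Im (RtoC (dcoef (S k)) * Cexp (- w) ^ S k)%C) = 0). apply is_series_unique. eapply ser_ext; [|exact ser_zero].
    intros k; cbv beta. rewrite Hx, <- RtoC_pow, <- RtoC_mult. reflexivity. }
  rewrite E1, E2. set (X := Cs _) in *. rewrite !Im_plus, !Im_RC, Im_plus, E3.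
  change (Im (RtoC (dcoef 0))) with 0. change (Im (RtoC (y ^ S n))) with 0. ring.
Qed.
End Primitive.

(** * The contour and the errors along it *)

Lemma PI_bounds : 3.14 < PI < 3.15.
Proof.
  destruct (PI_2_3_7_ineq 3) as [A B].
  unfold tg_alt, PI_2_3_7_tg, Ratan_seq in A, B. simpl in A, B. lra.
Qed.

Lemma Im_minus (x y : C) : Im (x - y)%C = Im x - Im y.
Proof. reflexivity. Qed.

(** Takes the place of integrating the error: only imaginary parts matter, so the real mean value
    theorem applies to the difference of the primitive F and the primitive G of the main term. *)
Lemma mean_value_Im (F g : R -> C) (G G' : R -> R) t0 t1 E : t0 <= t1 ->
  (forall t, t0 <= t <= t1 -> Cderiv F t (g t)) ->
  (forall t, t0 <= t <= t1 -> is_derive G t (G' t)) ->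
  (forall t, t0 <= t <= t1 -> Rabs (Im (g t) - G' t) <= E) ->
  Rabs (Im (F t1) - Im (F t0) - (G t1 - G t0)) <= E * (t1 - t0).
Proof.
  intros H D1 D2 B.
  destruct (MVT_gen (fun t => Im (F t) - G t) t0 t1 (fun t => Im (g t) - G' t)) as [x [Hx Ex]].
  - intros x; rewrite Rmin_left, Rmax_right by lra; intros Hx.
    apply der_minus; [apply (proj2 (D1 x ltac:(lra))) | apply D2; lra].
  - intros x; rewrite Rmin_left, Rmax_right by lra; intros Hx.
    eapply is_derive_continuity_pt, der_minus; [apply (proj2 (D1 x ltac:(lra))) | apply D2; lra].
  - rewrite Rmin_left, Rmax_right in Hx by lra.
    replace (Im (F t1) - Im (F t0) - (G t1 - G t0)) with ((Im (g x) - G' x) * (t1 - t0)) by lra.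
    rewrite Rabs_mult, (Rabs_pos_eq (t1 - t0)) by lra. apply Rmult_le_compat_r; [lra | apply B, Hx].
Qed.

(** For a < 2 this is e^a (1 - a / 2) <= 1 + a / 2; for a >= 2 the left side is not positive. *)
Lemma inv_exp_minus1_ge a : 0 < a -> / a - / 2 <= / (exp a - 1).
Proof.
  intros H.
  destruct (Rle_dec 2 a) as [h|h].
  - apply Rle_trans with 0; [pose proof (Rinv_le_contravar 2 a ltac:(lra) h); lra|].
    left; apply Rinv_0_lt_compat. pose proof (exp_ineq1 a). lra.
  - assert (Q : exp a * (1 - a / 2) <= 1 + a / 2).
    { destruct (MVT_gen (fun t => 1 + t / 2 - exp t * (1 - t / 2)) 0 a
        (fun t => / 2 - exp t * (1 - t / 2) + exp t / 2)) as [x [Hx Ex]].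
      - intros x _. auto_derive; auto. field.
      - intros x _. apply derivable_continuous_pt, ex_derive_Reals_0. auto_derive; auto.
      - rewrite exp_0 in Ex. rewrite Rmin_left, Rmax_right in Hx by lra.
        assert (0 <= / 2 - exp x * (1 - x / 2) + exp x / 2).
        { pose proof (exp_ineq1_le (- x)) as E. rewrite exp_Ropp in E. pose proof (exp_pos x).
          assert (exp x * (1 + - x) <= 1) by (apply Rle_trans with (exp x * / exp x); [apply Rmult_le_compat_l; lra | rewrite Rinv_r; lra]). lra. }
        nra. }
    assert (E : 0 < exp a - 1) by (pose proof (exp_ineq1 a); lra).
    replace (/ a - / 2) with ((1 - a / 2) / a) by (field; lra).
    apply Rmult_le_reg_r with (a * (exp a - 1)); [nra|].
    replace ((1 - a / 2) / a * (a * (exp a - 1))) with ((1 - a / 2) * (exp a - 1)) by (field; lra).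
    replace (/ (exp a - 1) * (a * (exp a - 1))) with a by (field; lra). lra.
Qed.

Lemma cos_le_taylor x : 0 <= x <= 1.5 -> cos x <= 1 - x ^ 2 / 2 + x ^ 4 / 24.
Proof.
  intros H. pose proof PI_gt3. 
  destruct (cos_bound x 0 ltac:(lra) ltac:(lra)) as [_ B].
  eapply Rle_trans; [exact B|]. unfold cos_approx, cos_term. simpl. lra.
Qed.

Lemma ex_RInt_cont (f : R -> R) a b : (forall t, continuous f t) -> ex_RInt f a b.
Proof. intros H. apply (@ex_RInt_continuous R_CompleteNormedModule). intros; apply H. Qed.
Lemma RInt_der (f : R -> R) a t : (forall x, continuous f x) -> is_derive (fun x => RInt f a x) t (f t).
Proof.
  intros H. apply (@is_derive_RInt R_NormedModule f (fun x => RInt f a x) a t); [|apply H].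
  exists (mkposreal 1 Rlt_0_1). intros y _.
  apply (@RInt_correct R_CompleteNormedModule f a y). apply ex_RInt_cont, H.
Qed.

Definition arcint (s : R) : R := RInt (fun t => cos t * exp (4 * PI * s * cos t)) 0 (PI / 4).

Section Contour.
Variable c : nat -> Z.
Hypothesis hc : is_j_coefficients c.
Variables (n0 : nat) (s : R).
Hypothesis Hs : 15 <= s.
Hypothesis Hn : INR (S n0) = s ^ 2.

(** The saddle point of n w + 4 pi^2 / w. On the circle of this radius the two terms are 2 pi s e^(i
    t) and its conjugate, so their sum is the real number 4 pi s cos t. *)
Let R0 := 2 * PI / s.
Let n := S n0.

Lemma R0_bounds : 0 < R0 <= 0.42.
Proof.
  pose proof PI_bounds. unfold R0. split; [apply Rdiv_lt_0_compat; lra|].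
  apply Rmult_le_reg_r with s; [lra|]. replace (2 * PI / s * s) with (2 * PI) by (field; lra). lra.
Qed.
Lemma nR0 : INR n * R0 = 2 * PI * s.
Proof. unfold n. rewrite Hn. unfold R0. field. lra. Qed.
Lemma R0s : R0 * s = 2 * PI.
Proof. unfold R0. field. lra. Qed.

(* The contour is the arc |w| = [R0] from the real axis to argument pi / 4, then the vertical
   segment [vert] up to imaginary part pi. *)
Definition arc (t : R) : C := (RtoC R0 * Cexp (RtoC t * Ci))%C.
Lemma Cexp_it t : Cexp (RtoC t * Ci) = (cos t, sin t).
Proof.
  unfold Cexp. replace (Re (RtoC t * Ci)%C) with 0 by (unfold Re; simpl; ring).
  replace (Im (RtoC t * Ci)%C) with t by (unfold Im; simpl; ring). rewrite exp_0, !Rmult_1_l. reflexivity.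
Qed.
Lemma arc_eq t : arc t = (R0 * cos t, R0 * sin t).
Proof. unfold arc. rewrite Cexp_it. apply C_eq; simpl; ring. Qed.
Lemma arc_deriv t : Cderiv arc t (Ci * arc t)%C.
Proof.
  eapply Cderiv_eq; [apply Cderiv_mult; [apply Cderiv_const | apply Cderiv_exp, Cderiv_ray]|].
  cbv beta. unfold arc. ring.
Qed.
Lemma arc_path : path_ok arc (fun t => Ci * arc t)%C (-1) 1 (R0 * cos 1) R0.
Proof.
  destruct R0_bounds as [R1 R2]. pose proof PI_bounds.
  assert (c1 : 0 < cos 1) by (apply cos_gt_0; lra).
  constructor.
  - intros; apply arc_deriv.
  - intros. eexists. apply Cderiv_mult; [apply Cderiv_const | apply arc_deriv].
  - nra.
  - intros x Hx. rewrite arc_eq. unfold Re; simpl fst. apply Rmult_le_compat_l; [lra|].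
    destruct (Rle_dec 0 x).
    + apply cos_decr_1; lra.
    + rewrite <- (cos_neg x). apply cos_decr_1; lra.
  - intros x Hx. unfold arc. rewrite !Cmod_mult, Cmod_R_pos, Cmod_Cexp by lra.
    replace (Re (RtoC x * Ci)%C) with 0 by (unfold Re; simpl; ring). rewrite exp_0.
    replace (Cmod Ci) with 1; [lra|]. unfold Cmod, Ci; simpl. replace (_ + _) with 1 by ring. symmetry; apply sqrt_1.
Qed.

Lemma Cmod_Ci : Cmod Ci = 1.
Proof. unfold Cmod, Ci; simpl. replace (_ + _) with 1 by ring. apply sqrt_1. Qed.

Lemma dual_arc t : dual (arc t) = (2 * PI * s * cos t, - (2 * PI * s * sin t)).
Proof.
  destruct R0_bounds as [R1 R2]. pose proof PI_bounds.
  assert (N : RtoC R0 <> RtoC 0) by (apply RtoC_neq0; lra).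
  assert (Q : dual (arc t) = (RtoC (2 * PI * s) * Cexp (RtoC (- t) * Ci))%C).
  { unfold dual, arc. replace (RtoC (- t) * Ci)%C with (- (RtoC t * Ci))%C by (rewrite RtoC_opp; ring).
    rewrite Cexp_opp. replace (RtoC (2 * PI * s)) with (RtoC (2 * PI) * RtoC (2 * PI) / RtoC R0)%C.
    - field. split; [apply Cexp_neq0 | auto].
    - unfold Cdiv. rewrite <- RtoC_inv, <- !RtoC_mult by lra. f_equal.
      rewrite <- R0s at 1. field. lra. }
  rewrite Q, Cexp_it, cos_neg, sin_neg. apply C_eq; simpl; ring.
Qed.

Lemma arc_main t : Im (Ci * arc t * (Cexp (RtoC (INR n) * arc t) * Cexp (dual (arc t))))%C
  = R0 * (cos t * exp (4 * PI * s * cos t)).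
Proof.
  rewrite <- Cexp_plus.
  replace (RtoC (INR n) * arc t + dual (arc t))%C with (RtoC (4 * PI * s * cos t)).
  - rewrite Cexp_R, arc_eq. unfold Im; simpl. ring.
  - rewrite dual_arc, arc_eq. pose proof nR0 as E. set (N := INR n) in *. clearbody N. apply C_eq; simpl.
    + replace (N * (R0 * cos t) - 0 * (R0 * sin t)) with (N * R0 * cos t) by ring. rewrite E. ring.
    + replace (N * (R0 * sin t) + 0 * (R0 * cos t)) with (N * R0 * sin t) by ring. rewrite E. ring.
Qed.

Lemma cos_PI4_bounds : 0.707 < cos (PI / 4) < 0.7072.
Proof.
  rewrite cos_PI4. assert (1.4142 < sqrt 2 < 1.4143).
  { pose proof (sqrt_sqrt 2 ltac:(lra)). pose proof (sqrt_pos 2). split; nra. }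
  assert (0 < sqrt 2) by lra.
  replace (1 / sqrt 2) with (sqrt 2 / 2); [lra|].
  apply Rmult_eq_reg_r with (sqrt 2); [|lra]. pose proof (sqrt_sqrt 2 ltac:(lra)). field_simplify; lra.
Qed.

(** By [J_major] the replacement of j costs a bounded amount, which is multiplied by |exp (n w)| <=
    exp (2 pi s), about the square root of the main term. *)
Lemma arc_part : Rabs (Im (Psi c n0 (arc (PI / 4))) - Im (Psi c n0 (arc 0)) - R0 * arcint s)
  <= J_cusp_bound * exp (2 * PI * s).
Proof.
  destruct R0_bounds as [R1 R2]. pose proof PI_bounds as Pb. pose proof cos_PI4_bounds as Cb.
  set (f := fun t => cos t * exp (4 * PI * s * cos t)).
  assert (Cf : forall t, continuous f t).
  { intros t. apply (ex_derive_continuous f). unfold f. auto_derive. auto. }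
  set (G := fun t => R0 * RInt f 0 t).
  assert (DG : forall t, is_derive G t (R0 * f t)).
  { intros t. unfold G. eapply der_eq; [apply der_mult; [apply der_const | apply (RInt_der f 0 t Cf)]|]. cbv beta. ring. }
  assert (G0 : G 0 = 0) by (unfold G; rewrite RInt_point; apply Rmult_0_r).
  replace (R0 * arcint s) with (G (PI / 4) - G 0) by (rewrite G0; apply Rminus_0_r).
  apply Rle_trans with (R0 * (exp (2 * PI * s) * J_cusp_bound) * (PI / 4 - 0)).
  - apply (mean_value_Im (fun t => Psi c n0 (arc t))
      (fun t => Ci * arc t * (Cexp (RtoC (INR n) * arc t) * Jfun (arc t)))%C G (fun t => R0 * f t)); try lra.
    + intros t Ht. apply (Psi_deriv c hc n0 arc (fun t => Ci * arc t)%C _ _ _ _ t arc_path). lra.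
    + intros; apply DG.
    + intros t Ht.
      assert (ct : cos (PI / 4) <= cos t <= 1).
      { split; [apply cos_decr_1; lra | apply COS_bound]. }
      unfold f. rewrite <- arc_main.
      assert (Rp : 0 < Re (arc t)) by (rewrite arc_eq; unfold Re; simpl fst; nra).
      assert (Rd : 2 * PI <= Re (dual (arc t))) by (rewrite dual_arc; unfold Re; simpl fst; assert (1 <= s * cos t) by nra; nra).
      pose proof (J_major _ Rp Rd) as M.
      set (u := (Ci * arc t)%C). set (eN := Cexp (RtoC (INR n) * arc t)).
      replace (Im (u * (eN * Jfun (arc t)))%C - Im (u * (eN * Cexp (dual (arc t))))%C)
        with (Im (u * (eN * (Jfun (arc t) - Cexp (dual (arc t)))))%C).
      2:{ rewrite <- Im_minus. f_equal. ring. }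
      eapply Rle_trans; [apply Im_le_Cmod|]. rewrite !Cmod_mult.
      assert (U : Cmod u <= R0) by (apply (path_speed _ _ _ _ _ _ arc_path); lra).
      assert (En : Cmod eN <= exp (2 * PI * s)).
      { unfold eN. rewrite Cmod_Cexp. apply exp_le. rewrite Re_RC, arc_eq. change (Re (R0 * cos t, R0 * sin t)) with (R0 * cos t).
        replace (INR n * (R0 * cos t)) with (INR n * R0 * cos t) by ring. rewrite nR0. assert (0 < 2 * PI * s) by nra. nra. }
      apply Rmult_le_compat; try apply Cmod_nonneg; auto.
      * apply Rmult_le_pos; apply Cmod_nonneg.
      * apply Rmult_le_compat; try apply Cmod_nonneg; auto.
  - assert (R0 * (PI / 4 - 0) <= 1) by nra. pose proof (exp_pos (2 * PI * s)).
    assert (0 < exp (2 * PI * s) * J_cusp_bound) by (unfold J_cusp_bound; nra). nra.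
Qed.

Let a0 := R0 * cos (PI / 4).
Definition vert (b : R) : C := (a0, b).
Lemma vert_path : path_ok vert (fun _ => Ci) (a0 - 1) 4 a0 1.
Proof.
  destruct R0_bounds as [R1 R2]. pose proof cos_PI4_bounds as Cb.
  constructor.
  - intros x _. split; unfold vert, Re, Im; simpl; [apply der_const | apply der_id].
  - intros. eexists. apply Cderiv_const.
  - unfold a0; nra.
  - intros x _. unfold vert, Re; simpl. lra.
  - intros. rewrite Cmod_Ci. lra.
Qed.

Lemma a0_bounds : 0 < a0 /\ 0.707 * R0 < a0 < 0.7072 * R0.
Proof. destruct R0_bounds as [R1 R2]. pose proof cos_PI4_bounds as Cb. unfold a0. split; nra. Qed.
Lemma a0_sqr : a0 * a0 = R0 * R0 / 2.
Proof.
  unfold a0. rewrite cos_PI4. assert (0 < sqrt 2) by (apply sqrt_lt_R0; lra).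
  replace (R0 * (1 / sqrt 2) * (R0 * (1 / sqrt 2))) with (R0 * R0 / (sqrt 2 * sqrt 2)) by (field; lra).
  rewrite sqrt_sqrt by lra. reflexivity.
Qed.

Lemma Re_dual_vert b : Re (dual (vert b)) = 2 * PI * s * R0 * a0 / (a0 * a0 + b * b).
Proof.
  destruct a0_bounds as [A0 _].
  rewrite Re_dual by (apply C_neq0_Re; unfold vert, Re; simpl; lra).
  rewrite Cmod_sqr. unfold vert, Re, Im; simpl fst; simpl snd.
  pose proof R0s as E. 
  replace (2 * PI * s * R0 * a0) with (2 * PI * (R0 * s) * a0) by ring. rewrite E.
  replace (a0 ^ 2 + b ^ 2) with (a0 * a0 + b * b) by ring. unfold Rdiv. ring.
Qed.

Let E1 := exp (0.7072 * (2 * PI * s)).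
Lemma exp_nvert b : Cmod (Cexp (RtoC (INR n) * vert b)) <= E1.
Proof.
  rewrite Cmod_Cexp. apply exp_le. rewrite Re_RC. change (Re (vert b)) with a0. unfold a0.
  replace (INR n * (R0 * cos (PI / 4))) with (INR n * R0 * cos (PI / 4)) by ring. rewrite nR0.
  pose proof cos_PI4_bounds. pose proof PI_bounds. assert (0 < 2 * PI * s) by nra. nra.
Qed.

Lemma J_cusp_bound_le : J_cusp_bound <= exp (15 + 15 + 15).
Proof. rewrite !exp_plus. pose proof (exp_ineq1_le 15). unfold J_cusp_bound. nra. Qed.
Lemma E1_big : J_cusp_bound <= E1.
Proof.
  unfold E1. pose proof PI_bounds. eapply Rle_trans; [apply J_cusp_bound_le | apply exp_le; nra].
Qed.

(** Up to height 3 R0 the dual point still has real part at least 2 pi, because R0 <= 0.42. This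
    real part decreases with the height and starts at sqrt 2 pi s < 0.7072 * 2 pi s. *)
Lemma vert_major b : a0 <= b <= 3 * R0 -> Cmod (Jfun (vert b)) <= 2 * E1.
Proof.
  intros Hb. destruct a0_bounds as [A0 A1]. destruct R0_bounds as [R1 R2]. pose proof PI_bounds.
  assert (Rp : 0 < Re (vert b)) by (unfold vert, Re; simpl; lra).
  pose proof (Re_dual_vert b) as E. pose proof a0_sqr as Q. pose proof R0s as RS.
  assert (p1 : 0 < a0 * a0 + b * b) by nra.
  assert (Rd : 2 * PI <= Re (dual (vert b))).
  { rewrite E. apply Rmult_le_reg_r with (a0 * a0 + b * b); auto.
    replace (2 * PI * s * R0 * a0 / (a0 * a0 + b * b) * (a0 * a0 + b * b)) with (2 * PI * (R0 * s * a0)) by (field; lra).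
    apply Rmult_le_compat_l; [lra|]. rewrite RS.
    assert (b * b <= 9 * (R0 * R0)) by nra.
    assert (R0 * R0 <= 0.42 * R0) by nra. nra. }
  assert (Ru : Re (dual (vert b)) <= 0.7072 * (2 * PI * s)).
  { rewrite E. apply Rmult_le_reg_r with (a0 * a0 + b * b); auto.
    replace (2 * PI * s * R0 * a0 / (a0 * a0 + b * b) * (a0 * a0 + b * b)) with (2 * PI * s * (R0 * a0)) by (field; lra).
    replace (0.7072 * (2 * PI * s) * (a0 * a0 + b * b)) with (2 * PI * s * (0.7072 * (a0 * a0 + b * b))) by ring.
    assert (0 < 2 * PI * s) by nra.
    apply Rmult_le_compat_l; [lra|].
    assert (a0 * a0 <= b * b) by nra. nra. }
  pose proof (J_major _ Rp Rd) as M. pose proof E1_big as EB.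
  replace (Jfun (vert b)) with ((Jfun (vert b) - Cexp (dual (vert b))) + Cexp (dual (vert b)))%C by ring.
  eapply Rle_trans; [apply Cmod_triangle|]. rewrite Cmod_Cexp.
  assert (exp (Re (dual (vert b))) <= E1) by (apply exp_le, Ru). lra.
Qed.

Lemma exp_vert_sub1 b : 3 * R0 <= b <= PI -> 2.88 * R0 <= Cmod (Cexp (vert b) - RtoC 1).
Proof.
  intros Hb. destruct a0_bounds as [A0 A1]. destruct R0_bounds as [R1 R2]. pose proof PI_bounds.
  pose proof (Cexp_sub1_sqr (vert b)) as E. change (Re (vert b)) with a0 in E. change (Im (vert b)) with b in E.
  pose proof (exp_ineq1_le a0) as X. pose proof a0_sqr as Q.
  assert (C1 : cos b <= cos (3 * R0)) by (apply cos_decr_1; lra).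
  pose proof (cos_le_taylor (3 * R0) ltac:(lra)) as C2.
  pose proof (Cmod_nonneg (Cexp (vert b) - RtoC 1)).
  apply Rsqr_incr_0_var; auto. unfold Rsqr.
  assert (L1 : a0 * a0 <= (exp a0 - 1) ^ 2) by nra.
  assert (L2 : 2 * (1 - cos b) <= 2 * exp a0 * (1 - cos b)) by (pose proof (COS_bound b); rewrite Rmult_assoc; apply Rmult_le_compat_l; [lra|]; rewrite <- (Rmult_1_l (1 - cos b)) at 1; apply Rmult_le_compat_r; lra).
  (* In terms of y <= 0.42^2 the squared modulus is at least y / 2 + 9 y - 6.75 y^2 >= 8.2944 y, and
     8.2944 = 2.88^2. *)
  set (y := R0 * R0) in *.
  assert (y0 : 0 < y <= 0.1764).
  { unfold y; split; [apply Rmult_lt_0_compat; lra|]. replace 0.1764 with (0.42 * 0.42) by lra. apply Rmult_le_compat; lra. }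
  replace ((3 * R0) ^ 2) with (9 * y) in C2 by (unfold y; ring).
  replace ((3 * R0) ^ 4) with (81 * (y * y)) in C2 by (unfold y; ring).
  replace (2.88 * R0 * (2.88 * R0)) with (8.2944 * y) by (unfold y; lra).
  assert (y2 : y * y <= 0.1764 * y) by (apply Rmult_le_compat_r; lra).
  fold y in Q. rewrite Q in L1. simpl pow in *. lra.
Qed.

(** The value at the real point a0 has size about exp (2 sqrt 2 pi s). The last factor is the gain
    of [J_minor]: e^w is at distance 2.88 R0 or more from 1, while e^a0 - 1 is only about 0.71 R0
    for small R0. *)
Lemma vert_minor b : 3 * R0 <= b <= PI ->
  Cmod (Jfun (vert b)) <= 2 * exp (2 * 0.7072 * (2 * PI * s)) * exp (12 - 4.06 * s).
Proof.
  intros Hb. destruct a0_bounds as [A0 A1]. destruct R0_bounds as [R1 R2]. pose proof PI_bounds as Pb.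
  pose proof R0s as RS. pose proof a0_sqr as Q.
  assert (Ra : Re (vert b) = a0) by reflexivity.
  pose proof (J_minor (vert b)) as M. rewrite Ra in M. specialize (M ltac:(lra)).
  eapply Rle_trans; [exact M|]. apply Rmult_le_compat.
  - left. apply Rplus_lt_0_compat; [apply exp_pos | unfold J_cusp_bound; lra].
  - left; apply exp_pos.
  - assert (exp (4 * PI ^ 2 / a0) <= exp (2 * 0.7072 * (2 * PI * s))).
    { apply exp_le. apply Rmult_le_reg_r with a0; auto.
      replace (4 * PI ^ 2 / a0 * a0) with ((2 * PI) * (2 * PI)) by (field; lra). rewrite <- RS at 1.
      replace (2 * 0.7072 * (2 * PI * s) * a0) with (s * (2 * PI) * (2 * 0.7072 * a0)) by ring.
      replace (R0 * s * (2 * PI)) with (s * (2 * PI) * R0) by ring.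
      apply Rmult_le_compat_l; [nra|].
      assert (R0 * R0 <= 2 * 0.7072 * a0 * R0) by nra. nra. }
    assert (J_cusp_bound <= exp (2 * 0.7072 * (2 * PI * s))).
    { eapply Rle_trans; [apply E1_big|]. apply exp_le. assert (0 < 2 * PI * s) by nra. lra. }
    lra.
  - apply exp_le.
    (* With t = s / (2 pi) >= 0.15873 s the gain in the exponent is at least 24 ((1.414 - 0.3473) t
       - 1 / 2) >= 4.06 s - 12. *)
    pose proof (inv_exp_minus1_ge a0 A0) as I1. pose proof (exp_vert_sub1 b Hb) as I2.
    assert (I3 : / Cmod (Cexp (vert b) - RtoC 1) <= / (2.88 * R0)) by (apply Rinv_le_contravar; lra).
    assert (I4 : / (0.7072 * R0) <= / a0) by (apply Rinv_le_contravar; lra).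
    assert (I5 : / R0 = s / (2 * PI)) by (rewrite <- RS; field; lra).
    rewrite Rinv_mult, I5 in I3. rewrite Rinv_mult, I5 in I4.
    assert (I6 : 0.15873 * s <= s / (2 * PI)).
    { apply Rmult_le_reg_r with (2 * PI); [lra|]. replace (s / (2 * PI) * (2 * PI)) with s by (field; lra). nra. }
    assert (/ 0.7072 >= 1.414) by lra. assert (/ 2.88 <= 0.3473) by lra.
    set (t := s / (2 * PI)) in *.
    assert (1.414 * t <= / 0.7072 * t) by nra. assert (/ 2.88 * t <= 0.3473 * t) by nra. lra.
Qed.

Lemma vert_bound b0 b1 E : a0 <= b0 <= b1 -> b1 <= PI ->
  (forall b, b0 <= b <= b1 -> Cmod (Jfun (vert b)) <= E) ->
  Rabs (Im (Psi c n0 (vert b1)) - Im (Psi c n0 (vert b0))) <= E1 * E * (b1 - b0).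
Proof.
  intros H1 H2 H3. pose proof PI_bounds.
  replace (Im (Psi c n0 (vert b1)) - Im (Psi c n0 (vert b0))) with
    (Im (Psi c n0 (vert b1)) - Im (Psi c n0 (vert b0)) - ((fun _ => 0) b1 - (fun _ => 0) b0)) by (cbv beta; ring).
  apply (mean_value_Im (fun b => Psi c n0 (vert b))
    (fun b => Ci * (Cexp (RtoC (INR n) * vert b) * Jfun (vert b)))%C (fun _ => 0) (fun _ => 0)); try lra.
  - intros t Ht. apply (Psi_deriv c hc n0 vert (fun _ => Ci) _ _ _ _ t vert_path). lra.
  - intros; apply der_const.
  - intros t Ht. rewrite Rminus_0_r. eapply Rle_trans; [apply Im_le_Cmod|].
    rewrite !Cmod_mult, Cmod_Ci, Rmult_1_l.
    apply Rmult_le_compat; try apply Cmod_nonneg; [apply exp_nvert | apply H3, Ht].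
Qed.

(** The exponent comes from the upper part of the vertical segment: 3 * 0.7072 * 2 pi - 4.06 < 4 pi
    - 3.25. The arc, the lower part and the upper part take 1, 1 and 7 of the factor 9. *)
Lemma contour_estimate :
  Rabs (PI * IZR (c n) - R0 * arcint s) <= 9 * exp (4 * PI * s + 12 - 3.25 * s).
Proof.
  destruct a0_bounds as [A0 A1]. destruct R0_bounds as [R1 R2]. pose proof PI_bounds as Pb.
  pose proof arc_part as Q1.
  pose proof (vert_bound a0 (3 * R0) (2 * E1) ltac:(lra) ltac:(lra) ltac:(intros; apply vert_major; lra)) as Q2.
  pose proof (vert_bound (3 * R0) PI _ ltac:(lra) ltac:(lra) ltac:(intros; apply vert_minor; lra)) as Q3.
  set (E2 := 2 * exp (2 * 0.7072 * (2 * PI * s)) * exp (12 - 4.06 * s)) in *.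
  assert (S0 : Im (Psi c n0 (arc 0)) = 0).
  { assert (Ea : arc 0 = RtoC R0) by (rewrite arc_eq, cos_0, sin_0; apply C_eq; simpl; ring).
    rewrite Ea. rewrite (Psi_Im_real c n0 (RtoC R0) (exp (- R0)) (exp R0)).
    - change (Im (RtoC R0)) with 0. ring.
    - apply Cexp_Ropp.
    - apply Cexp_R. }
  assert (S1 : arc (PI / 4) = vert a0).
  { rewrite arc_eq. unfold vert, a0. rewrite sin_PI4, cos_PI4. reflexivity. }
  assert (S2 : Im (Psi c n0 (vert PI)) = IZR (c n) * PI).
  { apply (Psi_Im_real c n0 (vert PI) (- exp (- a0)) (- exp a0)).
    - apply C_eq; unfold Cexp, vert, Re, Im; simpl; rewrite ?cos_neg, ?sin_neg, ?cos_PI, ?sin_PI; ring.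
    - apply C_eq; unfold Cexp, vert, Re, Im; simpl; rewrite ?cos_PI, ?sin_PI; ring. }
  rewrite S0, S1 in Q1. rewrite S2 in Q3.
  set (T := exp (4 * PI * s + 12 - 3.25 * s)).
  assert (T0 : 0 < T) by apply exp_pos.
  assert (Ps : 3.14 * s <= PI * s <= 3.15 * s) by (split; apply Rmult_le_compat_r; lra).
  assert (B1 : J_cusp_bound * exp (2 * PI * s) <= T).
  { apply Rle_trans with (exp (15 + 15 + 15) * exp (2 * PI * s)).
    - apply Rmult_le_compat_r; [left; apply exp_pos | apply J_cusp_bound_le].
    - unfold T. rewrite <- exp_plus. apply exp_le. lra. }
  assert (B2 : E1 * (2 * E1) * (3 * R0 - a0) <= T).
  { apply Rle_trans with (E1 * E1 * exp 12).
    - assert (0 < E1 * E1) by (apply Rmult_lt_0_compat; apply exp_pos).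
      replace (E1 * (2 * E1) * (3 * R0 - a0)) with (E1 * E1 * (2 * (3 * R0 - a0))) by ring.
      apply Rmult_le_compat_l; [lra|]. pose proof (exp_ineq1_le 12). lra.
    - unfold E1, T. rewrite <- !exp_plus. apply exp_le. lra. }
  assert (B3 : E1 * E2 * (PI - 3 * R0) <= 7 * T).
  { unfold E2. assert (Q : E1 * exp (2 * 0.7072 * (2 * PI * s)) * exp (12 - 4.06 * s) <= T).
    { unfold E1, T. rewrite <- !exp_plus. apply exp_le. lra. }
    replace (E1 * (2 * exp (2 * 0.7072 * (2 * PI * s)) * exp (12 - 4.06 * s)) * (PI - 3 * R0)) with
      (E1 * exp (2 * 0.7072 * (2 * PI * s)) * exp (12 - 4.06 * s) * (2 * (PI - 3 * R0))) by ring.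
    rewrite (Rmult_comm 7). apply Rmult_le_compat; auto; try lra.
    left; repeat apply Rmult_lt_0_compat; apply exp_pos. }
  apply Rabs_le_between in Q1. apply Rabs_le_between in Q2. apply Rabs_le_between in Q3.
  apply Rabs_le. lra.
Qed.
End Contour.

(** * The Laplace integral *)

Ltac eq_R := match goal with |- @eq _ ?a ?b => change (@eq R a b) end.

Lemma gauss_deriv_inner (x t : R) : is_derive (fun x => exp (- (x * x) * (1 + t * t)) / (1 + t * t)) x
  (- 2 * x * exp (- (x * x) * (1 + t * t))).
Proof.
  auto_derive; [nra|]. field. nra.
Qed.

Definition gint (x : R) : R := RInt (fun t => exp (- (t * t))) 0 x.
(** The auxiliary parameter integral of the classical evaluation of the Gaussian integral: [gint]^2
    + [gpar] is constant. *)
Definition gpar (x : R) : R := RInt (fun t => exp (- (x * x) * (1 + t * t)) / (1 + t * t)) 0 1.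

Lemma gint_der (x : R) : is_derive gint x (exp (- (x * x))).
Proof.
  apply (RInt_der (fun t => exp (- (t * t)))). intros t.
  apply (ex_derive_continuous (fun t => exp (- (t * t)))). auto_derive; auto.
Qed.

(** Differentiation under the integral sign, followed by the substitution u = x t. *)
Lemma gpar_der (x : R) : is_derive gpar x (- 2 * exp (- (x * x)) * gint x).
Proof.
  assert (E : RInt (fun t => Derive (fun u => exp (- (u * u) * (1 + t * t)) / (1 + t * t)) x) 0 1
    = - 2 * exp (- (x * x)) * gint x).
  { apply is_RInt_unique.
    (* The summand 0 gives the argument the affine shape expected by [is_RInt_comp_lin]. *)
    apply (is_RInt_ext (fun t => scal (- 2 * exp (- (x * x))) (scal x (exp (- ((x * t + 0) * (x * t + 0))))))).
    { intros t _. symmetry. apply (eq_trans (is_derive_unique _ _ _ (gauss_deriv_inner x t))). eq_R.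
      unfold scal; simpl; unfold mult; simpl.
      replace (- (x * x) * (1 + t * t)) with (- (x * x) + - ((x * t + 0) * (x * t + 0))) by ring.
      rewrite exp_plus. ring. }
    apply (is_RInt_scal (V := R_NormedModule)).
    apply (is_RInt_comp_lin (V := R_NormedModule) (fun t => exp (- (t * t))) x 0 0 1).
    replace (x * 0 + 0) with 0 by ring. replace (x * 1 + 0) with x by ring.
    apply (@RInt_correct R_CompleteNormedModule), ex_RInt_cont. intros t.
    apply (ex_derive_continuous (fun t => exp (- (t * t)))). auto_derive; auto. }
  rewrite <- E. unfold gpar.
  apply (is_derive_RInt_param (fun u t => exp (- (u * u) * (1 + t * t)) / (1 + t * t)) 0 1 x).
  - apply filter_forall. intros y t _. eexists. apply gauss_deriv_inner.
  - intros t _. apply (continuity_2d_pt_ext (fun u v => - 2 * u * exp (- (u * u) * (1 + v * v)))).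
    { intros u v. symmetry. apply is_derive_unique, gauss_deriv_inner. }
    apply continuity_2d_pt_mult.
    + apply continuity_2d_pt_mult; [apply continuity_2d_pt_const | apply continuity_2d_pt_id1].
    + apply (continuity_1d_2d_pt_comp exp (fun u v => - (u * u) * (1 + v * v))).
      * apply derivable_continuous, derivable_exp.
      * apply continuity_2d_pt_mult.
        -- apply continuity_2d_pt_opp, continuity_2d_pt_mult; apply continuity_2d_pt_id1.
        -- apply continuity_2d_pt_plus; [apply continuity_2d_pt_const|].
           apply continuity_2d_pt_mult; apply continuity_2d_pt_id2.
  - apply filter_forall. intros y. apply ex_RInt_cont. intros t.
    apply (ex_derive_continuous (fun t => exp (- (y * y) * (1 + t * t)) / (1 + t * t))). auto_derive. nra.
Qed.

Lemma gpar_0 : gpar 0 = PI / 4.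
Proof.
  unfold gpar. apply is_RInt_unique.
  apply (is_RInt_ext (fun t => / (1 + t ^ 2))).
  - intros t _. replace (- (0 * 0) * (1 + t * t)) with 0 by ring. rewrite exp_0. simpl. field. nra.
  - replace (PI / 4) with (minus (atan 1) (atan 0)) by (rewrite atan_1, atan_0; unfold minus, plus, opp; simpl; ring).
    apply (is_RInt_derive atan (fun t => / (1 + t ^ 2))).
    + intros t _. apply is_derive_Reals.
      apply derivable_pt_lim_atan.
    + intros t _. apply (ex_derive_continuous (fun t => / (1 + t ^ 2))). auto_derive. simpl; nra.
Qed.

Lemma gint_gpar x : 0 <= x -> gint x ^ 2 + gpar x = PI / 4.
Proof.
  intros H. 
  assert (E : (fun y => gint y * gint y + gpar y) 0 = (fun y => gint y * gint y + gpar y) x).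
  { assert (D : forall y, is_derive (fun y => gint y * gint y + gpar y) y 0).
    { intros y. eapply der_eq; [apply der_plus; [apply der_mult; apply gint_der | apply gpar_der]|]. ring. }
    apply (is_derive_zero_const (fun y => gint y * gint y + gpar y) 0 x); auto. intros y _. eapply is_derive_continuity_pt, D. }
  cbv beta in E. rewrite gpar_0 in E. unfold gint at 1 2 in E. rewrite RInt_point in E.
  unfold zero in E; simpl in E. simpl. lra.
Qed.

Lemma rint_scal (f : R -> R) a b k : ex_RInt f a b -> RInt (fun t => k * f t) a b = k * RInt f a b.
Proof. apply (RInt_scal (V := R_CompleteNormedModule) f a b k). Qed.

Lemma gpar_bound x : 0 <= gpar x <= exp (- (x * x)) * (PI / 4).
Proof.
  assert (Cf : forall y, ex_RInt (fun t => exp (- (y * y) * (1 + t * t)) / (1 + t * t)) 0 1).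
  { intros y. apply ex_RInt_cont. intros t.
    apply (ex_derive_continuous (fun t => exp (- (y * y) * (1 + t * t)) / (1 + t * t))). auto_derive. nra. }
  split.
  - apply RInt_ge_0; [lra | apply Cf |]. intros t _. apply Rdiv_le_0_compat; [left; apply exp_pos | nra].
  - rewrite <- gpar_0. unfold gpar at 2.
    rewrite <- rint_scal by apply Cf.
    apply RInt_le; [lra | apply Cf | apply (ex_RInt_scal (V := R_NormedModule)), Cf |].
    intros t _.
    replace (- (0 * 0) * (1 + t * t)) with 0 by ring. rewrite exp_0. unfold Rdiv. rewrite Rmult_1_l.
    apply Rmult_le_compat_r; [left; apply Rinv_0_lt_compat; nra|]. apply exp_le. 
    assert (0 <= x * x * (t * t)) by (apply Rmult_le_pos; nra). lra.
Qed.

(** Solving [gint_gpar] for [gint], with [gpar] between 0 and e^(-x^2) pi / 4; the lower bound uses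
    (1 - e)^2 <= 1 - e for e in [0, 1]. *)
Lemma gint_bounds x : 0 <= x ->
  sqrt PI / 2 * (1 - exp (- (x * x))) <= gint x <= sqrt PI / 2.
Proof.
  intros H. pose proof (gint_gpar x H) as E. pose proof (gpar_bound x) as B. pose proof PI_bounds as Pb.
  assert (G0 : 0 <= gint x).
  { apply RInt_ge_0; auto; [|intros; left; apply exp_pos]. apply ex_RInt_cont. intros t.
    apply (ex_derive_continuous (fun t => exp (- (t * t)))). auto_derive; auto. }
  assert (e1 : 0 < exp (- (x * x)) <= 1).
  { split; [apply exp_pos|]. rewrite <- exp_0. apply exp_le. nra. }
  pose proof (sqrt_sqrt PI ltac:(lra)) as Q. pose proof (sqrt_pos PI) as Q0.
  set (e := exp (- (x * x))) in *. set (p := sqrt PI) in *.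
  split; apply Rsqr_incr_0_var; auto; try lra; unfold Rsqr.
  - replace (p / 2 * (1 - e) * (p / 2 * (1 - e))) with (p * p * ((1 - e) * (1 - e)) / 4) by field. rewrite Q.
    assert ((1 - e) * (1 - e) <= 1 - e) by nra.
    assert (PI * ((1 - e) * (1 - e)) <= PI * (1 - e)) by (apply Rmult_le_compat_l; lra). simpl in E. lra.
  - replace (p / 2 * (p / 2)) with (p * p / 4) by field. rewrite Q. simpl in E. lra.
Qed.

Lemma nonincreasing_of_deriv (H H' : R -> R) b : 0 <= b ->
  (forall t, 0 <= t <= b -> is_derive H t (H' t)) -> (forall t, 0 <= t <= b -> H' t <= 0) -> H b <= H 0.
Proof.
  intros Hb D N.
  destruct (MVT_gen H 0 b H') as [x [Hx E]].
  - intros x; rewrite Rmin_left, Rmax_right by lra; intros; apply D; lra.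
  - intros x; rewrite Rmin_left, Rmax_right by lra; intros. eapply is_derive_continuity_pt, D; lra.
  - rewrite Rmin_left, Rmax_right in Hx by lra. specialize (N x Hx). nra.
Qed.

Section Moments.
Variable z : R.
Hypothesis Hz : 3 <= z.

(** With u = sin (t / 2) one has exp (z cos t) = exp z * gw u. *)
Definition gw (u : R) : R := exp (- (2 * z * (u * u))).
Definition mom (j : nat) (x : R) : R := RInt (fun u => u ^ j * gw u) 0 x.

Lemma mom_der j x : is_derive (mom j) x (x ^ j * gw x).
Proof.
  apply (RInt_der (fun u => u ^ j * gw u)). intros t.
  apply (ex_derive_continuous (fun u => u ^ j * gw u)). unfold gw. auto_derive; auto.
Qed.
Lemma mom_0 j : mom j 0 = 0.
Proof. unfold mom. rewrite RInt_point. reflexivity. Qed.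

(** Integration by parts, carried out as the constancy of a function of the upper limit. *)
Lemma mom_step j x : 0 <= x ->
  INR (S j) * mom j x - 4 * z * mom (S (S j)) x = x ^ S j * gw x.
Proof.
  intros Hx.
  assert (E : (fun x => INR (S j) * mom j x - 4 * z * mom (S (S j)) x - x ^ S j * gw x) 0 =
              (fun x => INR (S j) * mom j x - 4 * z * mom (S (S j)) x - x ^ S j * gw x) x).
  { assert (D : forall y : R, is_derive (fun x => INR (S j) * mom j x - 4 * z * mom (S (S j)) x - x ^ S j * gw x) y 0).
    { intros y.
      assert (DP : is_derive (fun x => x ^ S j * gw x) y (INR (S j) * (y ^ j * gw y) - 4 * z * (y ^ S (S j) * gw y))).
      { assert (D1 : is_derive (fun x => x ^ S j) y (INR (S j) * 1 * y ^ j)).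
        { apply (is_derive_pow (fun x => x) (S j) y 1). apply der_id. }
        assert (D2 : is_derive gw y (- (4 * z * y) * gw y)).
        { unfold gw. auto_derive; auto. ring. }
        eapply der_eq; [apply (der_mult _ _ _ _ _ D1 D2)|]. simpl pow. ring. }
      eapply der_eq; [apply der_minus; [apply der_minus; (apply der_mult; [apply der_const | apply mom_der]) | exact DP]|].
      cbv beta. ring. }
    apply (is_derive_zero_const (fun x => INR (S j) * mom j x - 4 * z * mom (S (S j)) x - x ^ S j * gw x) 0 x); auto.
    intros y _. eapply is_derive_continuity_pt, D. }
  cbv beta in E. rewrite !mom_0, pow_ne_zero in E by discriminate. lra.
Qed.

Lemma mom0_gint x : 0 <= x -> mom 0 x = gint (sqrt (2 * z) * x) / sqrt (2 * z).
Proof.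
  intros Hx. assert (k0 : 0 < sqrt (2 * z)) by (apply sqrt_lt_R0; lra).
  pose proof (sqrt_sqrt (2 * z) ltac:(lra)) as K. set (k := sqrt (2 * z)) in *.
  assert (E : (fun x => mom 0 x - gint (k * x) * / k) 0 = (fun x => mom 0 x - gint (k * x) * / k) x).
  { assert (D : forall y : R, is_derive (fun x => mom 0 x - gint (k * x) * / k) y 0).
    { intros y.
      assert (D2 : is_derive (fun x => gint (k * x)) y (k * exp (- ((k * y) * (k * y))))).
      { apply (der_comp gint (fun x => k * x) y); [apply gint_der|].
        eapply der_eq; [apply der_mult; [apply der_const | apply der_id]|]. cbv beta. ring. }
      eapply der_eq; [apply der_minus; [apply mom_der | apply (der_mult _ _ _ _ _ D2 (der_const (/ k) y))]|].
      unfold gw. replace ((k * y) * (k * y)) with (2 * z * (y * y)) by (rewrite <- K; ring). cbv beta. simpl pow. field. lra. }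
    apply (is_derive_zero_const (fun x => mom 0 x - gint (k * x) * / k) 0 x); auto.
    intros y _. eapply is_derive_continuity_pt, D. }
  cbv beta in E. rewrite mom_0, Rmult_0_r in E. unfold gint at 1 in E. rewrite RInt_point in E.
  unfold zero in E; simpl in E. unfold Rdiv. lra.
Qed.

Lemma mom0_bounds x : 0 <= x ->
  sqrt PI / 2 / sqrt (2 * z) * (1 - gw x) <= mom 0 x <= sqrt PI / 2 / sqrt (2 * z).
Proof.
  intros Hx. rewrite mom0_gint by auto. assert (k0 : 0 < sqrt (2 * z)) by (apply sqrt_lt_R0; lra).
  pose proof (sqrt_sqrt (2 * z) ltac:(lra)) as K. set (k := sqrt (2 * z)) in *.
  pose proof (gint_bounds (k * x) ltac:(nra)) as B. unfold gw.
  replace ((k * x) * (k * x)) with (2 * z * (x * x)) in B by (rewrite <- K; ring).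
  assert (0 < / k) by (apply Rinv_0_lt_compat; auto). unfold Rdiv in *. split.
  - replace (sqrt PI * / 2 * / k * (1 - exp (- (2 * z * (x * x))))) with (sqrt PI * / 2 * (1 - exp (- (2 * z * (x * x)))) * / k) by ring.
    apply Rmult_le_compat_r; lra.
  - apply Rmult_le_compat_r; lra.
Qed.

(* The weights are the Taylor coefficients of (1 - 2 u^2) / sqrt (1 - u^2) in u^2, which is
   cos t dt / (2 du) for u = sin (t / 2). *)
Definition amom (x : R) : R :=
  mom 0 x - 3 / 2 * mom 2 x - 5 / 8 * mom 4 x - 7 / 16 * mom 6 x - 45 / 128 * mom 8 x - 77 / 256 * mom 10 x.
(** The combination [amom] with the moment of order 2 j replaced by (2 j - 1)!! / N^j times that of
    order 0, as for the complete Gaussian with N = 4 z. *)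
Definition mtil (N : R) : R :=
  1 - 3 / 2 / N - 5 / 8 * 3 / N ^ 2 - 7 / 16 * 15 / N ^ 3 - 45 / 128 * 105 / N ^ 4 - 77 / 256 * 945 / N ^ 5.

Lemma moments x : 0 <= x <= 1 ->
  Rabs (amom x - mtil (4 * z) * mom 0 x) <= 4 * gw x /\
  0 <= mom 12 x <= 10395 / (4 * z) ^ 6 * mom 0 x.
Proof.
  intros Hx. set (N := 4 * z). assert (HN : 12 <= N) by (unfold N; lra).
  set (e := gw x). assert (e0 : 0 < e) by apply exp_pos.
  assert (P : forall j, 0 <= x ^ j <= 1).
  { intros j. split; [apply pow_le; lra|]. rewrite <- (pow1 j). apply pow_incr; lra. }
  assert (St : forall j, mom (S (S j)) x = (INR (S j) * mom j x - x ^ S j * e) / N).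
  { intros j. pose proof (mom_step j x ltac:(lra)) as Q. fold N e in Q. rewrite <- Q. field. lra. }
  assert (M12 : 0 <= mom 12 x).
  { apply RInt_ge_0; [lra | |].
    - apply ex_RInt_cont. intros t. apply (ex_derive_continuous (fun u => u ^ 12 * gw u)). unfold gw. auto_derive; auto.
    - intros t Ht. apply Rmult_le_pos; [apply pow_le; lra | left; apply exp_pos]. }
  set (g := mom 0 x) in *. set (w := / N).
  assert (w0 : 0 < w <= / 12) by (split; [apply Rinv_0_lt_compat; lra | apply Rinv_le_contravar; lra]).
  (* Invariant of the iteration: the accumulated boundary part c stays in [0, e], because each step
     divides by N >= 12 and multiplies by at most 11 before adding at most e / N. *)
  assert (D : forall j a c, mom j x = a * g - c -> 0 <= c <= e -> INR (S j) <= 11 ->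
     exists c', mom (S (S j)) x = (INR (S j) * w * a) * g - c' /\ 0 <= c' <= e).
  { intros j a c E Hc Hj. exists (w * (INR (S j) * c + x ^ S j * e)). split.
    - rewrite St, E. unfold w. field. lra.
    - specialize (P (S j)). pose proof (pos_INR (S j)). split.
      + apply Rmult_le_pos; [lra|]. nra.
      + apply Rle_trans with (/ 12 * (11 * e + 1 * e)); [|lra].
        apply Rmult_le_compat; try lra; [nra|]. apply Rplus_le_compat; [|apply Rmult_le_compat_r; lra].
        apply Rmult_le_compat; lra. }
  destruct (D 0%nat 1 0 ltac:(fold g; ring) ltac:(lra) ltac:(simpl; lra)) as [c1 [E1 H1]].
  destruct (D 2%nat _ _ E1 H1 ltac:(simpl; lra)) as [c2 [E2 H2]].
  destruct (D 4%nat _ _ E2 H2 ltac:(simpl; lra)) as [c3 [E3 H3]].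
  destruct (D 6%nat _ _ E3 H3 ltac:(simpl; lra)) as [c4 [E4 H4]].
  destruct (D 8%nat _ _ E4 H4 ltac:(simpl; lra)) as [c5 [E5 H5]].
  destruct (D 10%nat _ _ E5 H5 ltac:(simpl; lra)) as [c6 [E6 H6]].
  split.
  - unfold amom, mtil. rewrite E1, E2, E3, E4, E5. fold g.
    simpl INR.
    match goal with |- Rabs ?t <= _ => replace t with (3 / 2 * c1 + 5 / 8 * c2 + 7 / 16 * c3 + 45 / 128 * c4 + 77 / 256 * c5) end.
    + rewrite Rabs_pos_eq; lra.
    + unfold w. field. lra.
  - split; auto. rewrite E6. simpl INR.
    match goal with |- ?t <= _ => replace t with (10395 / N ^ 6 * g - c6) end; [lra|].
    unfold w. field. lra.
Qed.

(** The polynomial T is the Taylor polynomial of (1 - 2 x) / sqrt (1 - x). Multiplying by the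
    conjugate removes the root y: (1 - 2 x)^2 - (1 - x) T^2 = x^6 Q with Q small. The range 0.15
    covers sin^2 (pi / 8). *)
Lemma integrand_poly x y : 0 <= x <= 0.15 -> 0 < y -> y * y = 1 - x ->
  Rabs (1 - 2 * x - y * (1 - 3 / 2 * x - 5 / 8 * x ^ 2 - 7 / 16 * x ^ 3 - 45 / 128 * x ^ 4 - 77 / 256 * x ^ 5))
   <= y * x ^ 6.
Proof.
  intros Hx Hy E.
  set (T := 1 - 3 / 2 * x - 5 / 8 * x ^ 2 - 7 / 16 * x ^ 3 - 45 / 128 * x ^ 4 - 77 / 256 * x ^ 5).
  set (Q := -273 / 512 + 435 / 512 * x + 4863 / 16384 * x ^ 2 + 359 / 2048 * x ^ 3 + 7931 / 65536 * x ^ 4 + 5929 / 65536 * x ^ 5).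
  assert (F : (1 - 2 * x - y * T) * (1 - 2 * x + y * T) = x ^ 6 * Q).
  { transitivity ((1 - 2 * x) ^ 2 - (y * y) * T ^ 2); [ring|]. rewrite E. unfold T, Q. field. }
  assert (b2 : 0 <= x ^ 2 <= 0.15 * x) by (simpl; nra).
  assert (b3 : 0 <= x ^ 3 <= 0.15 * x) by (simpl in *; nra).
  assert (b4 : 0 <= x ^ 4 <= 0.15 * x) by (simpl in *; nra).
  assert (b5 : 0 <= x ^ 5 <= 0.15 * x) by (simpl in *; nra).
  assert (b6 : 0 <= x ^ 6) by (apply pow_le; lra).
  assert (TL : 0.7 <= T) by (unfold T; lra).
  assert (QL : Rabs Q <= 0.6) by (unfold Q; apply Rabs_le; lra).
  assert (yL : 0.9 <= y) by nra.
  assert (SL : 1.3 <= 1 - 2 * x + y * T) by nra.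
  apply Rmult_le_reg_r with (1 - 2 * x + y * T); [lra|].
  rewrite <- (Rabs_pos_eq (1 - 2 * x + y * T)) at 1 by lra.
  rewrite <- Rabs_mult, F, Rabs_mult, (Rabs_pos_eq (x ^ 6)) by auto.
  apply Rle_trans with (x ^ 6 * 0.6); [apply Rmult_le_compat_l; auto|].
  replace (y * x ^ 6 * (1 - 2 * x + y * T)) with (x ^ 6 * (y * (1 - 2 * x + y * T))) by ring.
  apply Rmult_le_compat_l; auto. nra.
Qed.

Lemma sin_half_sqr_bound t : 0 <= t <= PI / 4 -> 0 <= sin (t / 2) * sin (t / 2) <= 0.15.
Proof.
  intros Ht. pose proof PI_bounds. pose proof cos_PI4_bounds.
  assert (E : cos t = 1 - 2 * sin (t / 2) * sin (t / 2)) by (rewrite <- cos_2a_sin; f_equal; field).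
  assert (cos (PI / 4) <= cos t) by (apply cos_decr_1; lra).
  split; [nra | lra].
Qed.

(** Apply [integrand_poly] at x = u^2 and y = cos (t / 2); the factor cos (t / 2) / 2 is du / dt. *)
Lemma laplace_pointwise t : 0 <= t <= PI / 4 ->
  let u := sin (t / 2) in
  Rabs (cos t * exp (z * cos t) -
    2 * exp z * ((1 - 3 / 2 * u ^ 2 - 5 / 8 * u ^ 4 - 7 / 16 * u ^ 6 - 45 / 128 * u ^ 8 - 77 / 256 * u ^ 10) * gw u * (cos (t / 2) / 2)))
  <= 2 * exp z * (u ^ 12 * gw u * (cos (t / 2) / 2)).
Proof.
  intros Ht u. pose proof PI_bounds. pose proof (sin_half_sqr_bound t Ht) as B. fold u in B.
  assert (E : cos t = 1 - 2 * (u * u)) by (replace t with (2 * (t / 2)) by field; rewrite cos_2a_sin; unfold u; ring).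
  assert (Y : 0 < cos (t / 2)) by (apply cos_gt_0; lra).
  assert (YY : cos (t / 2) * cos (t / 2) = 1 - u * u) by (pose proof (sin2_cos2 (t / 2)) as Q; unfold Rsqr in Q; unfold u; lra).
  pose proof (integrand_poly (u * u) (cos (t / 2)) B Y YY) as P.
  assert (X : exp (z * cos t) = exp z * gw u).
  { unfold gw. rewrite <- exp_plus. f_equal. rewrite E. ring. }
  rewrite X. rewrite E at 1.
  set (y := cos (t / 2)) in *.
  match goal with |- Rabs ?a <= ?b => replace a with (exp z * gw u * (1 - 2 * (u * u) - y * (1 - 3 / 2 * (u * u) - 5 / 8 * (u * u) ^ 2 - 7 / 16 * (u * u) ^ 3 - 45 / 128 * (u * u) ^ 4 - 77 / 256 * (u * u) ^ 5))) by field;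
    replace b with (exp z * gw u * (y * (u * u) ^ 6)) by field end.
  assert (0 < exp z * gw u) by (apply Rmult_lt_0_compat; apply exp_pos).
  rewrite Rabs_mult, (Rabs_pos_eq (exp z * gw u)) by lra. apply Rmult_le_compat_l; lra.
Qed.

Lemma sin_half_der (t : R) : is_derive (fun t => sin (t / 2)) t (cos (t / 2) / 2).
Proof. auto_derive; auto. unfold Rdiv. ring. Qed.

Lemma comp_mom_der j (t : R) : is_derive (fun t => mom j (sin (t / 2))) t
  (cos (t / 2) / 2 * (sin (t / 2) ^ j * gw (sin (t / 2)))).
Proof. apply (der_comp (mom j) (fun t => sin (t / 2))); [apply mom_der | apply sin_half_der]. Qed.

Lemma amom_der (t : R) : is_derive (fun t => amom (sin (t / 2))) t
  ((1 - 3 / 2 * sin (t / 2) ^ 2 - 5 / 8 * sin (t / 2) ^ 4 - 7 / 16 * sin (t / 2) ^ 6 - 45 / 128 * sin (t / 2) ^ 8 - 77 / 256 * sin (t / 2) ^ 10) * gw (sin (t / 2)) * (cos (t / 2) / 2)).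
Proof.
  assert (M : forall a j, is_derive (fun t => a * mom j (sin (t / 2))) t
    (a * (cos (t / 2) / 2 * (sin (t / 2) ^ j * gw (sin (t / 2)))))).
  { intros a j. eapply der_eq; [apply (der_mult _ _ _ _ _ (der_const a t) (comp_mom_der j t))|]. cbv beta. ring. }
  pose proof (der_minus _ _ _ _ _ (der_minus _ _ _ _ _ (der_minus _ _ _ _ _ (der_minus _ _ _ _ _
    (der_minus _ _ _ _ _ (comp_mom_der 0 t) (M (3 / 2) 2%nat)) (M (5 / 8) 4%nat)) (M (7 / 16) 6%nat))
    (M (45 / 128) 8%nat)) (M (77 / 256) 10%nat)) as D.
  eapply der_eq; [exact D|]. ring.
Qed.

(** No integral is substituted: both sides are functions of the upper limit that vanish at 0, and
    [laplace_pointwise] compares their derivatives. The sign sg treats the two directions of the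
    absolute value. *)
Lemma laplace_arc : let X := sin (PI / 4 / 2) in
  Rabs (RInt (fun t => cos t * exp (z * cos t)) 0 (PI / 4) - 2 * exp z * amom X) <= 2 * exp z * mom 12 X.
Proof.
  intros X. pose proof PI_bounds as Pb.
  set (f := fun t => cos t * exp (z * cos t)).
  assert (Df : forall t : R, is_derive (fun x => RInt f 0 x) t (f t)).
  { intros t. apply RInt_der. intros u. apply (ex_derive_continuous f). unfold f. auto_derive; auto. }
  assert (X0 : sin (0 / 2) = 0) by (unfold Rdiv; rewrite Rmult_0_l; apply sin_0).
  assert (A0 : amom 0 = 0) by (unfold amom; rewrite !mom_0; ring).
  assert (F0 : RInt f 0 0 = 0) by (rewrite RInt_point; reflexivity).
  assert (U : forall sg, (sg = 1 \/ sg = -1) ->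
    sg * (RInt f 0 (PI / 4) - 2 * exp z * amom X) - 2 * exp z * mom 12 X <= 0).
  { intros sg Hsg.
    pose proof (nonincreasing_of_deriv
      (fun t => sg * (RInt f 0 t - 2 * exp z * amom (sin (t / 2))) - 2 * exp z * mom 12 (sin (t / 2)))
      (fun t => sg * (f t - 2 * exp z * ((1 - 3 / 2 * sin (t / 2) ^ 2 - 5 / 8 * sin (t / 2) ^ 4 - 7 / 16 * sin (t / 2) ^ 6 - 45 / 128 * sin (t / 2) ^ 8 - 77 / 256 * sin (t / 2) ^ 10) * gw (sin (t / 2)) * (cos (t / 2) / 2)))
         - 2 * exp z * (sin (t / 2) ^ 12 * gw (sin (t / 2)) * (cos (t / 2) / 2))) (PI / 4) ltac:(lra)) as N.
    cbv beta in N. rewrite F0, X0, A0, mom_0 in N.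
    apply Rle_trans with (sg * (0 - 2 * exp z * 0) - 2 * exp z * 0); [apply N | lra].
    - intros t Ht. eapply der_eq.
      + exact (der_minus _ _ _ _ _ (der_mult _ _ _ _ _ (der_const sg t) (der_minus _ _ _ _ _ (Df t)
          (der_mult _ _ _ _ _ (der_const (2 * exp z) t) (amom_der t))))
          (der_mult _ _ _ _ _ (der_const (2 * exp z) t) (comp_mom_der 12 t))).
      + cbv beta. ring.
    - intros t Ht. pose proof (laplace_pointwise t Ht) as L. cbv zeta in L. fold (f t) in L.
      apply Rabs_le_between in L. destruct Hsg as [-> | ->]; lra. }
  pose proof (U 1 (or_introl eq_refl)). pose proof (U (-1) (or_intror eq_refl)).
  apply Rabs_le. lra.
Qed.
End Moments.

(** * The closed form of the bounds, and the range n >= 225 *)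

Lemma Rpower_half x : 0 < x -> Rpower x (1 / 2) = sqrt x.
Proof. intros. replace (1 / 2) with (/ 2) by field. apply Rpower_sqrt; auto. Qed.
Lemma Rpower_quarter x : 0 < x -> Rpower x (1 / 4) = sqrt (sqrt x).
Proof.
  intros. replace (1 / 4) with (1 / 2 * (1 / 2)) by lra.
  rewrite <- Rpower_mult, (Rpower_half x) by auto. apply Rpower_half, sqrt_lt_R0; auto.
Qed.
Lemma Rpower_3_4 x : 0 < x -> Rpower x (3 / 4) = sqrt x * sqrt (sqrt x).
Proof.
  intros. replace (3 / 4) with (1 / 2 + 1 / 4) by lra.
  rewrite Rpower_plus, Rpower_half, Rpower_quarter by auto. reflexivity.
Qed.
Lemma Rpower_half_mult x (p : nat) : 0 < x -> Rpower x (INR p / 2) = sqrt x ^ p.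
Proof.
  intros. replace (INR p / 2) with (1 / 2 * INR p) by field.
  rewrite <- Rpower_mult, (Rpower_half x) by auto. apply Rpower_pow, sqrt_lt_R0; auto.
Qed.

Definition msqrt (s : R) : R :=
  1 - 3 / (32 * PI * s) - 15 / (2048 * PI ^ 2 * s ^ 2) - 105 / (65536 * PI ^ 3 * s ^ 3)
    - 4725 / (8388608 * PI ^ 4 * s ^ 4) - 72765 / (268435456 * PI ^ 5 * s ^ 5).

Lemma m_msqrt n : (1 <= n)%nat -> m n = msqrt (sqrt (INR n)).
Proof.
  intros Hn. assert (Hp : 0 < INR n) by (apply lt_0_INR; lia).
  pose proof (sqrt_sqrt (INR n) ltac:(lra)) as Q.
  unfold m, msqrt. cbv zeta.
  replace (3 / 2) with (INR 3 / 2) by (simpl; field). replace (5 / 2) with (INR 5 / 2) by (simpl; field).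
  rewrite Rpower_half, !Rpower_half_mult by auto.
  set (s := sqrt (INR n)) in *.
  replace (INR n) with (s ^ 2) by (rewrite <- Q; ring).
  replace ((s ^ 2) ^ 2) with (s ^ 4) by ring. reflexivity.
Qed.

(** Identifies the coefficients of m(n): they are those of the Laplace expansion at z = 4 pi s, that
    is N = 16 pi s. *)
Lemma msqrt_mtil s : 0 < s -> msqrt s = mtil (4 * (4 * PI * s)).
Proof. intros H. pose proof PI_bounds. unfold msqrt, mtil. field. lra. Qed.

Definition amp (s : R) : R := exp (4 * PI * s) / (sqrt 2 * (s * sqrt s)).

Lemma kl_amp n : (1 <= n)%nat -> let s := sqrt (INR n) in
  k n = amp s * (msqrt s - 1.57696 / 10 ^ 5 / s ^ 6) /\ l n = amp s * (msqrt s + 1.57696 / 10 ^ 5 / s ^ 6).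
Proof.
  intros Hn s. assert (Hp : 0 < INR n) by (apply lt_0_INR; lia).
  pose proof (sqrt_sqrt (INR n) ltac:(lra)) as Q. fold s in Q.
  unfold k, l, amp. cbv zeta. rewrite m_msqrt, Rpower_3_4 by auto. fold s.
  replace (INR n ^ 3) with (s ^ 6) by (rewrite <- Q; ring). split; reflexivity.
Qed.

Lemma exp_1_lower : 2.67 <= exp 1.
Proof.
  replace (exp 1) with (exp (/ 32) ^ 32).
  - pose proof (exp_ineq1_le (/ 32)).
    apply Rle_trans with ((1 + / 32) ^ 32); [lra|]. apply pow_incr; lra.
  - rewrite <- (exp_ln (exp (/ 32))) at 1 by apply exp_pos. rewrite ln_exp, <- Rpower_pow by apply exp_pos.
    unfold Rpower. rewrite ln_exp. f_equal. simpl. field.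
Qed.
Lemma exp_INR n : exp (INR n) = exp 1 ^ n.
Proof.
  rewrite <- Rpower_pow by apply exp_pos. unfold Rpower. rewrite ln_exp. f_equal. ring.
Qed.

(** The tangent bound s / 15 <= exp (s / 15 - 1) turns s^8 into an exponential. The total exponent
    then decreases in s and is 12 - 48.75 at s = 15, below -36. *)
Lemma decay s : 15 <= s -> 4.2 * exp 12 * (s ^ 8 * exp (- (3.25 * s))) <= 0.000014.
Proof.
  intros Hs.
  assert (A : s ^ 8 <= 15 ^ 8 * exp (8 * (s / 15 - 1))).
  { replace (8 * (s / 15 - 1)) with (INR 8 * (s / 15 - 1)) by (simpl; ring).
    replace (exp (INR 8 * (s / 15 - 1))) with (exp (s / 15 - 1) ^ 8).
    - rewrite <- Rpow_mult_distr. apply pow_incr. split; [lra|].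
      pose proof (exp_ineq1_le (s / 15 - 1)). lra.
    - rewrite <- Rpower_pow by apply exp_pos. unfold Rpower. rewrite ln_exp. reflexivity. }
  assert (B : exp 12 * (exp (8 * (s / 15 - 1)) * exp (- (3.25 * s))) <= / exp (INR 36)).
  { rewrite <- !exp_plus, <- exp_Ropp. apply exp_le. simpl. lra. }
  assert (Cc : / exp (INR 36) <= / (2.67 ^ 36)).
  { apply Rinv_le_contravar; [apply pow_lt; lra|]. rewrite exp_INR. apply pow_incr. pose proof exp_1_lower; lra. }
  apply Rle_trans with (4.2 * 15 ^ 8 * (exp 12 * (exp (8 * (s / 15 - 1)) * exp (- (3.25 * s))))).
  - assert (0 < exp 12 * exp (- (3.25 * s))) by (apply Rmult_lt_0_compat; apply exp_pos).
    replace (4.2 * exp 12 * (s ^ 8 * exp (- (3.25 * s)))) with (4.2 * (exp 12 * exp (- (3.25 * s))) * s ^ 8) by ring.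
    replace (4.2 * 15 ^ 8 * (exp 12 * (exp (8 * (s / 15 - 1)) * exp (- (3.25 * s))))) with
      (4.2 * (exp 12 * exp (- (3.25 * s))) * (15 ^ 8 * exp (8 * (s / 15 - 1)))) by ring.
    apply Rmult_le_compat_l; [lra | exact A].
  - apply Rle_trans with (4.2 * 15 ^ 8 * / 2.67 ^ 36); [apply Rmult_le_compat_l; lra | lra].
Qed.

(** All errors are measured relative to [amp s]: the sixth order remainder T of the Laplace
    expansion, the truncation of the Gaussian at X (the terms in g), and the contour error. *)
Lemma large_n (c : nat -> Z) (n : nat) : is_j_coefficients c -> (225 <= n)%nat ->
  let s := sqrt (INR n) in
  Rabs (IZR (c n) - amp s * msqrt s) < amp s * (1.57696 / 10 ^ 5 / s ^ 6).
Proof.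
  intros hc Hn s.
  assert (Hp : 225 <= INR n) by (replace 225 with (INR 225) by (simpl; ring); apply le_INR; auto).
  pose proof (sqrt_sqrt (INR n) ltac:(lra)) as Q. fold s in Q.
  assert (Hs : 15 <= s).
  { unfold s. replace 15 with (sqrt (15 ^ 2)) by (apply sqrt_pow2; lra). apply sqrt_le_1_alt. lra. }
  destruct n as [|n0]; [lia|].
  pose proof (contour_estimate c hc n0 s Hs ltac:(rewrite <- Q; ring)) as CE.
  pose proof PI_bounds as Pb. pose proof cos_PI4_bounds as Cb.
  set (z := 4 * PI * s). assert (Hz : 180 <= z) by (unfold z; nra).
  set (X := sin (PI / 4 / 2)).
  assert (XX : cos (PI / 4) = 1 - 2 * (X * X)) by (replace (PI / 4) with (2 * (PI / 4 / 2)) at 1 by field; rewrite cos_2a_sin; unfold X; ring).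
  assert (X0 : 0 <= X) by (apply sin_ge_0; lra).
  assert (X1 : 0 <= X <= 1) by (split; [auto | apply SIN_bound]).
  pose proof (laplace_arc z) as LA. cbv zeta in LA. fold X in LA. 
  change (RInt (fun t => cos t * exp (z * cos t)) 0 (PI / 4)) with (arcint s) in LA.
  destruct (moments z ltac:(lra) X X1) as [MA MB].
  pose proof (mom0_bounds z ltac:(lra) X X0) as M0.
  set (g := gw z X) in *. set (kap := sqrt PI / 2 / sqrt (2 * z)) in *.
  set (mm := mtil (4 * z)) in *. set (M := mom z 0 X) in *.
  assert (g0 : 0 < g) by apply exp_pos.
  (* Here X^2 = (1 - cos (pi / 4)) / 2 >= 0.1463, so the exponent 8 pi s X^2 exceeds 3.6 s. *)
  assert (gb : g <= exp (- (3.25 * s))).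
  { unfold g, gw. apply exp_le. apply Ropp_le_contravar.
    assert (0.1463 <= X * X) by lra. assert (3.14 * s <= PI * s) by (apply Rmult_le_compat_r; lra).
    unfold z. assert (2 * (4 * (3.14 * s)) * 0.1463 <= 2 * (4 * PI * s) * (X * X)) by (apply Rmult_le_compat; lra). lra. }
  assert (sp : 0 < sqrt PI) by (apply sqrt_lt_R0; lra).
  assert (s8 : sqrt (2 * z) = sqrt PI * (2 * (sqrt 2 * sqrt s))).
  { unfold z. replace (2 * (4 * PI * s)) with (PI * (2 ^ 2 * (2 * s))) by ring.
    rewrite !sqrt_mult by nra. rewrite sqrt_pow2 by lra. reflexivity. }
  assert (q2 : 0 < sqrt 2) by (apply sqrt_lt_R0; lra). assert (qs : 0 < sqrt s) by (apply sqrt_lt_R0; lra).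
  pose proof (sqrt_sqrt 2 ltac:(lra)) as q22. pose proof (sqrt_sqrt s ltac:(lra)) as qss.
  assert (kapE : kap = / (4 * (sqrt 2 * sqrt s))).
  { unfold kap. rewrite s8. field. repeat split; lra. }
  assert (kp : 0 < kap) by (rewrite kapE; apply Rinv_0_lt_compat; nra).
  (* The radius of the arc, the Jacobian factor 2 exp z and the complete Gaussian integral kap
     combine to the prefactor of k and l, with the factor pi of pi c(n). *)
  assert (EB : 2 * PI / s * (2 * exp z * kap) = PI * amp s).
  { rewrite kapE. unfold amp. fold z. field. lra. }
  assert (mmE : msqrt s = mm) by (apply msqrt_mtil; lra).
  assert (mb : 0 <= mm <= 1).
  { unfold mm, mtil. set (N := 4 * z). assert (HN : 700 <= N) by (unfold N; lra).
    assert (i1 : 0 < / N <= / 700) by (split; [apply Rinv_0_lt_compat; lra | apply Rinv_le_contravar; lra]).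
    unfold Rdiv. rewrite <- !pow_inv. set (w := / N) in *.
    assert (0 <= w ^ 2 <= w) by (simpl; nra). assert (0 <= w ^ 3 <= w) by (simpl in *; nra).
    assert (0 <= w ^ 4 <= w) by (simpl in *; nra). assert (0 <= w ^ 5 <= w) by (simpl in *; nra). lra. }
  set (T := 10395 / (4 * z) ^ 6) in *.
  assert (T0 : 0 < T) by (apply Rdiv_lt_0_compat; [lra | apply pow_lt; lra]).
  (* relative error of the truncated Laplace expansion *)
  assert (LE : Rabs (arcint s - 2 * exp z * (mm * kap)) <= 2 * exp z * (kap * (T + g + 4 * g / kap))).
  { replace (kap * (T + g + 4 * g / kap)) with (kap * T + kap * g + 4 * g) by (field; lra).
    assert (W : Rabs (amom z X - mm * kap) <= 4 * g + kap * g).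
    { apply Rabs_le_between in MA. apply Rabs_le.
      assert (0 <= mm * (kap - M) <= kap * g) by (split; [apply Rmult_le_pos; lra | nra]). lra. }
    assert (V : mom z 12 X <= T * kap) by (eapply Rle_trans; [apply MB|]; apply Rmult_le_compat_l; lra).
    pose proof (exp_pos z).
    replace (arcint s - 2 * exp z * (mm * kap)) with
      ((arcint s - 2 * exp z * amom z X) + 2 * exp z * (amom z X - mm * kap)) by ring.
    eapply Rle_trans; [apply Rabs_triang|]. rewrite Rabs_mult, (Rabs_pos_eq (2 * exp z)) by lra.
    apply Rle_trans with (2 * exp z * mom z 12 X + 2 * exp z * (4 * g + kap * g)).
    - apply Rplus_le_compat; [exact LA | apply Rmult_le_compat_l; [lra | exact W]].
    - rewrite <- Rmult_plus_distr_l. apply Rmult_le_compat_l; lra. }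
  set (B := amp s) in *.
  assert (Bp : 0 < B).
  { unfold B, amp. apply Rdiv_lt_0_compat; [apply exp_pos|]. apply Rmult_lt_0_compat; auto. apply Rmult_lt_0_compat; lra. }
  assert (R0p : 0 < 2 * PI / s) by (apply Rdiv_lt_0_compat; lra).
  assert (LE2 : Rabs (2 * PI / s * arcint s - PI * (B * mm)) <= PI * (B * (T + g + 4 * g / kap))).
  { replace (PI * (B * mm)) with (2 * PI / s * (2 * exp z * (mm * kap))) by (transitivity (2 * PI / s * (2 * exp z * kap) * mm); [ring | rewrite EB; ring]).
    rewrite <- Rmult_minus_distr_l, Rabs_mult, (Rabs_pos_eq (2 * PI / s)) by lra.
    replace (PI * (B * (T + g + 4 * g / kap))) with (2 * PI / s * (2 * exp z * (kap * (T + g + 4 * g / kap)))) by (transitivity (2 * PI / s * (2 * exp z * kap) * (T + g + 4 * g / kap)); [ring | rewrite EB; ring]).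
    apply Rmult_le_compat_l; lra. }
  assert (CE2 : 9 * exp (4 * PI * s + 12 - 3.25 * s) <= PI * (B * (4.1 * s ^ 2 * (exp 12 * exp (- (3.25 * s)))))).
  { replace (4 * PI * s + 12 - 3.25 * s) with (z + (12 + - (3.25 * s))) by (unfold z; ring).
    rewrite !exp_plus. set (F := exp 12 * exp (- (3.25 * s))).
    assert (F0 : 0 < F) by (apply Rmult_lt_0_compat; apply exp_pos).
    assert (Ez : exp z = B * (sqrt 2 * (s * sqrt s))).
    { unfold B, amp. fold z. field. lra. }
    rewrite Ez.
    assert (r1 : sqrt s <= s) by nra. assert (r2 : sqrt 2 <= 1.4143) by nra.
    assert (r3 : sqrt 2 * (s * sqrt s) <= 1.4143 * s ^ 2).
    { apply Rmult_le_compat; try lra; [nra|]. simpl. rewrite Rmult_1_r. apply Rmult_le_compat_l; lra. }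
    replace (9 * (B * (sqrt 2 * (s * sqrt s)) * F)) with (B * F * (9 * (sqrt 2 * (s * sqrt s)))) by ring.
    replace (PI * (B * (4.1 * s ^ 2 * F))) with (B * F * (PI * (4.1 * s ^ 2))) by ring.
    apply Rmult_le_compat_l; [nra|]. assert (0 < s ^ 2) by nra. nra. }
  (* After multiplication by s^6 the Laplace remainder takes at most 7 * 10^-7 and everything else,
     through [decay], at most 1.4 * 10^-5. *)
  assert (Fin : T + g + 4 * g / kap + 4.1 * s ^ 2 * (exp 12 * exp (- (3.25 * s))) < 1.57696 / 10 ^ 5 / s ^ 6).
  { assert (s6 : 0 < s ^ 6) by (apply pow_lt; lra).
    apply Rmult_lt_reg_r with (s ^ 6); auto.
    replace (1.57696 / 10 ^ 5 / s ^ 6 * s ^ 6) with (1.57696 / 10 ^ 5) by (field; lra).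
    assert (t1 : T * s ^ 6 <= 0.0000007).
    { unfold T, z. replace (10395 / (4 * (4 * PI * s)) ^ 6 * s ^ 6) with (10395 * / (16 * PI) ^ 6) by (field; lra).
      apply Rle_trans with (10395 * / (16 * 3.14) ^ 6); [|lra]. apply Rmult_le_compat_l; [lra|].
      apply Rinv_le_contravar; [apply pow_lt; lra | apply pow_incr; lra]. }
    set (e := exp (- (3.25 * s))) in *. assert (e0 : 0 < e) by apply exp_pos.
    assert (ik : / kap <= 6 * s).
    { rewrite kapE, Rinv_inv. assert (sqrt s <= s) by nra. assert (sqrt 2 <= 1.4143) by nra.
      assert (sqrt 2 * sqrt s <= 1.4143 * s) by (apply Rmult_le_compat; lra). lra. }
    assert (t2 : (g + 4 * g / kap) <= 2 * s ^ 2 * e).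
    { unfold Rdiv. assert (4 * g * / kap <= 4 * e * (6 * s)).
      { apply Rmult_le_compat; try lra. left; apply Rinv_0_lt_compat; auto. }
      assert (1 + 24 * s <= 2 * s ^ 2) by (simpl; nra). 
      assert (e * (1 + 24 * s) <= e * (2 * s ^ 2)) by (apply Rmult_le_compat_l; lra). lra. }
    pose proof (decay s Hs) as Dc. fold e in Dc.
    assert (E12 : 20 <= 0.1 * exp 12).
    { replace 12 with (INR 12) by (simpl; ring). rewrite exp_INR. pose proof exp_1_lower.
      apply Rle_trans with (0.1 * 2.67 ^ 12); [lra|]. apply Rmult_le_compat_l; [lra|]. apply pow_incr; lra. }
    assert (t3 : (g + 4 * g / kap + 4.1 * s ^ 2 * (exp 12 * e)) * s ^ 6 <= 4.2 * exp 12 * (s ^ 8 * e)).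
    { replace (4.2 * exp 12 * (s ^ 8 * e)) with ((0.1 * exp 12 * (s ^ 2 * e) + 4.1 * s ^ 2 * (exp 12 * e)) * s ^ 6) by (simpl; lra).
      apply Rmult_le_compat_r; [lra|]. apply Rplus_le_compat_r.
      eapply Rle_trans; [exact t2|]. assert (0 < s ^ 2 * e) by (apply Rmult_lt_0_compat; [apply pow_lt; lra|auto]). nra. }
    lra. }
  rewrite mmE.
  apply Rmult_lt_reg_l with PI; [lra|].
  rewrite <- (Rabs_pos_eq PI) at 1 by lra. rewrite <- Rabs_mult.
  replace (PI * (IZR (c (S n0)) - B * mm)) with
    ((PI * IZR (c (S n0)) - 2 * PI / s * arcint s) + (2 * PI / s * arcint s - PI * (B * mm))) by ring.
  eapply Rle_lt_trans; [apply Rabs_triang|].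
  apply Rle_lt_trans with (PI * (B * (4.1 * s ^ 2 * (exp 12 * exp (- (3.25 * s))))) + PI * (B * (T + g + 4 * g / kap))).
  - apply Rplus_le_compat; [eapply Rle_trans; [exact CE | exact CE2] | exact LE2].
  - rewrite <- Rmult_plus_distr_l, <- Rmult_plus_distr_l. apply Rmult_lt_compat_l; [lra|].
    apply Rmult_lt_compat_l; [auto|]. lra.
Qed.

(** * Recurrence for the coefficients *)

Definition on_disk (a : nat -> R) : Prop :=
  forall x : R, Rabs x < 1 -> Rbar_lt (Rabs x) (CV_radius a).

Lemma on_disk_intro (a : nat -> R) : (forall x : R, 0 < x < 1 -> ex_pseries a x) -> on_disk a.
Proof.
  intros H x Hx. pose proof (Rabs_pos x).
  set (r := (1 + Rabs x) / 2).
  assert (ex_series (fun n => a n * r ^ n)) as E.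
  { destruct (H r) as [s Hs]; [unfold r; lra|]. exists s. exact (proj1 (is_pseries_R a r s) Hs). }
  apply ex_series_lim_0 in E.
  assert (L : Rbar_le r (CV_radius a)).
  { apply CV_radius_bounded.
    apply is_lim_seq_Reals in E.
    destruct (maj_by_pos (fun n => a n * r ^ n) (exist _ _ E)) as [M [M0 HM]].
    exists M. exact HM. }
  eapply Rbar_lt_le_trans; [|exact L]. simpl. unfold r. lra.
Qed.

Lemma on_disk_ex a x : on_disk a -> Rabs x < 1 -> ex_pseries a x.
Proof. intros H Hx. apply CV_radius_inside, H, Hx. Qed.

Lemma on_disk_mult a b : on_disk a -> on_disk b -> on_disk (PS_mult a b).
Proof.
  intros A B. apply on_disk_intro. intros x Hx.
  assert (Rabs x < 1) by (rewrite Rabs_pos_eq; lra). apply ex_pseries_mult; auto.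
Qed.

Lemma on_disk_plus a b : on_disk a -> on_disk b -> on_disk (PS_plus a b).
Proof.
  intros A B. apply on_disk_intro. intros x Hx.
  assert (Rabs x < 1) by (rewrite Rabs_pos_eq; lra). apply ex_pseries_plus; apply on_disk_ex; auto.
Qed.

Lemma on_disk_scal (c : R) a : on_disk a -> on_disk (PS_scal c a).
Proof.
  intros A. apply on_disk_intro. intros x Hx.
  assert (Rabs x < 1) by (rewrite Rabs_pos_eq; lra). apply ex_pseries_scal; [apply Rmult_comm|].
  apply on_disk_ex; auto.
Qed.

Lemma on_disk_derive a : on_disk a -> on_disk (PS_derive a).
Proof. intros A x Hx. rewrite CV_radius_derive. apply A, Hx. Qed.

(** Negative s, reached with Im w = -pi, is covered because comparing power series coefficients
    needs an identity on both sides of 0. *)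
Lemma log_nome (s : R) : s <> 0 -> Rabs s < 1 -> exists w : C, 0 < Re w /\ Cexp (- w) = RtoC s.
Proof.
  intros s0 s1. pose proof (Rabs_pos_lt s s0) as p.
  assert (L : ln (Rabs s) < 0) by (rewrite <- ln_1; apply ln_increasing; auto).
  destruct (Rle_or_lt 0 s) as [h|h].
  - exists (RtoC (- ln (Rabs s))). split; [simpl; lra|].
    rewrite <- RtoC_opp, Ropp_involutive, Cexp_R, exp_ln, Rabs_pos_eq; auto.
  - exists (- ln (Rabs s), - PI). split; [simpl; lra|].
    unfold Cexp. simpl. rewrite !Ropp_involutive, exp_ln, cos_PI, sin_PI, Rabs_left; auto.
    apply C_eq; simpl; ring.
Qed.

Definition e4 (n : nat) : R := match n with O => 1 | S _ => 240 * INR (sigma3 n) end.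
(** Coefficients of minus the logarithm of the product of the 1 - q^n; its derivative has the
    coefficients sigma_1. *)
Definition dlog (n : nat) : R := match n with O => 0 | S _ => sig1 n / INR n end.

Section Recurrence.
Variable c : nat -> Z.
Hypothesis hc : is_j_coefficients c.

(** Coefficients of q j, which is a power series; hence the shift by one against c. *)
Definition jcoef (n : nat) : Z := match n with O => 1 | S n' => c n' end.
Let p (n : nat) : R := IZR (jcoef n).

Lemma Cis_RtoC_inv (f : nat -> C) (g : nat -> R) l : Cis f l -> (forall n, f n = RtoC (g n)) ->
  is_series g (Re l) /\ Im l = 0.
Proof.
  intros [A B] E. split.
  - apply (ser_ext (fun n => Re (f n))); [intros n; rewrite E; reflexivity | exact A].
  - rewrite <- (is_series_unique _ _ B). apply is_series_unique. apply (ser_ext (fun _ => 0)); [|apply ser_zero].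
    intros n. rewrite E; reflexivity.
Qed.

Lemma pseries_shift (a : nat -> R) (s l : R) :
  is_series (fun n => a (S n) * s ^ S n) l -> is_pseries a s (a 0%nat + l).
Proof.
  intros H. apply is_pseries_R. apply (is_series_decr (fun n => a n * s ^ n)) in H.
  replace (a 0%nat + l) with (l + a 0%nat * s ^ 0) by (simpl; ring). exact H.
Qed.

Lemma real_identity (s : R) : s <> 0 -> Rabs s < 1 ->
  exists P E D : R, is_pseries p s P /\ is_pseries e4 s E /\ is_pseries dlog s D /\ P = E ^ 3 * exp (24 * D).
Proof.
  intros s0 s1. destruct (log_nome s s0 s1) as [w [Hw Q]].
  assert (I1 : Cexp w = RtoC (/ s)).
  { replace w with (- - w)%C by ring. rewrite Cexp_opp, Q, RtoC_inv; auto. }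
  pose proof (j_coefficients_series c w hc Hw) as HJ. pose proof (S3_q w Hw) as HS. pose proof (D_q w Hw) as HD.
  rewrite Q in HJ, HS, HD.
  destruct (Cis_RtoC_inv _ (fun n => IZR (c n) * s ^ n) _ HJ) as [J1 J2].
  { intros n. rewrite RtoC_mult, RtoC_pow; reflexivity. }
  destruct (Cis_RtoC_inv _ (fun n => INR (sigma3 (S n)) * s ^ S n) _ HS) as [S1 S2].
  { intros n. rewrite RtoC_mult, RtoC_pow; reflexivity. }
  destruct (Cis_RtoC_inv _ (fun n => sig1 (S n) / INR (S n) * s ^ S n) _ HD) as [D1 D2].
  { intros n. rewrite RtoC_mult, RtoC_pow; reflexivity. }
  exists (1 + s * Re (Jfun w - Cexp w)%C), (1 + 240 * Re (S3fun w)), (0 + Re (Dfun w)).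
  split; [|split; [|split]].
  - apply (pseries_shift p). eapply ser_ext; [|apply (ser_scal s), J1]. intros n. unfold p, jcoef. simpl. ring.
  - apply (pseries_shift e4). eapply ser_ext; [|apply (ser_scal 240), S1]. intros n. unfold e4. cbv beta iota. ring.
  - apply (pseries_shift dlog). exact D1.
  - assert (ES : S3fun w = RtoC (Re (S3fun w))) by (apply C_eq; [reflexivity | exact S2]).
    assert (ED : Dfun w = RtoC (Re (Dfun w))) by (apply C_eq; [reflexivity | exact D2]).
    assert (EJ : Jfun w = RtoC ((1 + 240 * Re (S3fun w)) ^ 3 * (/ s * exp (24 * Re (Dfun w))))).
    { unfold Jfun, E4fun, Ufun. rewrite Cexp_plus, I1. revert ES ED.
      generalize (Re (S3fun w)) (Re (Dfun w)). intros a b -> ->.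
      rewrite <- (RtoC_mult 24), Cexp_R, <- !RtoC_mult, <- RtoC_plus, <- RtoC_pow, <- RtoC_mult. reflexivity. }
    rewrite EJ, I1, <- RtoC_minus. change (Re (RtoC ?x)) with x.
    rewrite Rplus_0_l. cbn [Re RtoC fst]. field. exact s0.
Qed.

Lemma on_disk_all : on_disk p /\ on_disk e4 /\ on_disk dlog.
Proof.
  assert (G : forall x : R, 0 < x < 1 -> ex_pseries p x /\ ex_pseries e4 x /\ ex_pseries dlog x).
  { intros x Hx. destruct (real_identity x) as [P [E [D [A [B [F _]]]]]]; [lra | rewrite Rabs_pos_eq; lra|].
    repeat split; eexists; eassumption. }
  split; [|split]; apply on_disk_intro; intros x Hx; apply (G x Hx).
Qed.

Lemma PSeries_identity (s : R) : Rabs s < 1 ->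
  PSeries p s = PSeries e4 s ^ 3 * exp (24 * PSeries dlog s).
Proof.
  intros s1. destruct (Req_dec s 0) as [->|s0].
  - rewrite !PSeries_0. cbn [p jcoef e4 dlog]. unfold p, jcoef. rewrite Rmult_0_r, exp_0. ring.
  - destruct (real_identity s s0 s1) as [P [E [D [A [B [F G]]]]]].
    rewrite (is_pseries_unique _ _ _ A), (is_pseries_unique _ _ _ B), (is_pseries_unique _ _ _ F). exact G.
Qed.

(** The logarithmic derivative of p = E^3 exp (24 D), multiplied by E p so that only products of
    power series occur. *)
Lemma PSeries_ode (s : R) : Rabs s < 1 ->
  PSeries (PS_derive p) s * PSeries e4 s
  = 3 * (PSeries (PS_derive e4) s * PSeries p s)
    + 24 * (PSeries e4 s * PSeries (PS_derive dlog) s * PSeries p s).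
Proof.
  intros s1. destruct on_disk_all as [Dp [De Dd]].
  pose proof (is_derive_PSeries p s (Dp s s1)) as H1.
  pose proof (is_derive_PSeries e4 s (De s s1)) as H2.
  pose proof (is_derive_PSeries dlog s (Dd s s1)) as H3.
  pose proof (der_mult _ _ _ _ _ H2 (der_mult _ _ _ _ _ H2 H2)) as H4.
  pose proof (der_comp exp _ _ _ _ (is_derive_exp (24 * PSeries dlog s)) (der_mult _ _ _ _ _ (der_const 24 s) H3)) as H5.
  pose proof (der_mult _ _ _ _ _ H4 H5) as H6. cbv beta in H6.
  assert (H7 : is_derive (PSeries p) s (Derive (PSeries p) s)) by (apply Derive_correct; eexists; exact H1).
  assert (E : Derive (PSeries p) s = PSeries (PS_derive p) s) by (apply is_derive_unique, H1).
  assert (F : Derive (PSeries p) s = Derive (fun x => PSeries e4 x * (PSeries e4 x * PSeries e4 x) * exp (24 * PSeries dlog x)) s).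
  { assert (G : forall y : R, Rabs (y - s) < 1 - Rabs s ->
      PSeries p y = PSeries e4 y * (PSeries e4 y * PSeries e4 y) * exp (24 * PSeries dlog y)).
    { intros y Hy. pose proof (Rabs_triang (y - s) s) as T.
      replace (y - s + s) with y in T by ring. rewrite PSeries_identity by lra. ring. }
    apply Derive_ext_loc. exists (mkposreal (1 - Rabs s) ltac:(lra)). exact G. }
  rewrite E, (is_derive_unique (fun x : R => PSeries e4 x * (PSeries e4 x * PSeries e4 x) * exp (24 * PSeries dlog x)) s _ H6) in F.
  rewrite F, PSeries_identity by auto. ring.
Qed.

Definition gsum (n : nat) : R :=
  3 * PS_derive e4 n + 24 * PS_mult e4 (PS_derive dlog) n.

Lemma coef_convolution n :
  PS_mult (PS_derive p) e4 n = PS_mult gsum p n.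
Proof.
  destruct on_disk_all as [Dp [De Dd]].
  pose proof (on_disk_derive _ Dp) as Dp'. pose proof (on_disk_derive _ De) as De'. pose proof (on_disk_derive _ Dd) as Dd'.
  pose proof (on_disk_mult _ _ De Dd') as D1.
  assert (Dg : on_disk (PS_plus (PS_scal 3 (PS_derive e4)) (PS_scal 24 (PS_mult e4 (PS_derive dlog)))))
    by (apply on_disk_plus; apply on_disk_scal; auto).
  pose proof (on_disk_mult _ _ Dp' De) as DL. pose proof (on_disk_mult _ _ Dg Dp) as DR.
  assert (z : Rabs 0 < 1) by (rewrite Rabs_R0; lra).
  pose proof (DL 0 z) as L0. pose proof (DR 0 z) as R0. rewrite Rabs_R0 in L0, R0.
  change (PS_mult gsum p n) with (PS_mult (PS_plus (PS_scal 3 (PS_derive e4)) (PS_scal 24 (PS_mult e4 (PS_derive dlog)))) p n).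
  apply PSeries_ext_recip; auto.
  assert (G : forall s : R, Rabs (s - 0) < 1 -> PSeries (PS_mult (PS_derive p) e4) s =
    PSeries (PS_mult (PS_plus (PS_scal 3 (PS_derive e4)) (PS_scal 24 (PS_mult e4 (PS_derive dlog)))) p) s);
    [|exists (mkposreal 1 Rlt_0_1); exact G].
  intros s Hs. rewrite Rminus_0_r in Hs.
  rewrite (PSeries_mult (PS_derive p)), (PSeries_mult (PS_plus _ _)) by auto. rewrite PSeries_plus, !PSeries_scal, PSeries_mult by (try apply on_disk_ex; auto using on_disk_scal).
  rewrite PSeries_ode by auto. ring.
Qed.

Lemma sum_f_rsum f n : sum_f_R0 f n = rsum f (S n).
Proof. induction n; cbn [sum_f_R0 rsum] in *; [ring|]. rewrite IHn. reflexivity. Qed.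

Lemma rsum_S_left f n : rsum f (S n) = f 0%nat + rsum (fun i => f (S i)) n.
Proof. induction n; cbn [rsum] in *; [ring|]. rewrite IHn. ring. Qed.

Lemma rsum_ext f g n : (forall i, (i < n)%nat -> f i = g i) -> rsum f n = rsum g n.
Proof. intros H. induction n; cbn [rsum]; [reflexivity|]. rewrite IHn, H by auto. reflexivity. Qed.

Lemma rsum_rev f n : rsum f n = rsum (fun i => f (n - S i)%nat) n.
Proof.
  induction n; [reflexivity|]. rewrite (rsum_S_left (fun i => f (S n - S i)%nat)).
  cbn [rsum]. rewrite IHn. replace (S n - 1)%nat with n by lia. rewrite Rplus_comm. f_equal.
Qed.

(** Solves the convolution identity for its top term, whose factor is the constant term 1 of E4. *)
Lemma coef_recurrence n :
  INR (S n) * p (S n) = rsum (fun i => gsum i * p (n - i)%nat) (S n)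
    - rsum (fun i => e4 (S i) * (INR (n - i) * p (n - i)%nat)) n.
Proof.
  pose proof (coef_convolution n) as H. unfold PS_mult at 1 2 in H. rewrite !sum_f_rsum in H.
  rewrite <- H, rsum_rev, rsum_S_left.
  replace (S n - 1)%nat with n by lia. rewrite Nat.sub_diag.
  unfold PS_derive at 1. change (e4 0) with 1.
  rewrite (rsum_ext (fun i => PS_derive p (S n - S (S i)) * e4 (n - (S n - S (S i))))
    (fun i => e4 (S i) * (INR (n - i) * p (n - i)%nat))); [ring|].
  intros i Hi. unfold PS_derive.
  replace (S (S n - S (S i))) with (n - i)%nat by lia.
  replace (n - (S n - S (S i)))%nat with (S i) by lia. ring.
Qed.
End Recurrence.

(** * The first coefficients *)

Fixpoint divisor_power_sum (a : Z) (N : nat) (K : nat) : Z :=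
  match K with
  | O => 0
  | S K' => divisor_power_sum a N K'
      + (if Z.of_nat N mod Z.of_nat K =? 0 then Z.of_nat K ^ a else 0)
  end%Z.

Definition sigmaZ (a : Z) (N : nat) : Z := divisor_power_sum a N N.
Definition e4Z (n : nat) : Z := match n with O => 1 | S _ => 240 * sigmaZ 3 n end.

(** Stops at the shorter list, so that one long list serves convolutions of every length; the other
    list is kept in reverse order, which makes a convolution a plain dot product. *)
Fixpoint dotZ (a b : list Z) : Z :=
  match a, b with x :: a', y :: b' => (x * y + dotZ a' b')%Z | _, _ => 0%Z end.

(* [revs] lists sigma_1(i), ..., sigma_1(1) *)
Fixpoint gsum_list (es revs : list Z) (K i : nat) : list Z :=
  match K with
  | O => nil
  | S K' =>
      let r := (sigmaZ 1 (S i) :: revs)%list in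
      (3 * (Z.of_nat (S i) * e4Z (S i)) + 24 * dotZ es r)%Z :: gsum_list es r K' (S i)
  end.

Lemma divisor_power_sum_IZR a N K :
  IZR (divisor_power_sum (Z.of_nat a) N K) =
  rsum (fun i => if (N mod S i =? 0)%nat then INR (S i) ^ a else 0) K.
Proof.
  induction K; [reflexivity|]. cbn [divisor_power_sum rsum]. rewrite plus_IZR, IHK. f_equal.
  rewrite <- Nat2Z.inj_mod. change 0%Z with (Z.of_nat 0).
  destruct (Nat.eqb_spec (N mod S K) 0) as [h|h].
  - rewrite h, Z.eqb_refl, <- pow_IZR, <- INR_IZR_INZ. reflexivity.
  - destruct (Z.eqb_spec (Z.of_nat (N mod S K)) (Z.of_nat 0)); [lia|reflexivity].
Qed.

Lemma e4Z_IZR n : IZR (e4Z n) = e4 n.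
Proof.
  destruct n; [reflexivity|]. unfold e4Z, e4, sigmaZ. rewrite mult_IZR, sigma3_dsum.
  change 3%Z with (Z.of_nat 3). rewrite divisor_power_sum_IZR. reflexivity.
Qed.

Lemma sigmaZ1_IZR n : IZR (sigmaZ 1 (S n)) = PS_derive dlog n.
Proof.
  unfold sigmaZ, PS_derive, dlog. change 1%Z with (Z.of_nat 1). rewrite divisor_power_sum_IZR.
  replace (INR (S n) * (sig1 (S n) / INR (S n))) with (sig1 (S n)) by (field; apply not_0_INR; lia).
  unfold sig1, dsum. apply rsum_ext. intros i _. destruct (S n mod S i =? 0)%nat; rewrite ?pow_1; reflexivity.
Qed.

Lemma dotZ_IZR f g M : forall K a b, (M <= K)%nat ->
  IZR (dotZ (map f (seq a K)) (map g (seq b M))) = rsum (fun i => IZR (f (a + i)%nat) * IZR (g (b + i)%nat)) M.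
Proof.
  induction M; intros K a b H.
  - destruct K; reflexivity.
  - destruct K; [lia|]. cbn [seq map dotZ]. rewrite plus_IZR, mult_IZR, IHM by lia.
    rewrite rsum_S_left, !Nat.add_0_r. f_equal. apply rsum_ext. intros i _.
    rewrite !Nat.add_succ_r. reflexivity.
Qed.

Lemma map_seq_cons (f : nat -> Z) n :
  f n :: map (fun k => f (n - S k)%nat) (seq 0 n) = map (fun k => f (n - k)%nat) (seq 0 (S n)).
Proof.
  cbn [seq map]. rewrite Nat.sub_0_r. f_equal. rewrite <- seq_shift, map_map. reflexivity.
Qed.

Definition gsumZ (i : nat) : Z :=
  (3 * (Z.of_nat (S i) * e4Z (S i))
   + 24 * dotZ (map e4Z (seq 0 (S i))) (map (fun k => sigmaZ 1 (S (i - k))) (seq 0 (S i))))%Z.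

Lemma gsumZ_IZR i : IZR (gsumZ i) = gsum i.
Proof.
  unfold gsumZ, gsum. rewrite plus_IZR, !mult_IZR, dotZ_IZR, e4Z_IZR by lia.
  unfold PS_mult. rewrite sum_f_rsum. unfold PS_derive at 1. rewrite INR_IZR_INZ. f_equal. f_equal.
  apply rsum_ext. intros m _. rewrite e4Z_IZR, sigmaZ1_IZR. reflexivity.
Qed.

Lemma dotZ_firstn f g M : forall K a b, (M <= K)%nat ->
  dotZ (map f (seq a K)) (map g (seq b M)) = dotZ (map f (seq a M)) (map g (seq b M)).
Proof.
  intros. apply eq_IZR. rewrite !dotZ_IZR by lia. reflexivity.
Qed.

Lemma gsum_list_eq L K : forall i, (i + K <= L)%nat ->
  gsum_list (map e4Z (seq 0 L)) (map (fun k => sigmaZ 1 (S (i - S k))) (seq 0 i)) K i = map gsumZ (seq i K).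
Proof.
  induction K; intros i H; [reflexivity|].
  cbn [gsum_list seq map]. rewrite (map_seq_cons (fun m => sigmaZ 1 (S m)) i). f_equal.
  - unfold gsumZ. rewrite dotZ_firstn by lia. reflexivity.
  - rewrite <- IHK by lia. f_equal.
Qed.

(** Merges both sums of [coef_recurrence] into one of (g_i - (N - i) e_(i+1)) p_(N-i); the counter n
    is N - i. At i = N the weight of e is 0, which reconciles the different lengths of the two
    sums. *)
Fixpoint wdotZ (gs es ps : list Z) (n : Z) : Z :=
  match gs, es, ps with
  | g :: gs', e :: es', x :: ps' => ((g - n * e) * x + wdotZ gs' es' ps' (n - 1))%Z
  | _, _, _ => 0%Z
  end.

Lemma wdotZ_IZR g e f M : forall K a b d n, (M <= K)%nat ->
  IZR (wdotZ (map g (seq a K)) (map e (seq b K)) (map f (seq d M)) n) =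
  rsum (fun i => (IZR (g (a + i)%nat) - (IZR n - INR i) * IZR (e (b + i)%nat)) * IZR (f (d + i)%nat)) M.
Proof.
  induction M; intros K a b d n H.
  - destruct K; reflexivity.
  - destruct K; [lia|]. cbn [seq map wdotZ]. rewrite plus_IZR, mult_IZR, minus_IZR, mult_IZR, IHM by lia.
    rewrite rsum_S_left, !Nat.add_0_r, Rminus_0_r. f_equal. apply rsum_ext. intros i _.
    rewrite !Nat.add_succ_r, minus_IZR, S_INR. f_equal. f_equal. f_equal. ring.
Qed.

(* [ps] lists p_N, ..., p_0 *)
Fixpoint coef_list (gs es ps : list Z) (K N : nat) : list Z :=
  match K with
  | O => ps
  | S K' => coef_list gs es (wdotZ gs es ps (Z.of_nat N) / Z.of_nat (S N) :: ps)%Z K' (S N)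
  end.

Definition j_list (K : nat) : list Z :=
  let es := map e4Z (seq 0 (S K)) in
  coef_list (gsum_list es nil K 0) (tl es) (1 :: nil)%Z K 0.

Lemma rsum_plus f g n : rsum (fun i => f i + g i) n = rsum f n + rsum g n.
Proof. induction n; cbn [rsum]; [ring|]. rewrite IHn. ring. Qed.

Section Coefficients.
Variable c : nat -> Z.
Hypothesis hc : is_j_coefficients c.
Let p := jcoef c.

Lemma coef_list_eq L K : forall N, (N + K <= L)%nat ->
  coef_list (map gsumZ (seq 0 L)) (map e4Z (seq 1 L)) (map (fun i => p (N - i)%nat) (seq 0 (S N))) K N
  = map (fun i => p (N + K - i)%nat) (seq 0 (S (N + K))).
Proof.
  induction K; intros N H; [rewrite Nat.add_0_r; reflexivity|].
  cbn [coef_list].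
  (* The dividend is N + 1 times an integer, the coefficients being integers, so the integer
     division is exact. *)
  assert (V : wdotZ (map gsumZ (seq 0 L)) (map e4Z (seq 1 L)) (map (fun i => p (N - i)%nat) (seq 0 (S N))) (Z.of_nat N)
     = (Z.of_nat (S N) * p (S N))%Z).
  { apply eq_IZR. rewrite wdotZ_IZR, mult_IZR, <- !INR_IZR_INZ by lia.
    pose proof (coef_recurrence c hc N) as R. fold p in R. rewrite R.
    cbn [rsum]. rewrite !Nat.add_0_l, Nat.sub_diag, gsumZ_IZR.
    rewrite (rsum_ext (fun i => (IZR (gsumZ (0 + i)) - (INR N - INR i) * IZR (e4Z (1 + i))) * IZR (p (N - (0 + i))))
      (fun i => gsum i * IZR (p (N - i)%nat) + -1 * (e4 (S i) * (INR (N - i) * IZR (p (N - i)%nat))))), rsum_plus, rsum_scal; [ring|].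
    intros i Hi. rewrite gsumZ_IZR, minus_INR by lia. change (1 + i)%nat with (S i). rewrite e4Z_IZR, Nat.add_0_l. ring. }
  rewrite V, Z.mul_comm, Z.div_mul by lia.
  replace (N + S K)%nat with (S N + K)%nat by lia. rewrite <- IHK by lia.
  rewrite <- (map_seq_cons p (S N)). reflexivity.
Qed.

Lemma j_list_eq K : j_list K = map (fun i => p (K - i)%nat) (seq 0 (S K)).
Proof.
  unfold j_list. cbv zeta.
  pose proof (gsum_list_eq (S K) K 0 ltac:(lia)) as G. change (map _ (seq 0 0)) with (@nil Z) in G. rewrite G.
  change (tl (map e4Z (seq 0 (S K)))) with (map e4Z (seq 1 K)).
  apply (coef_list_eq K K 0). lia.
Qed.
End Coefficients.

(** * Fixed-point enclosures *)

Lemma PI_fine : 57952155664616982730 / 2 ^ 64 < PI < 57952155664616982748 / 2 ^ 64.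
Proof.
  destruct (PI_2_3_7_ineq 9) as [A B]. unfold tg_alt, PI_2_3_7_tg, Ratan_seq in A, B.
  cbn [sum_f_R0 Nat.mul Nat.add] in A, B. simpl in A, B. split; lra.
Qed.

Fixpoint exp_term (n : nat) (y : R) : R :=
  match n with O => 1 | S n' => exp_term n' y * y / INR (S n') end.

Lemma exp_term_der n y : is_derive (exp_term (S n)) y (exp_term n y).
Proof.
  assert (St : forall i z, is_derive (exp_term i) y z ->
    is_derive (exp_term (S i)) y ((z * y + exp_term i y) / INR (S i))).
  { intros i z H. eapply der_eq.
    - exact (der_mult _ _ _ _ _ (der_mult _ _ _ _ _ H (der_id y)) (der_const (/ INR (S i)) y)).
    - unfold Rdiv. ring. }
  induction n.
  - eapply der_eq; [apply (St 0%nat 0), (der_const 1)|]. simpl. field.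
  - eapply der_eq; [apply St, IHn|]. cbn [exp_term]. rewrite (S_INR (S n)).
    pose proof (pos_INR n). rewrite S_INR. field. lra.
Qed.

(* Taylor polynomial with its last term weighted by [t]: [t = 1] gives a lower and, on [0, 1/2],
   [t = 2] an upper bound of the exponential. *)
Definition exp_taylor (t : R) (n : nat) (y : R) : R := rsum (fun i => exp_term i y) n + t * exp_term n y.

Lemma exp_taylor_der t n y : is_derive (exp_taylor t (S n)) y (exp_taylor t n y).
Proof.
  unfold exp_taylor. apply der_plus.
  - induction n.
    + exact (der_eq _ _ _ _ (der_const (0 + 1) y) eq_refl).
    + cbn [rsum] in *. apply der_plus; [exact IHn | apply exp_term_der].
  - eapply der_eq; [exact (der_mult _ _ _ _ _ (der_const t y) (exp_term_der n y))|]. cbv beta. ring.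
Qed.

Lemma exp_taylor_0 t n : exp_taylor t (S n) 0 = 1.
Proof.
  assert (Z : forall i, exp_term (S i) 0 = 0) by (intros; cbn [exp_term]; unfold Rdiv; ring).
  unfold exp_taylor. rewrite Z, rsum_S_left, (rsum_ext _ (fun _ => 0 * 0)) by (intros; rewrite Z; ring).
  rewrite rsum_scal. cbn [exp_term]. ring.
Qed.

Lemma nondecreasing_of_derive (f f' : R -> R) (b : R) : f 0 = 0 ->
  (forall x : R, 0 <= x <= b -> is_derive f x (f' x) /\ 0 <= f' x) ->
  forall y : R, 0 <= y <= b -> 0 <= f y.
Proof.
  intros f0 H y [Hy Hb]. destruct Hy as [Hy| <-]; [|lra].
  destruct (MVT_gen f 0 y f') as [x [Hx E]].
  - rewrite Rmin_left, Rmax_right by lra. intros x Hx. apply H; lra.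
  - rewrite Rmin_left, Rmax_right by lra. intros x Hx. eapply is_derive_continuity_pt, H; lra.
  - rewrite Rmin_left, Rmax_right in Hx by lra.
    destruct (H x) as [_ P]; [lra|]. rewrite f0 in E. assert (0 <= f' x * (y - 0)) by (apply Rmult_le_pos; lra). lra.
Qed.

(** Induction on the order: by [exp_taylor_der] the derivative of the difference is the preceding
    difference, and the difference vanishes at 0. *)
Lemma exp_taylor_lower n (y : R) : 0 <= y -> exp_taylor 1 n y <= exp y.
Proof.
  revert y. induction n; intros y Hy.
  - unfold exp_taylor. cbn [rsum exp_term]. pose proof (exp_ineq1_le y). lra.
  - assert (0 <= exp y - exp_taylor 1 (S n) y); [|lra].
    apply (nondecreasing_of_derive (fun y => exp y - exp_taylor 1 (S n) y) (fun y => exp y - exp_taylor 1 n y) y);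
      [rewrite exp_taylor_0, exp_0; ring | | lra].
    intros x Hx. split; [apply der_minus; [apply is_derive_exp | apply exp_taylor_der]|].
    specialize (IHn x ltac:(lra)). lra.
Qed.

(** As for the lower bound; the weight 2 starts the induction with e^y <= 2 on [0, 1/2]. *)
Lemma exp_taylor_upper n (y : R) : 0 <= y <= 1 / 2 -> exp y <= exp_taylor 2 n y.
Proof.
  revert y. induction n; intros y Hy.
  - unfold exp_taylor. cbn [rsum exp_term].
    assert (E : exp y * exp (- y) = 1) by (rewrite <- exp_plus, Rplus_opp_r; apply exp_0).
    pose proof (exp_ineq1_le (- y)). pose proof (exp_pos y). nra.
  - assert (0 <= exp_taylor 2 (S n) y - exp y); [|lra].
    apply (nondecreasing_of_derive (fun y => exp_taylor 2 (S n) y - exp y) (fun y => exp_taylor 2 n y - exp y) (1 / 2));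
      [rewrite exp_taylor_0, exp_0; ring | | lra].
    intros x Hx. split; [apply der_minus; [apply exp_taylor_der | apply is_derive_exp]|].
    specialize (IHn x ltac:(lra)). lra.
Qed.

Fixpoint exp_horner (t y : R) (n k : nat) : R :=
  match n with O => t | S n' => 1 + y / INR k * exp_horner t y n' (S k) end.

Lemma exp_horner_taylor t y : exp_horner t y 12 1 = exp_taylor t 12 y.
Proof.
  unfold exp_taylor. cbn [rsum exp_term exp_horner]. rewrite !S_INR, INR_0. field.
Qed.

Definition fp_one : Z := (2 ^ 64)%Z.
Notation fp_oneR := 18446744073709551616.

(* floor (a / 2^64); a shift is much cheaper to evaluate than [Z.div] *)
Definition fp_floor (a : Z) : Z := Z.shiftr a 64.

Lemma fp_floor_eq a : fp_floor a = (a / fp_one)%Z.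
Proof. apply Z.shiftr_div_pow2. lia. Qed.

(** Bounds by x / 2^64. Nonnegativity is built into both notions, so that products of bounds are
    bounds of products. *)
Definition lo (x : Z) (r : R) : Prop := (0 <= x)%Z /\ IZR x <= r * fp_oneR.
Definition hi (x : Z) (r : R) : Prop := 0 <= r /\ r * fp_oneR <= IZR x.

Lemma div_lower (a b : Z) : (0 < b)%Z -> IZR (a / b) * IZR b <= IZR a.
Proof. intros H. rewrite <- mult_IZR. apply IZR_le. pose proof (Z.mul_div_le a b H). lia. Qed.

Lemma div_upper (a b : Z) : (0 < b)%Z -> IZR a <= IZR (a / b + 1) * IZR b.
Proof. intros H. rewrite <- mult_IZR. apply IZR_le. pose proof (Z.mul_succ_div_gt a b H). lia. Qed.

Lemma lo_pos x r : lo x r -> 0 <= r.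
Proof. intros [H1 H2]. apply IZR_le in H1. lra. Qed.

Lemma lo_add x y r t : lo x r -> lo y t -> lo (x + y) (r + t).
Proof. intros [A1 A2] [B1 B2]. split; [lia|]. rewrite plus_IZR. lra. Qed.

Lemma hi_add x y r t : hi x r -> hi y t -> hi (x + y) (r + t).
Proof. intros [A1 A2] [B1 B2]. split; [lra|]. rewrite plus_IZR. lra. Qed.

Lemma lo_muldiv x y r t (k : Z) : (0 < k)%Z -> lo x r -> lo y t -> lo (fp_floor (x * y) / k) (r * t / IZR k).
Proof.
  rewrite fp_floor_eq. intros Hk [A1 A2] [B1 B2]. assert (0 < fp_one * k)%Z by (unfold fp_one; lia).
  rewrite Z.div_div by (unfold fp_one; lia). split; [apply Z.div_pos; lia|].
  pose proof (div_lower (x * y) (fp_one * k) H) as D. rewrite !mult_IZR in D. unfold fp_one in D. change (IZR (2 ^ 64)) with fp_oneR in D.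
  apply IZR_lt in Hk. apply IZR_le in A1, B1.
  assert (IZR x * IZR y <= (r * fp_oneR) * (t * fp_oneR)) by (apply Rmult_le_compat; lra).
  apply Rmult_le_reg_r with (fp_oneR * IZR k); [apply Rmult_lt_0_compat; lra|].
  eapply Rle_trans; [exact D|]. eapply Rle_trans; [exact H0|]. right. field. lra.
Qed.

(** The floor plus one serves as rounding upwards. *)
Lemma hi_muldiv x y r t (k : Z) : (0 < k)%Z -> hi x r -> hi y t -> hi (fp_floor (x * y) / k + 1) (r * t / IZR k).
Proof.
  rewrite fp_floor_eq. intros Hk [A1 A2] [B1 B2]. assert (0 < fp_one * k)%Z by (unfold fp_one; lia).
  rewrite Z.div_div by (unfold fp_one; lia).
  pose proof (div_upper (x * y) (fp_one * k) H) as D. rewrite !mult_IZR in D. unfold fp_one in D. change (IZR (2 ^ 64)) with fp_oneR in D.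
  apply IZR_lt in Hk. split; [apply Rdiv_le_0_compat; [apply Rmult_le_pos|]; lra|].
  assert ((r * fp_oneR) * (t * fp_oneR) <= IZR x * IZR y) by (apply Rmult_le_compat; lra).
  apply Rmult_le_reg_r with (fp_oneR * IZR k); [apply Rmult_lt_0_compat; lra|].
  eapply Rle_trans; [|exact D]. eapply Rle_trans; [|exact H0]. right. field. lra.
Qed.

Lemma lo_mul x y r t : lo x r -> lo y t -> lo (fp_floor (x * y)) (r * t).
Proof.
  intros A C. pose proof (lo_muldiv x y r t 1 eq_refl A C) as H. rewrite Z.div_1_r in H.
  unfold Rdiv in H. rewrite Rinv_1, Rmult_1_r in H. exact H.
Qed.

Lemma hi_mul x y r t : hi x r -> hi y t -> hi (fp_floor (x * y) + 1) (r * t).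
Proof.
  intros A C. pose proof (hi_muldiv x y r t 1 eq_refl A C) as H. rewrite Z.div_1_r in H.
  unfold Rdiv in H. rewrite Rinv_1, Rmult_1_r in H. exact H.
Qed.

Lemma lo_fp_one : lo fp_one 1.
Proof. split; [unfold fp_one; lia|]. unfold fp_one. change (IZR (2 ^ 64)) with fp_oneR. lra. Qed.

Lemma hi_fp_one : hi fp_one 1.
Proof. split; [lra|]. unfold fp_one. change (IZR (2 ^ 64)) with fp_oneR. lra. Qed.

Fixpoint horner_lo (t y : Z) (n : nat) (k : nat) : Z :=
  match n with O => t | S n' => fp_one + fp_floor (y * horner_lo t y n' (S k)) / Z.of_nat k end%Z.
Fixpoint horner_hi (t y : Z) (n : nat) (k : nat) : Z :=
  match n with O => t | S n' => fp_one + (fp_floor (y * horner_hi t y n' (S k)) / Z.of_nat k + 1) end%Z.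

Lemma horner_lo_spec t y r s n : forall k, (0 < k)%nat -> lo t s -> lo y r -> lo (horner_lo t y n k) (exp_horner s r n k).
Proof.
  induction n; intros k Hk A C; [exact A|]. cbn [horner_lo exp_horner]. apply lo_add; [apply lo_fp_one|].
  replace (r / INR k * exp_horner s r n (S k)) with (r * exp_horner s r n (S k) / INR k) by (unfold Rdiv; ring).
  rewrite INR_IZR_INZ. apply lo_muldiv; auto. lia.
Qed.

Lemma horner_hi_spec t y r s n : forall k, (0 < k)%nat -> hi t s -> hi y r -> hi (horner_hi t y n k) (exp_horner s r n k).
Proof.
  induction n; intros k Hk A C; [exact A|]. cbn [horner_hi exp_horner]. apply hi_add; [apply hi_fp_one|].
  replace (r / INR k * exp_horner s r n (S k)) with (r * exp_horner s r n (S k) / INR k) by (unfold Rdiv; ring).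
  rewrite INR_IZR_INZ. apply hi_muldiv; auto. lia.
Qed.

Fixpoint square_lo (x : Z) (n : nat) : Z := match n with O => x | S n' => square_lo (fp_floor (x * x)) n' end.
Fixpoint square_hi (x : Z) (n : nat) : Z := match n with O => x | S n' => square_hi (fp_floor (x * x) + 1) n' end.

Lemma square_lo_spec n : forall x r, lo x (exp r) -> lo (square_lo x n) (exp (2 ^ n * r)).
Proof.
  induction n; intros x r H; cbn [square_lo pow]; [rewrite Rmult_1_l; exact H|].
  replace (2 * 2 ^ n * r) with (2 ^ n * (r + r)) by ring. apply IHn. rewrite exp_plus. apply lo_mul; auto.
Qed.

Lemma square_hi_spec n : forall x r, hi x (exp r) -> hi (square_hi x n) (exp (2 ^ n * r)).
Proof.
  induction n; intros x r H; cbn [square_hi pow]; [rewrite Rmult_1_l; exact H|].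
  replace (2 * 2 ^ n * r) with (2 ^ n * (r + r)) by ring. apply IHn. rewrite exp_plus. apply hi_mul; auto.
Qed.

(** The argument is divided by 1024 = 2^10, the Taylor polynomial of order 12 is evaluated, and the
    result is squared ten times. *)
Definition exp_lo (x : Z) : Z := square_lo (horner_lo fp_one (x / 1024) 12 1) 10.
Definition exp_hi (x : Z) : Z := square_hi (horner_hi (2 * fp_one) (x / 1024 + 1) 12 1) 10.

Lemma exp_lo_spec x r : lo x r -> lo (exp_lo x) (exp r).
Proof.
  intros H. pose proof (lo_pos _ _ H) as P. destruct H as [H1 H2].
  replace r with (2 ^ 10 * (r / 1024)) by (simpl; field). apply square_lo_spec.
  assert (L : lo (x / 1024) (r / 1024)).
  { split; [apply Z.div_pos; lia|]. pose proof (div_lower x 1024 eq_refl). lra. }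
  pose proof (horner_lo_spec fp_one (x / 1024) (r / 1024) 1 12 1 ltac:(lia) lo_fp_one L) as [A1 A2].
  split; [exact A1|]. rewrite exp_horner_taylor in A2.
  pose proof (exp_taylor_lower 12 (r / 1024) ltac:(lra)). lra.
Qed.

Lemma exp_hi_spec x r : r <= 512 -> hi x r -> hi (exp_hi x) (exp r).
Proof.
  intros Hr [H1 H2].
  replace r with (2 ^ 10 * (r / 1024)) by (simpl; field). apply square_hi_spec.
  assert (L : hi (x / 1024 + 1) (r / 1024)).
  { split; [lra|]. pose proof (div_upper x 1024 eq_refl). lra. }
  assert (L2 : hi (2 * fp_one) 2).
  { split; [lra|]. unfold fp_one. rewrite mult_IZR. change (IZR (2 ^ 64)) with fp_oneR. lra. }
  pose proof (horner_hi_spec (2 * fp_one) (x / 1024 + 1) (r / 1024) 2 12 1 ltac:(lia) L2 L) as [A1 A2].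
  split; [left; apply exp_pos|]. rewrite exp_horner_taylor in A2.
  pose proof (exp_taylor_upper 12 (r / 1024) ltac:(lra)). lra.
Qed.

(** * The check of a single coefficient *)

Definition pi_lo : Z := 57952155664616982730.
Definition pi_hi : Z := 57952155664616982748.
Definition sqrt_lo (n : Z) : Z := Z.sqrt (n * (fp_one * fp_one)).
(** The denominator sqrt 2 n^(3/4) is the fourth root of 4 n^3. *)
Definition den_lo (n : Z) : Z := Z.sqrt (Z.sqrt (4 * n ^ 3 * (fp_one * fp_one * (fp_one * fp_one)))).

(* The coefficients of 1 - m(n) as a polynomial in 1 / (PI sqrt n), times 2^28. *)
Definition m_coefs : list Z := (25165824 :: 1966080 :: 430080 :: 151200 :: 72765 :: nil)%Z.

(** Horner's rule for 1 - m(n), all of whose coefficients are positive. The factor 2^36 turns k /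
    2^28 into units of 2^-64. *)
Definition mcomp_lo (a : Z) : Z := fold_right (fun k acc => fp_floor (a * (2 ^ 36 * k + acc)))%Z 0%Z m_coefs.
Definition mcomp_hi (a : Z) : Z := fold_right (fun k acc => fp_floor (a * (2 ^ 36 * k + acc)) + 1)%Z 0%Z m_coefs.

(** Both inequalities are multiplied out, every quantity being rounded to the unfavourable side; in
    particular e rounds the tolerance down. The condition n <= 255 keeps 4 pi sqrt n within the
    range of [exp_hi_spec]. *)
Definition check_coef (n x : Z) : bool :=
  let s := sqrt_lo n in
  let d := den_lo n in
  let e := (157696 * fp_one / (10 ^ 10 * n ^ 3))%Z in
  let pl := fp_floor (pi_lo * s) in
  let ph := (fp_floor (pi_hi * (s + 1)) + 1)%Z in
  let ql := mcomp_lo (fp_one * fp_one / ph) in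
  let qh := mcomp_hi (fp_one * fp_one / pl + 1) in
  ((n <=? 255) && (0 <? n) && (0 <=? x) && (0 <? fp_one - qh + e) && (0 <? fp_one - ql - e)
   && (x * (d + 1) * fp_one <? exp_lo (4 * pl) * (fp_one - qh + e))
   && (exp_hi (4 * ph) * (fp_one - ql - e) <? x * d * fp_one))%Z%bool.

Definition check_list (K : nat) (cs : list Z) : bool :=
  forallb (fun i => let n := (K - i)%nat in (Nat.ltb n 7 || check_coef (Z.of_nat n) (nth i cs 0%Z))%bool) (seq 0 (S K)).

(** Assuming only that r^2 lies in [a, a + 1) allows the bound to be iterated for the fourth
    root. *)
Lemma Zsqrt_bounds (a : Z) (r : R) : 0 <= r -> (0 <= a)%Z -> IZR a <= r * r < IZR (a + 1) ->
  IZR (Z.sqrt a) <= r < IZR (Z.sqrt a + 1).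
Proof.
  intros Hr Ha [H1 H2]. pose proof (Z.sqrt_spec a Ha) as [S1 S2]. pose proof (Z.sqrt_nonneg a) as S0.
  assert (T1 : IZR (Z.sqrt a) * IZR (Z.sqrt a) <= IZR a) by (rewrite <- mult_IZR; apply IZR_le; lia).
  assert (T2 : IZR (a + 1) <= IZR (Z.sqrt a + 1) * IZR (Z.sqrt a + 1)) by (rewrite <- mult_IZR; apply IZR_le; lia).
  apply IZR_le in S0. assert (0 <= IZR (Z.sqrt a + 1)) by (rewrite plus_IZR; lra).
  split; [apply Rnot_lt_le; intros C | apply Rnot_le_lt; intros C]; nra.
Qed.

Lemma IZR_fp_one : IZR fp_one = fp_oneR.
Proof. reflexivity. Qed.

Lemma sqrt_lo_spec n : (0 < n)%Z ->
  lo (sqrt_lo n) (sqrt (IZR n)) /\ hi (sqrt_lo n + 1) (sqrt (IZR n)) /\ (0 < sqrt_lo n)%Z.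
Proof.
  intros Hn. assert (Hr : 1 <= IZR n) by (apply IZR_le; lia).
  pose proof (sqrt_pos (IZR n)). pose proof (sqrt_sqrt (IZR n) ltac:(lra)) as Q.
  assert (E : IZR (n * (fp_one * fp_one)) = (sqrt (IZR n) * fp_oneR) * (sqrt (IZR n) * fp_oneR)).
  { rewrite !mult_IZR, IZR_fp_one. transitivity (sqrt (IZR n) * sqrt (IZR n) * (fp_oneR * fp_oneR)); [rewrite Q|]; ring. }
  destruct (Zsqrt_bounds (n * (fp_one * fp_one)) (sqrt (IZR n) * fp_oneR)) as [A1 A2]; [lra | unfold fp_one; lia | rewrite plus_IZR, E; lra|].
  fold (sqrt_lo n) in A1, A2. pose proof (Z.sqrt_nonneg (n * (fp_one * fp_one))).
  split; [split; [assumption|exact A1]|split; [split; [assumption|lra]|]].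
  apply Z.sqrt_pos. unfold fp_one; lia.
Qed.

Lemma den_lo_spec n : (0 < n)%Z -> let s := sqrt (IZR n) in
  lo (den_lo n) (sqrt 2 * (s * sqrt s)) /\ hi (den_lo n + 1) (sqrt 2 * (s * sqrt s)).
Proof.
  intros Hn s. assert (Hr : 1 <= IZR n) by (apply IZR_le; lia).
  pose proof (sqrt_pos (IZR n)) as P1. pose proof (sqrt_sqrt (IZR n) ltac:(lra)) as Q. fold s in P1, Q.
  pose proof (sqrt_pos s). pose proof (sqrt_sqrt s P1) as Q2. pose proof (sqrt_pos 2). pose proof (sqrt_sqrt 2 ltac:(lra)) as Q3.
  set (d := sqrt 2 * (s * sqrt s)).
  assert (d0 : 0 <= d) by (apply Rmult_le_pos; [|apply Rmult_le_pos]; assumption).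
  assert (D2 : d * d = 2 * (s * s) * s).
  { unfold d. transitivity (sqrt 2 * sqrt 2 * (s * s) * (sqrt s * sqrt s)); [|rewrite Q3, Q2]; ring. }
  assert (E : IZR (4 * n ^ 3 * (fp_one * fp_one * (fp_one * fp_one))) = (d * fp_oneR) * (d * fp_oneR) * ((d * fp_oneR) * (d * fp_oneR))).
  { replace (d * fp_oneR * (d * fp_oneR) * (d * fp_oneR * (d * fp_oneR))) with ((d * d) * (d * d) * (fp_oneR * fp_oneR * (fp_oneR * fp_oneR))) by ring.
    rewrite D2. replace (n ^ 3)%Z with (n * n * n)%Z by ring. rewrite !mult_IZR, IZR_fp_one.
    transitivity (4 * (s * s) * (s * s) * (s * s) * (fp_oneR * fp_oneR * (fp_oneR * fp_oneR))); [rewrite Q|]; ring. }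
  assert (p2 : 0 <= d * fp_oneR) by lra.
  set (N := (4 * n ^ 3 * (fp_one * fp_one * (fp_one * fp_one)))%Z) in *.
  assert (N0 : (0 <= N)%Z) by (apply le_IZR; rewrite E; apply Rmult_le_pos; apply Rmult_le_pos; exact p2).
  destruct (Zsqrt_bounds N (d * fp_oneR * (d * fp_oneR))) as [A1 A2]; [apply Rmult_le_pos; exact p2 | exact N0 | rewrite plus_IZR, E; lra|].
  destruct (Zsqrt_bounds (Z.sqrt N) (d * fp_oneR)) as [C1 C2]; [exact p2 | apply Z.sqrt_nonneg | split; [exact A1 | exact A2] |].
  unfold den_lo. fold N. split; split; [apply Z.sqrt_nonneg | exact C1 | exact d0 | left; exact C2].
Qed.

Definition mcomp (a : R) : R := fold_right (fun k acc => a * (IZR k / 2 ^ 28 + acc)) 0 m_coefs.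

Lemma msqrt_mcomp s : s <> 0 -> msqrt s = 1 - mcomp (/ (PI * s)).
Proof.
  intros H. pose proof PI_bounds. unfold msqrt, mcomp, m_coefs. cbn [fold_right]. field. split; [exact H|lra].
Qed.

Lemma const_lo_hi k : (0 <= k)%Z -> lo (2 ^ 36 * k) (IZR k / 2 ^ 28) /\ hi (2 ^ 36 * k) (IZR k / 2 ^ 28).
Proof.
  intros H. pose proof (IZR_le _ _ H) as P.
  assert (E : IZR (2 ^ 36 * k) = IZR k / 2 ^ 28 * fp_oneR).
  { rewrite mult_IZR. change (IZR (2 ^ 36)) with 68719476736. lra. }
  split; split; [lia | lra | | lra]. apply Rdiv_le_0_compat; lra.
Qed.

Lemma mcomp_lo_spec x a : lo x a -> lo (mcomp_lo x) (mcomp a).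
Proof.
  intros H. unfold mcomp_lo, mcomp, m_coefs. cbn [fold_right].
  do 5 (apply lo_mul; [exact H|]; apply lo_add; [apply const_lo_hi; lia|]). split; [lia|lra].
Qed.

Lemma mcomp_hi_spec x a : hi x a -> hi (mcomp_hi x) (mcomp a).
Proof.
  intros H. unfold mcomp_hi, mcomp, m_coefs. cbn [fold_right].
  do 5 (apply hi_mul; [exact H|]; apply hi_add; [apply const_lo_hi; lia|]). split; lra.
Qed.

Lemma pi_lo_hi : lo pi_lo PI /\ hi pi_hi PI.
Proof.
  pose proof PI_fine as [A C]. pose proof PI_bounds.
  split; split; [unfold pi_lo; lia | unfold pi_lo; lra | lra | unfold pi_hi; lra].
Qed.

Lemma inv_lo x r : 0 < r -> hi x r -> lo (fp_one * fp_one / x) (/ r).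
Proof.
  intros Hr [_ H]. assert (x0 : (0 < x)%Z) by (apply lt_IZR; lra). split; [apply Z.div_pos; unfold fp_one; lia|].
  pose proof (div_lower (fp_one * fp_one) x x0) as D. rewrite mult_IZR, IZR_fp_one in D.
  apply Rmult_le_reg_r with (r * fp_oneR); [lra|].
  replace (/ r * fp_oneR * (r * fp_oneR)) with (fp_oneR * fp_oneR) by (field; lra). eapply Rle_trans; [|exact D].
  apply Rmult_le_compat_l; [|exact H]. apply IZR_le, Z.div_pos; unfold fp_one; lia.
Qed.

Lemma inv_hi x r : 0 < r -> (0 < x)%Z -> lo x r -> hi (fp_one * fp_one / x + 1) (/ r).
Proof.
  intros Hr x0 [_ H]. split; [left; apply Rinv_0_lt_compat, Hr|].
  pose proof (div_upper (fp_one * fp_one) x x0) as D. rewrite mult_IZR, IZR_fp_one in D.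
  apply Rmult_le_reg_r with (r * fp_oneR); [lra|].
  replace (/ r * fp_oneR * (r * fp_oneR)) with (fp_oneR * fp_oneR) by (field; lra). eapply Rle_trans; [exact D|].
  apply Rmult_le_compat_l; [|exact H]. apply IZR_le. pose proof (Z.div_pos (fp_one * fp_one) x). unfold fp_one in *; lia.
Qed.

Lemma check_coef_sound n x : check_coef n x = true ->
  let s := sqrt (IZR n) in
  amp s * (msqrt s - 1.57696 / 10 ^ 5 / s ^ 6) < IZR x < amp s * (msqrt s + 1.57696 / 10 ^ 5 / s ^ 6).
Proof.
  unfold check_coef. cbv zeta. set (s := sqrt (IZR n)).
  rewrite !Bool.andb_true_iff, !Z.ltb_lt, !Z.leb_le. intros [[[[[[H1 H2] H3] H4] H5] H6] H7].
  destruct (sqrt_lo_spec n H2) as [S1 [S2 S3]]. destruct (den_lo_spec n H2) as [D1 D2]. fold s in S1, S2, D1, D2.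
  cbv zeta in D1, D2. fold s in D1, D2.
  destruct pi_lo_hi as [L1 L2].
  pose proof (lo_mul _ _ _ _ L1 S1) as PL. pose proof (hi_mul _ _ _ _ L2 S2) as PH.
  set (pl := fp_floor (pi_lo * sqrt_lo n)) in *. set (ph := (fp_floor (pi_hi * (sqrt_lo n + 1)) + 1)%Z) in *.
  set (e := (157696 * fp_one / (10 ^ 10 * n ^ 3))%Z) in *.
  assert (n1 : 1 <= IZR n) by (apply IZR_le; lia). assert (n2 : IZR n <= 255) by (apply IZR_le; lia).
  pose proof (sqrt_sqrt (IZR n) ltac:(lra)) as Q. fold s in Q. pose proof (sqrt_pos (IZR n)) as s0. fold s in s0.
  assert (s1 : 0 < s) by nra. assert (s16 : s <= 16) by nra.
  pose proof PI_bounds as PB. assert (ps : 0 < PI * s) by (apply Rmult_lt_0_compat; lra).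
  assert (pl0 : (0 < pl)%Z).
  { unfold pl. rewrite fp_floor_eq. apply Z.div_str_pos. unfold pi_lo, fp_one. unfold sqrt_lo in *. nia. }
  pose proof (mcomp_lo_spec _ _ (inv_lo _ _ ps PH)) as M1. pose proof (mcomp_hi_spec _ _ (inv_hi _ _ ps pl0 PL)) as M2.
  set (ql := mcomp_lo (fp_one * fp_one / ph)) in *. set (qh := mcomp_hi (fp_one * fp_one / pl + 1)) in *.
  assert (X1 : lo (exp_lo (4 * pl)) (exp (4 * PI * s))).
  { apply exp_lo_spec. destruct PL as [A C]. split; [lia|]. rewrite mult_IZR. lra. }
  assert (X2 : hi (exp_hi (4 * ph)) (exp (4 * PI * s))).
  { apply exp_hi_spec.
    - assert (PI * s <= 3.15 * 16) by (apply Rmult_le_compat; lra). lra.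
    - destruct PH as [A C]. split; [lra|]. rewrite mult_IZR. lra. }
  rewrite msqrt_mcomp by lra. unfold amp.
  set (X := exp (4 * PI * s)) in *. set (d := sqrt 2 * (s * sqrt s)) in *. set (q := mcomp (/ (PI * s))) in *.
  assert (d0 : 0 < d).
  { apply Rmult_lt_0_compat; [apply sqrt_lt_R0; lra|]. apply Rmult_lt_0_compat; [exact s1 | apply sqrt_lt_R0, s1]. }
  assert (Ee : IZR e <= 1.57696 / 10 ^ 5 / s ^ 6 * fp_oneR).
  { assert (n3 : (0 < 10 ^ 10 * n ^ 3)%Z) by (apply Z.mul_pos_pos; [lia | apply Z.pow_pos_nonneg; lia]).
    pose proof (div_lower (157696 * fp_one) _ n3) as D. fold e in D.
    replace (s ^ 6) with (IZR n ^ 3) by (rewrite <- Q; ring).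
    rewrite !mult_IZR, IZR_fp_one in D. change (n ^ 3)%Z with (n ^ Z.of_nat 3)%Z in D. rewrite <- pow_IZR in D.
    change (IZR (10 ^ 10)) with 10000000000 in D.
    assert (Hy : 0 < IZR n ^ 3) by (apply pow_lt; lra). revert Hy D. generalize (IZR n ^ 3). intros y Hy D.
    apply Rmult_le_reg_r with (10000000000 * y); [lra|]. eapply Rle_trans; [exact D|].
    set (u := 1.57696).
    replace (u / 10 ^ 5 / y * fp_oneR * (10000000000 * y)) with (u * 100000 * fp_oneR) by (field; lra). unfold u. lra. }
  set (E := 1.57696 / 10 ^ 5 / s ^ 6) in *.
  destruct M1 as [M1a M1b], M2 as [M2a M2b], X1 as [X1a X1b], X2 as [X2a X2b], D1 as [D1a D1b], D2 as [D2a D2b].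
  apply IZR_lt in H4, H5, H6, H7. apply IZR_le in H3, X1a, D1a.
  rewrite !mult_IZR, !plus_IZR, minus_IZR, IZR_fp_one in H6. rewrite !mult_IZR, !minus_IZR, IZR_fp_one in H7.
  rewrite plus_IZR, minus_IZR, IZR_fp_one in H4. rewrite !minus_IZR, IZR_fp_one in H5. rewrite plus_IZR in D2b.
  split.
  - apply Rmult_lt_reg_r with (d * (fp_oneR * fp_oneR)); [lra|].
    replace (X / d * (1 - q - E) * (d * (fp_oneR * fp_oneR))) with (X * fp_oneR * ((1 - q - E) * fp_oneR)) by (field; lra).
    apply Rle_lt_trans with (IZR (exp_hi (4 * ph)) * (fp_oneR - IZR ql - IZR e)).
    + apply Rle_trans with (X * fp_oneR * (fp_oneR - IZR ql - IZR e)).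
      * apply Rmult_le_compat_l; lra.
      * apply Rmult_le_compat_r; lra.
    + eapply Rlt_le_trans; [exact H7|].
      replace (IZR x * (d * (fp_oneR * fp_oneR))) with (IZR x * (d * fp_oneR) * fp_oneR) by ring.
      apply Rmult_le_compat_r; [lra|]. apply Rmult_le_compat_l; lra.
  - apply Rmult_lt_reg_r with (d * (fp_oneR * fp_oneR)); [lra|].
    replace (X / d * (1 - q + E) * (d * (fp_oneR * fp_oneR))) with (X * fp_oneR * ((1 - q + E) * fp_oneR)) by (field; lra).
    apply Rle_lt_trans with (IZR x * (IZR (den_lo n) + 1) * fp_oneR).
    + replace (IZR x * (d * (fp_oneR * fp_oneR))) with (IZR x * (d * fp_oneR) * fp_oneR) by ring.
      apply Rmult_le_compat_r; [lra|]. apply Rmult_le_compat_l; lra.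
    + eapply Rlt_le_trans; [exact H6|].
      apply Rle_trans with (X * fp_oneR * (fp_oneR - IZR qh + IZR e)).
      * apply Rmult_le_compat_r; lra.
      * apply Rmult_le_compat_l; lra.
Qed.

(** * The range 7 <= n < 225 and the conclusion *)

(** Because of the shift in [jcoef], the list [j_list 225] begins with c(224) and descends, which
    matches the indices K - i in [check_list]. *)
Lemma check_list_true : check_list 224 (j_list 225) = true.
Proof. vm_compute. reflexivity. Qed.

Lemma small_n (c : nat -> Z) (n : nat) : is_j_coefficients c -> (7 <= n < 225)%nat ->
  let s := sqrt (INR n) in
  amp s * (msqrt s - 1.57696 / 10 ^ 5 / s ^ 6) < IZR (c n) < amp s * (msqrt s + 1.57696 / 10 ^ 5 / s ^ 6).
Proof.
  intros hc Hn. pose proof check_list_true as H. rewrite (j_list_eq c hc 225) in H.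
  unfold check_list in H. rewrite forallb_forall in H. specialize (H (224 - n)%nat).
  rewrite in_seq in H. specialize (H ltac:(lia)). cbv zeta in H.
  rewrite (nth_indep _ 0%Z (jcoef c (225 - 0))), (map_nth (fun i => jcoef c (225 - i))), seq_nth in H
    by (rewrite ?length_map, ?length_seq; lia).
  replace (224 - (224 - n))%nat with n in H by lia. replace (225 - (0 + (224 - n)))%nat with (S n) in H by lia.
  apply Bool.orb_true_iff in H. destruct H as [H|H]; [apply Nat.ltb_lt in H; lia|].
  apply check_coef_sound in H. rewrite <- INR_IZR_INZ in H. exact H.
Qed.

Theorem lemma2p5 (c : nat -> Z) (hc : is_j_coefficients c) :
  forall n : nat, (7 <= n)%nat -> k n < IZR (c n) < l n.
Proof.
  intros n Hn. destruct (kl_amp n ltac:(lia)) as [-> ->].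
  destruct (Nat.lt_ge_cases n 225) as [H|H].
  - apply small_n; [exact hc | lia].
  - pose proof (Rabs_def2 _ _ (large_n c n hc H)). lra.
Qed.
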